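(* There is a unique pair $(f,\omega)$ of functions holomorphic in the unit disk $\mathbb D$ satisfying, for all $t>0$, with $q=e^{-t}$ and $q_1=e^{-\pi^2/t}$, $$q^{2/3}\,\omega(-q)=-\sqrt{\frac{\pi}{t}}\;q_1^{2/3}\,\omega(-q_1)+\sqrt{\frac{12t}{\pi}}\;W_3(t),$$ $$q^{2/3}\,\omega(q)=\sqrt{\frac{\pi}{4t}}\;q_1^{-1/12}f(q_1^2)-\sqrt{\frac{3t}{\pi}}\;W_2\!\left(\frac t2\right).$$
   Context: For $\Re t>0$, $$W_3(t)=\frac1t\int_0^\infty e^{-3x^2/t}\,\frac{\sinh x}{\sinh 3x}\,dx,\qquad W_2(t)=\frac1t\int_0^\infty e^{-\frac32x^2/t}\,\frac{\cosh x}{\cosh 3x}\,dx .$$ For rational $r$, $q^r=e^{-rt}$ and $q_1^r=e^{-r\pi^2/t}$. (The pair is Ramanujan's order-3 pair $f(q)=\sum_{n\ge0}\frac{q^{n^2}}{(-q;q)_n^2}$, $\omega(q)=\sum_{n\ge0}\frac{q^{2n(n+1)}}{(q;q^2)_{n+1}^2}$, where $(a;b)_n=\prod_{i=0}^{n-1}(1-ab^i)$.) *)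

(* Defs.v *)
From Stdlib Require Export Reals.
From Coquelicot Require Export Coquelicot.
Open Scope R_scope.

(* The value 0 that Rocq's total division gives to [sinh x / sinh (3 * x)] at
   x = 0 (instead of 1/3) does not affect the integral. *)
Definition W3 (t : R) : R :=
  / t * RInt_gen (fun x => exp (- 3 * x ^ 2 / t) * (sinh x / sinh (3 * x)))
          (at_point 0) (Rbar_locally p_infty).

Definition W2 (t : R) : R :=
  / t * RInt_gen (fun x => exp (- (3 / 2) * x ^ 2 / t) * (cosh x / cosh (3 * x)))
          (at_point 0) (Rbar_locally p_infty).

(* [qpow t r] is q^r and [q1pow t r] is q_1^r, for q = e^{-t} and
   q_1 = e^{-pi^2/t}. *)
Definition qpow (t r : R) : R := exp (- (r * t)).
Definition q1pow (t r : R) : R := exp (- (r * PI ^ 2 / t)).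

Definition in_unit_disk (z : C) : Prop := Cmod z < 1.

Definition holomorphic_in_disk (f : C -> C) : Prop :=
  forall z : C, in_unit_disk z -> @ex_derive C_AbsRing C_NormedModule f z.

Definition omega_equation (omega : C -> C) : Prop :=
  forall t : R, 0 < t ->
    (RtoC (qpow t (2 / 3)) * omega (RtoC (- qpow t 1)) =
     - RtoC (sqrt (PI / t)) * RtoC (q1pow t (2 / 3)) * omega (RtoC (- q1pow t 1))
     + RtoC (sqrt (12 * t / PI)) * RtoC (W3 t))%C.

Definition omega_f_equation (f omega : C -> C) : Prop :=
  forall t : R, 0 < t ->
    (RtoC (qpow t (2 / 3)) * omega (RtoC (qpow t 1)) =
     RtoC (sqrt (PI / (4 * t))) * RtoC (q1pow t (- (1 / 12))) * f (RtoC (q1pow t 1 ^ 2))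
     - RtoC (sqrt (3 * t / PI)) * RtoC (W2 (t / 2)))%C.

Definition is_solution (f omega : C -> C) : Prop :=
  holomorphic_in_disk f /\ holomorphic_in_disk omega /\
  omega_equation omega /\ omega_f_equation f omega.

(* Main.v *)
Require Import Defs.
From Stdlib Require Import ZArith Lra Lia Classical.
Open Scope R_scope.

(* Write t for the variable with q = e^{-t}.

   Uniqueness. The difference of two solutions is a pair (f, omega) satisfying the homogeneous
   equations. Their squares extend from t > 0 to Re t > 0 by the identity theorem. For
   h(q) = f(q^2) omega(q) omega(-q), the quantity |h(q)| e^{-5u/4} u^{3/4} with u = Re t is therefore
   invariant under t -> pi^2/t and t -> t + i pi, that is, under the full modular group. Moving a
   point of the circle |q| = e^{-4 pi/5} into the fundamental domain u >= pi sqrt(3)/2 and returning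
   by the maximum principle contracts the supremum of |h|; hence h = 0, so f = 0 or omega = 0, and
   the homogeneous equations give both.

   Existence. f and omega are the Appell-Lerch forms of Ramanujan's functions: a Lambert type series
   divided by (q;q)_oo, respectively (q^2;q^2)_oo. The Mordell integral
   A(xi) = int_0^oo (e^{-t(xi-x/t)^2/3} +- e^{-t(xi+x/t)^2/3}) 2/(e^x +- e^{-x}) dx satisfies a
   three-term shift equation in xi. Summed over the half-integers against partial theta functions it
   yields the Lambert series at q plus a multiple of A(1/2), which is W_2 or W_3. Poisson summation
   under the integral sign, with the Fourier transforms of 1/cosh and 1/sinh, yields instead the
   series at q_1. Dividing by eta, and using its inversion formula and Euler's pentagonal number
   theorem, gives both equations. *)

(** * Complex differentiability and Goursat's theorem on rectangles *)

(** Behind the uniqueness lies a count of zeros. In the variable tau = i t / pi, the product of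
    q^(2/3) omega(q), q^(2/3) omega(-q) and q^(-1/12) f(q^2) behaves, up to factors of modulus 1,
    like a modular form of weight 3/2 for the full modular group. Since 2/3 + 2/3 - 1/12 = 5/4 and
    the local parameter at the cusp is q^2, it vanishes there to order at least 5/8, whereas a
    nonzero form of weight 3/2 has zeros of total order 1/8. The contraction is an elementary
    substitute for this count: it uses only inversion, evenness and the maximum principle. For
    existence, the shift equation links arguments of A that differ by 3, so on the half-integers A
    is governed by its values at 1/2, 3/2 and 5/2. The parity of A determines the value at 3/2 and
    expresses the one at 5/2 by A(1/2), which therefore is the only transcendental quantity left.
    Its coefficient is the pentagonal series, that is (q^2;q^2)_oo; this is why the Lambert series
    have to be divided by eta before W_2 and W_3 stand alone. *)

Definition cderiv (f : C -> C) (z l : C) : Prop :=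
  forall eps, 0 < eps -> exists d, 0 < d /\ forall w, Cmod (w - z) < d ->
    Cmod (f w - f z - l * (w - z)) <= eps * Cmod (w - z).
Definition cdiff (f : C -> C) (z : C) : Prop := exists l, cderiv f z l.

Lemma cdiff_ex_derive f z : cdiff f z -> @ex_derive C_AbsRing C_NormedModule f z.
Proof.
intros [l Hl]. exists l. split. { apply is_linear_scal_l. }
intros x Hx. apply (@is_filter_lim_locally_unique C_AbsRing (AbsRing_NormedModule C_AbsRing)) in Hx. subst x.
intros eps. destruct (Hl eps (cond_pos eps)) as [d [Hd H]].
exists (mkposreal d Hd). intros w Hw.
specialize (H w Hw).
change (Cmod (f w - f z - (w - z) * l)%C <= eps * Cmod (w - z)%C).
rewrite (Cmult_comm _ l). exact H.
Qed.

Lemma ex_derive_cdiff f z : @ex_derive C_AbsRing C_NormedModule f z -> cdiff f z.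
Proof.
intros [l [_ H]]. exists l. intros eps Heps.
specialize (H z (fun P HP => HP) (mkposreal eps Heps)).
destruct H as [d Hd]. exists d. split. apply cond_pos.
intros w Hw. specialize (Hd w Hw).
rewrite (Cmult_comm l). exact Hd.
Qed.

Lemma Cmod_minus_sym (a b : C) : Cmod (a - b) = Cmod (b - a).
Proof. replace (a - b)%C with (- (b - a))%C by ring. apply Cmod_opp. Qed.

Lemma im_le_Cmod (c : C) : Rabs (Im c) <= Cmod c.
Proof. eapply Rle_trans; [|apply Rmax_Cmod]. apply Rmax_r. Qed.

Lemma Cmod_le_sum (c : C) : Cmod c <= Rabs (Re c) + Rabs (Im c).
Proof.
assert (Rabs (Re c) >= 0) by (apply Rle_ge, Rabs_pos).
assert (Rabs (Im c) >= 0) by (apply Rle_ge, Rabs_pos).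
apply Rsqr_incr_0_var; [|lra]. rewrite !Rsqr_pow2, Cmod2_alt.
rewrite <- (pow2_abs (Re c)), <- (pow2_abs (Im c)). nra.
Qed.

Lemma cderiv_lip f z l : cderiv f z l -> exists d, 0 < d /\ forall w, Cmod (w - z) < d ->
  Cmod (f w - f z) <= (Cmod l + 1) * Cmod (w - z).
Proof.
intros H. destruct (H 1 Rlt_0_1) as [d [Hd H']]. exists d; split; [exact Hd|].
intros w Hw. specialize (H' w Hw).
replace (f w - f z)%C with ((f w - f z - l * (w - z)) + l * (w - z))%C by ring.
eapply Rle_trans; [apply Cmod_triangle|]. rewrite Cmod_mult. lra.
Qed.

Definition ccont (f : C -> C) (z : C) : Prop :=
  forall eps, 0 < eps -> exists d, 0 < d /\ forall w, Cmod (w - z) < d -> Cmod (f w - f z) < eps.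

Lemma cdiff_ccont f z : cdiff f z -> ccont f z.
Proof.
intros [l Hl]. destruct (cderiv_lip _ _ _ Hl) as [d [Hd H]].
intros eps He. assert (HL := Cmod_ge_0 l).
exists (Rmin d (eps / (Cmod l + 1) )). split. apply Rmin_pos; [exact Hd|]. apply Rdiv_lt_0_compat; lra.
intros w Hw. eapply Rle_lt_trans. apply H. eapply Rlt_le_trans; [exact Hw|apply Rmin_l].
apply Rlt_le_trans with ((Cmod l + 1) * (eps / (Cmod l + 1))).
apply Rmult_lt_compat_l. lra. eapply Rlt_le_trans; [exact Hw|apply Rmin_r].
right. field. lra.
Qed.

Lemma cderiv_ext f g z l : (exists d, 0 < d /\ forall w, Cmod (w - z) < d -> f w = g w) ->
  cderiv f z l -> cderiv g z l.
Proof.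
intros [d [Hd E]] H eps He. destruct (H eps He) as [d' [Hd' H']].
exists (Rmin d d'). split. apply Rmin_pos; assumption.
intros w Hw. assert (E1 := Rmin_l d d'). assert (E2 := Rmin_r d d').
rewrite <- !E. apply H'. lra. replace (z - z)%C with (RtoC 0) by ring. rewrite Cmod_0. lra. lra.
Qed.

Lemma cdiff_ext f g z : (forall w, f w = g w) -> cdiff f z -> cdiff g z.
Proof. intros E [l H]. exists l. eapply cderiv_ext; [|exact H]. exists 1. split. lra. auto. Qed.

Lemma cdiff_const (k z : C) : cdiff (fun _ => k) z.
Proof.
exists 0. intros eps He. exists 1. split. lra. intros w _.
replace (k - k - 0 * (w - z))%C with (RtoC 0) by ring. rewrite Cmod_0.
apply Rmult_le_pos. lra. apply Cmod_ge_0.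
Qed.

Lemma cdiff_id z : cdiff (fun w => w) z.
Proof.
exists 1. intros eps He. exists 1. split. lra. intros w _.
replace (w - z - 1 * (w - z))%C with (RtoC 0) by ring. rewrite Cmod_0.
apply Rmult_le_pos. lra. apply Cmod_ge_0.
Qed.

Lemma cdiff_plus f g z : cdiff f z -> cdiff g z -> cdiff (fun w => f w + g w)%C z.
Proof.
intros [l Hl] [m Hm]. exists (l + m)%C. intros eps He.
destruct (Hl (eps/2) ltac:(lra)) as [d [Hd H]].
destruct (Hm (eps/2) ltac:(lra)) as [d' [Hd' H']].
exists (Rmin d d'). split. apply Rmin_pos; assumption.
intros w Hw. assert (E1 := Rmin_l d d'). assert (E2 := Rmin_r d d').
replace (f w + g w - (f z + g z) - (l + m) * (w - z))%C with
 ((f w - f z - l * (w - z)) + (g w - g z - m * (w - z)))%C by ring.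
eapply Rle_trans. apply Cmod_triangle.
specialize (H w ltac:(lra)). specialize (H' w ltac:(lra)). lra.
Qed.

Lemma cdiff_mult f g z : cdiff f z -> cdiff g z -> cdiff (fun w => f w * g w)%C z.
Proof.
intros Df Dg. destruct Df as [l Hl], Dg as [m Hm]. exists (l * g z + f z * m)%C. intros eps He.
destruct (cderiv_lip _ _ _ Hl) as [d1 [Hd1 H1]].
destruct (cdiff_ccont g z (ex_intro _ m Hm) (eps / 3 / (Cmod l + 1))) as [d2 [Hd2 H2]].
{ assert (HL := Cmod_ge_0 l). apply Rdiv_lt_0_compat; lra. }
assert (Pg := Cmod_ge_0 (g z)). assert (Pf := Cmod_ge_0 (f z)). assert (Pl := Cmod_ge_0 l).
destruct (Hl (eps/3/(Cmod (g z) + 1))) as [d3 [Hd3 H3]]. apply Rdiv_lt_0_compat; lra.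
destruct (Hm (eps/3/(Cmod (f z) + 1))) as [d4 [Hd4 H4]]. apply Rdiv_lt_0_compat; lra.
exists (Rmin (Rmin d1 d2) (Rmin d3 d4)). split. repeat apply Rmin_pos; assumption.
intros w Hw.
assert (E1 := Rmin_l (Rmin d1 d2) (Rmin d3 d4)). assert (E2 := Rmin_r (Rmin d1 d2) (Rmin d3 d4)).
assert (E3 := Rmin_l d1 d2). assert (E4 := Rmin_r d1 d2).
assert (E5 := Rmin_l d3 d4). assert (E6 := Rmin_r d3 d4).
specialize (H1 w ltac:(lra)). specialize (H2 w ltac:(lra)).
specialize (H3 w ltac:(lra)). specialize (H4 w ltac:(lra)).
replace (f w * g w - f z * g z - (l * g z + f z * m) * (w - z))%C with
 ((f w - f z) * (g w - g z) + ((f w - f z - l * (w - z)) * g z + f z * (g w - g z - m * (w - z))))%C by ring.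
eapply Rle_trans. apply Cmod_triangle.
eapply Rle_trans. apply Rplus_le_compat_l. apply Cmod_triangle. rewrite !Cmod_mult.
assert (A1 : Cmod (f w - f z) * Cmod (g w - g z) <= eps / 3 * Cmod (w - z)).
{ apply Rle_trans with (((Cmod l + 1) * Cmod (w - z)) * (eps / 3 / (Cmod l + 1))).
  apply Rmult_le_compat; try apply Cmod_ge_0. exact H1. lra. right. field. lra. }
assert (A2 : Cmod (f w - f z - l * (w - z)) * Cmod (g z) <= eps / 3 * Cmod (w - z)).
{ apply Rle_trans with ((eps / 3 / (Cmod (g z) + 1) * Cmod (w - z)) * (Cmod (g z) + 1)).
  apply Rmult_le_compat; try apply Cmod_ge_0. exact H3. lra. right. field. lra. }
assert (A3 : Cmod (f z) * Cmod (g w - g z - m * (w - z)) <= eps / 3 * Cmod (w - z)).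
{ apply Rle_trans with ((Cmod (f z) + 1) * (eps / 3 / (Cmod (f z) + 1) * Cmod (w - z))).
  apply Rmult_le_compat; try apply Cmod_ge_0. lra. exact H4. right. field. lra. }
lra.
Qed.

Lemma cdiff_comp f g z : cdiff f (g z) -> cdiff g z -> cdiff (fun w => f (g w)) z.
Proof.
intros [l Hl] [m Hm]. exists (l * m)%C. intros eps He.
destruct (cderiv_lip _ _ _ Hm) as [d1 [Hd1 H1]].
assert (Pl := Cmod_ge_0 l). assert (Pm := Cmod_ge_0 m).
destruct (Hl (eps/2/(Cmod m + 1))) as [d2 [Hd2 H2]]. apply Rdiv_lt_0_compat; lra.
destruct (Hm (eps/2/(Cmod l + 1))) as [d3 [Hd3 H3]]. apply Rdiv_lt_0_compat; lra.
exists (Rmin (Rmin d1 (d2 / (Cmod m + 1))) d3). split.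
repeat apply Rmin_pos; try assumption. apply Rdiv_lt_0_compat; lra.
intros w Hw.
assert (E1 := Rmin_l (Rmin d1 (d2 / (Cmod m + 1))) d3). assert (E2 := Rmin_r (Rmin d1 (d2 / (Cmod m + 1))) d3).
assert (E3 := Rmin_l d1 (d2 / (Cmod m + 1))). assert (E4 := Rmin_r d1 (d2 / (Cmod m + 1))).
specialize (H1 w ltac:(lra)). specialize (H3 w ltac:(lra)).
assert (Hg : Cmod (g w - g z) < d2).
{ eapply Rle_lt_trans. exact H1. apply Rlt_le_trans with ((Cmod m + 1) * (d2 / (Cmod m + 1))).
  apply Rmult_lt_compat_l; lra. right; field; lra. }
specialize (H2 _ Hg).
replace (f (g w) - f (g z) - l * m * (w - z))%C with
  ((f (g w) - f (g z) - l * (g w - g z)) + l * (g w - g z - m * (w - z)))%C by ring.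
eapply Rle_trans. apply Cmod_triangle. rewrite Cmod_mult.
assert (A1 : eps / 2 / (Cmod m + 1) * Cmod (g w - g z) <= eps / 2 * Cmod (w - z)).
{ apply Rle_trans with (eps / 2 / (Cmod m + 1) * ((Cmod m + 1) * Cmod (w - z))).
  apply Rmult_le_compat_l. apply Rlt_le, Rdiv_lt_0_compat; lra. exact H1. right; field; lra. }
assert (A2 : Cmod l * Cmod (g w - g z - m * (w - z)) <= eps / 2 * Cmod (w - z)).
{ apply Rle_trans with ((Cmod l + 1) * (eps / 2 / (Cmod l + 1) * Cmod (w - z))).
  apply Rmult_le_compat; try apply Cmod_ge_0. lra. exact H3. right; field; lra. }
lra.
Qed.

Lemma cdiff_inv (z : C) : z <> 0 -> cdiff (fun w => / w)%C z.
Proof.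
intros Hz. exists (- / (z * z))%C. intros eps He.
assert (Pz : 0 < Cmod z) by (apply Cmod_gt_0; exact Hz).
exists (Rmin (Cmod z / 2) (eps * Cmod z ^ 3 / 2)). split.
apply Rmin_pos. lra. assert (0 < Cmod z ^ 3) by (apply pow_lt; lra). nra.
intros w Hw. assert (E1 := Rmin_l (Cmod z / 2) (eps * Cmod z ^ 3 / 2)).
assert (E2 := Rmin_r (Cmod z / 2) (eps * Cmod z ^ 3 / 2)).
assert (Hw2 : Cmod z / 2 <= Cmod w).
{ assert (T := Cmod_triangle w (z - w)). replace (w + (z - w))%C with z in T by ring.
  rewrite (Cmod_minus_sym z w) in T. lra. }
assert (Hw0 : w <> 0). { apply Cmod_gt_0. lra. }
replace (/ w - / z - - / (z * z) * (w - z))%C with ((w - z) * (w - z) * / (z * z * w))%C.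
2:{ field. repeat split; assumption. }
assert (Pw := Cmod_ge_0 (w - z)).
rewrite !Cmod_mult, Cmod_inv, !Cmod_mult.
2:{ intro E. apply Cmod_gt_0 in Hw0. assert (Cmod (z * z * w) = 0) by (rewrite E; apply Cmod_0).
    rewrite !Cmod_mult in H. assert (0 < Cmod z * Cmod z * Cmod w) by (repeat apply Rmult_lt_0_compat; lra). lra. }
rewrite (Rmult_comm eps). rewrite Rmult_assoc. apply Rmult_le_compat_l. exact Pw.
apply Rle_trans with ((eps * Cmod z ^ 3 / 2) * / (Cmod z * Cmod z * (Cmod z / 2))).
apply Rmult_le_compat. lra. apply Rlt_le, Rinv_0_lt_compat. repeat apply Rmult_lt_0_compat; lra. lra.
apply Rinv_le_contravar. repeat apply Rmult_lt_0_compat; lra. apply Rmult_le_compat_l. nra. lra.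
right. field. lra.
Qed.

Lemma cdiff_opp f z : cdiff f z -> cdiff (fun w => - f w)%C z.
Proof.
intros H. apply cdiff_ext with (fun w => (RtoC (-1)) * f w)%C.
intros w. ring. apply cdiff_mult. apply cdiff_const. exact H.
Qed.
Lemma cdiff_minus f g z : cdiff f z -> cdiff g z -> cdiff (fun w => f w - g w)%C z.
Proof. intros. apply cdiff_plus. assumption. apply cdiff_opp. assumption. Qed.
Lemma cdiff_div f g z : cdiff f z -> cdiff g z -> g z <> 0 -> cdiff (fun w => f w / g w)%C z.
Proof.
intros. apply cdiff_mult. assumption. apply (cdiff_comp (fun w => / w)%C g).
apply cdiff_inv. assumption. assumption.
Qed.
Lemma cdiff_pow f n z : cdiff f z -> cdiff (fun w => f w ^ n)%C z.
Proof.
intros H. induction n. apply (cdiff_const 1).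
apply (cdiff_mult f (fun w => f w ^ n)%C); assumption.
Qed.

(** * Integrals of complex-valued functions along segments *)

Definition CInt (f : R -> C) (a b : R) : C :=
  (RInt (fun x => Re (f x)) a b, RInt (fun x => Im (f x)) a b).

Definition pcont (f : R -> C) (x : R) : Prop :=
  continuous (fun x => Re (f x)) x /\ continuous (fun x => Im (f x)) x.

Lemma continuous_eps (f : R -> R) x : (forall eps, 0 < eps -> exists d, 0 < d /\ forall y, Rabs (y - x) < d -> Rabs (f y - f x) < eps) <-> continuous f x.
Proof.
split.
- intros H. apply filterlim_locally. intros eps. destruct (H eps (cond_pos eps)) as [d [Hd H']].
  exists (mkposreal d Hd). intros y Hy. apply H'. exact Hy.
- intros H eps He. apply filterlim_locally with (eps := mkposreal eps He) in H.
  destruct H as [d Hd]. exists d. split. apply cond_pos. intros y Hy. apply Hd. exact Hy.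
Qed.

Lemma pcont_eps (f : R -> C) x : (forall eps, 0 < eps -> exists d, 0 < d /\ forall y, Rabs (y - x) < d -> Cmod (f y - f x) < eps) <-> pcont f x.
Proof.
split.
- intros H. split; apply continuous_eps; intros eps He; destruct (H eps He) as [d [Hd H']]; exists d; (split; [exact Hd|]); intros y Hy; specialize (H' y Hy); eapply Rle_lt_trans; try exact H'.
  apply (re_le_Cmod (f y - f x)). apply (im_le_Cmod (f y - f x)).
- intros [H1 H2] eps He. rewrite <- continuous_eps in H1, H2.
  destruct (H1 (eps/2) ltac:(lra)) as [d [Hd H]]. destruct (H2 (eps/2) ltac:(lra)) as [d' [Hd' H']].
  exists (Rmin d d'). split. apply Rmin_pos; assumption. intros y Hy.
  assert (E1 := Rmin_l d d'). assert (E2 := Rmin_r d d').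
  specialize (H y ltac:(lra)). specialize (H' y ltac:(lra)).
  eapply Rle_lt_trans. apply Cmod_le_sum.
  change (Rabs (Re (f y) - Re (f x)) + Rabs (Im (f y) - Im (f x)) < eps). lra.
Qed.

Lemma pcont_comp f (g : R -> C) x : ccont f (g x) -> pcont g x -> pcont (fun y => f (g y)) x.
Proof.
intros Hf Hg. rewrite <- pcont_eps in *. intros eps He.
destruct (Hf eps He) as [d [Hd H]]. destruct (Hg d Hd) as [d' [Hd' H']].
exists d'. split. exact Hd'. intros y Hy. apply H, H', Hy.
Qed.

Lemma pcont_h (c x : R) : pcont (fun x => (x, c)) x.
Proof. split; simpl. apply continuous_id. apply continuous_const. Qed.
Lemma pcont_v (c x : R) : pcont (fun x => (c, x)) x.
Proof. split; simpl. apply continuous_const. apply continuous_id. Qed.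

Lemma pcont_plus f g x : pcont f x -> pcont g x -> pcont (fun y => f y + g y)%C x.
Proof.
intros [A B] [A' B']. split; simpl; [apply (continuous_plus (fun y => Re (f y)) (fun y => Re (g y)))|apply (continuous_plus (fun y => Im (f y)) (fun y => Im (g y)))]; assumption.
Qed.

Lemma pcont_mult f g x : pcont f x -> pcont g x -> pcont (fun y => f y * g y)%C x.
Proof.
intros [A B] [A' B']. split; simpl.
- apply (continuous_minus (fun y => Re (f y) * Re (g y)) (fun y => Im (f y) * Im (g y)));
  apply @continuous_mult; assumption.
- apply (continuous_plus (fun y => Re (f y) * Im (g y)) (fun y => Im (f y) * Re (g y)));
  apply @continuous_mult; assumption.
Qed.

Lemma pcont_const k x : pcont (fun _ => k) x.
Proof. split; apply continuous_const. Qed.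

Lemma ex_RInt_cont (f : R -> R) a b : a <= b -> (forall x, a <= x <= b -> continuous f x) -> ex_RInt f a b.
Proof. intros Hab H. apply (@ex_RInt_continuous R_CompleteNormedModule). intros x. rewrite Rmin_left, Rmax_right by lra. apply H. Qed.

Lemma rint_ext (f g : R -> R) a b : a <= b -> (forall x, a <= x <= b -> f x = g x) -> RInt f a b = RInt g a b :> R.
Proof. intros Hab H. apply RInt_ext. intros x. rewrite Rmin_left, Rmax_right by lra. intros Hx. apply H. lra. Qed.
Lemma rint_plus (f g : R -> R) a b : ex_RInt f a b -> ex_RInt g a b ->
  RInt (fun x => f x + g x) a b = RInt f a b + RInt g a b :> R.
Proof. intros. apply (RInt_plus f g); assumption. Qed.
Lemma rint_minus (f g : R -> R) a b : ex_RInt f a b -> ex_RInt g a b ->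
  RInt (fun x => f x - g x) a b = RInt f a b - RInt g a b :> R.
Proof. intros. apply (RInt_minus f g); assumption. Qed.
Lemma rint_scal (f : R -> R) k a b : ex_RInt f a b -> RInt (fun x => k * f x) a b = k * RInt f a b :> R.
Proof. intros. apply (RInt_scal f); assumption. Qed.
Lemma rint_const (k a b : R) : RInt (fun _ => k) a b = (b - a) * k :> R.
Proof. apply (RInt_const (V := R_CompleteNormedModule)). Qed.
Lemma rint_Chasles (f : R -> R) a b c : ex_RInt f a b -> ex_RInt f b c -> RInt f a b + RInt f b c = RInt f a c :> R.
Proof. apply (RInt_Chasles f). Qed.
Lemma ex_rint_plus (f g : R -> R) a b : ex_RInt f a b -> ex_RInt g a b -> ex_RInt (fun x => f x + g x) a b.
Proof. apply (ex_RInt_plus f g). Qed.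
Lemma ex_rint_minus (f g : R -> R) a b : ex_RInt f a b -> ex_RInt g a b -> ex_RInt (fun x => f x - g x) a b.
Proof. apply (ex_RInt_minus f g). Qed.
Lemma ex_rint_scal (f : R -> R) k a b : ex_RInt f a b -> ex_RInt (fun x => k * f x) a b.
Proof. apply (ex_RInt_scal f). Qed.

Ltac exr := cbv beta; first [assumption | lazymatch goal with
  | |- ex_RInt (fun x => @?f x + @?g x) _ _ => apply (ex_rint_plus f g); exr
  | |- ex_RInt (fun x => @?f x - @?g x) _ _ => apply (ex_rint_minus f g); exr
  | |- ex_RInt (fun x => ?k * @?f x) _ _ => apply (ex_rint_scal f k); exr
  | _ => idtac
  end].

Definition pcont_on f a b := forall x, a <= x <= b -> pcont f x.

Lemma pcont_on_re f a b : a <= b -> pcont_on f a b -> ex_RInt (fun x => Re (f x)) a b.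
Proof. intros Hab H. apply ex_RInt_cont. exact Hab. intros x Hx. apply (H x Hx). Qed.
Lemma pcont_on_im f a b : a <= b -> pcont_on f a b -> ex_RInt (fun x => Im (f x)) a b.
Proof. intros Hab H. apply ex_RInt_cont. exact Hab. intros x Hx. apply (H x Hx). Qed.

Lemma CInt_plus f g a b : a <= b -> pcont_on f a b -> pcont_on g a b ->
  CInt (fun x => f x + g x)%C a b = (CInt f a b + CInt g a b)%C.
Proof.
intros Hab Hf Hg. unfold CInt. apply injective_projections; simpl.
- apply (RInt_plus (fun x => Re (f x)) (fun x => Re (g x))); apply pcont_on_re; assumption.
- apply (RInt_plus (fun x => Im (f x)) (fun x => Im (g x))); apply pcont_on_im; assumption.
Qed.

Lemma CInt_scal k f a b : a <= b -> pcont_on f a b ->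
  CInt (fun x => k * f x)%C a b = (k * CInt f a b)%C.
Proof.
intros Hab Hf.
assert (Er := pcont_on_re _ _ _ Hab Hf). assert (Ei := pcont_on_im _ _ _ Hab Hf).
unfold CInt. apply injective_projections; simpl.
- rewrite (RInt_minus (fun x => Re k * Re (f x)) (fun x => Im k * Im (f x))).
  rewrite (RInt_scal (fun x => Re (f x))), (RInt_scal (fun x => Im (f x))) by assumption. reflexivity.
  apply (ex_RInt_scal (fun x => Re (f x))); assumption. apply (ex_RInt_scal (fun x => Im (f x))); assumption.
- rewrite (RInt_plus (fun x => Re k * Im (f x)) (fun x => Im k * Re (f x))).
  rewrite (RInt_scal (fun x => Re (f x))), (RInt_scal (fun x => Im (f x))) by assumption. reflexivity.
  apply (ex_RInt_scal (fun x => Im (f x))); assumption. apply (ex_RInt_scal (fun x => Re (f x))); assumption.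
Qed.

Lemma CInt_ext f g a b : a <= b -> (forall x, a < x < b -> f x = g x) -> CInt f a b = CInt g a b.
Proof.
intros Hab H. unfold CInt. f_equal; apply RInt_ext; intros x; rewrite Rmin_left, Rmax_right by lra; intros Hx; rewrite H by lra; reflexivity.
Qed.

Lemma CInt_Chasles f a b c : a <= b <= c -> pcont_on f a c -> (CInt f a b + CInt f b c = CInt f a c)%C.
Proof.
intros Habc Hf. unfold CInt. apply injective_projections; simpl.
- apply (RInt_Chasles (fun x => Re (f x))); apply pcont_on_re; try lra; intros x Hx; apply Hf; lra.
- apply (RInt_Chasles (fun x => Im (f x))); apply pcont_on_im; try lra; intros x Hx; apply Hf; lra.
Qed.

Lemma abs_RInt_bound (f : R -> R) a b M : a <= b -> ex_RInt f a b -> (forall x, a <= x <= b -> Rabs (f x) <= M) ->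
  Rabs (RInt f a b) <= (b - a) * M.
Proof.
intros Hab He H. apply abs_RInt_le_const; assumption.
Qed.

(** Real and imaginary parts are bounded separately, which costs the factor 2. It passes on to
    Cauchy's estimate as a constant. *)
Lemma CInt_bound f a b M : a <= b -> pcont_on f a b -> (forall x, a <= x <= b -> Cmod (f x) <= M) ->
  Cmod (CInt f a b) <= 2 * (b - a) * M.
Proof.
intros Hab Hf H. eapply Rle_trans. apply Cmod_le_sum. unfold CInt. simpl.
assert (A := abs_RInt_bound (fun x => Re (f x)) a b M Hab (pcont_on_re _ _ _ Hab Hf)).
assert (B := abs_RInt_bound (fun x => Im (f x)) a b M Hab (pcont_on_im _ _ _ Hab Hf)).
enough (Rabs (RInt (fun x => Re (f x)) a b) <= (b - a) * M /\ Rabs (RInt (fun x => Im (f x)) a b) <= (b - a) * M) by lra.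
split; [apply A|apply B]; intros x Hx; eapply Rle_trans; try apply (H x Hx). apply re_le_Cmod. apply im_le_Cmod.
Qed.

Definition rect_int (f : C -> C) (a b c d : R) : C :=
  (CInt (fun x => f (x, c)) a b + Ci * CInt (fun y => f (b, y)) c d
   - CInt (fun x => f (x, d)) a b - Ci * CInt (fun y => f (a, y)) c d)%C.

Definition cdiff_rect f a b c d := forall x y, a <= x <= b -> c <= y <= d -> cdiff f (x, y).

Lemma cdiff_rect_h f a b c d y : cdiff_rect f a b c d -> c <= y <= d -> pcont_on (fun x => f (x, y)) a b.
Proof. intros H Hy x Hx. apply (pcont_comp f (fun x => (x, y))). apply cdiff_ccont. apply H; assumption. apply pcont_h. Qed.
Lemma cdiff_rect_v f a b c d x : cdiff_rect f a b c d -> a <= x <= b -> pcont_on (fun y => f (x, y)) c d.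
Proof. intros H Hx y Hy. apply (pcont_comp f (fun y => (x, y))). apply cdiff_ccont. apply H; assumption. apply pcont_v. Qed.

Lemma rect_int_quarter f a b c d m n : a <= m <= b -> c <= n <= d -> cdiff_rect f a b c d ->
  (rect_int f a b c d = (rect_int f a m c n + rect_int f m b c n) + (rect_int f a m n d + rect_int f m b n d))%C.
Proof.
intros Hm Hn H. unfold rect_int.
rewrite <- (CInt_Chasles (fun x => f (x, c)) a m b Hm) by (eapply cdiff_rect_h; [exact H|lra]).
rewrite <- (CInt_Chasles (fun x => f (x, d)) a m b Hm) by (eapply cdiff_rect_h; [exact H|lra]).
rewrite <- (CInt_Chasles (fun y => f (a, y)) c n d Hn) by (eapply cdiff_rect_v; [exact H|lra]).
rewrite <- (CInt_Chasles (fun y => f (b, y)) c n d Hn) by (eapply cdiff_rect_v; [exact H|lra]).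
ring.
Qed.

Lemma RInt_affine p q a b : RInt (fun x => p + q * x) a b = p * (b - a) + q * (b ^ 2 - a ^ 2) / 2 :> R.
Proof.
apply is_RInt_unique.
replace (p * (b - a) + q * (b ^ 2 - a ^ 2) / 2) with (minus ((fun x => p * x + q * x ^ 2 / 2) b) ((fun x => p * x + q * x ^ 2 / 2) a)).
2:{ unfold minus, plus, opp; simpl. field. }
apply (is_RInt_derive (fun x => p * x + q * x ^ 2 / 2)).
intros x _. auto_derive. trivial. field.
intros x _. apply (continuous_plus (fun x => p) (fun x => q * x)). apply continuous_const.
apply (continuous_mult (fun x => q) (fun x => x)). apply continuous_const. apply continuous_id.
Qed.

Lemma CInt_affine (p q : C) a b : a <= b ->
  CInt (fun x => p + q * RtoC x)%C a b = (p * (b - a) + q * ((b ^ 2 - a ^ 2) / 2)%R)%C.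
Proof.
intros Hab. unfold CInt. destruct p as [p1 p2], q as [q1 q2]. simpl.
rewrite (RInt_ext (fun x : R => p1 + (q1 * x - q2 * 0)) (fun x => p1 + q1 * x)) by (intros; simpl; ring).
rewrite (RInt_ext (fun x : R => p2 + (q1 * 0 + q2 * x)) (fun x => p2 + q2 * x)) by (intros; simpl; ring).
rewrite !RInt_affine. apply injective_projections; simpl; field.
Qed.

(** Needed in Goursat's theorem: the first-order part of [f] at the limit point drops out and only
    the remainder is integrated. Explicit integration of the four sides suffices. *)
Lemma rect_int_affine (al be : C) a b c d : a <= b -> c <= d ->
  rect_int (fun w => al + be * w)%C a b c d = 0.
Proof.
intros Hab Hcd. unfold rect_int.
assert (Eh : forall k, CInt (fun x => al + be * (x, k))%C a b = CInt (fun x => (al + be * (Ci * k)) + be * x)%C a b).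
{ intros k. apply CInt_ext; [exact Hab|]. intros x _. apply injective_projections; simpl; ring. }
assert (Ev : forall k, CInt (fun x => al + be * (k, x))%C c d = CInt (fun x => (al + be * k) + (be * Ci) * x)%C c d).
{ intros k. apply CInt_ext; [exact Hcd|]. intros x _. apply injective_projections; simpl; ring. }
rewrite !Eh, !Ev, !CInt_affine by assumption.
destruct al as [a1 a2], be as [b1 b2].
apply injective_projections; simpl; field.
Qed.

Lemma rect_int_bound f a b c d M : a <= b -> c <= d -> cdiff_rect f a b c d ->
  (forall x y, a <= x <= b -> c <= y <= d -> Cmod (f (x, y)) <= M) ->
  Cmod (rect_int f a b c d) <= 4 * ((b - a) + (d - c)) * M.
Proof.
intros Hab Hcd Hf H. unfold rect_int.
assert (H1 := CInt_bound (fun x => f (x, c)) a b M Hab (cdiff_rect_h _ _ _ _ _ c Hf ltac:(lra)) ltac:(intros; apply H; lra)).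
assert (H2 := CInt_bound (fun x => f (x, d)) a b M Hab (cdiff_rect_h _ _ _ _ _ d Hf ltac:(lra)) ltac:(intros; apply H; lra)).
assert (H3 := CInt_bound (fun y => f (a, y)) c d M Hcd (cdiff_rect_v _ _ _ _ _ a Hf ltac:(lra)) ltac:(intros; apply H; lra)).
assert (H4 := CInt_bound (fun y => f (b, y)) c d M Hcd (cdiff_rect_v _ _ _ _ _ b Hf ltac:(lra)) ltac:(intros; apply H; lra)).
unfold Cminus.
eapply Rle_trans. apply Cmod_triangle. rewrite Cmod_opp, Cmod_mult, Cmod_Ci.
eapply Rle_trans. apply Rplus_le_compat_r, Cmod_triangle. rewrite Cmod_opp.
eapply Rle_trans. apply Rplus_le_compat_r, Rplus_le_compat_r, Cmod_triangle. rewrite Cmod_mult, Cmod_Ci. lra.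
Qed.

Lemma rect_int_plus f g a b c d : a <= b -> c <= d -> cdiff_rect f a b c d -> cdiff_rect g a b c d ->
  (rect_int (fun w => f w + g w) a b c d = rect_int f a b c d + rect_int g a b c d)%C.
Proof.
intros Hab Hcd Hf Hg. unfold rect_int.
rewrite (CInt_plus (fun x => f (x, c)) (fun x => g (x, c))); [|exact Hab|eapply cdiff_rect_h; [eassumption|lra]..].
rewrite (CInt_plus (fun x => f (x, d)) (fun x => g (x, d))); [|exact Hab|eapply cdiff_rect_h; [eassumption|lra]..].
rewrite (CInt_plus (fun x => f (a, x)) (fun x => g (a, x))); [|exact Hcd|eapply cdiff_rect_v; [eassumption|lra]..].
rewrite (CInt_plus (fun x => f (b, x)) (fun x => g (b, x))); [|exact Hcd|eapply cdiff_rect_v; [eassumption|lra]..].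
ring.
Qed.

Lemma rect_int_ext f g a b c d : a <= b -> c <= d -> (forall z, f z = g z) ->
  rect_int f a b c d = rect_int g a b c d.
Proof.
intros Hab Hcd E. unfold rect_int.
rewrite (CInt_ext (fun x => f (x, c)) (fun x => g (x, c))), (CInt_ext (fun x => f (x, d)) (fun x => g (x, d))),
 (CInt_ext (fun x => f (a, x)) (fun x => g (a, x))), (CInt_ext (fun x => f (b, x)) (fun x => g (b, x))); auto.
Qed.

Section Goursat.
Variables (f : C -> C) (a b c d : R).
Hypothesis Hab : a <= b.
Hypothesis Hcd : c <= d.
Hypothesis Hf : cdiff_rect f a b c d.
Let W := b - a.
Let H := d - c.
Let mu (p : R * R) (n : nat) : R :=
  Cmod (rect_int f (fst p) (fst p + W / 2 ^ n) (snd p) (snd p + H / 2 ^ n)).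
Let inside (p : R * R) n := a <= fst p /\ fst p + W / 2 ^ n <= b /\ c <= snd p /\ snd p + H / 2 ^ n <= d.

(** Passes to the lower left corner of a quarter that carries at least one fourth of the integral.
    The last branch goes untested: if the other three quarters fail, the triangle inequality leaves
    the fourth. *)
Definition bisect_step (p : R * R) (n : nat) : R * R :=
  let w := W / 2 ^ S n in let h := H / 2 ^ S n in
  let (x, y) := p in
  if Rle_dec (mu p n / 4) (mu (x, y) (S n)) then (x, y) else
  if Rle_dec (mu p n / 4) (mu (x + w, y) (S n)) then (x + w, y) else
  if Rle_dec (mu p n / 4) (mu (x, y + h) (S n)) then (x, y + h) else
  (x + w, y + h).

Fixpoint bisect (n : nat) : R * R :=
  match n with O => (a, c) | S n => bisect_step (bisect n) n end.

Lemma bisect_halves L n : L / 2 ^ n = L / 2 ^ S n + L / 2 ^ S n.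
Proof. simpl. field. apply pow_nonzero. lra. Qed.
Lemma bisect_size_pos L n : 0 <= L -> 0 <= L / 2 ^ n.
Proof. intros. apply Rdiv_le_0_compat. assumption. apply pow_lt. lra. Qed.

Lemma bisect_stepP p n : inside p n ->
  let p' := bisect_step p n in
  inside p' (S n) /\ fst p <= fst p' /\ snd p <= snd p' /\
  fst p' + W / 2 ^ S n <= fst p + W / 2 ^ n /\ snd p' + H / 2 ^ S n <= snd p + H / 2 ^ n /\
  mu p n / 4 <= mu p' (S n).
Proof.
intros (I1 & I2 & I3 & I4). destruct p as [x y]. simpl in I1, I2, I3, I4.
assert (W0 := bisect_size_pos W (S n) ltac:(unfold W; lra)).
assert (H0 := bisect_size_pos H (S n) ltac:(unfold H; lra)).
assert (EW := bisect_halves W n). assert (EH := bisect_halves H n).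
unfold bisect_step, inside.
destruct (Rle_dec (mu (x, y) n / 4) (mu (x, y) (S n))) as [L1|L1]; [cbn [fst snd] in *; repeat split; lra|].
destruct (Rle_dec (mu (x, y) n / 4) (mu (x + W / 2 ^ S n, y) (S n))) as [L2|L2]; [cbn [fst snd] in *; repeat split; lra|].
destruct (Rle_dec (mu (x, y) n / 4) (mu (x, y + H / 2 ^ S n) (S n))) as [L3|L3]; [cbn [fst snd] in *; repeat split; lra|].
cbn [fst snd] in *; repeat split; try lra.
unfold mu in *. cbn [fst snd] in *.
assert (Q := rect_int_quarter f x (x + W / 2 ^ n) y (y + H / 2 ^ n) (x + W / 2 ^ S n) (y + H / 2 ^ S n) ltac:(lra) ltac:(lra)
  ltac:(intros u v Hu Hv; apply Hf; lra)).
replace (x + W / 2 ^ S n + W / 2 ^ S n) with (x + W / 2 ^ n) in * by lra.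
replace (y + H / 2 ^ S n + H / 2 ^ S n) with (y + H / 2 ^ n) in * by lra.
rewrite Q in *.
match goal with |- Cmod ((?A + ?B) + (?C + ?D)) / 4 <= _ =>
 assert (T1 := Cmod_triangle (A + B) (C + D)); assert (T2 := Cmod_triangle A B); assert (T3 := Cmod_triangle C D) end.
lra.
Qed.

Lemma bisect_inside n : inside (bisect n) n.
Proof.
induction n. unfold inside, bisect, W, H. simpl. repeat split; lra.
apply (bisect_stepP _ _ IHn).
Qed.

Lemma bisect_mu n : mu (a, c) 0 / 4 ^ n <= mu (bisect n) n.
Proof.
induction n. simpl. lra.
destruct (bisect_stepP _ _ (bisect_inside n)) as (_ & _ & _ & _ & _ & M).
change (bisect (S n)) with (bisect_step (bisect n) n). eapply Rle_trans; [|exact M].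
replace (mu (a, c) 0 / 4 ^ S n) with (mu (a, c) 0 / 4 ^ n / 4). lra. simpl. field. apply pow_nonzero. lra.
Qed.

Lemma nested_limit (u s : nat -> R) : (forall n, u n <= u (S n)) -> (forall n, u (S n) + s (S n) <= u n + s n) ->
  (forall n, 0 <= s n) -> exists l, forall n, u n <= l <= u n + s n.
Proof.
intros H1 H2 H3.
assert (Hi : forall n k, u n <= u (k + n)%nat). { intros n k. induction k; simpl. lra. specialize (H1 (k+n)%nat). lra. }
assert (Hd : forall n k, u (k + n)%nat + s (k + n)%nat <= u n + s n). { intros n k. induction k; simpl. lra. specialize (H2 (k+n)%nat). lra. }
assert (HA : forall m n, u m <= u n + s n).
{ intros m n. destruct (Nat.le_ge_cases m n) as [L|L].
  - specialize (Hi m (n - m)%nat). replace (n - m + m)%nat with n in Hi by lia. specialize (H3 n). lra.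
  - specialize (Hd n (m - n)%nat). replace (m - n + n)%nat with m in Hd by lia. specialize (H3 m). lra. }
destruct (completeness (fun x => exists n, x = u n)) as [l [U L]].
- exists (u 0%nat + s 0%nat). intros x [n ->]. apply HA.
- exists (u 0%nat), 0%nat. reflexivity.
- exists l. intros n. split. apply U. exists n; reflexivity. apply L. intros x [m ->]. apply HA.
Qed.

(** After [n] bisections the integral is at least [mu (a, c) 0 / 4 ^ n], while differentiability at
    the common point bounds it by [eps] times the square of the side lengths, which also shrinks
    like [4 ^ n]. The scales cancel, so the original integral is at most a constant times any
    [eps]. *)
Theorem goursat : rect_int f a b c d = 0.
Proof.
destruct (nested_limit (fun n => fst (bisect n)) (fun n => W / 2 ^ n)) as [X HX].
{ intros n. apply (bisect_stepP _ _ (bisect_inside n)). }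
{ intros n. apply (bisect_stepP _ _ (bisect_inside n)). }
{ intros n. apply bisect_size_pos. unfold W; lra. }
destruct (nested_limit (fun n => snd (bisect n)) (fun n => H / 2 ^ n)) as [Y HY].
{ intros n. apply (bisect_stepP _ _ (bisect_inside n)). }
{ intros n. apply (bisect_stepP _ _ (bisect_inside n)). }
{ intros n. apply bisect_size_pos. unfold H; lra. }
assert (W0 : 0 <= W) by (unfold W; lra). assert (H0 : 0 <= H) by (unfold H; lra).
assert (HXY : cdiff f (X, Y)).
{ apply Hf. specialize (HX 0%nat). simpl in HX. unfold W in HX. lra. specialize (HY 0%nat). simpl in HY. unfold H in HY. lra. }
destruct HXY as [l Hl].
assert (K : forall eps, 0 < eps -> mu (a, c) 0 <= 4 * (W + H) * (W + H) * eps).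
{ intros eps He. destruct (Hl eps He) as [del [Hdel D]].
  assert (exists n, (W + H) / 2 ^ n < del) as [n Hn].
  { destruct (pow_lt_1_zero (/2) ltac:(rewrite Rabs_pos_eq; lra) (del / (W + H + 1)) ltac:(apply Rdiv_lt_0_compat; lra)) as [n Hn].
    exists n. specialize (Hn n ltac:(lia)). rewrite pow_inv, Rabs_pos_eq in Hn.
    2:{ apply Rlt_le, Rinv_0_lt_compat, pow_lt; lra. }
    apply Rle_lt_trans with ((W + H + 1) * / 2 ^ n). apply Rmult_le_compat_r. apply Rlt_le, Rinv_0_lt_compat, pow_lt; lra. lra.
    apply Rlt_le_trans with ((W + H + 1) * (del / (W + H + 1))). apply Rmult_lt_compat_l; lra. right; field; lra. }
  assert (M := bisect_mu n). assert (I := bisect_inside n). destruct I as (I1 & I2 & I3 & I4).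
  specialize (HX n). specialize (HY n). unfold mu in M at 2.
  set (x := fst (bisect n)) in *. set (y := snd (bisect n)) in *.
  set (w := W / 2 ^ n) in *. set (h := H / 2 ^ n) in *.

  assert (Ewh : (W + H) / 2 ^ n = w + h) by (unfold w, h; field; apply pow_nonzero; lra).
  (* [al + l * z] is the tangent map of [f] at the limit point. Removing it does not change the
     contour integral. *)
  set (al := (f (X, Y) - l * (X, Y))%C).
  set (g := fun z => (f z - (al + l * z))%C).
  assert (DA : forall z, cdiff (fun z => al + l * z)%C z).
  { intros z. apply cdiff_plus. apply cdiff_const. apply cdiff_mult. apply cdiff_const. apply cdiff_id. }
  assert (Dg : cdiff_rect g x (x + w) y (y + h)).
  { intros u v Hu Hv. apply cdiff_minus. apply Hf; lra. apply DA. }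
  assert (E : rect_int f x (x + w) y (y + h) = rect_int g x (x + w) y (y + h)).
  { transitivity (rect_int (fun z => g z + (al + l * z))%C x (x + w) y (y + h)).
    - apply rect_int_ext; try lra; intros; unfold g; ring.
    - rewrite (rect_int_plus g (fun z => al + l * z)%C); try lra. rewrite rect_int_affine by lra. ring. exact Dg. intros u v _ _; apply DA. }
  rewrite E in M.
  assert (B : Cmod (rect_int g x (x + w) y (y + h)) <= 4 * (w + h) * (eps * (w + h))).
  { replace (w + h) with ((x + w - x) + (y + h - y)) at 1 by ring.
    apply rect_int_bound; try lra. exact Dg. intros u v Hu Hv.
    assert (N : Cmod ((u, v) - (X, Y))%C <= w + h).
    { eapply Rle_trans. apply Cmod_le_sum. simpl. apply Rplus_le_compat; apply Rabs_le; lra. }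
    specialize (D (u, v) ltac:(lra)). unfold g.
    replace (f (u, v) - (al + l * (u, v)))%C with (f (u, v) - f (X, Y) - l * ((u, v) - (X, Y)))%C by (unfold al; ring).
    eapply Rle_trans. exact D. apply Rmult_le_compat_l; lra. }
  assert (B2 := Rle_trans _ _ _ M B).
  rewrite <- Ewh in B2.
  assert (P4 : 0 < 4 ^ n) by (apply pow_lt; lra).
  apply Rmult_le_compat_r with (r := 4 ^ n) in B2; [|lra].
  replace (mu (a, c) 0 / 4 ^ n * 4 ^ n) with (mu (a, c) 0) in B2 by (field; lra).
  eapply Rle_trans. exact B2. right.
  replace 4 with (2 * 2) at 2 by ring. rewrite Rpow_mult_distr. field. apply pow_nonzero; lra. }
assert (Z : mu (a, c) 0 <= 0).
{ apply Rnot_lt_le. intros P. set (k := 4 * (W + H) * (W + H)) in *.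
  assert (k0 : 0 <= k) by (unfold k; repeat apply Rmult_le_pos; lra).
  assert (P' : 0 < mu (a, c) 0 / 2 / (k + 1)) by (apply Rdiv_lt_0_compat; lra).
  specialize (K _ P').
  assert (k * (mu (a, c) 0 / 2 / (k + 1)) <= mu (a, c) 0 / 2).
  { apply Rle_trans with ((k + 1) * (mu (a, c) 0 / 2 / (k + 1))). apply Rmult_le_compat_r; lra. right; field; lra. }
  lra. }
apply Cmod_eq_0. unfold mu in Z. simpl in Z.
replace (a + W / 1) with b in Z by (unfold W; field). replace (c + H / 1) with d in Z by (unfold H; field).
apply Rle_antisym. exact Z. apply Cmod_ge_0.
Qed.
End Goursat.

(** * Uniqueness of Fourier coefficients *)

Lemma continuous_bounded (f : R -> R) a b : a <= b -> (forall x, a <= x <= b -> continuous f x) ->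
  exists M, 0 <= M /\ forall x, a <= x <= b -> Rabs (f x) <= M.
Proof.
intros Hab H.
destruct (continuity_ab_maj (fun x => Rabs (f x)) a b Hab) as [m [Hm _]].
{ intros x Hx. apply continuity_pt_filterlim.
  apply (continuous_comp f Rabs). apply H. exact Hx. apply continuous_Rabs. }
exists (Rabs (f m)). split. apply Rabs_pos. exact Hm.
Qed.

(** The common end of three arguments: powers of a peaked kernel, powers of a function in the
    maximum principle, and the iterated contraction on a circle. *)
Lemma pow_dominates (r1 r2 A B : R) : 0 <= r1 < r2 -> 0 < A -> 0 <= B -> (forall m, A * r2 ^ m <= B * r1 ^ m) -> False.
Proof.
intros Hr HA HB H.
destruct (pow_lt_1_zero (r1 / r2)) with (y := A / (B + 1)) as [m Hm].
{ rewrite Rabs_pos_eq. apply Rmult_lt_reg_r with r2. lra. unfold Rdiv. rewrite Rmult_assoc, Rinv_l; lra.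
  apply Rdiv_le_0_compat; lra. }
{ apply Rdiv_lt_0_compat; lra. }
specialize (Hm m ltac:(lia)). specialize (H m).
assert (P : 0 < r2 ^ m) by (apply pow_lt; lra).
assert (P1 : 0 <= r1 ^ m) by (apply pow_le; lra).
unfold Rdiv in Hm at 1. rewrite Rpow_mult_distr, pow_inv, Rabs_pos_eq in Hm.
2:{ apply Rmult_le_pos. exact P1. apply Rlt_le, Rinv_0_lt_compat. exact P. }
apply Rmult_lt_compat_r with (r := r2 ^ m * (B + 1)) in Hm. 2: nra.
replace (r1 ^ m * / r2 ^ m * (r2 ^ m * (B + 1))) with (r1 ^ m * (B + 1)) in Hm by (field; lra).
replace (A / (B + 1) * (r2 ^ m * (B + 1))) with (A * r2 ^ m) in Hm by (field; lra).
nra.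
Qed.

Section FourierUniqueness.
Variable D : R -> R.
Hypothesis Dcont : forall x, continuous D x.
Hypothesis Dorth : forall (n : nat) phi, RInt (fun x => D x * cos (INR n * x + phi)) 0 (2 * PI) = 0 :> R.
Variable x0 : R.
(** A nonnegative kernel with maximum 1 at [x0]. Its powers are trigonometric polynomials that
    concentrate at [x0]. *)
Let kap x := (1 + cos (x - x0)) / 2.

Lemma kap_pow_cont m x : continuous (fun x => kap x ^ m) x.
Proof. apply @ex_derive_continuous. unfold kap. auto_derive. trivial. Qed.
Lemma cosZ_cont n phi x : continuous (fun x => cos (n * x + phi)) x.
Proof. apply @ex_derive_continuous. auto_derive. trivial. Qed.

Lemma DorthZ (n : Z) phi : RInt (fun x => D x * cos (IZR n * x + phi)) 0 (2 * PI) = 0 :> R.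
Proof.
destruct (Z_le_gt_dec 0 n) as [L|L].
- etransitivity; [|apply (Dorth (Z.to_nat n) phi)]. rewrite INR_IZR_INZ, Z2Nat.id by lia. reflexivity.
- etransitivity; [|apply (Dorth (Z.to_nat (- n)) (- phi))]. rewrite INR_IZR_INZ, Z2Nat.id by lia.
  apply RInt_ext. intros x _. rewrite opp_IZR. rewrite <- (cos_neg (IZR n * x + phi)). f_equal. f_equal. ring.
Qed.

(** One factor [kap] turns the frequency [n] into a combination of [n], [n + 1] and [n - 1] with
    shifted phases. The induction therefore runs over all phases and over integer frequencies, which
    may become negative. *)
Lemma kernel_orth m : forall (n : Z) phi, RInt (fun x => (D x * cos (IZR n * x + phi)) * kap x ^ m) 0 (2 * PI) = 0 :> R.
Proof.
assert (PP := PI_RGT_0).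
assert (C : forall m n phi x, continuous (fun x => (D x * cos (IZR n * x + phi)) * kap x ^ m) x).
{ intros k n phi x. apply @continuous_mult. apply @continuous_mult. apply Dcont. apply cosZ_cont. apply kap_pow_cont. }
induction m; intros n phi.
- etransitivity; [|apply (DorthZ n phi)]. apply rint_ext. lra. intros. simpl. ring.
- rewrite (rint_ext _ (fun x => (1/2) * ((D x * cos (IZR n * x + phi)) * kap x ^ m) +
     ((1/4) * ((D x * cos (IZR (n + 1) * x + (phi - x0))) * kap x ^ m) + (1/4) * ((D x * cos (IZR (n - 1) * x + (phi + x0))) * kap x ^ m)))).
  2: lra. 2:{ intros x _. rewrite plus_IZR, minus_IZR.
      change (kap x ^ S m) with (kap x * kap x ^ m). set (K := kap x ^ m). unfold kap.
      replace ((IZR n + 1) * x + (phi - x0)) with ((IZR n * x + phi) + (x - x0)) by ring.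
      replace ((IZR n - 1) * x + (phi + x0)) with ((IZR n * x + phi) - (x - x0)) by ring.
      set (a := IZR n * x + phi). set (b := x - x0). rewrite (cos_plus a b), (cos_minus a b). field. }
  assert (E : forall n phi, ex_RInt (fun x => (D x * cos (IZR n * x + phi)) * kap x ^ m) 0 (2 * PI)).
  { intros. apply ex_RInt_cont. lra. intros; apply C. }
  assert (I1 := IHm n phi). assert (I2 := IHm (n + 1)%Z (phi - x0)). assert (I3 := IHm (n - 1)%Z (phi + x0)).
  assert (E1 := E n phi). assert (E2 := E (n + 1)%Z (phi - x0)). assert (E3 := E (n - 1)%Z (phi + x0)). cbv beta in *.
  set (F1 := fun x => D x * cos (IZR n * x + phi) * kap x ^ m) in *.
  set (F2 := fun x => D x * cos (IZR (n + 1) * x + (phi - x0)) * kap x ^ m) in *.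
  set (F3 := fun x => D x * cos (IZR (n - 1) * x + (phi + x0)) * kap x ^ m) in *.
  change (RInt (fun x => (1 / 2) * F1 x + ((1/4) * F2 x + (1/4) * F3 x)) 0 (2 * PI) = 0 :> R).
  rewrite (rint_plus (fun x => (1/2) * F1 x) (fun x => (1/4) * F2 x + (1/4) * F3 x)), (rint_plus (fun x => (1/4) * F2 x) (fun x => (1/4) * F3 x)) by exr.
  rewrite (rint_scal F1), (rint_scal F2), (rint_scal F3), I1, I2, I3 by assumption. ring.
Qed.

(** If [D x0 > 0], the integral of [D * kap ^ m] vanishes although its part near [x0] is at least of
    order [k2 ^ m] and the rest is at least [- M * k1 ^ m] per unit length, with [k1 < k2]. *)
Lemma fourier_nonpos : 0 < x0 < 2 * PI -> D x0 <= 0.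
Proof.
intros Hx0. apply Rnot_lt_le. intros Pos.
assert (Hc := Dcont x0). rewrite <- continuous_eps in Hc.
destruct (Hc (D x0 / 2) ltac:(lra)) as [d0 [Hd0 Hd]].
(* Within distance [d] of [x0] the function [D] exceeds [D x0 / 2], and this window stays inside one
   period. *)
set (d := Rmin d0 (Rmin x0 (2 * PI - x0)) / 2).
assert (E1 := Rmin_l d0 (Rmin x0 (2 * PI - x0))). assert (E2 := Rmin_r d0 (Rmin x0 (2 * PI - x0))).
assert (E3 := Rmin_l x0 (2 * PI - x0)). assert (E4 := Rmin_r x0 (2 * PI - x0)).
assert (Pd : 0 < d). { unfold d. assert (0 < Rmin d0 (Rmin x0 (2 * PI - x0))) by (repeat apply Rmin_pos; lra). lra. }
assert (B1 : d < d0) by (unfold d in *; lra). assert (B2 : d < x0) by (unfold d in *; lra). assert (B3 : d < 2 * PI - x0) by (unfold d in *; lra).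
assert (B4 : d < PI) by lra.
destruct (continuous_bounded D 0 (2 * PI) ltac:(lra) ltac:(intros; apply Dcont)) as [M [HM0 HM]].
set (k1 := (1 + cos d) / 2). set (k2 := (1 + cos (d / 2)) / 2).
assert (K : 0 <= k1 < k2).
{ unfold k1, k2. assert (cos d < cos (d / 2)) by (apply cos_decreasing_1; lra). assert (T := COS_bound d). lra. }
assert (Kev : forall x, kap x = (1 + cos (Rabs (x - x0))) / 2).
{ intros x. unfold kap. unfold Rabs. destruct (Rcase_abs (x - x0)). rewrite cos_neg. reflexivity. reflexivity. }
assert (Kin : forall x, Rabs (x - x0) <= d / 2 -> k2 <= kap x).
{ intros x Hx. rewrite Kev. unfold k2. assert (A := Rabs_pos (x - x0)).
  assert (cos (d / 2) <= cos (Rabs (x - x0))) by (apply cos_decr_1; lra). lra. }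
assert (Kout : forall x, 0 <= x <= 2 * PI -> d <= Rabs (x - x0) -> 0 <= kap x <= k1).
{ intros x Hx Hx'. rewrite Kev. unfold k1. assert (T := COS_bound (Rabs (x - x0))). split. lra.
  assert (Rabs (x - x0) < 2 * PI - d). { apply Rabs_def1; lra. }
  assert (cos (Rabs (x - x0)) <= cos d).
  { destruct (Rle_dec (Rabs (x - x0)) PI). apply cos_decr_1; lra.
    replace (cos (Rabs (x - x0))) with (cos (2 * PI - Rabs (x - x0))) by (rewrite cos_minus, cos_2PI, sin_2PI; ring). apply cos_decr_1; lra. }
  lra. }
assert (Knn : forall x, 0 <= kap x). { intros x. unfold kap. assert (T := COS_bound (x - x0)). lra. }
assert (Cm : forall m x, continuous (fun x => D x * kap x ^ m) x).
{ intros. apply @continuous_mult. apply Dcont. apply kap_pow_cont. }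
apply (pow_dominates k1 k2 (D x0 / 2 * d) (2 * PI * M)); try assumption.
{ apply Rmult_lt_0_compat; lra. } { apply Rmult_le_pos; lra. }
intros m.
assert (Z : RInt (fun x => D x * kap x ^ m) 0 (2 * PI) = 0 :> R).
{ etransitivity; [|apply (kernel_orth m 0 0)]. apply rint_ext. lra. intros x _. simpl. rewrite Rmult_0_l, Rplus_0_l, cos_0. ring. }
assert (k1m : 0 <= k1 ^ m) by (apply pow_le; lra).
assert (Low : forall x, 0 <= x <= 2 * PI -> - (M * k1 ^ m) <= D x * kap x ^ m).
{ intros x Hx. assert (P := pow_le _ m (Knn x)).
  destruct (Rlt_le_dec (Rabs (x - x0)) d) as [L|L].
  - specialize (Hd x ltac:(lra)). apply Rabs_def2 in Hd. assert (0 <= D x * kap x ^ m) by (apply Rmult_le_pos; lra).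
    assert (0 <= M * k1 ^ m) by (apply Rmult_le_pos; lra). lra.
  - destruct (Kout x Hx L) as [K1 K2]. specialize (HM x Hx). apply Rabs_le_between in HM.
    assert (kap x ^ m <= k1 ^ m) by (apply pow_incr; lra). nra. }
assert (Mid : forall x, x0 - d / 2 <= x <= x0 + d / 2 -> D x0 / 2 * k2 ^ m <= D x * kap x ^ m).
{ intros x Hx. assert (A : Rabs (x - x0) <= d / 2) by (apply Rabs_le; lra).
  specialize (Kin x A). specialize (Hd x ltac:(lra)). apply Rabs_def2 in Hd.
  apply Rmult_le_compat; try lra. apply pow_le; lra. apply pow_incr; lra. }
assert (Ex : forall a b, a <= b -> ex_RInt (fun x => D x * kap x ^ m) a b) by (intros; apply ex_RInt_cont; auto).
rewrite <- (rint_Chasles (fun x => D x * kap x ^ m) 0 (x0 - d / 2) (2 * PI)) in Z by (apply Ex; lra).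
rewrite <- (rint_Chasles (fun x => D x * kap x ^ m) (x0 - d / 2) (x0 + d / 2) (2 * PI)) in Z by (apply Ex; lra).
assert (I1 := RInt_le (fun _ => - (M * k1 ^ m)) (fun x => D x * kap x ^ m) 0 (x0 - d / 2) ltac:(lra) ltac:(apply ex_RInt_const) ltac:(apply Ex; lra) ltac:(intros; apply Low; lra)).
assert (I2 := RInt_le (fun _ => D x0 / 2 * k2 ^ m) (fun x => D x * kap x ^ m) (x0 - d / 2) (x0 + d / 2) ltac:(lra) ltac:(apply ex_RInt_const) ltac:(apply Ex; lra) ltac:(intros; apply Mid; lra)).
assert (I3 := RInt_le (fun _ => - (M * k1 ^ m)) (fun x => D x * kap x ^ m) (x0 + d / 2) (2 * PI) ltac:(lra) ltac:(apply ex_RInt_const) ltac:(apply Ex; lra) ltac:(intros; apply Low; lra)).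
rewrite !rint_const in I1, I2, I3.
assert (0 <= M * k1 ^ m) by (apply Rmult_le_pos; lra). nra.
Qed.
End FourierUniqueness.

(** The sign argument applied to [D] and [- D] settles the open period. Continuity from the right
    adds the point 0, and periodicity the rest of the line. *)
Theorem fourier_unique (D : R -> R) : (forall x, continuous D x) -> (forall x, D (x + 2 * PI) = D x) ->
  (forall (n : nat) phi, RInt (fun x => D x * cos (INR n * x + phi)) 0 (2 * PI) = 0 :> R) -> forall x, D x = 0.
Proof.
intros Dc Dp Do.
assert (PP := PI_RGT_0).
assert (Z : forall x, 0 < x < 2 * PI -> D x = 0).
{ intros x Hx. apply Rle_antisym.
  - apply fourier_nonpos; assumption.
  - assert (T := fourier_nonpos (fun x => - D x) ltac:(intros y; apply (continuous_opp D), Dc)).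
    enough (- D x <= 0) by lra. apply T; [|exact Hx]. intros n phi.
    rewrite (rint_ext _ (fun x => (-1) * (D x * cos (INR n * x + phi)))); [|lra|intros; ring].
    rewrite rint_scal, Do. ring.
    apply ex_RInt_cont. lra. intros y _. apply @continuous_mult. apply Dc. apply cosZ_cont. }
assert (Pn : forall n x, D (x + 2 * PI * INR n) = D x).
{ induction n; intros x. simpl. f_equal. ring. rewrite S_INR. replace (x + 2 * PI * (INR n + 1)) with (x + 2 * PI * INR n + 2 * PI) by ring. rewrite Dp. apply IHn. }
assert (PZ : forall n x, D (x + 2 * PI * IZR n) = D x).
{ intros n x. destruct (Z_le_gt_dec 0 n).
  - rewrite <- (Pn (Z.to_nat n) x). rewrite INR_IZR_INZ, Z2Nat.id by lia. reflexivity.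
  - rewrite <- (Pn (Z.to_nat (- n)) (x + 2 * PI * IZR n)). rewrite INR_IZR_INZ, Z2Nat.id by lia. rewrite opp_IZR. f_equal. ring. }
assert (Zc : forall x, 0 <= x < 2 * PI -> D x = 0).
{ intros x Hx. destruct (Req_dec x 0) as [->|N]; [|apply Z; lra].
  destruct (Req_dec (D 0) 0) as [E|N]; [exact E|]. exfalso.
  assert (Hc := Dc 0). rewrite <- continuous_eps in Hc.
  destruct (Hc (Rabs (D 0))) as [d [Hd H]]. apply Rabs_pos_lt; exact N.
  set (y := Rmin (d / 2) PI). assert (Hy : 0 < y <= PI /\ y <= d / 2). { unfold y. split. split. apply Rmin_pos; lra. apply Rmin_r. apply Rmin_l. }
  specialize (H y ltac:(rewrite Rminus_0_r, Rabs_pos_eq; lra)). rewrite Z in H by lra.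
  replace (0 - D 0) with (- D 0) in H by ring. rewrite Rabs_Ropp in H. lra. }
intros x. destruct (archimed (x / (2 * PI))) as [A1 A2]. set (n := (up (x / (2 * PI)) - 1)%Z).
assert (Hn : IZR n = IZR (up (x / (2 * PI))) - 1) by (unfold n; rewrite minus_IZR; reflexivity).
replace x with ((x - 2 * PI * IZR n) + 2 * PI * IZR n) by ring. rewrite PZ. apply Zc.
assert (Ex : x = 2 * PI * (x / (2 * PI))) by (field; lra). rewrite Hn. rewrite Ex at 1 3.
split; nra.
Qed.

(** * The exponential function and dominated series *)

Definition cexp (z : C) : C := (exp (Re z) * cos (Im z), exp (Re z) * sin (Im z)).

Lemma cexp_plus z w : cexp (z + w) = (cexp z * cexp w)%C.
Proof.
destruct z as [x y], w as [x' y']. unfold cexp. apply injective_projections; simpl; rewrite exp_plus.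
rewrite cos_plus. ring. rewrite sin_plus. ring.
Qed.
Lemma cexp_0 : cexp 0 = 1.
Proof. unfold cexp. simpl. rewrite exp_0, cos_0, sin_0. apply injective_projections; simpl; ring. Qed.
Lemma cexp_R (x : R) : cexp x = RtoC (exp x).
Proof. unfold cexp. simpl. rewrite cos_0, sin_0. apply injective_projections; simpl; ring. Qed.
Lemma Cmod_cexp z : Cmod (cexp z) = exp (Re z).
Proof.
unfold Cmod, cexp. simpl fst; simpl snd. rewrite !Rpow_mult_distr.
replace (exp (Re z) ^ 2 * cos (Im z) ^ 2 + exp (Re z) ^ 2 * sin (Im z) ^ 2) with (exp (Re z) ^ 2).
rewrite <- Rsqr_pow2. apply sqrt_Rsqr. apply Rlt_le, exp_pos.
assert (T := sin2_cos2 (Im z)). rewrite !Rsqr_pow2 in T.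
rewrite <- Rmult_plus_distr_l. replace (cos (Im z) ^ 2 + sin (Im z) ^ 2) with 1 by lra. ring.
Qed.
Lemma cexp_pow z n : (cexp z ^ n)%C = cexp (INR n * z).
Proof.
induction n. simpl. rewrite Cmult_0_l, cexp_0. reflexivity.
rewrite Cpow_S, IHn, <- cexp_plus. f_equal. rewrite S_INR, RtoC_plus. ring.
Qed.
Lemma cexp_period z (k : Z) : cexp (z + (0, 2 * PI * IZR k)) = cexp z.
Proof.
destruct z as [a b]. unfold cexp. simpl. rewrite Rplus_0_r.
assert (Hc : forall n x, cos (x + 2 * PI * INR n) = cos x). { intros n x. rewrite <- (cos_period x n). f_equal. ring. }
assert (Hs : forall n x, sin (x + 2 * PI * INR n) = sin x). { intros n x. rewrite <- (sin_period x n). f_equal. ring. }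
destruct (Z_le_gt_dec 0 k).
- rewrite <- (Z2Nat.id k), <- INR_IZR_INZ by lia. rewrite Hc, Hs. reflexivity.
- rewrite <- (Hc (Z.to_nat (- k))), <- (Hs (Z.to_nat (- k))). rewrite !INR_IZR_INZ, Z2Nat.id by lia.
  rewrite opp_IZR. replace (b + 2 * PI * IZR k + 2 * PI * - IZR k) with b by ring. reflexivity.
Qed.

Lemma exp_minus_1_bound x : Rabs x <= 1/2 -> Rabs (exp x - 1 - x) <= 2 * x ^ 2.
Proof.
intros H. apply Rabs_le_between in H.
assert (A := exp_ineq1_le x). assert (B := exp_ineq1_le (- x)).
rewrite exp_Ropp in B.
assert (U : exp x * (1 - x) <= 1).
{ apply Rmult_le_compat_l with (r := exp x) in B; [|lra]. rewrite Rinv_r in B by lra. lra. }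
rewrite Rabs_pos_eq by lra. nra.
Qed.

Lemma Rabs_sin_le x : Rabs (sin x) <= Rabs x.
Proof.
assert (P : forall x, 0 < x -> Rabs (sin x) <= x).
{ intros y Hy. apply Rabs_le. assert (T := sin_lt_x y Hy). split; [|lra].
  destruct (Rle_dec y PI). assert (0 <= sin y) by (apply sin_ge_0; lra). lra.
  assert (S := SIN_bound y). assert (2 < PI) by (assert (T1 := PI2_1); lra). lra. }
destruct (Rtotal_order x 0) as [L|[->|L]].
- rewrite <- (Rabs_Ropp (sin x)), <- sin_neg, <- (Rabs_Ropp x), (Rabs_pos_eq (- x)) by lra. apply P. lra.
- rewrite sin_0. lra.
- rewrite (Rabs_pos_eq x) by lra. apply P, L.
Qed.

Lemma cos_minus_1_bound x : Rabs (cos x - 1) <= x ^ 2 / 2.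
Proof.
assert (E : cos x = 1 - 2 * sin (x / 2) * sin (x / 2)). { rewrite <- cos_2a_sin. f_equal. field. }
assert (S : Rabs (sin (x/2)) <= Rabs (x / 2)) by apply Rabs_sin_le.
rewrite E. replace (1 - 2 * sin (x / 2) * sin (x / 2) - 1) with (- (2 * (sin (x/2) * sin (x/2)))) by ring.
rewrite Rabs_Ropp, Rabs_mult, Rabs_pos_eq by lra. rewrite Rabs_mult.
assert (T : Rabs (x/2) * Rabs (x/2) = x ^ 2 / 4). { rewrite <- Rabs_mult, Rabs_pos_eq. field. apply Rle_0_sqr. }
assert (0 <= Rabs (sin (x/2))) by apply Rabs_pos. nra.
Qed.

(** The only derivative of [cexp] that is computed; the addition formula carries it to every other
    point. *)
Lemma cderiv_cexp_0 : cderiv cexp 0 1.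
Proof.
intros eps He.
destruct (derivable_pt_lim_sin 0 (eps / 4) ltac:(lra)) as [d Hd].
exists (Rmin d (Rmin (1/2) (eps / 32))). split. repeat apply Rmin_pos; try lra. apply cond_pos.
intros w Hw. replace (w - 0)%C with w in * by ring.
assert (L1 := Rmin_l d (Rmin (1/2) (eps / 32))). assert (L2 := Rmin_r d (Rmin (1/2) (eps / 32))).
assert (L3 := Rmin_l (1/2) (eps / 32)). assert (L4 := Rmin_r (1/2) (eps / 32)).
rewrite cexp_0. destruct w as [x y].
set (m := Cmod (x, y)) in *.
assert (Hx : Rabs x <= m) by apply (re_le_Cmod (x, y)). assert (Hy : Rabs y <= m) by apply (im_le_Cmod (x, y)).
assert (Px := Rabs_pos x). assert (Py := Rabs_pos y).
assert (X2 : x ^ 2 <= m * m). { rewrite <- pow2_abs. nra. }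
assert (Y2 : y ^ 2 <= m * m). { rewrite <- pow2_abs. nra. }
assert (B1 := exp_minus_1_bound x ltac:(lra)).
assert (B2 := cos_minus_1_bound y).
assert (B3 : Rabs (sin y - y) <= eps / 4 * m).
{ destruct (Req_dec y 0) as [->|N]. rewrite sin_0, Rminus_0_r, Rabs_R0. apply Rmult_le_pos; lra.
  specialize (Hd y N ltac:(lra)). rewrite Rplus_0_l, sin_0, cos_0, Rminus_0_r in Hd.
  replace (sin y - y) with ((sin y / y - 1) * y) by (field; exact N). rewrite Rabs_mult.
  apply Rmult_le_compat; try apply Rabs_pos; lra. }
assert (B4 : Rabs (sin y) <= m). { eapply Rle_trans. apply Rabs_sin_le. exact Hy. }
assert (B5 : Rabs (exp x - 1) <= 2 * m).
{ replace (exp x - 1) with ((exp x - 1 - x) + x) by ring. eapply Rle_trans. apply Rabs_triang. nra. }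
eapply Rle_trans. apply Cmod_le_sum. unfold cexp. simpl.
replace (exp x * cos y + -(1) + - (1 * x - 0 * y)) with ((exp x - 1 - x) * cos y + (1 + x) * (cos y - 1)) by ring.
replace (exp x * sin y + - 0 + - (1 * y + 0 * x)) with ((exp x - 1) * sin y + (sin y - y)) by ring.
assert (C1 : Rabs ((exp x - 1 - x) * cos y) <= 2 * (m * m)).
{ rewrite Rabs_mult. assert (Rabs (cos y) <= 1) by (apply Rabs_le; apply COS_bound). assert (T := Rabs_pos (exp x - 1 - x)). assert (T' := Rabs_pos (cos y)). nra. }
assert (C2 : Rabs ((1 + x) * (cos y - 1)) <= m * m).
{ rewrite Rabs_mult. assert (Rabs (1 + x) <= 2). { eapply Rle_trans. apply Rabs_triang. rewrite Rabs_R1. lra. }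
  assert (T := Rabs_pos (1 + x)). assert (T' := Rabs_pos (cos y - 1)). nra. }
assert (C3 : Rabs ((exp x - 1) * sin y) <= 2 * (m * m)).
{ rewrite Rabs_mult. assert (T := Rabs_pos (exp x - 1)). assert (T' := Rabs_pos (sin y)). nra. }
assert (T1 := Rabs_triang ((exp x - 1 - x) * cos y) ((1 + x) * (cos y - 1))).
assert (T2 := Rabs_triang ((exp x - 1) * sin y) (sin y - y)).
assert (m0 : 0 <= m) by apply Cmod_ge_0.
assert (m * m <= eps / 32 * m) by (apply Rmult_le_compat_r; lra).
assert (0 <= eps * m) by (apply Rmult_le_pos; lra).
lra.
Qed.

Lemma cdiff_cexp z : cdiff cexp z.
Proof.
apply cdiff_ext with (fun w => cexp z * cexp (w - z))%C.
{ intros w. rewrite <- cexp_plus. f_equal. ring. }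
apply cdiff_mult. apply cdiff_const.
apply (cdiff_comp cexp (fun w => w - z)%C).
replace (z - z)%C with (RtoC 0) by ring. exists 1. apply cderiv_cexp_0.
apply cdiff_minus. apply cdiff_id. apply cdiff_const.
Qed.

Lemma series_tail (a M : nat -> R) N : (forall n, Rabs (a n) <= M n) -> ex_series M ->
  Rabs (Series a - sum_n a N) <= Series M - sum_n M N.
Proof.
intros H HM.
assert (Ha : ex_series a) by (apply (ex_series_le a M); assumption).
rewrite (Series_incr_n a (S N)), (Series_incr_n M (S N)); try lia; try assumption.
rewrite !sum_n_Reals. simpl pred.
replace (sum_f_R0 a N + Series (fun k => a (S N + k)%nat) - sum_f_R0 a N) with (Series (fun k => a (S N + k)%nat)) by ring.
replace (sum_f_R0 M N + Series (fun k => M (S N + k)%nat) - sum_f_R0 M N) with (Series (fun k => M (S N + k)%nat)) by ring.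
assert (E : ex_series (fun k => M (S N + k)%nat)) by (apply (ex_series_incr_n M (S N)); exact HM).
eapply Rle_trans. apply Series_Rabs.
apply (ex_series_le (fun n => Rabs (a (S N + n)%nat)) (fun k => M (S N + k)%nat)); [|exact E].
intros n. simpl. change (Rabs (Rabs (a (S (N + n)))) <= M (S (N + n))). rewrite Rabs_Rabsolu. apply H.
apply Series_le; [|exact E]. intros n. split. apply Rabs_pos. apply H.
Qed.

Lemma series_tail_lim (M : nat -> R) : ex_series M -> is_lim_seq (fun N => Series M - sum_n M N) 0.
Proof.
intros H. replace (Finite 0) with (Finite (Series M - Series M)) by (f_equal; ring).
apply is_lim_seq_minus'. apply is_lim_seq_const. apply (Series_correct M H).
Qed.

Lemma series_tail_eps (M : nat -> R) eps : ex_series M -> 0 < eps -> exists N, forall n, (N <= n)%nat -> Rabs (Series M - sum_n M n) < eps.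
Proof.
intros H He. assert (T := series_tail_lim M H). apply is_lim_seq_spec in T.
destruct (T (mkposreal eps He)) as [N HN]. exists N. intros n Hn. specialize (HN n Hn). simpl in HN.
rewrite Rminus_0_r in HN. exact HN.
Qed.

Lemma continuous_sum_n (f : nat -> R -> R) N x : (forall n, continuous (f n) x) -> continuous (fun y => sum_n (fun n => f n y) N) x.
Proof.
intros H. induction N.
- apply (continuous_ext (f 0%nat)). intros y. rewrite sum_O. reflexivity. apply H.
- apply (continuous_ext (fun y => sum_n (fun n => f n y) N + f (S N) y)). intros y. rewrite sum_Sn. reflexivity.
  apply (continuous_plus (fun y => sum_n (fun n => f n y) N) (f (S N))). exact IHN. apply H.
Qed.

Lemma Series_continuous (f : nat -> R -> R) (M : nat -> R) x d : 0 < d ->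
  (forall n y, Rabs (y - x) < d -> Rabs (f n y) <= M n) -> ex_series M ->
  (forall n, continuous (f n) x) -> continuous (fun y => Series (fun n => f n y)) x.
Proof.
intros Hd HM EM Hc. apply continuous_eps. intros eps He.
destruct (series_tail_eps M (eps/3) EM ltac:(lra)) as [N HN]. specialize (HN N ltac:(lia)).
assert (C := continuous_sum_n f N x Hc). rewrite <- continuous_eps in C.
destruct (C (eps/3) ltac:(lra)) as [d' [Hd' H]].
exists (Rmin d d'). split. apply Rmin_pos; assumption. intros y Hy.
assert (L1 := Rmin_l d d'). assert (L2 := Rmin_r d d').
assert (A := series_tail (fun n => f n y) M N ltac:(intros; apply HM; lra) EM).
assert (B := series_tail (fun n => f n x) M N ltac:(intros; apply HM; rewrite Rminus_diag, Rabs_R0; lra) EM).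
specialize (H y ltac:(lra)).
apply Rabs_def2 in HN. apply Rabs_def2 in H. apply Rabs_le_between in A. apply Rabs_le_between in B.
apply Rabs_def1; lra.
Qed.

Lemma RInt_sum_n (f : nat -> R -> R) N a b : (forall n, ex_RInt (f n) a b) ->
  ex_RInt (fun x => sum_n (fun n => f n x) N) a b /\
  RInt (fun x => sum_n (fun n => f n x) N) a b = sum_n (fun n => RInt (f n) a b) N.
Proof.
intros H. induction N.
- rewrite sum_O. split. apply (ex_RInt_ext (f 0%nat)). intros; rewrite sum_O; reflexivity. apply H.
  apply RInt_ext. intros. rewrite sum_O. reflexivity.
- destruct IHN as [E I]. split.
  + apply (ex_RInt_ext (fun y => sum_n (fun n => f n y) N + f (S N) y)). intros. rewrite sum_Sn. reflexivity.
    exr. apply H.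
  + rewrite sum_Sn, <- I. rewrite (RInt_ext _ (fun y => sum_n (fun n => f n y) N + f (S N) y)) by (intros; rewrite sum_Sn; reflexivity).
    apply (rint_plus _ (f (S N))). exact E. apply H.
Qed.

Lemma RInt_Series (f : nat -> R -> R) (M : nat -> R) a b : a <= b ->
  (forall n x, a <= x <= b -> Rabs (f n x) <= M n) -> ex_series M ->
  (forall n, ex_RInt (f n) a b) -> ex_RInt (fun x => Series (fun n => f n x)) a b ->
  is_series (fun n => RInt (f n) a b) (RInt (fun x => Series (fun n => f n x)) a b).
Proof.
intros Hab HM EM Ef ES.
change (is_lim_seq (sum_n (fun n => RInt (f n) a b)) (RInt (fun x => Series (fun n => f n x)) a b)).
apply is_lim_seq_spec. intros eps.
destruct (series_tail_eps M (eps / (b - a + 1)) EM) as [N HN]. apply Rdiv_lt_0_compat. apply cond_pos. lra.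
exists N. intros n Hn. specialize (HN n Hn).
destruct (RInt_sum_n f n a b Ef) as [E1 E2]. rewrite <- E2.
rewrite Rabs_minus_sym, <- rint_minus by assumption.
apply Rle_lt_trans with ((b - a) * (eps / (b - a + 1))).
- apply abs_RInt_bound. exact Hab. exr. intros x Hx.
  eapply Rle_trans. apply (series_tail (fun n => f n x) M n). intros k; apply HM; exact Hx. exact EM.
  apply Rabs_def2 in HN. lra.
- assert (Pe := cond_pos eps). apply Rlt_le_trans with ((b - a + 1) * (eps / (b - a + 1))).
  apply Rmult_lt_compat_r. apply Rdiv_lt_0_compat; lra. lra. right; field; lra.
Qed.

(** [Series] is total and has a meaningful value only under convergence. For this reason the
    algebraic rules below ask for a summable majorant of the moduli. *)
Definition CSeries (a : nat -> C) : C := (Series (fun n => Re (a n)), Series (fun n => Im (a n))).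

Lemma ex_series_dom (a : nat -> C) (M : nat -> R) : (forall n, Cmod (a n) <= M n) -> ex_series M ->
  ex_series (fun n => Re (a n)) /\ ex_series (fun n => Im (a n)).
Proof.
intros H E. split; [apply (ex_series_le (fun n => Re (a n)) M)|apply (ex_series_le (fun n => Im (a n)) M)]; try exact E;
 intros n; eapply Rle_trans; try apply (H n). apply re_le_Cmod. apply im_le_Cmod.
Qed.

Lemma CSeries_bound (a : nat -> C) (M : nat -> R) : (forall n, Cmod (a n) <= M n) -> ex_series M -> Cmod (CSeries a) <= 2 * Series M.
Proof.
intros H E. eapply Rle_trans. apply Cmod_le_sum. unfold CSeries. simpl.
assert (A : forall b : nat -> R, (forall n, Rabs (b n) <= M n) -> Rabs (Series b) <= Series M).
{ intros b Hb. eapply Rle_trans. apply Series_Rabs. apply (ex_series_le (fun n => Rabs (b n)) M).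
  intros n. change (Rabs (Rabs (b n)) <= M n). rewrite Rabs_Rabsolu. apply Hb. exact E.
  apply Series_le; [|exact E]. intros n; split. apply Rabs_pos. apply Hb. }
assert (A1 := A (fun n => Re (a n)) ltac:(intros n; eapply Rle_trans; [apply re_le_Cmod|apply H])).
assert (A2 := A (fun n => Im (a n)) ltac:(intros n; eapply Rle_trans; [apply im_le_Cmod|apply H])).
lra.
Qed.

Lemma CSeries_ext a b : (forall n, a n = b n) -> CSeries a = CSeries b.
Proof. intros H. unfold CSeries. f_equal; apply Series_ext; intros n; rewrite H; reflexivity. Qed.

Lemma CSeries_scal k a M : (forall n, Cmod (a n) <= M n) -> ex_series M -> CSeries (fun n => k * a n)%C = (k * CSeries a)%C.
Proof.
intros H E. destruct (ex_series_dom a M H E) as [E1 E2]. unfold CSeries. apply injective_projections.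
- change (Series (fun n => Re k * Re (a n) - Im k * Im (a n)) = Re k * Series (fun n => Re (a n)) - Im k * Series (fun n => Im (a n))).
  rewrite (Series_minus (fun n => Re k * Re (a n)) (fun n => Im k * Im (a n))), !Series_scal_l. reflexivity.
  apply (ex_series_scal_l (Re k) (fun n => Re (a n))); exact E1. apply (ex_series_scal_l (Im k) (fun n => Im (a n))); exact E2.
- change (Series (fun n => Re k * Im (a n) + Im k * Re (a n)) = Re k * Series (fun n => Im (a n)) + Im k * Series (fun n => Re (a n))).
  rewrite (Series_plus (fun n => Re k * Im (a n)) (fun n => Im k * Re (a n))), !Series_scal_l. reflexivity.
  apply (ex_series_scal_l (Re k) (fun n => Im (a n))); exact E2. apply (ex_series_scal_l (Im k) (fun n => Re (a n))); exact E1.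
Qed.

Lemma CSeries_plus a b M M' : (forall n, Cmod (a n) <= M n) -> ex_series M -> (forall n, Cmod (b n) <= M' n) -> ex_series M' ->
  CSeries (fun n => a n + b n)%C = (CSeries a + CSeries b)%C.
Proof.
intros H E H' E'. destruct (ex_series_dom a M H E) as [E1 E2]. destruct (ex_series_dom b M' H' E') as [E3 E4].
unfold CSeries. apply injective_projections; simpl.
apply (Series_plus (fun n => Re (a n)) (fun n => Re (b n))); assumption.
apply (Series_plus (fun n => Im (a n)) (fun n => Im (b n))); assumption.
Qed.

Lemma CSeries_incr_1 a M : (forall n, Cmod (a n) <= M n) -> ex_series M -> CSeries a = (a O + CSeries (fun n => a (S n)))%C.
Proof.
intros H E. destruct (ex_series_dom a M H E) as [E1 E2]. unfold CSeries. apply injective_projections; simpl.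
apply (Series_incr_1 (fun n => Re (a n)) E1). apply (Series_incr_1 (fun n => Im (a n)) E2).
Qed.

Lemma CSeries_pcont (f : nat -> R -> C) (M : nat -> R) x :
  (forall n y, Cmod (f n y) <= M n) -> ex_series M ->
  (forall n, pcont (f n) x) -> pcont (fun y => CSeries (fun n => f n y)) x.
Proof.
intros H E Hc. split; simpl.
- apply (Series_continuous (fun n y => Re (f n y)) M x 1 Rlt_0_1); [|exact E|intros n; apply Hc].
  intros n y _. eapply Rle_trans. apply re_le_Cmod. apply H.
- apply (Series_continuous (fun n y => Im (f n y)) M x 1 Rlt_0_1); [|exact E|intros n; apply Hc].
  intros n y _. eapply Rle_trans. apply im_le_Cmod. apply H.
Qed.

Lemma CInt_CSeries (f : nat -> R -> C) (M : nat -> R) a b : a <= b ->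
  (forall n y, Cmod (f n y) <= M n) -> ex_series M ->
  (forall n x, pcont (f n) x) -> CInt (fun y => CSeries (fun n => f n y)) a b = CSeries (fun n => CInt (f n) a b).
Proof.
intros Hab H E Hc. assert (P := fun x => CSeries_pcont f M x H E (fun n => Hc n x)).
assert (P' : pcont_on (fun y => CSeries (fun n => f n y)) a b) by (intros x _; apply P).
assert (Pn : forall n, pcont_on (f n) a b) by (intros n x _; apply Hc).
unfold CInt, CSeries. f_equal; symmetry; apply is_series_unique.
- apply (RInt_Series (fun n y => Re (f n y)) M); try assumption.
  intros n x _. eapply Rle_trans. apply re_le_Cmod. apply H.
  intros n. apply pcont_on_re; auto. apply (pcont_on_re _ _ _ Hab P').
- apply (RInt_Series (fun n y => Im (f n y)) M); try assumption.
  intros n x _. eapply Rle_trans. apply im_le_Cmod. apply H.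
  intros n. apply pcont_on_im; auto. apply (pcont_on_im _ _ _ Hab P').
Qed.

(** * Taylor expansion in the unit disk *)

Definition holo (f : C -> C) : Prop := forall z, Cmod z < 1 -> cdiff f z.

(* Substituting z = e^w turns circles into vertical segments, so that Goursat on rectangles suffices
   to see that the coefficients do not depend on the radius. *)
Definition logpull (f : C -> C) (n : Z) (w : C) : C := (f (cexp w) * cexp (RtoC (- IZR n) * w))%C.

(* computed on the circle of radius e^{-1} *)
Definition tcoef (f : C -> C) (n : Z) : C := (RtoC (/ (2 * PI)) * CInt (fun y => logpull f n ((- (1))%R, y)) 0 (2 * PI))%C.

Lemma cexp_in_disk u y : u < 0 -> Cmod (cexp (u, y)) < 1.
Proof. intros. rewrite Cmod_cexp. simpl. rewrite <- exp_0. apply exp_increasing. exact H. Qed.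

Lemma cdiff_logpull f n w : holo f -> Re w < 0 -> cdiff (logpull f n) w.
Proof.
intros Hf Hw. apply cdiff_mult.
- apply (cdiff_comp f cexp). apply Hf. destruct w. apply cexp_in_disk. exact Hw. apply cdiff_cexp.
- apply (cdiff_comp cexp (fun w => RtoC (- IZR n) * w)%C). apply cdiff_cexp. apply cdiff_mult. apply cdiff_const. apply cdiff_id.
Qed.

Lemma logpull_period f n x : logpull f n (x, 2 * PI) = logpull f n (x, 0).
Proof.
unfold logpull. f_equal.
- replace (x, 2 * PI) with ((x, 0%R) + (0%R, (2 * PI * IZR 1)%R))%C. rewrite cexp_period. reflexivity.
  apply injective_projections; simpl; ring.
- replace (RtoC (- IZR n) * (x, (2 * PI)%R))%C with (RtoC (- IZR n) * (x, 0%R) + (0%R, (2 * PI * IZR (- n))%R))%C. apply cexp_period.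
  rewrite opp_IZR. apply injective_projections; simpl; ring.
Qed.

Lemma logpull_vert f n u : holo f -> u < 0 -> pcont_on (fun y => logpull f n (u, y)) 0 (2 * PI).
Proof.
intros Hf Hu y _. apply (pcont_comp (logpull f n) (fun y => (u, y))). apply cdiff_ccont, cdiff_logpull. exact Hf. exact Hu. apply pcont_v.
Qed.

(** Goursat on the rectangle between the two vertical segments: by periodicity of [cexp] the
    horizontal sides cancel, so the vertical ones agree. *)
Lemma circle_const_aux f n u v : holo f -> u <= v -> v < 0 ->
  CInt (fun y => logpull f n (u, y)) 0 (2 * PI) = CInt (fun y => logpull f n (v, y)) 0 (2 * PI).
Proof.
intros Hf Huv Hv. assert (PP := PI_RGT_0).
assert (G := goursat (logpull f n) u v 0 (2 * PI) Huv ltac:(lra) ltac:(intros x y Hx Hy; apply cdiff_logpull; [exact Hf|simpl; lra])).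
unfold rect_int in G.
rewrite (CInt_ext (fun x => logpull f n (x, 2 * PI)) (fun x => logpull f n (x, 0))) in G; [|exact Huv|intros; apply logpull_period].
set (A := CInt (fun y => logpull f n (u, y)) 0 (2 * PI)) in *.
set (B := CInt (fun y => logpull f n (v, y)) 0 (2 * PI)) in *.
set (H0 := CInt (fun x => logpull f n (x, 0)) u v) in *.
assert (E : (Ci * (B - A) = 0)%C). { rewrite <- G. ring. }
assert (E2 : (B - A = - Ci * (Ci * (B - A)))%C). { assert (J : (Ci * Ci = - (1))%C) by (apply injective_projections; simpl; ring).
  transitivity (- (Ci * Ci) * (B - A))%C. rewrite J. ring. ring. }
rewrite E in E2. replace A with (B - (B - A))%C by ring. rewrite E2. ring.
Qed.

Lemma circle_const f n u : holo f -> u < 0 ->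
  CInt (fun y => logpull f n (u, y)) 0 (2 * PI) = (RtoC (2 * PI) * tcoef f n)%C.
Proof.
intros Hf Hu. assert (PP := PI_RGT_0). unfold tcoef. rewrite Cmult_assoc, <- RtoC_mult.
replace (2 * PI * / (2 * PI)) with 1 by (field; lra). rewrite Cmult_1_l.
destruct (Rle_dec u (-1)). apply circle_const_aux; lra || assumption. symmetry. apply circle_const_aux; lra || assumption.
Qed.

(** Cauchy's estimate on the circle of radius [exp u], with the factor 2 inherited from
    [CInt_bound]. *)
Lemma tcoef_bound f n u M : holo f -> u < 0 -> (forall z, Cmod z = exp u -> Cmod (f z) <= M) ->
  Cmod (tcoef f n) <= 2 * M * exp (- IZR n * u).
Proof.
intros Hf Hu HM. assert (PP := PI_RGT_0).
assert (B := CInt_bound (fun y => logpull f n (u, y)) 0 (2 * PI) (M * exp (- IZR n * u)) ltac:(lra) (logpull_vert f n u Hf Hu)).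
rewrite (circle_const f n u Hf Hu), Cmod_mult, Cmod_R, (Rabs_pos_eq (2 * PI)) in B by lra.
apply Rmult_le_reg_l with (2 * PI). lra.
eapply Rle_trans. apply B.
- intros y _. unfold logpull. rewrite Cmod_mult, (Cmod_cexp (_ * _)). simpl Re.
  replace (- IZR n * u - 0 * y) with (- IZR n * u) by ring.
  apply Rmult_le_compat_r. apply Rlt_le, exp_pos. apply HM. rewrite Cmod_cexp. reflexivity.
- right. ring.
Qed.

Lemma holo_bounded_near_0 f : holo f -> exists d M, 0 < d < 1 /\ forall z, Cmod z < d -> Cmod (f z) <= M.
Proof.
intros Hf. destruct (cdiff_ccont f 0 (Hf 0 ltac:(rewrite Cmod_0; lra)) 1 Rlt_0_1) as [d [Hd H]].
exists (Rmin d (1/2)), (Cmod (f 0) + 1). split. split. apply Rmin_pos; lra. assert (T := Rmin_r d (1/2)). lra.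
intros z Hz. assert (T := Rmin_l d (1/2)).
replace (f z) with ((f z - f 0) + f 0)%C by ring. eapply Rle_trans. apply Cmod_triangle.
specialize (H z). replace (z - 0)%C with z in H by ring. specialize (H ltac:(lra)). lra.
Qed.

Lemma exp_small eps : 0 < eps -> exists u, u < 0 /\ exp u < eps.
Proof.
intros He. exists (- (1 + / eps)). assert (P := Rinv_0_lt_compat _ He). split. lra.
rewrite exp_Ropp. assert (T := exp_ineq1_le (1 + / eps)).
apply Rlt_le_trans with (/ / eps). apply Rinv_lt_contravar. apply Rmult_lt_0_compat. exact P. apply exp_pos. lra.
rewrite Rinv_inv. lra.
Qed.

(** Let the radius tend to 0 in Cauchy's estimate: [f] stays bounded near 0, and for negative [n]
    the factor [exp (- IZR n * u)] tends to 0. *)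
Lemma tcoef_neg f n : holo f -> (n < 0)%Z -> tcoef f n = 0.
Proof.
intros Hf Hn. apply Cmod_eq_0. apply Rle_antisym; [|apply Cmod_ge_0].
destruct (holo_bounded_near_0 f Hf) as [d [M [Hd HM]]].
assert (M0 : 0 <= M). { eapply Rle_trans; [apply (Cmod_ge_0 (f 0))|apply HM]. rewrite Cmod_0; lra. }
apply le_epsilon. intros eps He. rewrite Rplus_0_l.
destruct (exp_small (Rmin d (eps / (2 * M + 1)))) as [u [Hu Hu2]]. apply Rmin_pos. lra. apply Rdiv_lt_0_compat; lra.
assert (L1 := Rmin_l d (eps / (2 * M + 1))). assert (L2 := Rmin_r d (eps / (2 * M + 1))).
eapply Rle_trans. apply (tcoef_bound f n u M Hf Hu). intros z Hz. apply HM. lra.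
assert (N : - IZR n * u <= u). { assert (IZR n <= -1) by (apply IZR_le; lia). nra. }
assert (exp (- IZR n * u) <= exp u). { destruct N as [N|N]. left; apply exp_increasing; exact N. rewrite N; lra. }
assert (0 < exp (- IZR n * u)) by apply exp_pos.
apply Rle_trans with ((2 * M + 1) * (eps / (2 * M + 1))).
apply Rmult_le_compat; lra. right; field; lra.
Qed.

(** The coefficient is the mean of [f] over any circle, and over small circles this mean is close to
    [f 0]. *)
Lemma tcoef_0 f : holo f -> tcoef f 0 = f 0.
Proof.
intros Hf. assert (PP := PI_RGT_0).
assert (E : (tcoef f 0 - f 0 = 0)%C).
2:{ replace (tcoef f 0) with ((tcoef f 0 - f 0) + f 0)%C by ring. rewrite E. ring. }
apply Cmod_eq_0. apply Rle_antisym; [|apply Cmod_ge_0].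
apply le_epsilon. intros eps He. rewrite Rplus_0_l.
destruct (cdiff_ccont f 0 (Hf 0 ltac:(rewrite Cmod_0; lra)) (eps/2) ltac:(lra)) as [d [Hd H]].
destruct (exp_small d Hd) as [u [Hu Hud]].
assert (Hc := circle_const f 0 u Hf Hu). assert (Pv := logpull_vert f 0 u Hf Hu).
assert (B := CInt_bound (fun y => logpull f 0 (u, y) + - f 0)%C 0 (2 * PI) (eps / 2) ltac:(lra)).
rewrite CInt_plus in B; [|lra|exact Pv|intros x _; apply pcont_const].
rewrite Hc in B.
replace (CInt (fun _ => - f 0)%C 0 (2 * PI)) with (RtoC (2 * PI) * - f 0)%C in B.
2:{ unfold CInt. rewrite !rint_const. apply injective_projections; simpl; ring. }
replace (RtoC (2 * PI) * tcoef f 0 + RtoC (2 * PI) * - f 0)%C with (RtoC (2 * PI) * (tcoef f 0 - f 0))%C in B by ring.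
rewrite Cmod_mult, Cmod_R, (Rabs_pos_eq (2 * PI)) in B by lra.
apply Rmult_le_reg_l with (2 * PI). lra.
eapply Rle_trans. apply B.
- intros x Hx. apply pcont_plus. apply Pv; exact Hx. apply pcont_const.
- intros x Hx. unfold logpull. replace (RtoC (- IZR 0) * (u, x))%C with (RtoC 0) by (apply injective_projections; simpl; ring).
  rewrite cexp_0, Cmult_1_r. left. apply (H (cexp (u, x))). replace (cexp (u, x) - 0)%C with (cexp (u, x)) by ring. rewrite Cmod_cexp. exact Hud.
- right. field.
Qed.

Lemma CInt_cexp (k : Z) : CInt (fun y => cexp (0, IZR k * y)) 0 (2 * PI) = if Z.eq_dec k 0 then RtoC (2 * PI) else 0.
Proof.
assert (PP := PI_RGT_0). destruct (Z.eq_dec k 0) as [->|N].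
- rewrite (CInt_ext _ (fun _ => RtoC 1)); [|lra|intros; rewrite Rmult_0_l; apply cexp_0].
  unfold CInt. simpl. rewrite !rint_const. apply injective_projections; simpl; ring.
- assert (Nk : IZR k <> 0) by (apply eq_IZR_contrapositive; exact N).
  assert (P : cexp (0, IZR k * (2 * PI)) = 1).
  { rewrite <- cexp_0, <- (cexp_period 0 k). f_equal. apply injective_projections; simpl; ring. }
  unfold cexp in P; simpl in P. rewrite exp_0, !Rmult_1_l in P. injection P as Pc Ps.
  unfold CInt, cexp; simpl. apply injective_projections; simpl.
  + rewrite (rint_ext _ (fun y => cos (IZR k * y))); [|lra|intros; rewrite exp_0; ring].
    apply is_RInt_unique. replace 0 with (minus (sin (IZR k * (2 * PI)) / IZR k) (sin (IZR k * 0) / IZR k)) at 2.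
    apply (is_RInt_derive (fun y => sin (IZR k * y) / IZR k)).
    intros x _. auto_derive. exact I. field. exact Nk.
    intros x _. apply @ex_derive_continuous. auto_derive. exact I.
    unfold minus, plus, opp; simpl. rewrite Ps, Rmult_0_r, sin_0. field. exact Nk.
  + rewrite (rint_ext _ (fun y => sin (IZR k * y))); [|lra|intros; rewrite exp_0; ring].
    apply is_RInt_unique. replace 0 with (minus (- cos (IZR k * (2 * PI)) / IZR k) (- cos (IZR k * 0) / IZR k)) at 2.
    apply (is_RInt_derive (fun y => - cos (IZR k * y) / IZR k)).
    intros x _. auto_derive. exact I. field. exact Nk.
    intros x _. apply @ex_derive_continuous. auto_derive. exact I.
    unfold minus, plus, opp; simpl. rewrite Pc, Rmult_0_r, cos_0. field. exact Nk.
Qed.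

(** The real version applies to both components, since [cos (n * y + phi)] is a combination of the
    exponentials of frequency [n] and [- n]. *)
Lemma fourier_unique_C (D : R -> C) : (forall x, pcont D x) -> (forall x, D (x + 2 * PI) = D x) ->
  (forall n : Z, CInt (fun y => D y * cexp (0, IZR n * y)%R)%C 0 (2 * PI) = 0) -> forall x, D x = 0.
Proof.
intros Dc Dp Do x. assert (PP := PI_RGT_0).
assert (Ce : forall a b y, pcont (fun y => cexp (0, a * y + b)) y).
{ intros a b y. apply (pcont_comp cexp (fun y => (0, a * y + b))). apply cdiff_ccont, cdiff_cexp.
  split; simpl. apply continuous_const. apply @ex_derive_continuous. auto_derive. exact I. }
assert (Z : forall (n : nat) phi, CInt (fun y => D y * RtoC (cos (INR n * y + phi)))%C 0 (2 * PI) = 0).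
{ intros n phi.
  rewrite (CInt_ext _ (fun y => (cexp (0, phi)%R / 2) * (D y * cexp (0, IZR (Z.of_nat n) * y)%R) + (cexp (0, - phi)%R / 2) * (D y * cexp (0, IZR (- Z.of_nat n) * y)%R))%C).
  - assert (Pc : forall k : Z, pcont_on (fun y => D y * cexp (0, IZR k * y)%R)%C 0 (2 * PI)).
    { intros k y _. apply pcont_mult. apply Dc. destruct (Ce (IZR k) 0 y) as [Q1 Q2]. split.
      eapply continuous_ext; [|exact Q1]. intros; simpl; rewrite Rplus_0_r; reflexivity.
      eapply continuous_ext; [|exact Q2]. intros; simpl; rewrite Rplus_0_r; reflexivity. }
    rewrite CInt_plus; [|lra|intros y Hy; apply pcont_mult; [apply pcont_const|apply Pc; exact Hy]..].
    rewrite !CInt_scal; try lra; try apply Pc. rewrite !Do. ring.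
  - lra.
  - intros y _. rewrite opp_IZR, <- INR_IZR_INZ.
    transitivity (D y * ((cexp (0, phi)%R * cexp (0, INR n * y)%R + cexp (0, - phi)%R * cexp (0, - INR n * y)%R) / 2))%C.
    2:{ field. }
    f_equal. rewrite <- !cexp_plus.
    replace ((0, phi)%R + (0, INR n * y)%R)%C with (0, INR n * y + phi) by (apply injective_projections; simpl; ring).
    replace ((0, - phi)%R + (0, - INR n * y)%R)%C with (0, - (INR n * y + phi)) by (apply injective_projections; simpl; ring).
    unfold cexp; simpl. rewrite exp_0, cos_neg, sin_neg.
    apply injective_projections; simpl; field. }
apply injective_projections.
- apply (fourier_unique (fun x => Re (D x))). intros; apply Dc. intros; rewrite Dp; reflexivity.
  intros n phi. specialize (Z n phi). apply (f_equal fst) in Z. simpl in Z. etransitivity; [|exact Z].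
  apply rint_ext. lra. intros; simpl. unfold Re. ring.
- apply (fourier_unique (fun x => Im (D x))). intros; apply Dc. intros; rewrite Dp; reflexivity.
  intros n phi. specialize (Z n phi). apply (f_equal snd) in Z. simpl in Z. etransitivity; [|exact Z].
  apply rint_ext. lra. intros; simpl. unfold Im. ring.
Qed.

Definition tc (f : C -> C) (n : nat) : C := tcoef f (Z.of_nat n).

Lemma unit_polar a b : a ^ 2 + b ^ 2 = 1 -> exists th, 0 <= th <= 2 * PI /\ cos th = a /\ sin th = b.
Proof.
intros H. assert (Ha : -1 <= a <= 1) by nra.
assert (B := acos_bound a).
assert (S : sin (acos a) = Rabs b).
{ rewrite sin_acos by exact Ha. rewrite <- sqrt_Rsqr_abs. f_equal. rewrite !Rsqr_pow2. lra. }
destruct (Rle_dec 0 b).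
- exists (acos a). split. lra. split. apply cos_acos; exact Ha. rewrite S, Rabs_pos_eq; lra.
- exists (2 * PI - acos a). split. lra. split.
  rewrite cos_minus, cos_2PI, sin_2PI, cos_acos by exact Ha. ring.
  rewrite sin_minus, cos_2PI, sin_2PI, S. rewrite Rabs_left by lra. ring.
Qed.

Lemma polar z u : Cmod z = exp u -> exists th, 0 <= th <= 2 * PI /\ z = cexp (u, th).
Proof.
intros H. assert (P := exp_pos u). destruct z as [a b].
destruct (unit_polar (a / exp u) (b / exp u)) as [th [Hth [Hc Hs]]].
{ assert (E := Cmod2_alt (a, b)). rewrite H in E. simpl Re in E. simpl Im in E.
  replace ((a / exp u) ^ 2 + (b / exp u) ^ 2) with ((a ^ 2 + b ^ 2) / exp u ^ 2) by (field; lra). rewrite <- E. field. lra. }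
exists th. split. exact Hth. unfold cexp; simpl. rewrite Hc, Hs. f_equal; field; lra.
Qed.

Lemma circle_bounded f u : holo f -> u < 0 -> exists M, 0 <= M /\ forall z, Cmod z = exp u -> Cmod (f z) <= M.
Proof.
intros Hf Hu. assert (PP := PI_RGT_0).
assert (P : forall y, pcont (fun y => f (cexp (u, y))) y).
{ intros y. apply (pcont_comp (fun w => f (cexp w)) (fun y => (u, y))). apply cdiff_ccont.
  apply (cdiff_comp f cexp). apply Hf, cexp_in_disk, Hu. apply cdiff_cexp. apply pcont_v. }
destruct (continuous_bounded (fun y => Re (f (cexp (u, y)))) 0 (2 * PI) ltac:(lra) ltac:(intros; apply P)) as [M1 [M10 HM1]].
destruct (continuous_bounded (fun y => Im (f (cexp (u, y)))) 0 (2 * PI) ltac:(lra) ltac:(intros; apply P)) as [M2 [M20 HM2]].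
exists (M1 + M2). split. lra. intros z Hz. destruct (polar z u Hz) as [th [Hth ->]].
eapply Rle_trans. apply Cmod_le_sum. apply Rplus_le_compat. apply HM1; exact Hth. apply HM2; exact Hth.
Qed.

Lemma exp_INR_mul n u : exp (INR n * u) = exp u ^ n.
Proof. induction n. simpl. rewrite Rmult_0_l. apply exp_0. rewrite S_INR, Rmult_plus_distr_r, exp_plus, IHn, Rmult_1_l. simpl. ring. Qed.

Lemma ex_series_exp u k : u < 0 -> ex_series (fun n => k * exp (INR n * u)).
Proof.
intros Hu. apply (ex_series_scal_l k (fun n => exp (INR n * u))).
apply (ex_series_ext (fun n => exp u ^ n)). intros n; symmetry; apply exp_INR_mul.
apply ex_series_geom. rewrite Rabs_pos_eq by (apply Rlt_le, exp_pos). rewrite <- exp_0. apply exp_increasing; exact Hu.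
Qed.

Lemma tc_bound f u M : holo f -> u < 0 -> (forall z, Cmod z = exp u -> Cmod (f z) <= M) ->
  forall n, Cmod (tc f n) <= 2 * M * exp (- INR n * u).
Proof. intros Hf Hu HM n. rewrite INR_IZR_INZ. apply tcoef_bound; assumption. Qed.

Lemma Series_single (m : nat) (v : R) : Series (fun n => if Nat.eq_dec n m then v else 0) = v.
Proof.
apply is_series_unique.
assert (Z : forall N, (N < m)%nat -> sum_n (fun n => if Nat.eq_dec n m then v else 0) N = 0).
{ induction N; intros L. rewrite sum_O. destruct (Nat.eq_dec 0 m). lia. reflexivity.
  rewrite sum_Sn, IHN by lia. destruct (Nat.eq_dec (S N) m). lia. unfold plus; simpl; ring. }
assert (V : forall k, sum_n (fun n => if Nat.eq_dec n m then v else 0) (m + k) = v).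
{ induction k. rewrite Nat.add_0_r. destruct m. rewrite sum_O. destruct (Nat.eq_dec 0 0). reflexivity. lia.
  rewrite sum_Sn, Z by lia. destruct (Nat.eq_dec (S m) (S m)). unfold plus; simpl; ring. lia.
  rewrite Nat.add_succ_r, sum_Sn, IHk. destruct (Nat.eq_dec (S (m + k)) m). lia. unfold plus; simpl; ring. }
change (is_lim_seq (sum_n (fun n => if Nat.eq_dec n m then v else 0)) v).
apply (is_lim_seq_ext_loc (fun _ => v)); [|apply is_lim_seq_const].
exists m. intros n Hn. specialize (V (n - m)%nat). replace (m + (n - m))%nat with n in V by lia. symmetry. exact V.
Qed.

Lemma CSeries_single (m : nat) (v : C) : CSeries (fun n => if Nat.eq_dec n m then v else 0) = v.
Proof.
unfold CSeries. destruct v as [v1 v2]. f_equal; [etransitivity; [|apply (Series_single m v1)]|etransitivity; [|apply (Series_single m v2)]]; apply Series_ext; intros n; destruct (Nat.eq_dec n m); reflexivity.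
Qed.

Lemma Series_zero : Series (fun _ => 0) = 0.
Proof. etransitivity; [|apply (Series_single 0 0)]. apply Series_ext. intros n. destruct (Nat.eq_dec n 0); reflexivity. Qed.

Lemma Series_nonneg (a : nat -> R) : (forall n, 0 <= a n) -> ex_series a -> 0 <= Series a.
Proof. intros H E. rewrite <- Series_zero. apply Series_le; [|exact E]. intros n. split. lra. apply H. Qed.

Lemma CSeries_zero : CSeries (fun _ => 0) = 0.
Proof. unfold CSeries; simpl. rewrite Series_zero. reflexivity. Qed.

Lemma taylor_dom f u v : holo f -> u < v -> v < 0 -> exists K, 0 <= K /\ forall n z, Cmod z <= exp u -> Cmod (tc f n * z ^ n) <= K * exp (INR n * (u - v)).
Proof.
intros Hf Huv Hv. destruct (circle_bounded f v Hf Hv) as [M [M0 HM]].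
exists (2 * M). split. lra. intros n z Hz. rewrite Cmod_mult, Cmod_pow.
apply Rle_trans with ((2 * M * exp (- INR n * v)) * exp (INR n * u)).
- apply Rmult_le_compat. apply Cmod_ge_0. apply pow_le, Cmod_ge_0. apply tc_bound; assumption.
  rewrite exp_INR_mul. apply pow_incr. split. apply Cmod_ge_0. exact Hz.
- right. rewrite Rmult_assoc, <- exp_plus. f_equal. f_equal. ring.
Qed.

(** No Cauchy integral formula is involved. On the circle through [z], [f] and its power series are
    continuous functions of the angle with the same Fourier coefficients: those of negative index
    vanish for [f] by [tcoef_neg]. Fourier uniqueness makes them equal. *)
Theorem taylor f z : holo f -> Cmod z < 1 -> f z = CSeries (fun n => tc f n * z ^ n)%C.
Proof.
intros Hf Hz. assert (PP := PI_RGT_0).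
(* The origin lies on no circle of radius [exp u], so it is treated apart. *)
destruct (Req_dec (Cmod z) 0) as [Z0|Z0].
{ apply Cmod_eq_0 in Z0. subst z.
  rewrite (CSeries_ext _ (fun n => if Nat.eq_dec n 0 then f 0 else RtoC 0)).
  rewrite CSeries_single. reflexivity.
  intros n. destruct (Nat.eq_dec n 0) as [->|N]. simpl. unfold tc. simpl. rewrite tcoef_0 by exact Hf. ring.
  destruct n. lia. simpl. ring. }
assert (Pz : 0 < Cmod z) by (assert (T := Cmod_ge_0 z); lra).
set (u := ln (Cmod z)). assert (Hu : u < 0). { unfold u. rewrite <- ln_1. apply ln_increasing; lra. }
assert (Eu : Cmod z = exp u) by (unfold u; rewrite exp_ln; lra).
(* Cauchy's estimate on the larger radius [exp (u / 2)] gives a geometric majorant on the circle of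
   radius [exp u]. *)
destruct (taylor_dom f u (u / 2) Hf ltac:(lra) ltac:(lra)) as [K [K0 HK]].
assert (EM := ex_series_exp (u - u / 2) K ltac:(lra)).
set (S := fun y => CSeries (fun n => tc f n * cexp (u, y) ^ n)%C).
assert (Cd : forall y, Cmod (cexp (u, y)) <= exp u) by (intros; rewrite Cmod_cexp; simpl; lra).
assert (Pcx : forall y, pcont (fun y => cexp (u, y)) y).
{ intros. apply (pcont_comp cexp (fun y => (u, y))). apply cdiff_ccont, cdiff_cexp. apply pcont_v. }
assert (Pe : forall a y, pcont (fun y => cexp (0, a * y)) y).
{ intros a y. apply (pcont_comp cexp (fun y => (0, a * y))). apply cdiff_ccont, cdiff_cexp.
  split; simpl. apply continuous_const. apply @ex_derive_continuous. auto_derive. exact I. }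
assert (Pt : forall n y, pcont (fun y => tc f n * cexp (u, y) ^ n)%C y).
{ intros n y. apply pcont_mult. apply pcont_const. apply (pcont_comp (fun w => w ^ n)%C (fun y => cexp (u, y))).
  apply cdiff_ccont. apply (cdiff_pow (fun w => w)). apply cdiff_id. apply Pcx. }
assert (PS : forall y, pcont S y).
{ intros y. apply (CSeries_pcont (fun n y => tc f n * cexp (u, y) ^ n)%C (fun n => K * exp (INR n * (u - u / 2)))); auto. }
assert (Pf : forall y, pcont (fun y => f (cexp (u, y))) y).
{ intros y. apply (pcont_comp f (fun y => cexp (u, y))). apply cdiff_ccont, Hf, cexp_in_disk, Hu. apply Pcx. }
assert (D0 : forall y, (f (cexp (u, y)) + (RtoC (-1)) * S y = 0)%C).
{ apply (fourier_unique_C (fun y => f (cexp (u, y)) + RtoC (-1) * S y)%C).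
  - intros y. apply pcont_plus. apply Pf. apply pcont_mult. apply pcont_const. apply PS.
  - intros y. unfold S. replace (u, y + 2 * PI) with ((u, y) + (0, 2 * PI * IZR 1)%R)%C. rewrite cexp_period. reflexivity.
    apply injective_projections; simpl; ring.
  - intros k.
    rewrite (CInt_ext _ (fun y => RtoC (exp (- (IZR k * u))) * logpull f (- k) (u, y) + RtoC (-1) * (S y * cexp (0, IZR k * y)%R))%C); [|lra|].
    2:{ intros y _. unfold logpull. rewrite opp_IZR.
        replace (RtoC (- - IZR k) * (u, y))%C with ((IZR k * u)%R + (0, IZR k * y)%R)%C by (apply injective_projections; simpl; ring).
        rewrite cexp_plus, cexp_R.
        transitivity ((RtoC (exp (- (IZR k * u)) * exp (IZR k * u)) * f (cexp (u, y)) + RtoC (-1) * S y) * cexp (0, IZR k * y)%R)%C.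
        rewrite <- exp_plus, Rplus_opp_l, exp_0. ring. rewrite RtoC_mult. ring. }
    rewrite CInt_plus; [|lra| |].
    2:{ intros y Hy. apply pcont_mult. apply pcont_const. apply (logpull_vert f (- k) u Hf Hu). exact Hy. }
    2:{ intros y Hy. apply pcont_mult. apply pcont_const. apply pcont_mult. apply PS. apply Pe. }
    rewrite !CInt_scal; [|lra| |lra|].
    2:{ intros y Hy. apply pcont_mult. apply PS. apply Pe. }
    2:{ apply (logpull_vert f (- k) u Hf Hu). }
    rewrite (circle_const f (- k) u Hf Hu).
    (* Termwise integration: by orthogonality only the index [n = - k] survives, and none does for
       positive [k]. *)
    assert (ES : CInt (fun y => S y * cexp (0, IZR k * y)%R)%C 0 (2 * PI) =
       CSeries (fun n => tc f n * RtoC (exp (INR n * u)) * (if Z.eq_dec (Z.of_nat n + k) 0 then RtoC (2 * PI) else 0))%C).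
    { set (F := fun n y => (cexp (0, IZR k * y)%R * (tc f n * cexp (u, y) ^ n))%C).
      rewrite (CInt_ext _ (fun y => CSeries (fun n => F n y))); [|lra|].
      2:{ intros y _. unfold S, F. rewrite (CSeries_scal _ (fun n => tc f n * cexp (u, y) ^ n)%C (fun n => K * exp (INR n * (u - u / 2)))); auto. ring. }
      rewrite (CInt_CSeries F (fun n => K * exp (INR n * (u - u / 2)))); [|lra| |exact EM|].
      2:{ intros n y. unfold F. rewrite Cmod_mult, Cmod_cexp. simpl Re. rewrite exp_0, Rmult_1_l. apply HK. apply Cd. }
      2:{ intros n y. unfold F. apply pcont_mult. apply Pe. apply Pt. }
      apply CSeries_ext. intros n. rewrite <- CInt_cexp.
      rewrite <- CInt_scal; [|lra|intros y _; apply Pe].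
      apply CInt_ext. lra. intros y _. unfold F. rewrite cexp_pow.
      replace (RtoC (INR n) * (u, y))%C with ((INR n * u)%R + (0, INR n * y)%R)%C by (apply injective_projections; simpl; ring).
      rewrite cexp_plus, cexp_R. rewrite plus_IZR, <- INR_IZR_INZ.
      replace (0, (INR n + IZR k) * y) with ((0, IZR k * y)%R + (0, INR n * y)%R)%C by (apply injective_projections; simpl; ring).
      rewrite cexp_plus. ring. }
    rewrite ES. clear ES.
    destruct (Z_le_gt_dec k 0) as [L|L].
    + set (m := Z.to_nat (- k)). assert (Em : (- k = Z.of_nat m)%Z) by (unfold m; rewrite Z2Nat.id; lia).
      rewrite (CSeries_ext _ (fun n => if Nat.eq_dec n m then tc f m * RtoC (exp (INR m * u)) * RtoC (2 * PI) else 0)%C).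
      rewrite CSeries_single. unfold tc. rewrite Em.
      replace (- (IZR k * u)) with (INR m * u). ring. rewrite INR_IZR_INZ, <- Em, opp_IZR. ring.
      intros n. destruct (Nat.eq_dec n m) as [->|N]. destruct (Z.eq_dec (Z.of_nat m + k) 0). reflexivity. lia.
      destruct (Z.eq_dec (Z.of_nat n + k) 0). lia. ring.
    + rewrite tcoef_neg; [|exact Hf|lia].
      rewrite (CSeries_ext _ (fun _ => 0)). rewrite CSeries_zero. ring.
      intros n. destruct (Z.eq_dec (Z.of_nat n + k) 0). lia. ring. }
destruct (polar z u Eu) as [th [_ Hth]]. specialize (D0 th). unfold S in D0. rewrite <- Hth in D0.
set (s := CSeries (fun n => tc f n * z ^ n)%C) in *.
transitivity (f z + RtoC (-1) * s + s)%C. ring. rewrite D0. ring.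
Qed.

(** * Zeros, the maximum principle and Weierstrass' theorem *)

Lemma CSeries_shift (a : nat -> C) (M : nat -> R) m z : (forall n, Cmod (a n * z ^ n) <= M n) -> ex_series M ->
  (forall n, (n < m)%nat -> a n = 0) ->
  CSeries (fun n => a n * z ^ n)%C = (z ^ m * CSeries (fun n => a (m + n)%nat * z ^ n))%C.
Proof.
intros HM EM Z.
assert (E : CSeries (fun n => a n * z ^ n)%C = CSeries (fun n => a (m + n)%nat * z ^ (m + n))%C).
{ revert Z. induction m; intros Z. reflexivity. rewrite IHm by (intros; apply Z; lia).
  rewrite (CSeries_incr_1 (fun n => a (m + n)%nat * z ^ (m + n))%C (fun n => M (m + n)%nat)).
  - rewrite Nat.add_0_r, Z by lia. rewrite Cmult_0_l, Cplus_0_l. apply CSeries_ext. intros n. rewrite Nat.add_succ_r. reflexivity.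
  - intros n. apply HM.
  - apply (ex_series_incr_n M m). exact EM. }
rewrite E.
destruct (Req_dec (Cmod z) 0) as [Z0|Z0].
{ apply Cmod_eq_0 in Z0. subst z. destruct m.
  - rewrite Cmult_1_l. reflexivity.
  - rewrite (CSeries_ext _ (fun _ => 0)). rewrite CSeries_zero. simpl. ring. intros n. simpl. ring. }
assert (Pz : 0 < Cmod z ^ m) by (apply pow_lt; assert (T := Cmod_ge_0 z); lra).
rewrite <- (CSeries_scal (z ^ m) _ (fun n => / Cmod z ^ m * M (m + n)%nat)).
- apply CSeries_ext. intros n. rewrite Cpow_add_r. ring.
- intros n. apply Rmult_le_reg_l with (Cmod z ^ m). exact Pz.
  rewrite <- Cmod_pow at 1. rewrite <- Cmod_mult.
  replace (z ^ m * (a (m + n)%nat * z ^ n))%C with (a (m + n)%nat * z ^ (m + n))%C by (rewrite Cpow_add_r; ring).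
  eapply Rle_trans. apply HM. right. field. lra.
- apply (ex_series_scal_l (/ Cmod z ^ m) (fun n => M (m + n)%nat)). apply (ex_series_incr_n M m). exact EM.
Qed.

Lemma first_nonzero (a : nat -> C) : (forall n, a n = 0) \/ exists m, a m <> 0 /\ forall n, (n < m)%nat -> a n = 0.
Proof.
destruct (classic (exists n, a n <> 0)) as [[n Hn]|N].
- right. revert Hn. induction n as [n IH] using (well_founded_induction lt_wf). intros Hn.
  destruct (classic (exists k, (k < n)%nat /\ a k <> 0)) as [[k [Hk Hk']]|N].
  + apply (IH k Hk Hk').
  + exists n. split. exact Hn. intros k Hk. apply NNPP. intros Q. apply N. exists k. auto.
- left. intros n. apply NNPP. intros Q. apply N. exists n. exact Q.
Qed.

(** Factor out the power of [z] at the first nonzero coefficient; near 0 that coefficient outweighs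
    the rest of the series, which is [z] times a bounded function. Zeros near the origin are the
    only ones that matter, because the identity theorem is applied to functions vanishing on the
    segment from 0 to 1. *)
Theorem isolated_zero f : holo f -> (forall z, Cmod z < 1 -> f z = 0) \/
  exists d, 0 < d /\ forall z, 0 < Cmod z < d -> f z <> 0.
Proof.
intros Hf. destruct (first_nonzero (tc f)) as [Z|[m [Hm Z]]].
- left. intros z Hz. rewrite (taylor f z Hf Hz). rewrite (CSeries_ext _ (fun _ => 0)). apply CSeries_zero. intros n. rewrite Z. ring.
- right.
  (* Cauchy's estimate at radius [exp (-1)] controls the series on the disk of radius
     [r = exp (-2)]. *)
  destruct (taylor_dom f (-2) (-1) Hf ltac:(lra) ltac:(lra)) as [K [K0 HK]].
  replace (-2 - -1) with (-1) in HK by ring.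
  assert (EM := ex_series_exp (-1) K ltac:(lra)).
  set (r := exp (-2)). assert (Pr : 0 < r) by apply exp_pos.
  set (B := 2 * Series (fun n => / r ^ S m * (K * exp (INR (S m + n) * -1)))).
  assert (ES : ex_series (fun n => / r ^ S m * (K * exp (INR (S m + n) * -1)))).
  { apply (ex_series_scal_l (/ r ^ S m) (fun n => K * exp (INR (S m + n) * -1))). apply (ex_series_incr_n (fun n => K * exp (INR n * -1)) (S m)). exact EM. }
  assert (HB : forall z, Cmod z <= r -> Cmod (CSeries (fun n => tc f (S m + n)%nat * z ^ n)%C) <= B).
  { intros z Hz. apply CSeries_bound; [|exact ES]. intros n.
    apply Rle_trans with (Cmod (tc f (S m + n)%nat * RtoC r ^ n)).
    - rewrite !Cmod_mult, !Cmod_pow, Cmod_R. apply Rmult_le_compat_l. apply Cmod_ge_0. apply pow_incr. split. apply Cmod_ge_0. rewrite Rabs_pos_eq; lra.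
    - apply Rmult_le_reg_l with (r ^ S m). apply pow_lt; exact Pr.
      replace (r ^ S m * Cmod (tc f (S m + n)%nat * RtoC r ^ n)) with (Cmod (tc f (S m + n)%nat * RtoC r ^ (S m + n))).
      + eapply Rle_trans. apply HK. rewrite Cmod_R, Rabs_pos_eq; unfold r in *; lra. right. field. apply pow_nonzero; lra.
      + rewrite !Cmod_mult, !Cmod_pow, Cmod_R, Rabs_pos_eq, pow_add by lra. ring. }
  assert (Pm : 0 < Cmod (tc f m)) by (apply Cmod_gt_0; exact Hm).
  assert (B0 : 0 <= B). { eapply Rle_trans; [apply Cmod_ge_0|apply (HB 0)]. rewrite Cmod_0; lra. }
  exists (Rmin r (Cmod (tc f m) / (B + 1))). split. apply Rmin_pos. exact Pr. apply Rdiv_lt_0_compat; lra.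
  intros z [Hz0 Hz] F0.
  assert (L1 := Rmin_l r (Cmod (tc f m) / (B + 1))). assert (L2 := Rmin_r r (Cmod (tc f m) / (B + 1))).
  assert (r1 : r < 1). { unfold r. rewrite <- exp_0. apply exp_increasing. lra. }
  rewrite (taylor f z Hf ltac:(lra)) in F0.
  assert (Hd : forall n, Cmod (tc f n * z ^ n) <= K * exp (INR n * -1)) by (intros; apply HK; unfold r in *; lra).
  rewrite (CSeries_shift (tc f) (fun n => K * exp (INR n * -1)) m z Hd EM Z) in F0.
  assert (Nz : (z ^ m)%C <> 0). { apply Cpow_nz. apply Cmod_gt_0. exact Hz0. }
  assert (F1 : CSeries (fun n => tc f (m + n)%nat * z ^ n)%C = 0).
  { transitivity (/ z ^ m * (z ^ m * CSeries (fun n => tc f (m + n)%nat * z ^ n)))%C. field. exact Nz. rewrite F0. ring. }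
  assert (Hd2 : forall n, Cmod (tc f (m + n)%nat * z ^ n) <= / Cmod z ^ m * (K * exp (INR (m + n) * -1))).
  { intros n. apply Rmult_le_reg_l with (Cmod z ^ m). apply pow_lt; exact Hz0.
    eapply Rle_trans; [|eapply Rle_trans; [apply (Hd (m + n)%nat)|]].
    right. rewrite !Cmod_mult, !Cmod_pow, pow_add. ring. right. field. apply pow_nonzero; lra. }
  rewrite (CSeries_incr_1 _ (fun n => / Cmod z ^ m * (K * exp (INR (m + n) * -1))) Hd2) in F1.
  2:{ apply (ex_series_scal_l (/ Cmod z ^ m) (fun n => K * exp (INR (m + n) * -1))). apply (ex_series_incr_n (fun n => K * exp (INR n * -1)) m). exact EM. }
  rewrite Nat.add_0_r in F1.
  assert (F2 : CSeries (fun n => tc f (m + S n)%nat * z ^ S n)%C = (z * CSeries (fun n => tc f (S m + n)%nat * z ^ n))%C).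
  { rewrite <- (CSeries_scal z _ (fun n => / r ^ S m * (K * exp (INR (S m + n) * -1)))); [|clear - HK Hz L1 Pr|exact ES].
    apply CSeries_ext. intros n. rewrite Nat.add_succ_r. simpl. ring.
    intros n.
    apply Rle_trans with (Cmod (tc f (S m + n)%nat * RtoC r ^ n)).
    - rewrite !Cmod_mult, !Cmod_pow, Cmod_R. apply Rmult_le_compat_l. apply Cmod_ge_0. apply pow_incr. split. apply Cmod_ge_0. rewrite Rabs_pos_eq; lra.
    - apply Rmult_le_reg_l with (r ^ S m). apply pow_lt; exact Pr.
      replace (r ^ S m * Cmod (tc f (S m + n)%nat * RtoC r ^ n)) with (Cmod (tc f (S m + n)%nat * RtoC r ^ (S m + n))).
      + eapply Rle_trans. apply HK. rewrite Cmod_R, Rabs_pos_eq; unfold r in *; lra. right. field. apply pow_nonzero; lra.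
      + rewrite !Cmod_mult, !Cmod_pow, Cmod_R, Rabs_pos_eq, pow_add by lra. ring. }
  rewrite F2 in F1. simpl Cpow in F1. rewrite Cmult_1_r in F1.
  (* A zero at [z] would make the leading coefficient of size at most [Cmod z * B], and [z] was
     chosen too small for that. *)
  assert (E : tc f m = (- (z * CSeries (fun n => tc f (S m + n)%nat * z ^ n)))%C).
  { transitivity ((tc f m + z * CSeries (fun n => tc f (S m + n)%nat * z ^ n)) - z * CSeries (fun n => tc f (S m + n)%nat * z ^ n))%C. ring. rewrite F1. ring. }
  assert (Em : Cmod (tc f m) <= Cmod z * B).
  { rewrite E, Cmod_opp, Cmod_mult. apply Rmult_le_compat_l. lra. apply HB. lra. }
  assert (Cmod z * (B + 1) < Cmod (tc f m)).
  { apply Rlt_le_trans with (Cmod (tc f m) / (B + 1) * (B + 1)). apply Rmult_lt_compat_r; lra. right; field; lra. }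
  lra.
Qed.

Lemma Series_exp_pos u k : u < 0 -> 0 <= k -> 0 <= Series (fun n => k * exp (INR n * u)).
Proof.
intros Hu Hk. apply Series_nonneg. intros n. apply Rmult_le_pos. exact Hk. apply Rlt_le, exp_pos. apply ex_series_exp; exact Hu.
Qed.

Lemma holo_mult f g : holo f -> holo g -> holo (fun z => f z * g z)%C.
Proof. intros Hf Hg z Hz. apply cdiff_mult; auto. Qed.
Lemma holo_pow f k : holo f -> holo (fun z => f z ^ k)%C.
Proof. intros Hf z Hz. apply cdiff_pow; auto. Qed.

(* Cauchy's estimate is only used up to a constant; applying it to the powers of f removes the constant. *)
Theorem max_principle f u v M z : holo f -> u < v -> v < 0 -> (forall w, Cmod w = exp v -> Cmod (f w) <= M) ->
  Cmod z <= exp u -> Cmod (f z) <= M.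
Proof.
intros Hf Huv Hv HM Hz.
assert (M0 : 0 <= M). { eapply Rle_trans; [apply Cmod_ge_0|apply (HM (cexp (v, 0)))]. rewrite Cmod_cexp. reflexivity. }
apply Rnot_lt_le. intros L.
set (B := 2 * Series (fun n => 2 * exp (INR n * (u - v)))).
assert (z1 : Cmod z < 1). { eapply Rle_lt_trans. exact Hz. rewrite <- exp_0. apply exp_increasing. lra. }
apply (pow_dominates M (Cmod (f z)) 1 B); try lra.
{ unfold B. assert (T := Series_exp_pos (u - v) 2 ltac:(lra) ltac:(lra)). lra. }
intros k. rewrite Rmult_1_l, <- Cmod_pow.
assert (T := taylor (fun z => f z ^ k)%C z (holo_pow f k Hf) z1). cbv beta in T. rewrite T.
eapply Rle_trans. apply (CSeries_bound _ (fun n => M ^ k * (2 * exp (INR n * (u - v))))).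
- intros n. rewrite Cmod_mult, Cmod_pow.
  apply Rle_trans with ((2 * M ^ k * exp (- INR n * v)) * exp (INR n * u)).
  + apply Rmult_le_compat. apply Cmod_ge_0. apply pow_le, Cmod_ge_0.
    apply tc_bound. apply holo_pow, Hf. exact Hv. intros w Hw. rewrite Cmod_pow. apply pow_incr. split. apply Cmod_ge_0. apply HM; exact Hw.
    rewrite exp_INR_mul. apply pow_incr. split. apply Cmod_ge_0. exact Hz.
  + right. rewrite Rmult_assoc, <- exp_plus. replace (- INR n * v + INR n * u) with (INR n * (u - v)) by ring. ring.
- apply (ex_series_scal_l (M ^ k) (fun n => 2 * exp (INR n * (u - v)))). apply ex_series_exp. lra.
- rewrite Series_scal_l. unfold B. right. ring.
Qed.

(** The factor [rho] on the left takes the place of the exponent [n - 1] on the right, so that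
    [n = 0] needs no exception. The two estimates feed each other in the induction. *)
Lemma pow_remainder (z w : C) rho n : Cmod z <= rho -> Cmod w <= rho ->
  Cmod (w ^ n - z ^ n) * rho <= INR n * rho ^ n * Cmod (w - z) /\
  Cmod (w ^ S n - z ^ S n - INR (S n) * z ^ n * (w - z)) * rho <= INR n ^ 2 * rho ^ n * Cmod (w - z) ^ 2.
Proof.
intros Hz Hw. assert (Pz := Cmod_ge_0 z). assert (Pd := Cmod_ge_0 (w - z)).
induction n.
- split.
  + replace (w ^ 0 - z ^ 0)%C with (RtoC 0) by (simpl; ring). rewrite Cmod_0. change (INR 0) with 0. lra.
  + replace (w ^ 1 - z ^ 1 - INR 1 * z ^ 0 * (w - z))%C with (RtoC 0) by (simpl; ring). rewrite Cmod_0.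
    change (INR 0) with 0. replace (0 ^ 2) with 0 by ring. lra.
- destruct IHn as [I1 I2].
  assert (J1 : Cmod (w ^ S n - z ^ S n) * rho <= INR (S n) * rho ^ S n * Cmod (w - z)).
  { replace (w ^ S n - z ^ S n)%C with (w * (w ^ n - z ^ n) + (w - z) * z ^ n)%C by (simpl; ring).
    apply Rle_trans with ((rho * Cmod (w ^ n - z ^ n) + Cmod (w - z) * rho ^ n) * rho).
    - apply Rmult_le_compat_r. lra. eapply Rle_trans. apply Cmod_triangle. rewrite !Cmod_mult. apply Rplus_le_compat.
      apply Rmult_le_compat_r. apply Cmod_ge_0. exact Hw. apply Rmult_le_compat_l. exact Pd. rewrite Cmod_pow. apply pow_incr; lra.
    - rewrite S_INR. simpl. assert (rho * (Cmod (w ^ n - z ^ n) * rho) <= rho * (INR n * rho ^ n * Cmod (w - z))) by (apply Rmult_le_compat_l; lra). lra. }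
  split. exact J1.
  replace (w ^ S (S n) - z ^ S (S n) - INR (S (S n)) * z ^ S n * (w - z))%C with
    (z * (w ^ S n - z ^ S n - INR (S n) * z ^ n * (w - z)) + (w - z) * (w ^ S n - z ^ S n))%C.
  2:{ rewrite (S_INR (S n)), RtoC_plus. simpl. ring. }
  apply Rle_trans with ((rho * Cmod (w ^ S n - z ^ S n - INR (S n) * z ^ n * (w - z)) + Cmod (w - z) * Cmod (w ^ S n - z ^ S n)) * rho).
  + apply Rmult_le_compat_r. lra. eapply Rle_trans. apply Cmod_triangle. rewrite !Cmod_mult. apply Rplus_le_compat_r.
    apply Rmult_le_compat_r. apply Cmod_ge_0. exact Hz.
  + set (A := Cmod (w ^ S n - z ^ S n - INR (S n) * z ^ n * (w - z))) in *. set (D := Cmod (w ^ S n - z ^ S n)) in *. set (e := Cmod (w - z)) in *.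
    assert (Q1 : rho * (A * rho) <= rho * (INR n ^ 2 * rho ^ n * e ^ 2)) by (apply Rmult_le_compat_l; lra).
    assert (Q2 : e * (D * rho) <= e * (INR (S n) * rho ^ S n * e)) by (apply Rmult_le_compat_l; lra).
    assert (P0 : 0 <= rho ^ S n * e ^ 2). { apply Rmult_le_pos. apply pow_le; lra. apply pow_le; exact Pd. }
    assert (N0 := pos_INR n). rewrite S_INR in *.
    assert (Q3 : 0 <= INR n * (rho ^ S n * e ^ 2)) by (apply Rmult_le_pos; assumption).
    change (rho ^ S n) with (rho * rho ^ n) in *. replace (e ^ 2) with (e * e) in * by ring. replace (INR n ^ 2) with (INR n * INR n) in * by ring.
    replace ((INR n + 1) ^ 2) with (INR n * INR n + 2 * INR n + 1) by ring. lra.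
Qed.

Lemma Cmod_neg1 : Cmod (RtoC (-1)) = 1.
Proof. rewrite Cmod_R, Rabs_left; lra. Qed.

(** Each of the [n] summands of [1 + s + ... + s ^ (n - 1)] is at least [s ^ n]. *)
Lemma nat_geom_bound s n : 0 < s < 1 -> INR n * s ^ n <= / (1 - s).
Proof.
intros Hs.
assert (P : forall n, INR n * s ^ n * (1 - s) <= 1 - s ^ n).
{ induction n0. simpl. lra. rewrite S_INR. simpl.
  assert (0 < s ^ n0) by (apply pow_lt; lra). assert (s ^ n0 <= 1) by (rewrite <- (pow1 n0); apply pow_incr; lra).
  assert (s * (INR n0 * s ^ n0 * (1 - s)) <= s * (1 - s ^ n0)) by (apply Rmult_le_compat_l; lra).
  assert (s * s ^ n0 <= 1) by nra. nra. }
apply Rmult_le_reg_r with (1 - s). lra. rewrite Rinv_l by lra. eapply Rle_trans. apply P.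
assert (0 < s ^ n) by (apply pow_lt; lra). lra.
Qed.

(** The termwise derivative of the Taylor series; in this form it can be bounded uniformly in
    [f]. *)
Definition tderiv (f : C -> C) (z : C) : C := CSeries (fun n => tc f (S n) * (INR (S n) * z ^ n))%C.

(** [K] depends on [s] alone, which is what allows the estimate to be summed over a series of
    functions. On radius [s ^ 4] Cauchy's estimate at radius [s] leaves the factor [s ^ (3 * n)]:
    two thirds of it absorb the [n ^ 2] of the second-order remainder, the last third is summed. *)
Lemma taylor_quadratic s : 0 < s < 1 -> exists K, 0 <= K /\ forall f M z, holo f ->
  (forall w, Cmod w = s -> Cmod (f w) <= M) -> Cmod z <= s ^ 4 ->
  Cmod (tderiv f z) <= K * M /\
  forall w, Cmod w <= s ^ 4 -> Cmod (f w - f z - tderiv f z * (w - z)) <= K * M * Cmod (w - z) ^ 2.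
Proof.
intros Hs. set (c := / (1 - s)). assert (Pc : 0 < c) by (apply Rinv_0_lt_compat; lra).
assert (Ps : forall k, 0 < s ^ k) by (intros; apply pow_lt; lra).
assert (Sg : ex_series (fun n => s ^ n)) by (apply ex_series_geom; rewrite Rabs_pos_eq; lra).
assert (SN : 0 <= Series (fun n => s ^ n)). { rewrite Series_geom by (rewrite Rabs_pos_eq; lra). fold c. lra. }
set (k1 := 2 * c / s ^ 2). set (k2 := 2 * c ^ 2 / s ^ 5).
assert (Pk1 : 0 < k1) by (apply Rdiv_lt_0_compat; [nra|apply Ps]).
assert (Pk2 : 0 < k2) by (apply Rdiv_lt_0_compat; [nra|apply Ps]).
exists (2 * (k1 + k2) * Series (fun n => s ^ n)). split. apply Rmult_le_pos; lra.
intros f M z Hf HM Hz.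
assert (M0 : 0 <= M). { eapply Rle_trans; [apply Cmod_ge_0|apply (HM s)]. rewrite Cmod_R, Rabs_pos_eq; lra. }
assert (Es : s = exp (ln s)) by (rewrite exp_ln; lra).
assert (Hl : ln s < 0). { rewrite <- ln_1. apply ln_increasing; lra. }
assert (Ta : forall n, Cmod (tc f n) <= 2 * M / s ^ n).
{ intros n. eapply Rle_trans. apply (tc_bound f (ln s) M Hf Hl). rewrite <- Es. exact HM.
  right. replace (- INR n * ln s) with (- (INR n * ln s)) by ring. rewrite exp_Ropp, exp_INR_mul, <- Es. reflexivity. }
assert (s4 : s ^ 4 < 1). { rewrite <- (pow1 4). simpl. assert (0 < s * s < 1) by nra. nra. }
assert (Hsn : forall n, 0 <= s ^ n <= 1). { intros n. split. left; apply Ps. rewrite <- (pow1 n); apply pow_incr; lra. }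
assert (D1 : forall n, Cmod (tc f (S n) * (INR (S n) * z ^ n)) <= M * k1 * s ^ n).
{ intros n. rewrite !Cmod_mult, Cmod_pow, Cmod_R, (Rabs_pos_eq (INR (S n))) by apply pos_INR.
  apply Rle_trans with (2 * M / s ^ S n * (INR (S n) * (s ^ 4) ^ n)).
  - apply Rmult_le_compat; [apply Cmod_ge_0| |apply Ta|]. apply Rmult_le_pos. apply pos_INR. apply pow_le, Cmod_ge_0.
    apply Rmult_le_compat_l. apply pos_INR. apply pow_incr. split; [apply Cmod_ge_0|exact Hz].
  - replace (2 * M / s ^ S n * (INR (S n) * (s ^ 4) ^ n)) with (2 * M / s ^ 2 * (s ^ n * s ^ n) * (INR (S n) * s ^ S n)).
    2:{ rewrite <- pow_mult. replace (4 * n)%nat with (n + n + n + n)%nat by lia. rewrite !pow_add. simpl. field. split. apply pow_nonzero; lra. lra. }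
    assert (B := nat_geom_bound s (S n) Hs). fold c in B.
    apply Rle_trans with (2 * M / s ^ 2 * (s ^ n * 1) * c).
    + apply Rmult_le_compat; [|apply Rmult_le_pos; [apply pos_INR|apply Hsn]| |exact B].
      repeat apply Rmult_le_pos; try apply Hsn; try lra. apply Rlt_le, Rinv_0_lt_compat, Ps.
      apply Rmult_le_compat_l. repeat apply Rmult_le_pos; try lra. apply Rlt_le, Rinv_0_lt_compat, Ps.
      apply Rmult_le_compat_l; apply Hsn.
    + right. unfold k1. field. lra. }
assert (ED1 : ex_series (fun n => M * k1 * s ^ n)) by (apply (ex_series_scal_l (M * k1) (fun n => s ^ n)); exact Sg).
split.
{ unfold tderiv. eapply Rle_trans. apply (CSeries_bound _ _ D1 ED1). rewrite Series_scal_l. change (Series (pow s)) with (Series (fun n => s ^ n)).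
  assert (0 <= M * k2 * Series (fun n => s ^ n)) by (apply Rmult_le_pos; [apply Rmult_le_pos|]; lra). lra. }
intros w Hw.
assert (Dp : forall x, Cmod x <= s ^ 4 -> forall n, Cmod (tc f n * x ^ n) <= 2 * M * s ^ n).
{ intros x Hx n. rewrite Cmod_mult, Cmod_pow. apply Rle_trans with (2 * M / s ^ n * (s ^ 4) ^ n).
  apply Rmult_le_compat; [apply Cmod_ge_0|apply pow_le, Cmod_ge_0|apply Ta|]. apply pow_incr. split; [apply Cmod_ge_0|exact Hx].
  replace (2 * M / s ^ n * (s ^ 4) ^ n) with (2 * M * s ^ n * (s ^ n * s ^ n)).
  2:{ rewrite <- pow_mult. replace (4 * n)%nat with (n + n + n + n)%nat by lia. rewrite !pow_add. field. apply pow_nonzero; lra. }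
  rewrite <- (Rmult_1_r (2 * M * s ^ n)) at 2. apply Rmult_le_compat_l. repeat apply Rmult_le_pos; try lra. apply Hsn.
  assert (T := Hsn n). nra. }
assert (EDp : ex_series (fun n => 2 * M * s ^ n)) by (apply (ex_series_scal_l (2 * M) (fun n => s ^ n)); exact Sg).
assert (EDp' : ex_series (fun n => 2 * M * s ^ S n)) by (apply (ex_series_incr_1 (fun n => 2 * M * s ^ n)); exact EDp).
assert (Df : forall x, Cmod x <= s ^ 4 -> f x = (tc f 0 + CSeries (fun n => tc f (S n) * x ^ S n))%C).
{ intros x Hx. rewrite (taylor f x Hf ltac:(lra)). rewrite (CSeries_incr_1 _ _ (Dp x Hx) EDp). simpl. ring. }
set (e := Cmod (w - z)).
assert (R : forall n, Cmod (tc f (S n) * (w ^ S n - z ^ S n - INR (S n) * z ^ n * (w - z))) <= M * k2 * e ^ 2 * s ^ n).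
{ intros n. destruct (pow_remainder z w (s ^ 4) n Hz Hw) as [_ Q]. fold e in Q.
  rewrite Cmod_mult.
  set (A := Cmod (w ^ S n - z ^ S n - INR (S n) * z ^ n * (w - z))) in *.
  assert (QA : A <= INR n ^ 2 * (s ^ 4) ^ n * e ^ 2 / s ^ 4).
  { apply Rmult_le_reg_r with (s ^ 4). apply Ps. eapply Rle_trans. exact Q. right. field. lra. }
  apply Rle_trans with (2 * M / s ^ S n * (INR n ^ 2 * (s ^ 4) ^ n * e ^ 2 / s ^ 4)).
  { apply Rmult_le_compat. apply Cmod_ge_0. apply Cmod_ge_0. apply Ta. exact QA. }
  replace (2 * M / s ^ S n * (INR n ^ 2 * (s ^ 4) ^ n * e ^ 2 / s ^ 4)) with (2 * M * e ^ 2 / s ^ 5 * s ^ n * ((INR n * s ^ n) * (INR n * s ^ n))).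
  2:{ rewrite <- pow_mult. replace (4 * n)%nat with (n + n + n + n)%nat by lia. rewrite !pow_add. simpl. field. split. lra. apply pow_nonzero; lra. }
  assert (B := nat_geom_bound s n Hs). fold c in B. assert (B0 : 0 <= INR n * s ^ n) by (apply Rmult_le_pos; [apply pos_INR|apply Hsn]).
  apply Rle_trans with (2 * M * e ^ 2 / s ^ 5 * s ^ n * (c * c)).
  - apply Rmult_le_compat_l. repeat apply Rmult_le_pos; try apply Hsn; try lra. unfold e; apply Cmod_ge_0. unfold e; apply Cmod_ge_0. apply Rlt_le, Rinv_0_lt_compat, Ps.
    apply Rmult_le_compat; lra.
  - right. unfold k2. field. lra. }
assert (ER : ex_series (fun n => M * k2 * e ^ 2 * s ^ n)) by (apply (ex_series_scal_l (M * k2 * e ^ 2) (fun n => s ^ n)); exact Sg).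
assert (Eq : (f w - f z - tderiv f z * (w - z))%C = CSeries (fun n => tc f (S n) * (w ^ S n - z ^ S n - INR (S n) * z ^ n * (w - z)))%C).
{ rewrite (Df w Hw), (Df z Hz). unfold tderiv.
  rewrite (CSeries_ext (fun n => tc f (S n) * (w ^ S n - z ^ S n - INR (S n) * z ^ n * (w - z)))%C
     (fun n => tc f (S n) * w ^ S n + (RtoC (-1) * (tc f (S n) * z ^ S n) + (- (w - z)) * (tc f (S n) * (INR (S n) * z ^ n))))%C) by (intros; ring).
  rewrite (CSeries_plus _ _ (fun n => 2 * M * s ^ S n) (fun n => 1 * (2 * M * s ^ S n) + e * (M * k1 * s ^ n))).
  rewrite (CSeries_plus _ _ (fun n => 1 * (2 * M * s ^ S n)) (fun n => e * (M * k1 * s ^ n))).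
  rewrite (CSeries_scal _ _ _ (fun n => Dp z Hz (S n)) EDp').
  rewrite (CSeries_scal _ _ _ D1 ED1). ring.
  - intros n. rewrite Cmod_mult, Cmod_neg1. apply Rmult_le_compat_l. lra. apply (Dp z Hz (S n)).
  - apply (ex_series_scal_l 1 (fun n => 2 * M * s ^ S n)). exact EDp'.
  - intros n. rewrite Cmod_mult, Cmod_opp. fold e. apply Rmult_le_compat_l. apply Cmod_ge_0. apply D1.
  - apply (ex_series_scal_l e (fun n => M * k1 * s ^ n)). exact ED1.
  - intros n. apply (Dp w Hw (S n)).
  - exact EDp'.
  - intros n. eapply Rle_trans. apply Cmod_triangle. apply Rplus_le_compat.
    rewrite Cmod_mult, Cmod_neg1. apply Rmult_le_compat_l. lra. apply (Dp z Hz (S n)).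
    rewrite Cmod_mult, Cmod_opp. fold e. apply Rmult_le_compat_l. apply Cmod_ge_0. apply D1.
  - apply (ex_series_plus (fun n => 1 * (2 * M * s ^ S n)) (fun n => e * (M * k1 * s ^ n))).
    apply (ex_series_scal_l 1 (fun n => 2 * M * s ^ S n)). exact EDp'.
    apply (ex_series_scal_l e (fun n => M * k1 * s ^ n)). exact ED1. }
rewrite Eq. eapply Rle_trans. apply (CSeries_bound _ _ R ER). rewrite Series_scal_l. change (Series (pow s)) with (Series (fun n => s ^ n)).
assert (0 <= M * k1 * e ^ 2 * Series (fun n => s ^ n)).
{ apply Rmult_le_pos; [|lra]. apply Rmult_le_pos. apply Rmult_le_pos; lra. apply pow_le, Cmod_ge_0. }
lra.
Qed.

(** The quadratic estimates of the terms share one constant, so they add up to a quadratic estimate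
    for the sum, with the series of derivatives as its derivative. *)
Theorem holo_CSeries (u : nat -> C -> C) : (forall n, holo (u n)) ->
  (forall r, 0 < r < 1 -> exists M, ex_series M /\ forall n z, Cmod z <= r -> Cmod (u n z) <= M n) ->
  holo (fun z => CSeries (fun n => u n z)).
Proof.
intros Hu HM z Hz.
(* With [h = (1 - Cmod z) / 8] this is [s = 1 - h], and [(1 - h) ^ 4 > 1 - 8 * h] places [z] inside
   the radius [s ^ 4]. *)
set (s := (7 + Cmod z) / 8). assert (Z0 := Cmod_ge_0 z).
assert (Hs : 0 < s < 1) by (unfold s; lra).
assert (Hzs : Cmod z < s ^ 4).
{ set (h := (1 - Cmod z) / 8). assert (Eh : s = 1 - h) by (unfold s, h; field).
  replace (Cmod z) with (1 - 8 * h) by (unfold h; field).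
  rewrite Eh. nra. }
destruct (taylor_quadratic s Hs) as [K [K0 HK]].
destruct (HM s Hs) as [M [EM HMs]].
assert (Q : forall n, Cmod (tderiv (u n) z) <= K * M n /\
  forall w, Cmod w <= s ^ 4 -> Cmod (u n w - u n z - tderiv (u n) z * (w - z)) <= K * M n * Cmod (w - z) ^ 2).
{ intros n. apply HK. apply Hu. intros w Hw. apply HMs. lra. lra. }
assert (EK : ex_series (fun n => K * M n)) by (apply (ex_series_scal_l K M); exact EM).
assert (s4 : s ^ 4 <= s). { simpl. assert (0 < s * s < 1) by nra. nra. }
exists (CSeries (fun n => tderiv (u n) z)). intros eps He.
set (B := 2 * Series (fun n => K * M n)).
assert (B0 : 0 <= B).
{ eapply Rle_trans; [apply Cmod_ge_0|]. apply (CSeries_bound (fun n => tderiv (u n) z) (fun n => K * M n)). intros; apply Q. exact EK. }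
exists (Rmin (s ^ 4 - Cmod z) (eps / (B + 1))). split. apply Rmin_pos. lra. apply Rdiv_lt_0_compat; lra.
intros w Hw. assert (L1 := Rmin_l (s ^ 4 - Cmod z) (eps / (B + 1))). assert (L2 := Rmin_r (s ^ 4 - Cmod z) (eps / (B + 1))).
assert (Hws : Cmod w <= s ^ 4). { replace w with ((w - z) + z)%C by ring. eapply Rle_trans. apply Cmod_triangle. lra. }
set (e := Cmod (w - z)) in *. assert (e0 : 0 <= e) by apply Cmod_ge_0.
assert (Eq : (CSeries (fun n => u n w) - CSeries (fun n => u n z) - CSeries (fun n => tderiv (u n) z) * (w - z))%C
   = CSeries (fun n => u n w - u n z - tderiv (u n) z * (w - z))%C).
{ rewrite (CSeries_ext (fun n => u n w - u n z - tderiv (u n) z * (w - z))%C (fun n => u n w + (RtoC (-1) * u n z + (- (w - z)) * tderiv (u n) z))%C) by (intros; ring).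
  assert (Dw : forall n, Cmod (u n w) <= M n) by (intros; apply HMs; lra).
  assert (Dz : forall n, Cmod (u n z) <= M n) by (intros; apply HMs; lra).
  assert (D1 : forall n, Cmod (RtoC (-1) * u n z) <= M n) by (intros; rewrite Cmod_mult, Cmod_neg1, Rmult_1_l; apply Dz).
  assert (D2 : forall n, Cmod (- (w - z) * tderiv (u n) z) <= e * (K * M n)) by (intros; rewrite Cmod_mult, Cmod_opp; apply Rmult_le_compat_l; [exact e0|apply Q]).
  assert (E2 : ex_series (fun n => e * (K * M n))) by (apply (ex_series_scal_l e (fun n => K * M n)); exact EK).
  rewrite (CSeries_plus _ _ M (fun n => M n + e * (K * M n)) Dw EM).
  rewrite (CSeries_plus _ _ M (fun n => e * (K * M n)) D1 EM D2 E2).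
  rewrite (CSeries_scal _ _ M Dz EM), (CSeries_scal _ _ (fun n => K * M n) (fun n => proj1 (Q n)) EK). ring.
  intros n. eapply Rle_trans. apply Cmod_triangle. apply Rplus_le_compat. apply D1. apply D2.
  apply (ex_series_plus M (fun n => e * (K * M n))); assumption. }
rewrite Eq. eapply Rle_trans. apply (CSeries_bound _ (fun n => e ^ 2 * (K * M n))).
- intros n. eapply Rle_trans. apply Q. exact Hws. fold e. lra.
- apply (ex_series_scal_l (e ^ 2) (fun n => K * M n)). exact EK.
- rewrite Series_scal_l. replace (2 * (e ^ 2 * Series (fun n => K * M n))) with (B * e * e) by (unfold B; ring).
  apply Rmult_le_compat_r. exact e0.
  apply Rle_trans with ((B + 1) * (eps / (B + 1))). apply Rmult_le_compat; lra. right; field; lra.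
Qed.

(** * Uniqueness *)

Lemma identity_real f : holo f -> (forall x, 0 < x < 1 -> f (RtoC x) = 0) -> forall z, Cmod z < 1 -> f z = 0.
Proof.
intros Hf H. destruct (isolated_zero f Hf) as [Z|[d [Hd N]]]. exact Z.
exfalso. set (x := Rmin (d / 2) (1/2)).
assert (Hx : 0 < x) by (apply Rmin_pos; lra). assert (L1 := Rmin_l (d/2) (1/2)). assert (L2 := Rmin_r (d/2) (1/2)). fold x in L1, L2.
apply (N (RtoC x)). rewrite Cmod_R, Rabs_pos_eq; lra. apply H. lra.
Qed.

Lemma Cmod_sqr_lt (a b : C) : Re a ^ 2 + Im a ^ 2 < Re b ^ 2 + Im b ^ 2 -> Cmod a < Cmod b.
Proof. intros H. rewrite <- !Cmod2_alt in H. apply Rsqr_incrst_0; try apply Cmod_ge_0. rewrite !Rsqr_pow2. exact H. Qed.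

(** The Cayley map (1 + z) / (1 - z) carries the disk onto the half-plane and the segment from 0 to
    1 into the positive axis, which reduces the claim to the disk. *)
Lemma identity_halfplane F : (forall t, 0 < Re t -> cdiff F t) -> (forall x : R, 0 < x -> F (RtoC x) = 0) ->
  forall t, 0 < Re t -> F t = 0.
Proof.
intros HF H t Ht.
set (phi := fun z : C => ((1 + z) / (1 - z))%C).
assert (Nz : forall z, Cmod z < 1 -> (1 - z)%C <> 0).
{ intros z Hz E. assert (z = 1) by (replace z with (1 - (1 - z))%C by ring; rewrite E; ring). subst z. rewrite Cmod_1 in Hz. lra. }
assert (Rp : forall z, Cmod z < 1 -> 0 < Re (phi z)).
{ intros [a b] Hz.
  assert (E := Cmod2_alt (a, b)). simpl Re in E; simpl Im in E. assert (P := Cmod_ge_0 (a, b)).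
  assert (Q : a ^ 2 + b ^ 2 < 1) by (rewrite <- E; nra).
  assert (D : 0 < (1 - a) ^ 2 + b ^ 2).
  { assert (0 <= b ^ 2) by apply pow2_ge_0. assert (a < 1) by nra. nra. }
  replace (Re (phi (a, b))) with ((1 - a ^ 2 - b ^ 2) / ((1 - a) ^ 2 + b ^ 2)).
  apply Rdiv_lt_0_compat; lra. unfold phi. simpl. field. intro E'; nra. }
assert (Hphi : holo (fun z => F (phi z))).
{ intros z Hz. apply (cdiff_comp F phi). apply HF, Rp, Hz. apply cdiff_div.
  apply cdiff_plus. apply cdiff_const. apply cdiff_id. apply cdiff_minus. apply cdiff_const. apply cdiff_id. apply Nz, Hz. }
assert (Z := identity_real _ Hphi).
assert (Nt : (t + 1)%C <> 0). { intros E. apply (f_equal fst) in E. destruct t; simpl in *. lra. }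
replace t with (phi ((t - 1) / (t + 1))%C).
- apply Z.
  + intros x Hx. unfold phi. replace ((1 + RtoC x) / (1 - RtoC x))%C with (RtoC ((1 + x) / (1 - x))).
    apply H. apply Rdiv_lt_0_compat; lra. rewrite RtoC_div, RtoC_plus, RtoC_minus by lra. reflexivity.
  + rewrite Cmod_div by exact Nt. apply Rmult_lt_reg_r with (Cmod (t + 1)). apply Cmod_gt_0, Nt.
    unfold Rdiv. rewrite Rmult_assoc, Rinv_l, Rmult_1_r, Rmult_1_l. apply Cmod_sqr_lt. destruct t as [a b]; simpl in *. nra.
    apply Rgt_not_eq, Cmod_gt_0, Nt.
- unfold phi. field. split. exact Nt.
  replace (t + 1 - (t - 1))%C with (RtoC 2) by ring. intros E. apply (f_equal fst) in E. simpl in E. lra.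
Qed.

Section Homogeneous.
Variables f om : C -> C.
Hypothesis Hf : holo f.
Hypothesis Hom : holo om.
Let G (t : C) : C := (cexp (RtoC (- (2/3)) * t) * om (- cexp (- t)))%C.
Let H (t : C) : C := (cexp (RtoC (- (2/3)) * t) * om (cexp (- t)))%C.
Let K (t : C) : C := (cexp (RtoC (1/12) * t) * f (cexp (RtoC (-2) * t)))%C.
(** Squaring replaces the square roots of [PI / t] by rational factors, so that both sides make
    sense and are holomorphic for complex [t]. The loss of sign is harmless, as only moduli are
    used. *)
Hypothesis E1 : forall t : R, 0 < t -> (t * G t ^ 2 = PI * G (RtoC (PI ^ 2 / t)) ^ 2)%C.
Hypothesis E2 : forall t : R, 0 < t -> (RtoC (4 * t) * H t ^ 2 = PI * K (RtoC (PI ^ 2 / t)) ^ 2)%C.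

Let inv (t : C) : C := (RtoC (PI ^ 2) / t)%C.

Lemma re_pos_neq0 (t : C) : 0 < Re t -> t <> 0.
Proof. intros Ht E. rewrite E in Ht. simpl in Ht. lra. Qed.

Lemma inv_re t : 0 < Re t -> Re (inv t) = PI ^ 2 * Re t / Cmod t ^ 2.
Proof.
intros Ht. assert (N := re_pos_neq0 t Ht).
assert (P : 0 < Cmod t ^ 2) by (apply pow_lt, Cmod_gt_0, N). rewrite Cmod2_alt in *. destruct t as [a b]. unfold inv. simpl in *. field. lra.
Qed.

Lemma inv_re_pos t : 0 < Re t -> 0 < Re (inv t).
Proof.
intros Ht. rewrite inv_re by exact Ht. assert (PP := PI_RGT_0). assert (N := re_pos_neq0 t Ht). apply Cmod_gt_0 in N.
apply Rdiv_lt_0_compat. apply Rmult_lt_0_compat; [apply pow_lt|]; lra. apply pow_lt; lra.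
Qed.

Lemma cexp_neg_disk t : 0 < Re t -> Cmod (cexp (- t)) < 1.
Proof. intros Ht. rewrite Cmod_cexp. simpl. rewrite <- exp_0. apply exp_increasing. unfold Re in Ht. lra. Qed.

Lemma cdiff_lin k (z : C) : cdiff (fun w => RtoC k * w)%C z.
Proof. apply cdiff_mult. apply cdiff_const. apply cdiff_id. Qed.

Lemma cdiff_G t : 0 < Re t -> cdiff G t.
Proof.
intros Ht. apply cdiff_mult. apply (cdiff_comp cexp (fun w => RtoC (- (2/3)) * w)%C). apply cdiff_cexp. apply cdiff_lin.
apply (cdiff_comp om (fun w => - cexp (- w))%C). apply Hom. rewrite Cmod_opp. apply cexp_neg_disk, Ht.
apply cdiff_opp. apply (cdiff_comp cexp (fun w => - w)%C). apply cdiff_cexp. apply cdiff_opp, cdiff_id.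
Qed.
Lemma cdiff_H t : 0 < Re t -> cdiff H t.
Proof.
intros Ht. apply cdiff_mult. apply (cdiff_comp cexp (fun w => RtoC (- (2/3)) * w)%C). apply cdiff_cexp. apply cdiff_lin.
apply (cdiff_comp om (fun w => cexp (- w))%C). apply Hom. apply cexp_neg_disk, Ht.
apply (cdiff_comp cexp (fun w => - w)%C). apply cdiff_cexp. apply cdiff_opp, cdiff_id.
Qed.
Lemma cdiff_K t : 0 < Re t -> cdiff K t.
Proof.
intros Ht. apply cdiff_mult. apply (cdiff_comp cexp (fun w => RtoC (1/12) * w)%C). apply cdiff_cexp. apply cdiff_lin.
apply (cdiff_comp f (fun w => cexp (RtoC (-2) * w))%C). apply Hf.
rewrite Cmod_cexp. rewrite <- exp_0. apply exp_increasing. destruct t; simpl in *. lra.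
apply (cdiff_comp cexp (fun w => RtoC (-2) * w)%C). apply cdiff_cexp. apply cdiff_lin.
Qed.
Lemma cdiff_inv_map t : 0 < Re t -> cdiff inv t.
Proof. intros Ht. apply cdiff_div. apply cdiff_const. apply cdiff_id. apply re_pos_neq0, Ht. Qed.

Lemma E1c t : 0 < Re t -> (t * G t ^ 2 = PI * G (inv t) ^ 2)%C.
Proof.
intros Ht.
assert (Z : (t * G t ^ 2 - PI * G (inv t) ^ 2 = 0)%C).
{ apply (identity_halfplane (fun t => t * G t ^ 2 - PI * G (inv t) ^ 2)%C); [| |exact Ht].
  - intros s Hs. apply cdiff_minus. apply cdiff_mult. apply cdiff_id. apply cdiff_pow, cdiff_G, Hs.
    apply cdiff_mult. apply cdiff_const. apply cdiff_pow. apply (cdiff_comp G inv). apply cdiff_G, inv_re_pos, Hs. apply cdiff_inv_map, Hs.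
  - intros x Hx. unfold inv. rewrite <- RtoC_div by lra. rewrite <- E1 by exact Hx. ring. }
transitivity ((t * G t ^ 2 - PI * G (inv t) ^ 2) + PI * G (inv t) ^ 2)%C. ring. rewrite Z. ring.
Qed.
Lemma E2c t : 0 < Re t -> (4 * t * H t ^ 2 = PI * K (inv t) ^ 2)%C.
Proof.
intros Ht.
assert (Z : (4 * t * H t ^ 2 - PI * K (inv t) ^ 2 = 0)%C).
{ apply (identity_halfplane (fun t => 4 * t * H t ^ 2 - PI * K (inv t) ^ 2)%C); [| |exact Ht].
  - intros s Hs. apply cdiff_minus. apply cdiff_mult. apply cdiff_lin. apply cdiff_pow, cdiff_H, Hs.
    apply cdiff_mult. apply cdiff_const. apply cdiff_pow. apply (cdiff_comp K inv). apply cdiff_K, inv_re_pos, Hs. apply cdiff_inv_map, Hs.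
  - intros x Hx. unfold inv. rewrite <- RtoC_div by lra. rewrite <- E2 by exact Hx. rewrite RtoC_mult. ring. }
transitivity ((4 * t * H t ^ 2 - PI * K (inv t) ^ 2) + PI * K (inv t) ^ 2)%C. ring. rewrite Z. ring.
Qed.

(** Inversion keeps [G] and exchanges [H] and [K], hence the product of all three; evenness of [h]
    is invariance under the shift of [t] by i pi. *)
Let h (q : C) : C := (f (q ^ 2) * (om q * om (- q)))%C.

Lemma holo_h : holo h.
Proof.
intros q Hq. apply cdiff_mult. apply (cdiff_comp f (fun q => q ^ 2)%C). apply Hf. rewrite Cmod_pow. assert (T := Cmod_ge_0 q). nra.
apply (cdiff_pow (fun w => w)), cdiff_id. apply cdiff_mult. apply Hom, Hq.
apply (cdiff_comp om (fun q => - q)%C). apply Hom. rewrite Cmod_opp. exact Hq. apply cdiff_opp, cdiff_id.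
Qed.

Lemma h_even q : h (- q)%C = h q.
Proof. unfold h. replace ((- q) ^ 2)%C with (q ^ 2)%C by ring. replace (- - q)%C with q by ring. ring. Qed.

(** The exponent is 2/3 + 2/3 - 1/12 = 5/4. *)
Lemma mod_GHK t : Cmod (G t) * Cmod (H t) * Cmod (K t) = exp (- (5/4) * Re t) * Cmod (h (cexp (- t))).
Proof.
unfold G, H, K, h. rewrite !Cmod_mult, !Cmod_cexp.
replace (cexp (- t) ^ 2)%C with (cexp (RtoC (-2) * t)).
2:{ rewrite cexp_pow. f_equal. simpl INR. replace (1 + 1) with 2 by ring. ring. }
destruct t as [u v]. cbn [Re Cmult RtoC fst snd].
replace (- (5/4) * u) with ((- (2/3) * u - 0 * v) + ((- (2/3) * u - 0 * v) + (1/12 * u - 0 * v))) by field.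
rewrite !exp_plus. ring.
Qed.

(** The squared moduli of [G], [K], [H] at the inverted point acquire the factors [Cmod t / PI],
    [4 * Cmod t / PI] and [Cmod t / (4 * PI)]. The last comes from the second equation at [inv t].
    The factors 4 cancel in the product. *)
Lemma h_inversion t : 0 < Re t ->
  (exp (- (5/4) * Re (inv t)) * Cmod (h (cexp (- inv t)))) ^ 2 = (Cmod t / PI) ^ 3 * (exp (- (5/4) * Re t) * Cmod (h (cexp (- t)))) ^ 2.
Proof.
intros Ht. rewrite <- !mod_GHK. assert (PP := PI_RGT_0).
assert (N := re_pos_neq0 t Ht). assert (Pt := proj1 (Cmod_gt_0 t) N).
assert (A1 := f_equal Cmod (E1c t Ht)). assert (A2 := f_equal Cmod (E2c t Ht)). assert (A3 := f_equal Cmod (E2c (inv t) (inv_re_pos t Ht))).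
replace (inv (inv t)) with t in A3.
2:{ unfold inv. field. split. exact N. intros E. apply (f_equal fst) in E. simpl in E. assert (0 < PI ^ 2) by (apply pow_lt; lra). simpl in H0. lra. }
assert (Ci : Cmod (inv t) = PI ^ 2 / Cmod t).
{ unfold inv. rewrite Cmod_div by exact N. rewrite Cmod_R, Rabs_pos_eq. reflexivity. apply pow2_ge_0. }
remember (G t) as g eqn:X1. remember (G (inv t)) as g' eqn:X2. remember (H t) as y eqn:X3. remember (H (inv t)) as y' eqn:X4.
remember (K t) as k eqn:X5. remember (K (inv t)) as k' eqn:X6. remember (inv t) as t' eqn:X7. clear X1 X2 X3 X4 X5 X6 X7.
repeat (rewrite Cmod_mult in A1 || rewrite Cmod_pow in A1). repeat (rewrite Cmod_mult in A2 || rewrite Cmod_pow in A2).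
repeat (rewrite Cmod_mult in A3 || rewrite Cmod_pow in A3).
rewrite !Cmod_R, (Rabs_pos_eq PI) in A1 by lra. rewrite !Cmod_R, (Rabs_pos_eq PI), (Rabs_pos_eq 4) in A2 by lra.
rewrite !Cmod_R, (Rabs_pos_eq PI), (Rabs_pos_eq 4), Ci in A3 by lra.
assert (B1 : Cmod g' ^ 2 = Cmod t * Cmod g ^ 2 / PI) by (rewrite A1; field; lra).
assert (B2 : Cmod k' ^ 2 = 4 * Cmod t * Cmod y ^ 2 / PI) by (rewrite A2; field; lra).
assert (B3 : Cmod y' ^ 2 = Cmod t * Cmod k ^ 2 / (4 * PI)).
{ apply Rmult_eq_reg_l with (4 * (PI ^ 2 / Cmod t)). rewrite A3. field. split; lra.
  apply Rgt_not_eq. apply Rmult_lt_0_compat. lra. apply Rdiv_lt_0_compat. apply pow_lt; lra. lra. }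
rewrite !Rpow_mult_distr, B1, B2, B3. field. lra.
Qed.

(** Below [PI * sqrt 3 / 2], so that every [t] on this line with imaginary part at most [PI / 2] in
    size has modulus less than [PI]. Large enough that the decay rate [5 * u0 = 4 * PI] beats the
    cubic factor in [h_contract]. *)
Let u0 := 4 * PI / 5.

Lemma exp_le a b : a <= b -> exp a <= exp b.
Proof. intros [L| ->]. left; apply exp_increasing; exact L. lra. Qed.

(** Inversion multiplies the real part by [lam > 1], so the image lies inside the circle and
    inherits the bound [M] by the maximum principle. Transporting it back costs [lam ^ 3] and gains
    [exp (- 5 * u0 * (lam - 1))]. Fourth powers clear the exponent 3/4 of the invariant quantity. *)
Lemma h_contract M : (forall w, Cmod w = exp (- u0) -> Cmod (h w) <= M) ->
  forall w, Cmod w = exp (- u0) -> Cmod (h w) ^ 4 <= exp (-1) * M ^ 4.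
Proof.
intros HM w Hw. assert (P3 : 3 < PI) by (assert (T := PI2_3_2); lra).
assert (Hu0 : 0 < u0) by (unfold u0; lra).
(* Evenness of [h] allows the angle to be shifted by multiples of [PI] into a half turn. *)
assert (Red : exists v, - (PI / 2) <= v <= PI / 2 /\ h w = h (cexp (- (u0, v)))).
{ destruct (polar w (- u0) Hw) as [th [Hth ->]].
  assert (Sh : forall y, h (cexp (- u0, y - PI)) = h (cexp (- u0, y))).
  { intros y. rewrite <- h_even. f_equal. unfold cexp; simpl. rewrite cos_minus, sin_minus, cos_PI, sin_PI.
    apply injective_projections; simpl; ring. }
  assert (Ex : forall y, h (cexp (- u0, th)) = h (cexp (- u0, y)) -> - (PI/2) <= y <= PI/2 -> exists v, - (PI / 2) <= v <= PI / 2 /\ h (cexp (- u0, th)) = h (cexp (- (u0, v)))).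
  { intros y Ey By. exists (- y). split. lra. rewrite Ey. f_equal. f_equal. apply injective_projections; simpl; ring. }
  destruct (Rle_dec th (PI / 2)). apply (Ex th); [reflexivity|lra].
  destruct (Rle_dec th (3 * PI / 2)). apply (Ex (th - PI)); [symmetry; apply Sh|lra].
  apply (Ex (th - PI - PI)); [rewrite !Sh; reflexivity|lra]. }
destruct Red as [v [Hv ->]].
set (t := (u0, v)). assert (Ht : 0 < Re t) by exact Hu0.
assert (I := h_inversion t Ht). assert (Pi := inv_re_pos t Ht).
assert (Pt : 0 < Cmod t) by (apply Cmod_gt_0, re_pos_neq0, Ht).
assert (Et : Cmod t ^ 2 = u0 ^ 2 + v ^ 2) by apply (Cmod2_alt t).
(* 89/100 = (4/5)^2 + (1/2)^2, whose reciprocal exceeds 1 + 12/100. *)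
assert (Bt : Cmod t ^ 2 <= 89/100 * PI ^ 2). { rewrite Et. unfold u0. assert (v ^ 2 <= (PI/2) ^ 2) by nra. nra. }
set (lam := PI ^ 2 / Cmod t ^ 2).
assert (Pt2 : 0 < Cmod t ^ 2) by (apply pow_lt; exact Pt).
assert (Hlam : 1 + 12/100 <= lam).
{ unfold lam. apply Rmult_le_reg_r with (Cmod t ^ 2). exact Pt2. unfold Rdiv at 2. rewrite Rmult_assoc, Rinv_l, Rmult_1_r by lra. nra. }
assert (Er : Re (inv t) = lam * u0). { rewrite inv_re by exact Ht. unfold lam. simpl. field. lra. }
rewrite Er in I, Pi. change (Re t) with u0 in I.
assert (Mh : Cmod (h (cexp (- inv t))) <= M).
{ apply (max_principle h (- (lam * u0)) (- u0) M); try exact holo_h; try exact HM; try nra.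
  rewrite Cmod_cexp. right. f_equal. simpl. rewrite <- Er. reflexivity. }
set (a := Cmod (h (cexp (- inv t)))) in *. set (b := Cmod (h (cexp (- t)))) in *.
assert (a0 : 0 <= a) by apply Cmod_ge_0. assert (b0 : 0 <= b) by apply Cmod_ge_0.
assert (I2 := f_equal (fun x => x ^ 2) I). cbv beta in I2.
replace (((Cmod t / PI) ^ 3 * (exp (- (5 / 4) * u0) * b) ^ 2) ^ 2) with (/ lam ^ 3 * exp (- (5/4) * u0) ^ 4 * b ^ 4) in I2.
2:{ unfold lam. field. split; lra. }
replace (((exp (- (5 / 4) * (lam * u0)) * a) ^ 2) ^ 2) with (exp (- (5/4) * (lam * u0)) ^ 4 * a ^ 4) in I2 by ring.
rewrite <- !exp_INR_mul in I2. replace (INR 4) with 4 in I2 by (simpl; ring).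
assert (L3 : 0 < lam ^ 3) by (apply pow_lt; lra).
assert (Eb : b ^ 4 = lam ^ 3 * exp (- (5 * u0 * (lam - 1))) * a ^ 4).
{ replace (- (5 * u0 * (lam - 1))) with (4 * (- (5/4) * (lam * u0)) + - (4 * (- (5/4) * u0))) by field.
  rewrite exp_plus, exp_Ropp. set (X := exp (4 * (- (5 / 4) * (lam * u0)))) in *. set (Y := exp (4 * (- (5 / 4) * u0))) in *.
  assert (0 < Y) by apply exp_pos.
  transitivity (lam ^ 3 * / Y * (X * a ^ 4)). rewrite I2. field. split; lra. ring. }
rewrite Eb.
apply Rmult_le_compat. apply Rmult_le_pos. lra. apply Rlt_le, exp_pos. apply pow_le; exact a0. 2: apply pow_incr; lra.
(* [lam <= exp (lam - 1)] leaves the exponent [(3 - 4 * PI) * (lam - 1)], which is at most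
   [- 9 * 12/100 < -1]. *)
apply Rle_trans with (exp (3 * (lam - 1)) * exp (- (5 * u0 * (lam - 1)))).
- apply Rmult_le_compat_r. apply Rlt_le, exp_pos. replace (3 * (lam - 1)) with (INR 3 * (lam - 1)) by (simpl; ring). rewrite exp_INR_mul. apply pow_incr.
  assert (T := exp_ineq1_le (lam - 1)). lra.
- rewrite <- exp_plus. apply exp_le. unfold u0. nra.
Qed.

(** The contraction acts on fourth powers by [exp (-1)], hence on the bound itself by
    [k = exp (- 1/4)]; iterating it from any bound leaves only 0. *)
Lemma h_zero_circle w : Cmod w = exp (- u0) -> h w = 0.
Proof.
intros Hw. assert (PP := PI_RGT_0). assert (Hu0 : - u0 < 0) by (unfold u0; lra).
destruct (circle_bounded h (- u0) holo_h Hu0) as [M [M0 HM]].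
set (k := exp (- (1/4))). assert (Pk : 0 < k) by apply exp_pos.
assert (k1 : k < 1). { assert (T := exp_increasing (- (1/4)) 0 ltac:(lra)). rewrite exp_0 in T. exact T. }
assert (k4 : exp (-1) = k ^ 4). { unfold k. rewrite <- exp_INR_mul. f_equal. simpl. field. }
assert (It : forall n w, Cmod w = exp (- u0) -> Cmod (h w) <= k ^ n * M).
{ induction n; intros x Hx. rewrite Rmult_1_l. apply HM, Hx.
  assert (C := h_contract _ IHn x Hx). rewrite k4 in C.
  assert (P : 0 <= k ^ S n * M) by (apply Rmult_le_pos; [apply pow_le|]; lra).
  apply Rnot_lt_le. intros L.
  assert (Q : (k ^ S n * M) ^ 4 < Cmod (h x) ^ 4).
  { set (c := k ^ S n * M) in *. set (d := Cmod (h x)) in *. assert (c ^ 2 < d ^ 2) by nra. assert (0 <= c ^ 2) by nra. replace (c ^ 4) with (c ^ 2 * c ^ 2) by ring. replace (d ^ 4) with (d ^ 2 * d ^ 2) by ring. nra. }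
  replace (k ^ 4 * (k ^ n * M) ^ 4) with ((k ^ S n * M) ^ 4) in C by (simpl; ring). lra. }
apply Cmod_eq_0. apply Rle_antisym; [|apply Cmod_ge_0]. apply Rnot_lt_le. intros L.
apply (pow_dominates k 1 (Cmod (h w)) M); try lra. intros n. rewrite pow1, Rmult_1_r, (Rmult_comm M). apply It, Hw.
Qed.

Lemma h_zero z : Cmod z <= exp (- u0 - 1) -> h z = 0.
Proof.
intros Hz. assert (PP := PI_RGT_0). apply Cmod_eq_0. apply Rle_antisym; [|apply Cmod_ge_0].
apply (max_principle h (- u0 - 1) (- u0) 0 z holo_h); try (unfold u0; lra).
intros w Hw. rewrite h_zero_circle by exact Hw. rewrite Cmod_0. lra. exact Hz.
Qed.

Lemma homogeneous_f_or_om : (forall z, Cmod z < 1 -> f z = 0) \/ (forall z, Cmod z < 1 -> om z = 0).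
Proof.
destruct (isolated_zero f Hf) as [Zf|[d [Hd Nf]]]. left; exact Zf.
destruct (isolated_zero om Hom) as [Zo|[d' [Hd' No]]]. right; exact Zo.
exfalso. set (x := Rmin (Rmin (d / 2) (d' / 2)) (Rmin (1/2) (exp (- u0 - 1)))).
assert (Hx : 0 < x). { repeat apply Rmin_pos; try lra. apply exp_pos. }
assert (L1 := Rmin_l (Rmin (d / 2) (d' / 2)) (Rmin (1/2) (exp (- u0 - 1)))). assert (L2 := Rmin_r (Rmin (d / 2) (d' / 2)) (Rmin (1/2) (exp (- u0 - 1)))).
assert (L3 := Rmin_l (d / 2) (d' / 2)). assert (L4 := Rmin_r (d / 2) (d' / 2)).
assert (L5 := Rmin_l (1/2) (exp (- u0 - 1))). assert (L6 := Rmin_r (1/2) (exp (- u0 - 1))). fold x in L1, L2.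
assert (Cx : Cmod x = x) by (rewrite Cmod_R, Rabs_pos_eq; lra).
assert (Z := h_zero x ltac:(lra)). unfold h in Z.
assert (A : f (RtoC x ^ 2)%C <> 0). { apply Nf. rewrite Cmod_pow, Cx. split. apply pow_lt; lra. nra. }
assert (B : om x <> 0) by (apply No; rewrite Cx; lra).
assert (C : om (- RtoC x)%C <> 0) by (apply No; rewrite Cmod_opp, Cx; lra).
revert Z. apply Cmult_neq_0. exact A. apply Cmult_neq_0; assumption.
Qed.
End Homogeneous.

Lemma holomorphic_holo f : holomorphic_in_disk f <-> holo f.
Proof. split; intros H z Hz. apply ex_derive_cdiff, H, Hz. apply cdiff_ex_derive, H, Hz. Qed.

Lemma RtoC_neq (x : R) : x <> 0 -> RtoC x <> 0.
Proof. intros Hx E. apply Hx. apply (f_equal fst) in E. exact E. Qed.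

Lemma Cmult_cancel (a b : C) : a <> 0 -> (a * b = 0)%C -> b = 0.
Proof. intros Ha E. transitivity (/ a * (a * b))%C. field. exact Ha. rewrite E. ring. Qed.

Theorem solution_unique (f1 om1 f2 om2 : C -> C) : is_solution f1 om1 -> is_solution f2 om2 ->
  forall z : C, in_unit_disk z -> f1 z = f2 z /\ om1 z = om2 z.
Proof.
intros (F1 & O1 & A1 & B1) (F2 & O2 & A2 & B2). assert (PP := PI_RGT_0).
apply holomorphic_holo in F1, O1, F2, O2.
set (f := fun z => (f1 z - f2 z)%C). set (om := fun z => (om1 z - om2 z)%C).
assert (Hf : holo f) by (intros z Hz; apply cdiff_minus; auto).
assert (Ho : holo om) by (intros z Hz; apply cdiff_minus; auto).
assert (A : forall t, 0 < t -> (RtoC (exp (- (2/3) * t)) * om (- RtoC (exp (- t)))%C =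
   - RtoC (sqrt (PI / t)) * RtoC (exp (- (2/3) * (PI ^ 2 / t))) * om (- RtoC (exp (- (PI ^ 2 / t)))))%C).
{ intros t Ht. specialize (A1 t Ht). specialize (A2 t Ht). unfold qpow, q1pow in A1, A2.
  rewrite !RtoC_opp in A1, A2.
  replace (- (2 / 3 * t)) with (- (2/3) * t) in A1, A2 by ring. replace (- (1 * t)) with (- t) in A1, A2 by ring.
  replace (- (2 / 3 * PI ^ 2 / t)) with (- (2/3) * (PI ^ 2 / t)) in A1, A2 by (field; lra).
  replace (- (1 * PI ^ 2 / t)) with (- (PI ^ 2 / t)) in A1, A2 by (field; lra).
  unfold om.
  match type of A1 with (?a * ?b = _)%C => match type of A2 with (_ * ?c = _)%C => transitivity (a * b - a * c)%C end end.
  ring. rewrite A1, A2. ring. }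
assert (B : forall t, 0 < t -> (RtoC (exp (- (2/3) * t)) * om (RtoC (exp (- t))) =
   RtoC (sqrt (PI / (4 * t))) * RtoC (exp (1/12 * (PI ^ 2 / t))) * f (RtoC (exp (-2 * (PI ^ 2 / t)))))%C).
{ intros t Ht. specialize (B1 t Ht). specialize (B2 t Ht). unfold qpow, q1pow in B1, B2.
  replace (- (2 / 3 * t)) with (- (2/3) * t) in B1, B2 by ring. replace (- (1 * t)) with (- t) in B1, B2 by ring.
  replace (- (- (1 / 12) * PI ^ 2 / t)) with (1/12 * (PI ^ 2 / t)) in B1, B2 by (field; lra).
  replace (exp (- (1 * PI ^ 2 / t)) ^ 2) with (exp (-2 * (PI ^ 2 / t))) in B1, B2.
  2:{ rewrite <- exp_INR_mul. f_equal. simpl. field. lra. }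
  unfold om, f.
  match type of B1 with (?a * ?b = _)%C => match type of B2 with (_ * ?c = _)%C => transitivity (a * b - a * c)%C end end.
  ring. rewrite B1, B2. ring. }
assert (Z : (forall z, Cmod z < 1 -> f z = 0) \/ (forall z, Cmod z < 1 -> om z = 0)).
{ apply homogeneous_f_or_om; try assumption.
  - intros t Ht. rewrite <- !RtoC_opp, <- !RtoC_mult, !cexp_R, <- !RtoC_opp in *.
    specialize (A t Ht). rewrite <- !RtoC_opp in A. rewrite A.
    assert (Es : (RtoC (sqrt (PI / t)) * RtoC (sqrt (PI / t)) = RtoC (PI / t))%C).
    { rewrite <- RtoC_mult, sqrt_sqrt. reflexivity. left. apply Rdiv_lt_0_compat; lra. }
    set (X := RtoC (exp (- (2/3) * (PI ^ 2 / t)))). set (Y := om (RtoC (- exp (- (PI ^ 2 / t))))). rewrite RtoC_opp.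
    transitivity ((RtoC t * (RtoC (sqrt (PI / t)) * RtoC (sqrt (PI / t)))) * (X * Y) ^ 2)%C. ring.
    rewrite Es, <- RtoC_mult. replace (t * (PI / t)) with PI by (field; lra). reflexivity.
  - intros t Ht. rewrite <- !RtoC_opp, <- !RtoC_mult, !cexp_R.
    rewrite (B t Ht).
    assert (Es : (RtoC (sqrt (PI / (4 * t))) * RtoC (sqrt (PI / (4 * t))) = RtoC (PI / (4 * t)))%C).
    { rewrite <- RtoC_mult, sqrt_sqrt. reflexivity. left. apply Rdiv_lt_0_compat; lra. }
    set (X := RtoC (exp (1/12 * (PI ^ 2 / t)))). set (Y := f (RtoC (exp (-2 * (PI ^ 2 / t))))).
    transitivity ((RtoC (4 * t) * (RtoC (sqrt (PI / (4 * t))) * RtoC (sqrt (PI / (4 * t))))) * (X * Y) ^ 2)%C. ring.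
    rewrite Es, <- RtoC_mult. replace (4 * t * (PI / (4 * t))) with PI by (field; lra). reflexivity. }
assert (Ln : forall x, 0 < x < 1 -> ln x < 0). { intros x Hx. rewrite <- ln_1. apply ln_increasing; lra. }
assert (ZZ : (forall z, Cmod z < 1 -> f z = 0) /\ (forall z, Cmod z < 1 -> om z = 0)).
(* The second homogeneous equation ties [f] and [om] together with nonzero factors, so either one
   vanishing forces the other to vanish on the positive segment. *)
{ destruct Z as [Z|Z]; split; try exact Z; apply identity_real; try assumption; intros x Hx; specialize (Ln x Hx).
  - specialize (B (- ln x) ltac:(lra)). rewrite Ropp_involutive, exp_ln in B by lra.
    rewrite Z, Cmult_0_r in B. apply Cmult_cancel in B. exact B. apply RtoC_neq, Rgt_not_eq, exp_pos.
    rewrite Cmod_R, Rabs_pos_eq by (left; apply exp_pos). rewrite <- exp_0. apply exp_increasing.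
    assert (0 < PI ^ 2 / - ln x) by (apply Rdiv_lt_0_compat; [apply pow_lt|]; lra). lra.
  (* This [t] makes the argument [q_1^2] of [f] equal to [x]. *)
  - assert (Pt : 0 < 2 * PI ^ 2 / - ln x). { apply Rdiv_lt_0_compat. apply Rmult_lt_0_compat; [lra|apply pow_lt; lra]. lra. }
    specialize (B _ Pt). rewrite Z, Cmult_0_r in B.
    replace (-2 * (PI ^ 2 / (2 * PI ^ 2 / - ln x))) with (ln x) in B by (field; lra).
    rewrite exp_ln in B by lra. symmetry in B. apply Cmult_cancel in B. exact B.
    rewrite <- RtoC_mult. apply RtoC_neq, Rgt_not_eq. apply Rmult_lt_0_compat. apply sqrt_lt_R0. apply Rdiv_lt_0_compat; lra. apply exp_pos.
    rewrite Cmod_R, Rabs_pos_eq by (left; apply exp_pos). rewrite <- exp_0. apply exp_increasing. lra. }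
intros z Hz. destruct ZZ as [Z1 Z2]. specialize (Z1 z Hz). specialize (Z2 z Hz). split.
- transitivity (f z + f2 z)%C. unfold f; ring. rewrite Z1. ring.
- transitivity (om z + om2 z)%C. unfold om; ring. rewrite Z2. ring.
Qed.

(** * Integrals over the half-line *)

(** Continuity and exponential decay on the open half-line, with nothing required at 0. The constant
    [K] is explicit so that it can be summed over a family of integrands. *)
Record dom (g : R -> R) (K a : R) : Prop := {
  dom_rate : 0 < a;
  dom_cont : forall y, 0 < y -> continuous g y;
  dom_bound : forall y, 0 < y -> Rabs (g y) <= K * exp (- a * y) }.

(* Both ends are cut off, so that the junk value at 0 of integrands such as sinh x / sinh (3 x) is irrelevant. *)
Definition Int_upto (g : R -> R) (n : nat) : R := RInt g (/ (INR n + 1)) (INR n + 1).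
Definition Int (g : R -> R) : R := real (Lim_seq (Int_upto g)).

Lemma dom_nonneg g K a : dom g K a -> 0 <= K.
Proof.
intros H. assert (B := dom_bound _ _ _ H 1 Rlt_0_1). assert (P := exp_pos (- a * 1)). assert (Q := Rabs_pos (g 1)).
apply Rnot_lt_le. intros L. nra.
Qed.

Lemma dom_ex g K a p q : dom g K a -> 0 < p <= q -> ex_RInt g p q.
Proof. intros H Hpq. apply ex_RInt_cont. lra. intros x Hx. apply (dom_cont _ _ _ H). lra. Qed.

Lemma RInt_exp_decay K a p q : 0 < a -> RInt (fun y => K * exp (- a * y)) p q = K * (exp (- a * p) - exp (- a * q)) / a :> R.
Proof.
intros Ha. apply is_RInt_unique.
replace (K * (exp (- a * p) - exp (- a * q)) / a) with (minus (- K / a * exp (- a * q)) (- K / a * exp (- a * p))).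
2:{ unfold minus, plus, opp; simpl. field. lra. }
apply (is_RInt_derive (fun y => - K / a * exp (- a * y))).
intros x _. auto_derive. exact I. field. lra.
intros x _. apply @ex_derive_continuous. auto_derive. exact I.
Qed.

Lemma dom_RInt_bound g K a p q : dom g K a -> 0 < p <= q ->
  Rabs (RInt g p q) <= K * (exp (- a * p) - exp (- a * q)) / a.
Proof.
intros H Hpq. assert (Ha := dom_rate _ _ _ H). rewrite <- RInt_exp_decay by exact Ha.
eapply Rle_trans. apply abs_RInt_le. lra. eapply dom_ex; [exact H|lra].
apply RInt_le. lra. apply (ex_RInt_norm g). eapply dom_ex; [exact H|lra].
apply ex_RInt_cont. lra. intros x _. apply @ex_derive_continuous. auto_derive. exact I.
intros x Hx. apply (dom_bound _ _ _ H). lra.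
Qed.

Lemma exp_lt_1 x : x < 0 -> exp x < 1.
Proof. intros. rewrite <- exp_0. apply exp_increasing. exact H. Qed.

Lemma exp_neg_le1 x : x <= 0 -> exp x <= 1.
Proof. intros. rewrite <- exp_0. apply exp_le. exact H. Qed.

Lemma dom_RInt_bound0 g K a p q : dom g K a -> 0 < p <= q -> Rabs (RInt g p q) <= K * (q - p).
Proof.
intros H Hpq. assert (K0 := dom_nonneg _ _ _ H). rewrite Rmult_comm. apply abs_RInt_bound. lra. eapply dom_ex; [exact H|lra].
intros x Hx. eapply Rle_trans. apply (dom_bound _ _ _ H). lra.
assert (Ha := dom_rate _ _ _ H). assert (E : exp (- a * x) <= 1) by (apply exp_neg_le1; nra).
nra.
Qed.

Lemma dom_RInt_diff g K a e Y e' Y' : dom g K a -> 0 < e' <= e -> e <= Y -> Y <= Y' ->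
  Rabs (RInt g e' Y' - RInt g e Y) <= K * (e + exp (- a * Y) / a).
Proof.
intros H He HeY HY. assert (K0 := dom_nonneg _ _ _ H). assert (Ha := dom_rate _ _ _ H).
rewrite <- (rint_Chasles g e' e Y'), <- (rint_Chasles g e Y Y') by (eapply dom_ex; [exact H|lra]).
replace (RInt g e' e + (RInt g e Y + RInt g Y Y') - RInt g e Y) with (RInt g e' e + RInt g Y Y') by ring.
eapply Rle_trans. apply Rabs_triang.
assert (B1 := dom_RInt_bound0 g K a e' e H ltac:(lra)). assert (B2 := dom_RInt_bound g K a Y Y' H ltac:(lra)).
assert (P := exp_pos (- a * Y')).
assert (K * (exp (- a * Y) - exp (- a * Y')) / a <= K * (exp (- a * Y) / a)).
{ unfold Rdiv. rewrite <- Rmult_assoc. apply Rmult_le_compat_r. left; apply Rinv_0_lt_compat; lra. apply Rmult_le_compat_l; lra. }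
assert (0 <= K * e') by (apply Rmult_le_pos; lra). lra.
Qed.

Lemma INR1_pos n : 0 < INR n + 1. Proof. assert (T := pos_INR n). lra. Qed.

Lemma upto_interval n : 0 < / (INR n + 1) <= INR n + 1.
Proof.
assert (T := pos_INR n). split. apply Rinv_0_lt_compat; lra.
apply Rle_trans with 1; [|lra]. rewrite <- Rinv_1. apply Rinv_le_contravar; lra.
Qed.

Lemma dom_err_lim K a : 0 < a -> is_lim_seq (fun n => K * (/ (INR n + 1) + exp (- a * (INR n + 1)) / a)) 0.
Proof.
intros Ha. replace (Finite 0) with (Finite (K * (0 + 0))) by (f_equal; ring).
apply is_lim_seq_mult'. apply is_lim_seq_const.
assert (L : is_lim_seq (fun n => / (INR n + 1)) 0).
{ replace (Finite 0) with (Rbar_inv p_infty) by reflexivity. apply is_lim_seq_inv; [|discriminate].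
  apply (is_lim_seq_ext (fun n => INR (S n))). intros; apply S_INR. apply (is_lim_seq_incr_1 INR). apply is_lim_seq_INR. }
apply is_lim_seq_plus'. exact L.
apply is_lim_seq_le_le with (fun _ => 0) (fun n => / (INR n + 1) * (/ a * / a)).
- intros n. assert (P := INR1_pos n). split. left; apply Rdiv_lt_0_compat. apply exp_pos. exact Ha.
  unfold Rdiv. rewrite <- Rmult_assoc. apply Rmult_le_compat_r. left; apply Rinv_0_lt_compat; exact Ha.
  replace (- a * (INR n + 1)) with (- (a * (INR n + 1))) by ring. rewrite exp_Ropp. replace (/ (INR n + 1) * / a) with (/ (a * (INR n + 1))) by (field; lra).
  apply Rinv_le_contravar. apply Rmult_lt_0_compat; lra. assert (T := exp_ineq1_le (a * (INR n + 1))). lra.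
- apply is_lim_seq_const.
- replace (Finite 0) with (Finite (0 * (/ a * / a))) by (f_equal; ring). apply is_lim_seq_mult'. exact L. apply is_lim_seq_const.
Qed.

Lemma Int_lim g K a : dom g K a -> is_lim_seq (Int_upto g) (Int g).
Proof.
intros H. apply Lim_seq_correct'. apply ex_lim_seq_cauchy_corr. intros eps.
assert (L := dom_err_lim K a (dom_rate _ _ _ H)). apply is_lim_seq_spec in L.
assert (e2 : 0 < eps / 2) by (assert (T := cond_pos eps); lra).
destruct (L (mkposreal _ e2)) as [N HN]. exists N. specialize (HN N ltac:(lia)). simpl in HN. rewrite Rminus_0_r in HN. apply Rabs_def2 in HN.
assert (D : forall n, (N <= n)%nat -> Rabs (Int_upto g n - Int_upto g N) < eps / 2).
{ intros n Hn. eapply Rle_lt_trans; [|apply HN]. unfold Int_upto.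
  assert (INR N <= INR n) by (apply le_INR; exact Hn).
  apply dom_RInt_diff. exact H. split. apply upto_interval. apply Rinv_le_contravar. apply INR1_pos. lra. apply upto_interval. lra. }
intros n m Hn Hm. assert (D1 := D n Hn). assert (D2 := D m Hm). apply Rabs_def2 in D1, D2. apply Rabs_def1; lra.
Qed.

Lemma is_lim_seq_abs_le (u : nat -> R) (l c B : R) : is_lim_seq u l -> (exists N, forall n, (N <= n)%nat -> Rabs (u n - c) <= B) -> Rabs (l - c) <= B.
Proof.
intros L [N HN]. apply le_epsilon. intros eps He. apply is_lim_seq_spec in L. destruct (L (mkposreal eps He)) as [M HM].
specialize (HN (max N M) ltac:(lia)). specialize (HM (max N M) ltac:(lia)). simpl in HM.
apply Rabs_def2 in HM. apply Rabs_le_between in HN. apply Rabs_le. lra.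
Qed.

Lemma Int_err g K a e Y : dom g K a -> 0 < e <= Y -> Rabs (Int g - RInt g e Y) <= K * (e + exp (- a * Y) / a).
Proof.
intros H HeY. apply (is_lim_seq_abs_le (Int_upto g)). eapply Int_lim; exact H.
destruct (INR_unbounded (Y + / e)) as [N HN]. exists N. intros n Hn. assert (INR N <= INR n) by (apply le_INR; exact Hn).
assert (Pe := Rinv_0_lt_compat e ltac:(lra)).
apply dom_RInt_diff. exact H. split. apply upto_interval. rewrite <- (Rinv_inv e). apply Rinv_le_contravar; lra. lra. lra.
Qed.

Lemma Int_bound g K a : dom g K a -> Rabs (Int g) <= K / a.
Proof.
intros H. rewrite <- (Rminus_0_r (Int g)). apply (is_lim_seq_abs_le (Int_upto g)). eapply Int_lim; exact H.
exists 0%nat. intros n _. rewrite Rminus_0_r. assert (K0 := dom_nonneg _ _ _ H). assert (Ha := dom_rate _ _ _ H).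
eapply Rle_trans. unfold Int_upto. apply (dom_RInt_bound g K a _ _ H (upto_interval n)).
unfold Rdiv. apply Rmult_le_compat_r. left; apply Rinv_0_lt_compat; exact Ha. rewrite <- (Rmult_1_r K) at 2. apply Rmult_le_compat_l. exact K0.
assert (P := exp_pos (- a * (INR n + 1))). assert (Q : exp (- a * / (INR n + 1)) <= 1).
{ apply exp_neg_le1. assert (T := upto_interval n). nra. }
lra.
Qed.

Lemma Int_ext f g : (forall y, 0 < y -> f y = g y) -> Int f = Int g.
Proof.
intros H. unfold Int. f_equal. apply Lim_seq_ext. intros n. unfold Int_upto. assert (T := upto_interval n).
apply rint_ext. lra. intros x Hx. apply H. lra.
Qed.

Lemma Int_unique g (l : R) : is_lim_seq (Int_upto g) l -> Int g = l.
Proof. intros H. unfold Int. rewrite (is_lim_seq_unique _ _ H). reflexivity. Qed.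

Lemma Int_plus f g K a K' a' : dom f K a -> dom g K' a' -> Int (fun y => f y + g y) = Int f + Int g.
Proof.
intros Hf Hg. apply Int_unique. apply (is_lim_seq_ext (fun n => Int_upto f n + Int_upto g n)).
intros n. unfold Int_upto. symmetry. apply rint_plus; eapply dom_ex; try eassumption; apply upto_interval.
apply is_lim_seq_plus'; eapply Int_lim; eassumption.
Qed.

Lemma Int_scal f k K a : dom f K a -> Int (fun y => k * f y) = k * Int f.
Proof.
intros Hf. apply Int_unique. apply (is_lim_seq_ext (fun n => k * Int_upto f n)).
intros n. unfold Int_upto. symmetry. apply rint_scal; eapply dom_ex; try eassumption; apply upto_interval.
apply is_lim_seq_mult'. apply is_lim_seq_const. eapply Int_lim; eassumption.
Qed.

Lemma dom_weaken f K a K' a' : dom f K a -> 0 < a' <= a -> K <= K' -> dom f K' a'.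
Proof.
intros H Ha HK. split. lra. apply (dom_cont _ _ _ H). intros y Hy. eapply Rle_trans. apply (dom_bound _ _ _ H). exact Hy.
apply Rmult_le_compat. eapply dom_nonneg; exact H. left; apply exp_pos. exact HK. apply exp_le. nra.
Qed.

Lemma dom_ext f g K a : (forall y, 0 < y -> f y = g y) -> dom f K a -> dom g K a.
Proof.
intros E H. split. apply (dom_rate _ _ _ H).
- intros y Hy. assert (C := dom_cont _ _ _ H y Hy). rewrite <- continuous_eps in *. intros eps He. destruct (C eps He) as [d [Hd Q]].
  exists (Rmin d y). split. apply Rmin_pos; lra. intros x Hx. assert (L1 := Rmin_l d y). assert (L2 := Rmin_r d y).
  assert (Hx2 := Rlt_le_trans _ _ _ Hx L2). apply Rabs_def2 in Hx2.
  rewrite <- !E by lra. apply Q. lra.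
- intros y Hy. rewrite <- E by exact Hy. apply (dom_bound _ _ _ H). exact Hy.
Qed.

Lemma dom_plus f g K K' a : dom f K a -> dom g K' a -> dom (fun y => f y + g y) (K + K') a.
Proof.
intros H H'. split. apply (dom_rate _ _ _ H). intros y Hy. apply (continuous_plus f g). apply (dom_cont _ _ _ H _ Hy). apply (dom_cont _ _ _ H' _ Hy).
intros y Hy. eapply Rle_trans. apply Rabs_triang. rewrite Rmult_plus_distr_r. apply Rplus_le_compat. apply (dom_bound _ _ _ H _ Hy). apply (dom_bound _ _ _ H' _ Hy).
Qed.

Lemma dom_scal f k K a : dom f K a -> dom (fun y => k * f y) (Rabs k * K) a.
Proof.
intros H. split. apply (dom_rate _ _ _ H). intros y Hy. apply (continuous_mult (fun _ => k) f). apply continuous_const. apply (dom_cont _ _ _ H _ Hy).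
intros y Hy. rewrite Rabs_mult, Rmult_assoc. apply Rmult_le_compat_l. apply Rabs_pos. apply (dom_bound _ _ _ H _ Hy).
Qed.

Lemma dom_mult_bounded f g K a B : dom f K a -> (forall y, 0 < y -> continuous g y) -> (forall y, 0 < y -> Rabs (g y) <= B) ->
  dom (fun y => g y * f y) (B * K) a.
Proof.
intros H Hc Hb. split. apply (dom_rate _ _ _ H). intros y Hy. apply @continuous_mult. apply Hc, Hy. apply (dom_cont _ _ _ H _ Hy).
intros y Hy. rewrite Rabs_mult, Rmult_assoc. apply Rmult_le_compat. apply Rabs_pos. apply Rabs_pos. apply Hb, Hy. apply (dom_bound _ _ _ H _ Hy).
Qed.

Lemma dom_Series (g : nat -> R -> R) (M : nat -> R) a : (forall k, dom (g k) (M k) a) -> ex_series M ->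
  dom (fun y => Series (fun k => g k y)) (Series M) a.
Proof.
intros H E. assert (Ha := dom_rate _ _ _ (H 0%nat)). split. exact Ha.
- intros y Hy. apply (Series_continuous g M y y Hy); [|exact E|].
  + intros n x Hx. apply Rabs_def2 in Hx. eapply Rle_trans. apply (dom_bound _ _ _ (H n)). lra.
    rewrite <- (Rmult_1_r (M n)) at 2. apply Rmult_le_compat_l. eapply dom_nonneg, H. apply exp_neg_le1. nra.
  + intros n. apply (dom_cont _ _ _ (H n)). exact Hy.
- intros y Hy. assert (T : forall n, Rabs (g n y) <= M n * exp (- a * y)) by (intros; apply (dom_bound _ _ _ (H n)); exact Hy).
  assert (E2 : ex_series (fun n => M n * exp (- a * y))) by (apply (ex_series_scal_r (exp (- a * y)) M); exact E).
  eapply Rle_trans. apply Series_Rabs. apply (ex_series_le (fun n => Rabs (g n y)) (fun n => M n * exp (- a * y))); [|exact E2].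
  intros n. change (Rabs (Rabs (g n y)) <= M n * exp (- a * y)). rewrite Rabs_Rabsolu. apply T.
  rewrite <- Series_scal_r. apply Series_le; [|exact E2]. intros n. split. apply Rabs_pos. apply T.
Qed.

Lemma dom_sum_n (g : nat -> R -> R) (M : nat -> R) a N : (forall k, dom (g k) (M k) a) ->
  dom (fun y => sum_n (fun k => g k y) N) (sum_n M N) a /\ Int (fun y => sum_n (fun k => g k y) N) = sum_n (fun k => Int (g k)) N.
Proof.
intros H. induction N.
- rewrite !sum_O. split. eapply dom_ext; [|apply (H 0%nat)]. intros; rewrite sum_O; reflexivity.
  apply Int_ext. intros; rewrite sum_O; reflexivity.
- destruct IHN as [D I]. assert (P := dom_plus _ _ _ _ _ D (H (S N))). rewrite !sum_Sn. split.
  eapply dom_ext; [|exact P]. intros; rewrite sum_Sn; reflexivity.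
  rewrite <- I. transitivity (Int (fun y => sum_n (fun k => g k y) N + g (S N) y)).
  apply Int_ext; intros; rewrite sum_Sn; reflexivity. apply (Int_plus _ _ _ _ _ _ D (H (S N))).
Qed.

(** All terms share the rate [a], so the remainder of the series is itself dominated, with the tail
    of [M] as its constant; [Int_bound] then makes its integral small. *)
Lemma Int_Series (g : nat -> R -> R) (M : nat -> R) a : (forall k, dom (g k) (M k) a) -> ex_series M ->
  is_series (fun k => Int (g k)) (Int (fun y => Series (fun k => g k y))).
Proof.
intros H E. assert (Ha := dom_rate _ _ _ (H 0%nat)). assert (DS := dom_Series g M a H E).
change (is_lim_seq (sum_n (fun k => Int (g k))) (Int (fun y => Series (fun k => g k y)))).
apply is_lim_seq_spec. intros eps.
destruct (series_tail_eps M (eps * a) E) as [N HN]. apply Rmult_lt_0_compat. apply cond_pos. exact Ha.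
exists N. intros n Hn. specialize (HN n Hn). destruct (dom_sum_n g M a n H) as [D I]. rewrite <- I.
rewrite Rabs_minus_sym.
replace (Int (fun y => Series (fun k => g k y)) - Int (fun y => sum_n (fun k => g k y) n)) with
  (Int (fun y => Series (fun k => g k y) + (-1) * sum_n (fun k => g k y) n)).
2:{ rewrite (Int_plus _ _ _ _ _ _ DS (dom_scal _ (-1) _ _ D)), (Int_scal _ _ _ _ D). ring. }
apply Rle_lt_trans with ((Series M - sum_n M n) / a).
- apply Int_bound. split. exact Ha. apply (dom_cont _ _ _ (dom_plus _ _ _ _ _ DS (dom_scal _ (-1) _ _ D))).
  intros y Hy.
  assert (T : forall k, Rabs (g k y) <= M k * exp (- a * y)) by (intros; apply (dom_bound _ _ _ (H k)); exact Hy).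
  assert (E2 : ex_series (fun k => M k * exp (- a * y))) by (apply (ex_series_scal_r (exp (- a * y)) M); exact E).
  replace (Series (fun k => g k y) + -1 * sum_n (fun k => g k y) n) with (Series (fun k => g k y) - sum_n (fun k => g k y) n) by ring.
  eapply Rle_trans. apply (series_tail _ _ n T E2). right. rewrite Series_scal_r.
  rewrite (sum_n_mult_r (exp (- a * y)) M n : sum_n (fun k => M k * exp (- a * y)) n = sum_n M n * exp (- a * y)). ring.
- apply Rmult_lt_reg_r with a. exact Ha. unfold Rdiv. rewrite Rmult_assoc, Rinv_l, Rmult_1_r by lra. apply Rabs_def2 in HN. lra.
Qed.

(** The substitution multiplies both cut-offs by [lam]; [Int_err] shows that the limit does not
    depend on this choice of cut-offs. *)
Lemma Int_scale g K a lam : dom g K a -> 0 < lam -> Int (fun y => g (lam * y)) = Int g / lam.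
Proof.
intros H Hl. assert (Ha := dom_rate _ _ _ H). apply Int_unique.
assert (E : forall n, Int_upto (fun y => g (lam * y)) n = RInt g (lam * / (INR n + 1)) (lam * (INR n + 1)) / lam).
{ intros n. unfold Int_upto. assert (T := upto_interval n).
  assert (RL := RInt_comp_lin g lam 0 (/ (INR n + 1)) (INR n + 1)). rewrite !Rplus_0_r in RL. rewrite <- RL.
  2:{ eapply dom_ex. exact H. split. apply Rmult_lt_0_compat; lra. apply Rmult_le_compat_l; lra. }
  rewrite (rint_ext (fun y => scal lam (g (lam * y + 0))) (fun y => lam * g (lam * y))).
  rewrite rint_scal. assert (Q : forall J, J = lam * J / lam) by (intros; field; lra). apply Q.
  { apply ex_RInt_cont. lra. intros x Hx. apply (continuous_comp (fun y => lam * y) g). apply (continuous_mult (fun _ => lam) (fun y => y)). apply continuous_const. apply continuous_id. apply (dom_cont _ _ _ H). nra. }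
  lra. intros x _. rewrite Rplus_0_r. reflexivity. }
apply (is_lim_seq_ext (fun n => RInt g (lam * / (INR n + 1)) (lam * (INR n + 1)) / lam)). intros; symmetry; apply E.
apply is_lim_seq_mult'; [|apply is_lim_seq_const].
assert (L := dom_err_lim (K * (lam + / lam)) (a * lam) ltac:(apply Rmult_lt_0_compat; lra)).
apply is_lim_seq_spec. intros eps. apply is_lim_seq_spec in L.
assert (L1 : is_lim_seq (fun n => K * (lam * / (INR n + 1)) + K * (exp (- a * (lam * (INR n + 1))) / a)) 0).
{ replace (Finite 0) with (Finite (lam * 0)) by (f_equal; ring).
  apply (is_lim_seq_ext (fun n => lam * (K * (/ (INR n + 1) + exp (- (a * lam) * (INR n + 1)) / (a * lam))))).
  intros n. replace (- a * (lam * (INR n + 1))) with (- (a * lam) * (INR n + 1)) by ring. assert (T := INR1_pos n). field. lra.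
  apply is_lim_seq_mult'. apply is_lim_seq_const. apply dom_err_lim. apply Rmult_lt_0_compat; lra. }
apply is_lim_seq_spec in L1. destruct (L1 eps) as [N HN]. exists N. intros n Hn. specialize (HN n Hn). rewrite Rminus_0_r in HN. apply Rabs_def2 in HN.
rewrite Rabs_minus_sym. assert (T := upto_interval n).
eapply Rle_lt_trans. apply (Int_err g K a _ _ H). split. apply Rmult_lt_0_compat; lra. apply Rmult_le_compat_l; lra. lra.
Qed.

Lemma continuous_derivable (f : R -> R) x : ex_derive f x -> continuous f x.
Proof. apply @ex_derive_continuous. Qed.

Lemma gauss_exp_bound s x : 0 < s -> - s * x ^ 2 <= / (4 * s) - x.
Proof.
intros Hs. apply Rmult_le_reg_l with (4 * s). lra.
replace (4 * s * (/ (4 * s) - x)) with (1 - 4 * s * x) by (field; lra). assert (0 <= (2 * s * x - 1) ^ 2) by apply pow2_ge_0. nra.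
Qed.

Lemma dom_gauss s : 0 < s -> dom (fun x => exp (- s * x ^ 2)) (exp (/ (4 * s))) 1.
Proof.
intros Hs. split. lra. intros y _. apply continuous_derivable. auto_derive. exact I.
intros y _. rewrite Rabs_pos_eq by (left; apply exp_pos). rewrite <- exp_plus. apply exp_le.
assert (T := gauss_exp_bound s y Hs). lra.
Qed.

(** * Fourier transforms of the Gaussian, 1/cosh and 1/sinh *)

Lemma Int_err0 g K a Y : dom g K a -> (forall y, 0 <= y -> continuous g y) -> 0 < Y ->
  Rabs (Int g - RInt g 0 Y) <= K * exp (- a * Y) / a.
Proof.
intros H Hc HY. assert (K0 := dom_nonneg _ _ _ H). assert (Ha := dom_rate _ _ _ H).
destruct (continuous_bounded g 0 Y ltac:(lra) ltac:(intros; apply Hc; lra)) as [B [B0 HB]].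
apply le_epsilon. intros eps He.
set (e := Rmin Y (eps / (K + B + 1))). assert (Pe : 0 < e). { apply Rmin_pos. exact HY. apply Rdiv_lt_0_compat; lra. }
assert (L1 := Rmin_l Y (eps / (K + B + 1))). assert (L2 := Rmin_r Y (eps / (K + B + 1))). fold e in L1, L2.
assert (E1 := Int_err g K a e Y H ltac:(lra)).
rewrite <- (rint_Chasles g 0 e Y) by (apply ex_RInt_cont; [lra|intros; apply Hc; lra]).
assert (E2 : Rabs (RInt g 0 e) <= (e - 0) * B) by (apply abs_RInt_bound; [lra|apply ex_RInt_cont; [lra|intros; apply Hc; lra]|intros; apply HB; lra]).
assert (E3 : e * (K + B + 1) <= eps). { apply Rle_trans with (eps / (K + B + 1) * (K + B + 1)). apply Rmult_le_compat_r; lra. right; field; lra. }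
apply Rabs_le_between in E1, E2.
replace (K * exp (- a * Y) / a) with (K * (exp (- a * Y) / a)) by (field; lra).
apply Rabs_le. assert (0 <= e * K) by (apply Rmult_le_pos; lra). split; lra.
Qed.

Lemma Int_le f g K a K' a' : dom f K a -> dom g K' a' -> (forall y, 0 < y -> Rabs (f y) <= g y) -> Rabs (Int f) <= Int g.
Proof.
intros Hf Hg H. rewrite <- (Rminus_0_r (Int f)). apply le_epsilon. intros eps He.
assert (L := Int_lim _ _ _ Hg). apply is_lim_seq_spec in L. destruct (L (mkposreal eps He)) as [N HN].
apply (is_lim_seq_abs_le (Int_upto f)). eapply Int_lim; exact Hf.
exists N. intros n Hn. rewrite Rminus_0_r. specialize (HN n Hn). simpl in HN. apply Rabs_def2 in HN.
assert (T := upto_interval n).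
apply Rle_trans with (Int_upto g n); [|lra]. unfold Int_upto.
eapply Rle_trans. apply abs_RInt_le. lra. eapply dom_ex; eassumption.
apply RInt_le. lra. apply (ex_RInt_norm f). eapply dom_ex; eassumption. eapply dom_ex; eassumption. intros x Hx. apply H. lra.
Qed.

Lemma exp_decay_zero x C a : 0 < a -> (forall X, 0 < X -> Rabs x <= C * exp (- a * X)) -> x = 0.
Proof.
intros Ha H. destruct (Req_dec x 0) as [E|N]; [exact E|]. exfalso.
assert (P := Rabs_pos_lt x N).
destruct (exp_small (Rabs x / (Rabs C + 1))) as [u [Hu Hu2]]. apply Rdiv_lt_0_compat. exact P. assert (T := Rabs_pos C). lra.
specialize (H (- u / a) ltac:(apply Rdiv_lt_0_compat; lra)). replace (- a * (- u / a)) with u in H by (field; lra).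
assert (T := Rabs_pos C). assert (T2 := Rle_abs C). assert (Q := exp_pos u).
assert (Rabs C * exp u < Rabs x).
{ apply Rle_lt_trans with ((Rabs C + 1) * exp u). nra. apply Rlt_le_trans with ((Rabs C + 1) * (Rabs x / (Rabs C + 1))). apply Rmult_lt_compat_l; lra. right; field; lra. }
nra.
Qed.

(** Goursat on the rectangle [[0, X] x [0, b]]. The right side decays with [X]; the left side
    contributes only the imaginary part of [f] to the real part of the contour integral, because dz
    = i dy there. Hence contours can be moved on a half-line. *)
Lemma line_shift f b K a : 0 <= b -> 0 < a -> (forall x y, 0 <= x -> 0 <= y <= b -> cdiff f (x, y)) ->
  (forall y, 0 <= y <= b -> Im (f (0, y)) = 0) ->
  (forall x y, 0 <= x -> 0 <= y <= b -> Cmod (f (x, y)) <= K * exp (- a * x)) ->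
  Int (fun x => Re (f (x, 0))) = Int (fun x => Re (f (x, b))).
Proof.
intros Hb Ha Hf Hi HB.
assert (Ch : forall y x, 0 <= y <= b -> 0 <= x -> pcont (fun x => f (x, y)) x).
{ intros y x Hy Hx. apply (pcont_comp f (fun x => (x, y))). apply cdiff_ccont, Hf; assumption. apply pcont_h. }
assert (D : forall y, 0 <= y <= b -> dom (fun x => Re (f (x, y))) K a).
{ intros y Hy. split. exact Ha. intros x Hx. apply Ch. exact Hy. lra. intros x Hx. eapply Rle_trans. apply re_le_Cmod. apply HB; lra. }
assert (D0 := D 0 ltac:(lra)). assert (Db := D b ltac:(lra)).
apply Rminus_diag_uniq. apply (exp_decay_zero _ (2 * K / a + b * K) a Ha). intros X HX.
assert (E0 := Int_err0 _ _ _ X D0 ltac:(intros; apply Ch; lra) HX).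
assert (Eb := Int_err0 _ _ _ X Db ltac:(intros; apply Ch; lra) HX).
assert (CR : cdiff_rect f 0 X 0 b) by (intros x y Hx Hy; apply Hf; lra).
assert (G : RInt (fun x => Re (f (x, 0))) 0 X - RInt (fun y => Im (f (X, y))) 0 b - RInt (fun x => Re (f (x, b))) 0 X
   + RInt (fun y => Im (f (0, y))) 0 b = 0).
{ transitivity (fst (rect_int f 0 X 0 b)). unfold rect_int, CInt; simpl; ring. rewrite (goursat f 0 X 0 b ltac:(lra) Hb CR). reflexivity. }
assert (Z : RInt (fun x => Im (f (0, x))) 0 b = 0 :> R).
{ rewrite (rint_ext _ (fun _ => 0)). rewrite rint_const. ring. exact Hb. intros y Hy. apply (Hi y Hy). }
assert (S : Rabs (RInt (fun x => Im (f (X, x))) 0 b) <= (b - 0) * (K * exp (- a * X))).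
{ apply abs_RInt_bound. exact Hb. apply (pcont_on_im (fun y => f (X, y)) 0 b Hb). apply (cdiff_rect_v _ _ _ _ _ X CR). lra.
  intros y Hy. eapply Rle_trans. apply im_le_Cmod. apply HB; lra. }
rewrite Z in G.
set (A := RInt (fun x => Re (f (x, 0))) 0 X) in *. set (B := RInt (fun x => Re (f (x, b))) 0 X) in *.
set (V := RInt (fun x => Im (f (X, x))) 0 b) in *.
assert (EV : A - B = V) by lra.
apply Rabs_le_between in E0, Eb, S. apply Rabs_le.
replace ((2 * K / a + b * K) * exp (- a * X)) with (K * exp (- a * X) / a + K * exp (- a * X) / a + (b - 0) * (K * exp (- a * X))) by (field; lra).
split; lra.
Qed.

(** The height [b = w / (2 * s)] completes the square: there the real part of e^(-s z^2) is
    [exp (s * b ^ 2)] times the left integrand. *)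
Lemma gauss_fourier s w : 0 < s -> 0 <= w ->
  Int (fun x => exp (- s * x ^ 2) * cos (w * x)) = exp (- (w ^ 2) / (4 * s)) * Int (fun x => exp (- s * x ^ 2)).
Proof.
intros Hs Hw. set (b := w / (2 * s)). assert (Hb : 0 <= b) by (apply Rdiv_le_0_compat; lra).
set (f := fun z => cexp (RtoC (- s) * (z * z))%C).
assert (Ef : forall x y, f (x, y) = (exp (- s * (x ^ 2 - y ^ 2)) * cos (2 * s * y * x), - (exp (- s * (x ^ 2 - y ^ 2)) * sin (2 * s * y * x)))).
{ intros x y. unfold f, cexp; simpl.
  replace (- s * (x * x - y * y) - 0 * (x * y + y * x)) with (- s * (x * (x * 1) - y * (y * 1))) by ring.
  replace (- s * (x * y + y * x) + 0 * (x * x - y * y)) with (- (2 * s * y * x)) by ring. rewrite cos_neg, sin_neg. f_equal. ring. }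
assert (L := line_shift f b (exp (s * b ^ 2) * exp (/ (4 * s))) 1 Hb Rlt_0_1).
assert (DG : dom (fun x => exp (- s * x ^ 2) * cos (w * x)) (exp (/ (4 * s))) 1).
{ eapply dom_ext; [|eapply dom_weaken; [apply (dom_mult_bounded _ (fun x => cos (w * x)) _ _ 1 (dom_gauss s Hs))|lra|rewrite Rmult_1_l; lra]].
  intros; simpl; ring. intros y _. apply continuous_derivable. auto_derive. exact I. intros y _. apply Rabs_le, COS_bound. }
transitivity (exp (- (w ^ 2) / (4 * s)) * Int (fun x => Re (f (x, b)))).
- rewrite (Int_ext (fun x => Re (f (x, b))) (fun x => exp (s * b ^ 2) * (exp (- s * x ^ 2) * cos (w * x)))).
  + rewrite (Int_scal _ _ _ _ DG), <- Rmult_assoc, <- exp_plus. replace (- (w ^ 2) / (4 * s) + s * b ^ 2) with 0 by (unfold b; field; lra). rewrite exp_0. ring.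
  + intros x _. rewrite Ef. cbn [Re fst]. replace (- s * (x ^ 2 - b ^ 2)) with (s * b ^ 2 + - s * x ^ 2) by ring. rewrite exp_plus.
    replace (2 * s * b * x) with (w * x) by (unfold b; field; lra). cbn [Re fst]. ring.
- f_equal. rewrite <- L.
  + apply Int_ext. intros x _. rewrite Ef. cbn [Re fst]. rewrite Rmult_0_r, Rmult_0_l, cos_0, Rmult_1_r. f_equal. ring.
  + intros x y _ _. apply (cdiff_comp cexp (fun z => RtoC (- s) * (z * z))%C). apply cdiff_cexp. apply cdiff_mult. apply cdiff_const. apply cdiff_mult; apply cdiff_id.
  + intros y _. rewrite Ef. cbn [Im snd]. rewrite Rmult_0_r, sin_0. ring.
  + intros x y Hx Hy. unfold f. rewrite Cmod_cexp, <- !exp_plus. apply exp_le. simpl. assert (T := gauss_exp_bound s x Hs). simpl in T.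
    assert (y * y <= b * b) by nra. nra.
Qed.

Definition ccosh (z : C) : C := (cosh (Re z) * cos (Im z), sinh (Re z) * sin (Im z)).

Lemma cdiff_ccosh z : cdiff ccosh z.
Proof.
apply cdiff_ext with (fun w => RtoC (1/2) * (cexp w + cexp (- w)))%C.
- intros [x y]. unfold ccosh, cexp, cosh, sinh; simpl. rewrite cos_neg, sin_neg. apply injective_projections; simpl; field.
- apply cdiff_mult. apply cdiff_const. apply cdiff_plus. apply cdiff_cexp. apply (cdiff_comp cexp (fun w => - w)%C). apply cdiff_cexp. apply cdiff_opp, cdiff_id.
Qed.

Lemma cosh_pos x : 0 < cosh x.
Proof. unfold cosh. assert (A := exp_pos x). assert (B := exp_pos (- x)). lra. Qed.
Lemma cosh_ge_1 x : 1 <= cosh x.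
Proof. unfold cosh. assert (A := exp_ineq1_le x). assert (B := exp_ineq1_le (- x)). lra. Qed.
Lemma cosh_sqr x : cosh x ^ 2 = 1 + sinh x ^ 2.
Proof. unfold cosh, sinh. assert (A := exp_pos x). rewrite exp_Ropp. field. lra. Qed.
Lemma cosh_inv_bound x : / cosh x <= 2 * exp (- x).
Proof. unfold cosh. assert (A := exp_pos x). rewrite exp_Ropp. replace (2 * / exp x) with (/ (exp x / 2)) by (field; lra). apply Rinv_le_contravar. lra. assert (0 < / exp x) by (apply Rinv_0_lt_compat; lra). lra. Qed.
Lemma sinh_pos x : 0 < x -> 0 < sinh x.
Proof. intros H. unfold sinh. assert (exp (- x) < exp x) by (apply exp_increasing; lra). lra. Qed.
Lemma sinh_ge x : 0 <= x -> x <= sinh x.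
Proof.
intros Hx. destruct Hx as [Hx| <-]; [|rewrite sinh_0; lra].
destruct (MVT_cor2 (fun x => sinh x - x) (fun x => cosh x - 1) 0 x Hx) as [c [E _]].
{ intros c _. apply is_derive_Reals. unfold sinh, cosh. auto_derive. exact I. field. }
rewrite sinh_0 in E. assert (T := cosh_ge_1 c). nra.
Qed.

(** A quarter of the full decay rate 1 pays for the linear factor, through
    [1 + 2 * x <= 8 * exp (x / 4)]. The rate 3/4 is still enough for the square of the ratio to beat
    [cosh x]. *)
Lemma ratio_sinh_bound x : 0 < x -> x / sinh x <= 8 * exp (- (3/4) * x).
Proof.
intros Hx. assert (S := sinh_pos x Hx). apply Rmult_le_reg_r with (sinh x). exact S. replace (x / sinh x * sinh x) with x by (field; lra).
assert (E : sinh x = exp x * (1 - exp (-2 * x)) / 2). { unfold sinh. replace (exp (- x)) with (exp x * exp (-2 * x)) by (rewrite <- exp_plus; f_equal; ring). field. }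
assert (P2 : 0 < exp (2 * x)) by apply exp_pos. assert (A := exp_ineq1_le (2 * x)).
assert (B : 2 * x <= (1 + 2 * x) * (1 - exp (-2 * x))).
{ replace (-2 * x) with (- (2 * x)) by ring. rewrite exp_Ropp. assert (/ exp (2 * x) <= / (1 + 2 * x)) by (apply Rinv_le_contravar; lra).
  assert ((1 + 2 * x) * / (1 + 2 * x) = 1) by (field; lra). nra. }
assert (C4 : 1 + 2 * x <= 8 * exp (1/4 * x)). { assert (T := exp_ineq1_le (1/4 * x)). lra. }
rewrite E. replace (8 * exp (- (3 / 4) * x) * (exp x * (1 - exp (-2 * x)) / 2)) with ((8 * exp (1/4 * x)) * (1 - exp (-2 * x)) / 2).
2:{ replace (exp (1/4 * x)) with (exp (- (3/4) * x) * exp x) by (rewrite <- exp_plus; f_equal; field). field. }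
assert (Q := exp_increasing (-2 * x) 0 ltac:(lra)). rewrite exp_0 in Q. assert ((1 + 2 * x) * (1 - exp (-2 * x)) <= 8 * exp (1/4 * x) * (1 - exp (-2 * x))) by (apply Rmult_le_compat_r; lra). lra.
Qed.

Section SechTransform.
Variables (xi a : R).
Hypothesis Ha : 0 < a < PI / 2.
Let den x := sinh x ^ 2 + cos a ^ 2.
Let kc x := cos (xi * x) * cosh x * cos a / den x.
Let ks x := sin (xi * x) * sinh x * sin a / den x.

Lemma cosa_pos : 0 < cos a.
Proof. apply cos_gt_0; lra. Qed.
Lemma den_ge x y : 0 <= y <= a -> cosh x ^ 2 * cos a ^ 2 <= sinh x ^ 2 + cos y ^ 2.
Proof.
intros Hy. assert (C := cosa_pos). assert (T := cosh_sqr x).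
assert (cos a <= cos y) by (apply cos_decr_1; lra).
assert (cos a ^ 2 <= cos y ^ 2) by (apply pow_incr; lra). assert (0 <= sinh x ^ 2) by apply pow2_ge_0.
assert (cos a ^ 2 <= 1). { assert (Q := COS_bound a). nra. }
rewrite T. nra.
Qed.
Lemma den_pos x y : 0 <= y <= a -> 0 < sinh x ^ 2 + cos y ^ 2.
Proof. intros Hy. eapply Rlt_le_trans; [|apply den_ge; exact Hy]. apply Rmult_lt_0_compat; apply pow_lt; [apply cosh_pos|apply cosa_pos]. Qed.

Lemma ccosh_mod x y : Cmod (ccosh (x, y)) ^ 2 = sinh x ^ 2 + cos y ^ 2.
Proof.
rewrite Cmod2_alt. unfold ccosh; cbn [Re Im fst snd]. rewrite !Rpow_mult_distr, cosh_sqr.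
assert (T := sin2_cos2 y). rewrite !Rsqr_pow2 in T. replace (sin y ^ 2) with (1 - cos y ^ 2) by lra. ring.
Qed.

Lemma dom_kernel (h : R -> R) : (forall y, 0 < y -> continuous h y) -> (forall y, 0 < y -> Rabs (h y) <= cosh y) ->
  dom (fun x => h x / den x) (2 / cos a ^ 2) 1.
Proof.
intros Hc Hb. assert (C := cosa_pos). assert (C2 : 0 < cos a ^ 2) by (apply pow_lt; exact C). split. lra.
- intros y Hy. apply (continuous_mult h (fun x => / den x)). apply Hc; exact Hy.
  apply continuous_derivable. unfold den, sinh. auto_derive. assert (T := den_pos y a ltac:(lra)). unfold sinh in T. intros E. lra.
- intros y Hy. assert (D := den_ge y a ltac:(lra)). assert (Dp := den_pos y a ltac:(lra)). fold (den y) in D, Dp.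
  unfold Rdiv. rewrite Rabs_mult, (Rabs_pos_eq (/ den y)) by (left; apply Rinv_0_lt_compat; exact Dp).
  assert (Pc := cosh_pos y).
  apply Rle_trans with (cosh y * / (cosh y ^ 2 * cos a ^ 2)).
  apply Rmult_le_compat. apply Rabs_pos. left; apply Rinv_0_lt_compat; exact Dp. apply Hb; exact Hy. apply Rinv_le_contravar. apply Rmult_lt_0_compat; [apply pow_lt|]; assumption. exact D.
  replace (cosh y * / (cosh y ^ 2 * cos a ^ 2)) with (/ cosh y * / cos a ^ 2) by (field; lra).
  replace (2 * / cos a ^ 2 * exp (- (1) * y)) with ((2 * exp (- y)) * / cos a ^ 2) by (replace (- (1) * y) with (- y) by ring; ring).
  apply Rmult_le_compat_r. left; apply Rinv_0_lt_compat; exact C2. apply cosh_inv_bound.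
Qed.

Lemma sinh_le_cosh x : Rabs (sinh x) <= cosh x.
Proof. unfold sinh, cosh. assert (A := exp_pos x). assert (B := exp_pos (- x)). apply Rabs_le. lra. Qed.

Lemma Rabs_prod3 x y z X : Rabs x <= 1 -> Rabs y <= X -> Rabs z <= 1 -> Rabs (x * y * z) <= X.
Proof.
intros H1 H2 H3. rewrite !Rabs_mult. assert (A := Rabs_pos x). assert (B := Rabs_pos y). assert (C := Rabs_pos z).
apply Rle_trans with (1 * Rabs y * 1); [|lra]. apply Rmult_le_compat; try lra. apply Rmult_le_pos; lra. apply Rmult_le_compat_r; lra.
Qed.

Lemma dom_kc : dom kc (2 / cos a ^ 2) 1.
Proof.
apply (dom_kernel (fun x => cos (xi * x) * cosh x * cos a)).
intros y _. apply continuous_derivable. unfold cosh. auto_derive. exact I.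
intros y _. apply Rabs_prod3; try (apply Rabs_le; apply COS_bound). rewrite Rabs_pos_eq. lra. left; apply cosh_pos.
Qed.
Lemma dom_ks : dom ks (2 / cos a ^ 2) 1.
Proof.
apply (dom_kernel (fun x => sin (xi * x) * sinh x * sin a)).
intros y _. apply continuous_derivable. unfold sinh. auto_derive. exact I.
intros y _. apply Rabs_prod3; try (apply Rabs_le; apply SIN_bound). apply sinh_le_cosh.
Qed.

(** The function e^(i xi z) / cosh z is moved from height 0 to height [a], which stays below its
    pole at i pi / 2. Since |cosh (x + i a)|^2 is [den x], its real part on the upper line is
    [exp (- xi * a) * (kc x + ks x)]; on the imaginary axis it is real. *)
Lemma sech_shift : Int (fun x => cos (xi * x) / cosh x) = exp (- xi * a) * (Int kc + Int ks).
Proof.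
assert (C := cosa_pos).
set (f := fun z => (cexp ((0, xi)%R * z) / ccosh z)%C).
assert (N : forall x y, 0 <= y <= a -> ccosh (x, y) <> 0).
{ intros x y Hy E. assert (T := ccosh_mod x y). rewrite E, Cmod_0 in T. assert (T2 := den_pos x y Hy). replace (0 ^ 2) with 0 in T by ring. lra. }
assert (Ef : forall x y, 0 <= y <= a -> f (x, y) = (exp (- xi * y) * (cos (xi * x) * cosh x * cos y + sin (xi * x) * sinh x * sin y) / (sinh x ^ 2 + cos y ^ 2),
   exp (- xi * y) * (sin (xi * x) * cosh x * cos y - cos (xi * x) * sinh x * sin y) / (sinh x ^ 2 + cos y ^ 2))).
{ intros x y Hy. assert (T := ccosh_mod x y). rewrite Cmod2_alt in T. assert (T2 := den_pos x y Hy). rewrite <- T in T2. rewrite <- T.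
  unfold f, cexp, ccosh, Cdiv, Cinv. unfold ccosh in T2. cbn [Re Im fst snd Cmult] in *.
  replace (0 * x - xi * y) with (- xi * y) by ring. replace (0 * y + xi * x) with (xi * x) by ring.
  unfold Cmult; cbn [fst snd]. f_equal; field; lra. }
assert (L := line_shift f a (exp (Rabs xi * a) * (2 / cos a)) 1 ltac:(lra) Rlt_0_1).
rewrite <- (Int_plus _ _ _ _ _ _ dom_kc dom_ks).
rewrite <- (Int_scal _ _ _ _ (dom_plus _ _ _ _ _ dom_kc dom_ks)).
transitivity (Int (fun x => Re (f (x, 0)))).
{ apply Int_ext. intros x Hx. rewrite Ef by lra. cbn [Re fst]. rewrite Rmult_0_r, exp_0, cos_0, sin_0.
  assert (T := cosh_sqr x). assert (Pc := cosh_pos x). replace (sinh x ^ 2 + 1 ^ 2) with (cosh x ^ 2) by lra. field. lra. }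
rewrite L.
- apply Int_ext. intros x Hx. rewrite Ef by lra. cbn [Re fst]. unfold kc, ks, den. field. assert (T := den_pos x a ltac:(lra)). simpl in T. lra.
- intros x y _ Hy. apply cdiff_div. apply (cdiff_comp cexp (fun z => (0, xi)%R * z)%C). apply cdiff_cexp. apply cdiff_mult. apply cdiff_const. apply cdiff_id.
  apply cdiff_ccosh. apply N, Hy.
- intros y Hy. rewrite Ef by exact Hy. cbn [Im snd]. rewrite Rmult_0_r, sin_0, sinh_0. unfold Rdiv. ring.
- intros x y Hx Hy. unfold f. rewrite Cmod_div by (apply N, Hy). rewrite Cmod_cexp. simpl Re.
  assert (D := den_ge x y Hy). assert (Pc := cosh_pos x).
  assert (M : cosh x * cos a <= Cmod (ccosh (x, y))).
  { apply Rsqr_incr_0_var; [|apply Cmod_ge_0]. rewrite !Rsqr_pow2, ccosh_mod, Rpow_mult_distr. exact D. }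
  assert (P0 : 0 < cosh x * cos a) by (apply Rmult_lt_0_compat; assumption).
  apply Rle_trans with (exp (Rabs xi * a) * / (cosh x * cos a)).
  + apply Rmult_le_compat. left; apply exp_pos. left; apply Rinv_0_lt_compat; lra.
    apply exp_le. assert (T := Rle_abs (- xi)). rewrite Rabs_Ropp in T. assert (T2 := Rabs_pos xi). nra.
    apply Rinv_le_contravar; assumption.
  + rewrite Rmult_assoc. apply Rmult_le_compat_l. left; apply exp_pos. rewrite Rinv_mult.
    replace (2 / cos a * exp (- (1) * x)) with (2 * exp (- x) * / cos a) by (replace (- (1) * x) with (- x) by ring; field; lra).
    apply Rmult_le_compat_r. left; apply Rinv_0_lt_compat; exact C. apply cosh_inv_bound.
Qed.
End SechTransform.

(** The kernel [kc] at [xi = 0]. As [a] approaches [PI / 2] it concentrates at 0, its mass on the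
    half-line remaining [PI / 2]. *)
Definition peak (a x : R) : R := cosh x * cos a / (sinh x ^ 2 + cos a ^ 2).

Lemma dom_peak a : 0 < a < PI / 2 -> dom (peak a) (2 / cos a ^ 2) 1.
Proof.
intros Ha. eapply dom_ext; [|apply (dom_kc 0 a Ha)]. intros y _. unfold peak. rewrite Rmult_0_l, cos_0, Rmult_1_l. reflexivity.
Qed.

Lemma atan_large y : 0 < y -> PI / 2 - / y <= atan y <= PI / 2.
Proof.
intros Hy. assert (B := atan_bound y). split; [|lra].
assert (I := atan_inv y Hy).
assert (P := Rinv_0_lt_compat y Hy).
assert (atan (/ y) <= / y); [|lra].
destruct (MVT_cor2 atan (fun x => / (1 + x ^ 2)) 0 (/ y) P) as [c [E _]].
{ intros c _. apply derivable_pt_lim_atan. }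
rewrite atan_0, !Rminus_0_r in E. rewrite E.
rewrite <- (Rmult_1_l (/ y)) at 2. apply Rmult_le_compat_r. lra. rewrite <- Rinv_1. apply Rinv_le_contravar. lra. assert (0 <= c ^ 2) by apply pow2_ge_0. lra.
Qed.

(** An antiderivative is [atan (sinh x / cos a)]. *)
Lemma Int_peak a : 0 < a < PI / 2 -> Int (peak a) = PI / 2.
Proof.
intros Ha. assert (C := cosa_pos a Ha). assert (D := dom_peak a Ha).
assert (Dn : forall x, 0 < sinh x ^ 2 + cos a ^ 2) by (intros; apply (den_pos a Ha); lra).
assert (Cp : forall y, continuous (peak a) y).
{ intros y. apply continuous_derivable. unfold peak. specialize (Dn y). unfold sinh, cosh in *. auto_derive. simpl in Dn. lra. }
assert (I : forall X, RInt (peak a) 0 X = atan (sinh X / cos a) :> R).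
{ intros X. apply is_RInt_unique.
  replace (atan (sinh X / cos a)) with (minus (atan (sinh X / cos a)) (atan (sinh 0 / cos a))).
  2:{ rewrite sinh_0. unfold minus, plus, opp, Rdiv; simpl. rewrite Rmult_0_l, atan_0. ring. }
  apply (is_RInt_derive (fun x => atan (sinh x / cos a))); [|intros; apply Cp].
  intros x _. specialize (Dn x). unfold peak, sinh, cosh in *.
  auto_derive. exact I. simpl in Dn. field. split; [intro E; nra|lra]. }
apply cond_eq. intros eps He.
set (k := 2 / cos a ^ 2 + cos a). assert (k0 : 0 < k). { unfold k. assert (0 < 2 / cos a ^ 2) by (apply Rdiv_lt_0_compat; [lra|apply pow_lt; exact C]). lra. }
set (X := k / eps + 1). assert (HX : 0 < X). { unfold X. assert (0 < k / eps) by (apply Rdiv_lt_0_compat; lra). lra. }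
assert (E := Int_err0 _ _ _ X D ltac:(intros; apply Cp) HX). rewrite I in E.
assert (S := sinh_ge X ltac:(lra)).
assert (A := atan_large (sinh X / cos a) ltac:(apply Rdiv_lt_0_compat; lra)).
assert (S2 : / (sinh X / cos a) <= cos a / X). { replace (/ (sinh X / cos a)) with (cos a * / sinh X) by (field; lra). apply Rmult_le_compat_l. lra. apply Rinv_le_contravar; lra. }
assert (Ex : exp (- (1) * X) <= / X). { replace (- (1) * X) with (- X) by ring. rewrite exp_Ropp. apply Rinv_le_contravar. exact HX. assert (T := exp_ineq1_le X). lra. }
assert (B : 2 / cos a ^ 2 * exp (- (1) * X) / 1 <= 2 / cos a ^ 2 / X).
{ unfold Rdiv at 1 3. rewrite Rinv_1, Rmult_1_r. apply Rmult_le_compat_l. left; apply Rdiv_lt_0_compat; [lra|apply pow_lt; exact C]. exact Ex. }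
assert (F : 2 / cos a ^ 2 / X + cos a / X = k / X). { unfold k. field. split; lra. }
assert (G : k / X < eps). { apply Rmult_lt_reg_r with X. exact HX. replace (k / X * X) with k by (field; lra). unfold X. replace (eps * (k / eps + 1)) with (k + eps) by (field; lra). lra. }
apply Rabs_le_between in E. apply Rabs_def1; lra.
Qed.

Lemma continuous_le_end (phi : R -> R) x0 : 0 < x0 -> continuous phi x0 -> (forall a, 0 < a < x0 -> phi a <= 0) -> phi x0 <= 0.
Proof.
intros Hx Hc H. apply Rnot_lt_le. intros L. rewrite <- continuous_eps in Hc. destruct (Hc (phi x0) L) as [d [Hd Q]].
set (e := Rmin (d/2) (x0/2)). assert (L1 := Rmin_l (d/2) (x0/2)). assert (L2 := Rmin_r (d/2) (x0/2)).
assert (Pe : 0 < e) by (apply Rmin_pos; lra). fold e in L1, L2.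
specialize (Q (x0 - e)). specialize (H (x0 - e) ltac:(lra)).
replace (x0 - e - x0) with (- e) in Q by ring. rewrite Rabs_Ropp, Rabs_pos_eq in Q by lra. specialize (Q ltac:(lra)). apply Rabs_def2 in Q. lra.
Qed.

(** Replacing [xi] by [- xi] in [sech_shift] keeps the transform and the cosine part and reverses
    the sine part. Sum and difference of the two identities separate them. *)
Lemma shift_pair xi a : 0 < a < PI / 2 ->
  Int (fun x => cos (xi * x) * cosh x * cos a / (sinh x ^ 2 + cos a ^ 2)) = cosh (xi * a) * Int (fun x => cos (xi * x) / cosh x) /\
  Int (fun x => sin (xi * x) * sinh x * sin a / (sinh x ^ 2 + cos a ^ 2)) = sinh (xi * a) * Int (fun x => cos (xi * x) / cosh x).
Proof.
intros Ha. assert (A := sech_shift xi a Ha). assert (B := sech_shift (- xi) a Ha).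
rewrite (Int_ext (fun x => cos (- xi * x) / cosh x) (fun x => cos (xi * x) / cosh x)) in B.
2:{ intros x _. replace (- xi * x) with (- (xi * x)) by ring. rewrite cos_neg. reflexivity. }
rewrite (Int_ext (fun x => cos (- xi * x) * cosh x * cos a / (sinh x ^ 2 + cos a ^ 2)) (fun x => cos (xi * x) * cosh x * cos a / (sinh x ^ 2 + cos a ^ 2))) in B.
2:{ intros x _. replace (- xi * x) with (- (xi * x)) by ring. rewrite cos_neg. reflexivity. }
rewrite (Int_ext (fun x => sin (- xi * x) * sinh x * sin a / (sinh x ^ 2 + cos a ^ 2)) (fun x => (-1) * (sin (xi * x) * sinh x * sin a / (sinh x ^ 2 + cos a ^ 2)))) in B.
2:{ intros x _. replace (- xi * x) with (- (xi * x)) by ring. rewrite sin_neg. unfold Rdiv. ring. }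
rewrite (Int_scal _ _ _ _ (dom_ks xi a Ha)) in B.
set (J := Int (fun x => cos (xi * x) / cosh x)) in *.
set (Kc := Int (fun x => cos (xi * x) * cosh x * cos a / (sinh x ^ 2 + cos a ^ 2))) in *.
set (Ks := Int (fun x => sin (xi * x) * sinh x * sin a / (sinh x ^ 2 + cos a ^ 2))) in *.
replace (- - xi * a) with (xi * a) in B by ring. replace (- xi * a) with (- (xi * a)) in A by ring.
assert (P := exp_pos (xi * a)).
rewrite exp_Ropp in A.
assert (A1 : Kc + Ks = exp (xi * a) * J) by (rewrite A; field; lra).
assert (B1 : Kc - Ks = / exp (xi * a) * J) by (rewrite B; field; lra).
unfold cosh, sinh. rewrite exp_Ropp. split; lra.
Qed.

(** Let [a] tend to [PI / 2] in the cosine half of [shift_pair]: its left side is [cos (xi * x)]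
    integrated against [peak a] and tends to [PI / 2]. No residue is computed. *)
Theorem sech_transform xi : Int (fun x => cos (xi * x) / cosh x) = PI / (2 * cosh (PI * xi / 2)).
Proof.
assert (PP := PI_RGT_0).
set (J := Int (fun x => cos (xi * x) / cosh x)).
(* The constant arises from [(xi * x) ^ 2 / 2], from twice [ratio_sinh_bound] and from
   [cosh x <= exp x]: an integrand at most [32 * xi ^ 2 * cos a * exp (- x / 2)]. *)
assert (K : forall a, 0 < a < PI / 2 -> Rabs (cosh (xi * a) * J - PI / 2) <= 64 * xi ^ 2 * cos a).
{ intros a Ha. assert (C := cosa_pos a Ha). destruct (shift_pair xi a Ha) as [S _]. fold J in S. rewrite <- S, <- (Int_peak a Ha).
  replace (Int (fun x => cos (xi * x) * cosh x * cos a / (sinh x ^ 2 + cos a ^ 2)) - Int (peak a)) with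
    (Int (fun x => cos (xi * x) * cosh x * cos a / (sinh x ^ 2 + cos a ^ 2) + (-1) * peak a x)).
  2:{ rewrite (Int_plus _ _ _ _ _ _ (dom_kc xi a Ha) (dom_scal _ (-1) _ _ (dom_peak a Ha))), (Int_scal _ _ _ _ (dom_peak a Ha)). ring. }
  replace (64 * xi ^ 2 * cos a) with (32 * xi ^ 2 * cos a / (1/2)) by field.
  apply Int_bound. split. lra.
  apply (dom_cont _ _ _ (dom_plus _ _ _ _ _ (dom_kc xi a Ha) (dom_scal _ (-1) _ _ (dom_peak a Ha)))).
  intros x Hx. unfold peak. assert (Dp := den_pos a Ha x a ltac:(lra)).
  assert (Sp := sinh_pos x Hx). assert (Pc := cosh_pos x).
  replace (cos (xi * x) * cosh x * cos a / (sinh x ^ 2 + cos a ^ 2) + -1 * (cosh x * cos a / (sinh x ^ 2 + cos a ^ 2))) with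
    ((cos (xi * x) - 1) * (cosh x * cos a / (sinh x ^ 2 + cos a ^ 2))) by (field; lra).
  rewrite Rabs_mult. assert (P0 : 0 < cosh x * cos a / (sinh x ^ 2 + cos a ^ 2)) by (apply Rdiv_lt_0_compat; [apply Rmult_lt_0_compat; assumption|exact Dp]).
  rewrite (Rabs_pos_eq (cosh x * cos a / _)) by lra.
  assert (P1 : cosh x * cos a / (sinh x ^ 2 + cos a ^ 2) <= cosh x * cos a / sinh x ^ 2).
  { apply Rmult_le_compat_l. apply Rmult_le_pos; lra. apply Rinv_le_contravar. apply pow_lt; exact Sp. assert (0 <= cos a ^ 2) by apply pow2_ge_0. lra. }
  apply Rle_trans with ((xi * x) ^ 2 / 2 * (cosh x * cos a / sinh x ^ 2)).
  { apply Rmult_le_compat. apply Rabs_pos. lra. apply cos_minus_1_bound. exact P1. }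
  replace ((xi * x) ^ 2 / 2 * (cosh x * cos a / sinh x ^ 2)) with (xi ^ 2 * cos a / 2 * ((x / sinh x) * (x / sinh x) * cosh x)) by (field; lra).
  replace (32 * xi ^ 2 * cos a * exp (- (1 / 2) * x)) with (xi ^ 2 * cos a / 2 * (64 * exp (- (1/2) * x))) by field.
  apply Rmult_le_compat_l. { assert (0 <= xi ^ 2) by apply pow2_ge_0. assert (0 <= xi ^ 2 * cos a) by (apply Rmult_le_pos; lra). lra. }
  assert (R := ratio_sinh_bound x Hx). assert (R0 : 0 < x / sinh x) by (apply Rdiv_lt_0_compat; lra).
  assert (Cx : cosh x <= exp x). { unfold cosh. assert (exp (- x) < exp x) by (apply exp_increasing; lra). lra. }
  apply Rle_trans with ((8 * exp (- (3 / 4) * x)) * (8 * exp (- (3 / 4) * x)) * exp x).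
  { apply Rmult_le_compat; try lra. apply Rmult_le_pos; lra. apply Rmult_le_compat; lra. }
  right. replace (- (1/2) * x) with ((- (3/4) * x + - (3/4) * x) + x) by field. rewrite !exp_plus. ring. }
assert (E : Rabs (cosh (xi * (PI / 2)) * J - PI / 2) <= 0).
{ replace 0 with (64 * xi ^ 2 * cos (PI / 2)) by (rewrite cos_PI2; ring). apply Rminus_le.
  apply (continuous_le_end (fun a => Rabs (cosh (xi * a) * J - PI / 2) - 64 * xi ^ 2 * cos a)). lra.
  - apply (continuous_minus (fun a => Rabs (cosh (xi * a) * J - PI / 2)) (fun a => 64 * xi ^ 2 * cos a)).
    apply (continuous_comp (fun a => cosh (xi * a) * J - PI / 2) Rabs). apply continuous_derivable. unfold cosh. auto_derive. exact I. apply continuous_Rabs.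
    apply continuous_derivable. auto_derive. exact I.
  - intros a Ha. specialize (K a Ha). lra. }
assert (Z := Rabs_pos (cosh (xi * (PI / 2)) * J - PI / 2)).
assert (Q : cosh (xi * (PI / 2)) * J - PI / 2 = 0). { apply Rabs_eq_0. lra. }
replace (PI * xi / 2) with (xi * (PI / 2)) by field. assert (Pc := cosh_pos (xi * (PI / 2))).
apply Rmult_eq_reg_l with (cosh (xi * (PI / 2))); [|lra]. replace (cosh (xi * (PI / 2)) * (PI / (2 * cosh (xi * (PI / 2))))) with (PI / 2) by (field; lra). lra.
Qed.

Lemma dom_csch xi : dom (fun x => sin (xi * x) / sinh x) (8 * Rabs xi) (3/4).
Proof.
split. lra.
- intros y Hy. apply continuous_derivable. assert (S := sinh_pos y Hy). unfold sinh in *. auto_derive. lra.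
- intros y Hy. assert (S := sinh_pos y Hy). unfold Rdiv. rewrite Rabs_mult, (Rabs_pos_eq (/ sinh y)) by (left; apply Rinv_0_lt_compat; exact S).
  apply Rle_trans with (Rabs (xi * y) * / sinh y). apply Rmult_le_compat_r. left; apply Rinv_0_lt_compat; exact S. apply Rabs_sin_le.
  rewrite Rabs_mult, (Rabs_pos_eq y) by lra. assert (R := ratio_sinh_bound y Hy). unfold Rdiv in R. assert (X := Rabs_pos xi).
  replace (Rabs xi * y * / sinh y) with (Rabs xi * (y * / sinh y)) by ring.
  apply Rle_trans with (Rabs xi * (8 * exp (- (3 * / 4) * y))). apply Rmult_le_compat_l; assumption. right; ring.
Qed.

(** The sine half of [shift_pair] has the integrand [sin (xi * x) / sinh x] as its limit for [a]
    tending to [PI / 2]; the deviation is at most [Rabs xi * cos a * peak a x]. So the transform is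
    [sinh (PI * xi / 2)] times that of 1/cosh. *)
Theorem csch_transform xi : Int (fun x => sin (xi * x) / sinh x) = PI / 2 * (sinh (PI * xi / 2) / cosh (PI * xi / 2)).
Proof.
assert (PP := PI_RGT_0).
assert (EJ := sech_transform xi). set (J := Int (fun x => cos (xi * x) / cosh x)) in *.
set (T := Int (fun x => sin (xi * x) / sinh x)).
assert (K : forall a, 0 < a < PI / 2 -> Rabs (sinh (xi * a) * J - sin a * T) <= Rabs xi * cos a * (PI / 2)).
{ intros a Ha. assert (C := cosa_pos a Ha). destruct (shift_pair xi a Ha) as [_ S]. fold J in S. rewrite <- S, <- (Int_peak a Ha).
  assert (D1 := dom_weaken _ _ _ _ (3/4) (dom_ks xi a Ha) ltac:(lra) (Rle_refl _)).
  assert (D2 := dom_scal _ (- sin a) _ _ (dom_csch xi)). assert (D3 := dom_plus _ _ _ _ _ D1 D2).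
  replace (Int (fun x => sin (xi * x) * sinh x * sin a / (sinh x ^ 2 + cos a ^ 2)) - sin a * T) with
    (Int (fun x => sin (xi * x) * sinh x * sin a / (sinh x ^ 2 + cos a ^ 2) + (- sin a) * (sin (xi * x) / sinh x))).
  2:{ rewrite (Int_plus _ _ _ _ _ _ D1 D2), (Int_scal _ _ _ _ (dom_csch xi)). unfold T. ring. }
  rewrite <- (Int_scal _ (Rabs xi * cos a) _ _ (dom_peak a Ha)).
  apply (Int_le _ _ _ _ _ _ D3 (dom_scal _ (Rabs xi * cos a) _ _ (dom_peak a Ha))).
  intros x Hx. unfold peak. assert (Dp := den_pos a Ha x a ltac:(lra)). assert (Sp := sinh_pos x Hx). assert (Pc := cosh_ge_1 x).
  replace (sin (xi * x) * sinh x * sin a / (sinh x ^ 2 + cos a ^ 2) + - sin a * (sin (xi * x) / sinh x)) with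
    (- (sin a * sin (xi * x) * (cos a * cos a / (sinh x ^ 2 + cos a ^ 2) / sinh x))) by (field; split; lra).
  rewrite Rabs_Ropp, !Rabs_mult.
  assert (P0 : 0 < cos a * cos a / (sinh x ^ 2 + cos a ^ 2) / sinh x) by (apply Rdiv_lt_0_compat; [apply Rdiv_lt_0_compat; [apply Rmult_lt_0_compat; assumption|exact Dp]|exact Sp]).
  rewrite (Rabs_pos_eq (cos a * cos a / _ / _)) by lra.
  apply Rle_trans with (1 * (Rabs xi * x) * (cos a * cos a / (sinh x ^ 2 + cos a ^ 2) / sinh x)).
  { apply Rmult_le_compat_r. lra. apply Rmult_le_compat; try apply Rabs_pos. apply Rabs_le, SIN_bound. eapply Rle_trans. apply Rabs_sin_le. rewrite Rabs_mult, (Rabs_pos_eq x); lra. }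
  replace (1 * (Rabs xi * x) * (cos a * cos a / (sinh x ^ 2 + cos a ^ 2) / sinh x)) with (Rabs xi * cos a * ((x / sinh x) * (cos a / (sinh x ^ 2 + cos a ^ 2)))) by (field; split; lra).
  apply Rmult_le_compat_l. apply Rmult_le_pos. apply Rabs_pos. lra.
  replace (cosh x * cos a / (sinh x ^ 2 + cos a ^ 2)) with (cosh x * (cos a / (sinh x ^ 2 + cos a ^ 2))) by (field; lra).
  apply Rmult_le_compat_r. left; apply Rdiv_lt_0_compat; assumption.
  apply Rle_trans with 1; [|exact Pc]. apply Rmult_le_reg_r with (sinh x). exact Sp. replace (x / sinh x * sinh x) with x by (field; lra). rewrite Rmult_1_l. apply sinh_ge. lra. }
assert (E : Rabs (sinh (xi * (PI / 2)) * J - sin (PI / 2) * T) <= 0).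
{ replace 0 with (Rabs xi * cos (PI / 2) * (PI / 2)) by (rewrite cos_PI2; ring). apply Rminus_le.
  apply (continuous_le_end (fun a => Rabs (sinh (xi * a) * J - sin a * T) - Rabs xi * cos a * (PI / 2))). lra.
  - apply (continuous_minus (fun a => Rabs (sinh (xi * a) * J - sin a * T)) (fun a => Rabs xi * cos a * (PI / 2))).
    apply (continuous_comp (fun a => sinh (xi * a) * J - sin a * T) Rabs). apply continuous_derivable. unfold sinh. auto_derive. exact I. apply continuous_Rabs.
    apply continuous_derivable. auto_derive. exact I.
  - intros a Ha. specialize (K a Ha). lra. }
assert (Z := Rabs_pos (sinh (xi * (PI / 2)) * J - sin (PI / 2) * T)).
assert (Q : sinh (xi * (PI / 2)) * J - sin (PI / 2) * T = 0). { apply Rabs_eq_0. lra. }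
rewrite sin_PI2 in Q. replace (PI * xi / 2) with (xi * (PI / 2)) in * by field. rewrite EJ in Q.
assert (Pc := cosh_pos (xi * (PI / 2))).
replace (PI / 2 * (sinh (xi * (PI / 2)) / cosh (xi * (PI / 2)))) with (sinh (xi * (PI / 2)) * (PI / (2 * cosh (xi * (PI / 2))))) by (field; lra). lra.
Qed.

(** * Poisson summation and theta inversion *)

(** Multiplying by [cos (x / 2 + psi)] makes the antiperiodic [D] periodic and turns integer
    frequencies into half-integer ones. At a given point [x0] the phase [psi = - x0 / 2] makes this
    factor 1. *)
Lemma fourier_unique_anti (D : R -> R) : (forall x, continuous D x) -> (forall x, D (x + 2 * PI) = - D x) ->
  (forall (n : nat) phi, RInt (fun x => D x * cos ((INR n + 1/2) * x + phi)) 0 (2 * PI) = 0 :> R) -> forall x, D x = 0.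
Proof.
intros Dc Dp Do x0. assert (PP := PI_RGT_0).
assert (Cc : forall a phi x, continuous (fun x => cos (a * x + phi)) x) by (intros; apply continuous_derivable; auto_derive; exact I).
assert (Ex : forall a phi, ex_RInt (fun x => D x * cos (a * x + phi)) 0 (2 * PI)).
{ intros. apply ex_RInt_cont. lra. intros. apply @continuous_mult. apply Dc. apply Cc. }
assert (Z : forall psi x, D x * cos (1/2 * x + psi) = 0).
{ intros psi. apply (fourier_unique (fun x => D x * cos (1/2 * x + psi))).
  - intros x. apply @continuous_mult. apply Dc. apply Cc.
  - intros x. rewrite Dp. replace (1/2 * (x + 2 * PI) + psi) with (1/2 * x + psi + PI) by field. rewrite neg_cos. ring.
  - intros n phi.
    assert (E : RInt (fun x => D x * cos ((INR n - 1/2) * x + (phi - psi))) 0 (2 * PI) = 0 :> R).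
    { destruct n.
      - etransitivity; [|apply (Do 0%nat (psi - phi))]. apply rint_ext. lra. intros x _. simpl INR. f_equal.
        rewrite <- (cos_neg ((0 + 1/2) * x + (psi - phi))). f_equal. field.
      - etransitivity; [|apply (Do n (phi - psi))]. apply rint_ext. lra. intros x _. rewrite S_INR. f_equal. f_equal. field. }
    rewrite (rint_ext _ (fun x => (1/2) * (D x * cos ((INR n + 1/2) * x + (phi + psi))) + (1/2) * (D x * cos ((INR n - 1/2) * x + (phi - psi))))); [|lra|].
    + assert (E1 := Ex (INR n + 1/2) (phi + psi)). assert (E2 := Ex (INR n - 1/2) (phi - psi)).
      rewrite (rint_plus (fun x => (1/2) * (D x * cos ((INR n + 1/2) * x + (phi + psi)))) (fun x => (1/2) * (D x * cos ((INR n - 1/2) * x + (phi - psi))))) by exr.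
      rewrite (rint_scal (fun x => D x * cos ((INR n + 1/2) * x + (phi + psi)))), (rint_scal (fun x => D x * cos ((INR n - 1/2) * x + (phi - psi)))) by assumption.
      rewrite E, Do. ring.
    + intros x _. replace ((INR n + 1/2) * x + (phi + psi)) with ((INR n * x + phi) + (1/2 * x + psi)) by field.
      replace ((INR n - 1/2) * x + (phi - psi)) with ((INR n * x + phi) - (1/2 * x + psi)) by field.
      set (a := INR n * x + phi). set (b := 1/2 * x + psi). rewrite (cos_plus a b), (cos_minus a b). field. }
specialize (Z (- (1/2 * x0)) x0). rewrite Rplus_opp_r, cos_0, Rmult_1_r in Z. exact Z.
Qed.

Lemma RInt_cos_period (p phi : R) : p <> 0 -> cos (p * (2 * PI)) = 1 -> sin (p * (2 * PI)) = 0 -> RInt (fun x => cos (p * x + phi)) 0 (2 * PI) = 0 :> R.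
Proof.
intros Hp Hc Hs. apply is_RInt_unique.
replace 0 with (minus (sin (p * (2 * PI) + phi) / p) (sin (p * 0 + phi) / p)) at 2.
apply (is_RInt_derive (fun x => sin (p * x + phi) / p)).
intros x _. auto_derive. exact I. field. exact Hp. intros x _. apply continuous_derivable. auto_derive. exact I.
unfold minus, plus, opp; simpl. rewrite sin_plus, Hc, Hs. replace (p * 0 + phi) with phi by ring. field. exact Hp.
Qed.

Lemma cos_2PI_INR k : cos (INR k * (2 * PI)) = 1.
Proof. rewrite <- cos_0, <- (cos_period 0 k). f_equal. ring. Qed.
Lemma sin_2PI_INR k : sin (INR k * (2 * PI)) = 0.
Proof. rewrite <- sin_0, <- (sin_period 0 k). f_equal. ring. Qed.

Section Poisson.
Variables (sg dl w0 s : R).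
(** Two cases at once: plain summation with integer frequencies, where frequency 0 counts once, and
    alternating summation with half-integer frequencies, where each one stands for itself and its
    negative. *)
Hypothesis Hsg : (sg = 1 /\ dl = 0 /\ w0 = 1) \/ (sg = -1 /\ dl = 1/2 /\ w0 = 2).
Hypothesis Hs : 0 < s.
Let g x := exp (- s * x ^ 2).
Let nu (n : nat) := INR n + dl.
Let G0 := Int g.
(** The sum of [sg ^ m * g (2 * PI * m + th)] over all integers [m], folded by pairing [m = k] with
    [m = - (k + 1)]. *)
Let term k th := sg ^ k * (g (2 * PI * INR k + th) + sg * g (2 * PI * (INR k + 1) - th)).
Let wt (n : nat) := match n with O => w0 | _ => 2 end.
Let pterm n th := G0 / PI * wt n * exp (- (nu n) ^ 2 / (4 * s)) * cos (nu n * th).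

Lemma sg_sqr : sg * sg = 1.
Proof. destruct Hsg as [[-> _]|[-> _]]; ring. Qed.
Lemma sg_abs : Rabs sg = 1.
Proof. destruct Hsg as [[-> _]|[-> _]]. apply Rabs_R1. rewrite Rabs_left; lra. Qed.
Lemma sg_pow_abs k : Rabs (sg ^ k) = 1.
Proof. rewrite <- RPow_abs, sg_abs. apply pow1. Qed.
Lemma sg_pow_sqr k : sg ^ k * sg ^ k = 1.
Proof. rewrite <- Rpow_mult_distr, sg_sqr. apply pow1. Qed.
Lemma nu_nonneg n : 0 <= nu n.
Proof. unfold nu. assert (T := pos_INR n). destruct Hsg as [[_ [-> _]]|[_ [-> _]]]; lra. Qed.
Lemma g_even x : g (- x) = g x.
Proof. unfold g. f_equal. ring. Qed.
Lemma g_bound x : 0 < g x <= exp (/ (4 * s)) * exp (- x).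
Proof. unfold g. split. apply exp_pos. rewrite <- exp_plus. apply exp_le. assert (T := gauss_exp_bound s x Hs). lra. Qed.

Lemma cos_nu_shift n k y : cos (y - 2 * PI * nu n * INR k) = sg ^ k * cos y.
Proof.
revert y. induction k; intros y. simpl. rewrite Rmult_0_r, Rminus_0_r. ring.
rewrite S_INR. replace (y - 2 * PI * nu n * (INR k + 1)) with ((y - 2 * PI * nu n) - 2 * PI * nu n * INR k) by ring. rewrite IHk.
enough (E : cos (y - 2 * PI * nu n) = sg * cos y) by (rewrite E; simpl; ring).
unfold nu. destruct Hsg as [[-> [-> _]]|[-> [-> _]]].
- replace (2 * PI * (INR n + 0)) with (INR n * (2 * PI)) by ring. rewrite cos_minus, cos_2PI_INR, sin_2PI_INR. ring.
- replace (y - 2 * PI * (INR n + 1/2)) with (y - PI - INR n * (2 * PI)) by field. rewrite cos_minus, cos_2PI_INR, sin_2PI_INR, cos_minus, cos_PI, sin_PI. ring.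
Qed.

Lemma ex_series_geo2pi K : ex_series (fun k => K * exp (INR k * - (2 * PI))).
Proof. apply ex_series_exp. assert (PP := PI_RGT_0). lra. Qed.

Lemma term_bound B k th : Rabs th <= B -> Rabs (term k th) <= 2 * exp (/ (4 * s)) * exp B * exp (INR k * - (2 * PI)).
Proof.
intros HB. assert (PP := PI_RGT_0). apply Rabs_le_between in HB. unfold term. rewrite Rabs_mult, sg_pow_abs, Rmult_1_l.
assert (G1 := g_bound (2 * PI * INR k + th)). assert (G2 := g_bound (2 * PI * (INR k + 1) - th)).
eapply Rle_trans. apply Rabs_triang. rewrite Rabs_mult, sg_abs, Rmult_1_l, !Rabs_pos_eq by lra.
assert (P := exp_pos (/ (4 * s))).
assert (E : forall x, - x <= B + INR k * - (2 * PI) -> g x <= exp (/ (4 * s)) * exp B * exp (INR k * - (2 * PI))).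
{ intros x Hx. eapply Rle_trans. apply g_bound. replace (exp (/ (4 * s)) * exp B * exp (INR k * - (2 * PI))) with (exp (/ (4 * s)) * exp (B + INR k * - (2 * PI))) by (rewrite exp_plus; ring).
  apply Rmult_le_compat_l. lra. apply exp_le. exact Hx. }
assert (E1 := E (2 * PI * INR k + th) ltac:(lra)). assert (E2 := E (2 * PI * (INR k + 1) - th) ltac:(lra)). lra.
Qed.

Lemma term_cont k th : continuous (term k) th.
Proof. apply continuous_derivable. unfold term, g. auto_derive. exact I. Qed.

Definition theta_sum (th : R) : R := Series (fun k => term k th).
Definition theta_dual (th : R) : R := Series (fun n => pterm n th).

Lemma theta_sum_cont th : continuous theta_sum th.
Proof.
apply (Series_continuous term (fun k => 2 * exp (/ (4 * s)) * exp (Rabs th + 1) * exp (INR k * - (2 * PI))) th 1 Rlt_0_1).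
- intros k y Hy. apply term_bound. replace y with ((y - th) + th) by ring. eapply Rle_trans. apply Rabs_triang. lra.
- apply ex_series_geo2pi.
- intros k. apply term_cont.
Qed.

Lemma theta_sum_period th : theta_sum (th + 2 * PI) = sg * theta_sum th.
Proof.
assert (EA : forall x, ex_series (fun k => sg ^ k * g (2 * PI * INR k + x))).
{ intros x. apply (ex_series_le (fun k => sg ^ k * g (2 * PI * INR k + x)) (fun k => exp (/ (4 * s)) * exp (- x) * exp (INR k * - (2 * PI)))).
  - intros k. change (Rabs (sg ^ k * g (2 * PI * INR k + x)) <= exp (/ (4 * s)) * exp (- x) * exp (INR k * - (2 * PI))).
    rewrite Rabs_mult, sg_pow_abs, Rmult_1_l. assert (T := g_bound (2 * PI * INR k + x)). rewrite Rabs_pos_eq by lra. eapply Rle_trans. apply T.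
    right. replace (- (2 * PI * INR k + x)) with (- x + INR k * - (2 * PI)) by ring. rewrite exp_plus. ring.
  - apply ex_series_geo2pi. }
assert (SA : forall x, Series (fun k => sg ^ k * g (2 * PI * INR k + x)) = g x + sg * Series (fun k => sg ^ k * g (2 * PI * INR k + (2 * PI + x)))).
{ intros x. rewrite (Series_incr_1 _ (EA x)). rewrite <- Series_scal_l. change (INR 0) with 0. change (sg ^ 0) with 1. rewrite Rmult_0_r, Rplus_0_l, Rmult_1_l. f_equal.
  apply Series_ext. intros k. rewrite S_INR. change (sg ^ S k) with (sg * sg ^ k). replace (2 * PI * (INR k + 1) + x) with (2 * PI * INR k + (2 * PI + x)) by ring. ring. }
assert (SF : forall x, theta_sum x = Series (fun k => sg ^ k * g (2 * PI * INR k + x)) + sg * Series (fun k => sg ^ k * g (2 * PI * INR k + (2 * PI - x)))).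
{ intros x. rewrite <- Series_scal_l, <- Series_plus. apply Series_ext. intros k. unfold term. replace (2 * PI * (INR k + 1) - x) with (2 * PI * INR k + (2 * PI - x)) by ring. ring.
  apply EA. apply (ex_series_scal_l sg (fun k => sg ^ k * g (2 * PI * INR k + (2 * PI - x)))). apply EA. }
rewrite !SF. replace (2 * PI - (th + 2 * PI)) with (- th) by ring.
rewrite (SA th), (SA (- th)), g_even. replace (2 * PI + - th) with (2 * PI - th) by ring. replace (2 * PI + th) with (th + 2 * PI) by ring.
set (X := Series (fun k => sg ^ k * g (2 * PI * INR k + (th + 2 * PI)))). set (Y := Series (fun k => sg ^ k * g (2 * PI * INR k + (2 * PI - th)))).
transitivity ((sg * sg) * X + sg * (g th + sg * Y)). rewrite sg_sqr. ring. ring.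
Qed.

Lemma dom_gcos w : dom (fun x => g x * cos (w * x)) (exp (/ (4 * s))) 1.
Proof.
eapply dom_ext; [|eapply dom_weaken; [apply (dom_mult_bounded _ (fun x => cos (w * x)) _ _ 1 (dom_gauss s Hs))|lra|rewrite Rmult_1_l; lra]].
intros; unfold g; simpl; ring. intros y _. apply continuous_derivable. auto_derive. exact I. intros y _. apply Rabs_le, COS_bound.
Qed.

(** Unfolding: one half of the term is translated and the other reflected onto the same interval,
    with phases [phi] and [- phi] that add up to [2 * cos phi * cos (nu n * x)]. *)
Lemma term_coef n phi k : RInt (fun th => term k th * cos (nu n * th + phi)) 0 (2 * PI) =
  RInt (fun x => 2 * cos phi * (g x * cos (nu n * x))) (2 * PI * INR k) (2 * PI * INR (S k)) :> R.
Proof.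
assert (PP := PI_RGT_0). rewrite S_INR.
set (A := fun x => g x * cos (nu n * x + phi)). set (B := fun x => g x * cos (nu n * x - phi)).
assert (cA : forall x, continuous A x) by (intros; apply continuous_derivable; unfold A, g; auto_derive; exact I).
assert (cB : forall x, continuous B x) by (intros; apply continuous_derivable; unfold B, g; auto_derive; exact I).
assert (exA : forall p q, p <= q -> ex_RInt A p q) by (intros; apply ex_RInt_cont; auto).
assert (exB : forall p q, p <= q -> ex_RInt B p q) by (intros; apply ex_RInt_cont; auto).
assert (LA := RInt_comp_lin A 1 (2 * PI * INR k) 0 (2 * PI)).
replace (1 * 0 + 2 * PI * INR k) with (2 * PI * INR k) in LA by ring. replace (1 * (2 * PI) + 2 * PI * INR k) with (2 * PI * (INR k + 1)) in LA by ring.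
assert (Hk : 2 * PI * INR k <= 2 * PI * (INR k + 1)) by nra.
specialize (LA (exA _ _ Hk)).
assert (LB := RInt_comp_lin B (-1) (2 * PI * (INR k + 1)) 0 (2 * PI)).
replace (-1 * 0 + 2 * PI * (INR k + 1)) with (2 * PI * (INR k + 1)) in LB by ring. replace (-1 * (2 * PI) + 2 * PI * (INR k + 1)) with (2 * PI * INR k) in LB by ring.
specialize (LB (ex_RInt_swap _ _ _ (exB _ _ Hk))).
rewrite <- (opp_RInt_swap B) in LB by (apply exB; exact Hk).
set (A' := fun th => A (2 * PI * INR k + th)). set (B' := fun th => B (2 * PI * (INR k + 1) - th)).
assert (exA' : ex_RInt A' 0 (2 * PI)). { apply ex_RInt_cont. lra. intros. apply continuous_derivable. unfold A', A, g. auto_derive. exact I. }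
assert (exB' : ex_RInt B' 0 (2 * PI)). { apply ex_RInt_cont. lra. intros. apply continuous_derivable. unfold B', B, g. auto_derive. exact I. }
assert (LA2 : RInt A' 0 (2 * PI) = RInt A (2 * PI * INR k) (2 * PI * (INR k + 1)) :> R).
{ rewrite <- LA. apply rint_ext. lra. intros x _. unfold A', scal; simpl. unfold mult; simpl. rewrite Rmult_1_l. f_equal. ring. }
assert (LB2 : RInt B' 0 (2 * PI) = RInt B (2 * PI * INR k) (2 * PI * (INR k + 1)) :> R).
{ transitivity (- (- RInt B (2 * PI * INR k) (2 * PI * (INR k + 1)))); [|ring].
  transitivity (- RInt (fun y => -1 * B (-1 * y + 2 * PI * (INR k + 1))) 0 (2 * PI)); [|f_equal; exact LB].
  rewrite (rint_ext (fun y => -1 * B (-1 * y + 2 * PI * (INR k + 1))) (fun y => (-1) * B' y)); [|lra|].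
  rewrite rint_scal by exact exB'. assert (Q : forall J, J = - (-1 * J)) by (intros; ring). apply Q. intros x _. unfold B'. f_equal. f_equal. ring. }
rewrite (rint_ext _ (fun th => A' th + B' th)); [|lra|].
- rewrite (rint_plus A' B' _ _ exA' exB'), LA2, LB2. rewrite <- (rint_plus A B) by (apply exA || apply exB; exact Hk).
  apply rint_ext. exact Hk. intros x _. unfold A, B. rewrite cos_plus, cos_minus. ring.
- intros th _. unfold term, A', B', A, B.
  replace (nu n * (2 * PI * INR k + th) + phi) with ((nu n * th + phi) + 2 * PI * nu n * INR k) by ring.
  replace (nu n * (2 * PI * (INR k + 1) - th) - phi) with (- ((nu n * th + phi) - 2 * PI * nu n * INR (S k))) by (rewrite S_INR; ring).
  rewrite cos_neg, cos_nu_shift.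
  replace (cos (nu n * th + phi + 2 * PI * nu n * INR k)) with (sg ^ k * cos (nu n * th + phi)).
  simpl. ring.
  assert (E := cos_nu_shift n k (nu n * th + phi + 2 * PI * nu n * INR k)). replace (nu n * th + phi + 2 * PI * nu n * INR k - 2 * PI * nu n * INR k) with (nu n * th + phi) in E by ring.
  rewrite E, <- Rmult_assoc, sg_pow_sqr. ring.
Qed.

(** The unfolded partial sums are integrals of one function over [[0, 2 * PI * (N + 1)]]; their
    limit is the Fourier transform of the Gaussian. *)
Lemma theta_sum_coef n phi : RInt (fun th => theta_sum th * cos (nu n * th + phi)) 0 (2 * PI) =
  2 * cos phi * (exp (- (nu n) ^ 2 / (4 * s)) * G0) :> R.
Proof.
assert (PP := PI_RGT_0).
set (h := fun x => 2 * cos phi * (g x * cos (nu n * x))).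
assert (Dh := dom_scal _ (2 * cos phi) _ _ (dom_gcos (nu n))). fold h in Dh.
assert (ch : forall x, continuous h x) by (intros; apply continuous_derivable; unfold h, g; auto_derive; exact I).
assert (Ih : Int h = 2 * cos phi * (exp (- (nu n) ^ 2 / (4 * s)) * G0)).
{ unfold h. rewrite (Int_scal _ _ _ _ (dom_gcos (nu n))). f_equal. apply gauss_fourier. exact Hs. apply nu_nonneg. }
rewrite <- Ih.
assert (S := RInt_Series (fun k th => term k th * cos (nu n * th + phi)) (fun k => 2 * exp (/ (4 * s)) * exp (2 * PI) * exp (INR k * - (2 * PI))) 0 (2 * PI) ltac:(lra)).
rewrite (rint_ext _ (fun th => Series (fun k => term k th * cos (nu n * th + phi)))); [|lra|intros; rewrite Series_scal_r; reflexivity].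
assert (S' : is_series (fun k => RInt (fun th => term k th * cos (nu n * th + phi)) 0 (2 * PI)) (RInt (fun th => Series (fun k => term k th * cos (nu n * th + phi))) 0 (2 * PI))).
{ apply S.
  - intros k x Hx. rewrite Rabs_mult. rewrite <- (Rmult_1_r (2 * _ * _ * _)). apply Rmult_le_compat; try apply Rabs_pos. apply term_bound. rewrite Rabs_pos_eq; lra. apply Rabs_le, COS_bound.
  - apply ex_series_geo2pi.
  - intros k. apply ex_RInt_cont. lra. intros x _. apply @continuous_mult. apply term_cont. apply cosZ_cont.
  - apply (ex_RInt_ext (fun th => theta_sum th * cos (nu n * th + phi))). intros; symmetry; apply Series_scal_r.
    apply ex_RInt_cont. lra. intros x _. apply @continuous_mult. apply theta_sum_cont. apply cosZ_cont. }
clear S.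
assert (L : is_lim_seq (sum_n (fun k => RInt (fun th => term k th * cos (nu n * th + phi)) 0 (2 * PI))) (Int h)).
{ assert (E : forall N, sum_n (fun k => RInt (fun th => term k th * cos (nu n * th + phi)) 0 (2 * PI)) N = RInt h 0 (2 * PI * INR (S N)) :> R).
  { induction N. rewrite sum_O, term_coef. simpl INR. rewrite Rmult_0_r. reflexivity.
    rewrite sum_Sn, IHN, term_coef. change (RInt h 0 (2 * PI * INR (S N)) + RInt h (2 * PI * INR (S N)) (2 * PI * INR (S (S N))) = RInt h 0 (2 * PI * INR (S (S N)))).
    assert (T := pos_INR N). apply rint_Chasles; apply ex_RInt_cont; auto; rewrite !S_INR; nra. }
  apply (is_lim_seq_ext (fun N => RInt h 0 (2 * PI * INR (S N)))). intros; symmetry; apply E.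
  apply is_lim_seq_spec. intros eps.
  set (K := Rabs (2 * cos phi) * exp (/ (4 * s))) in *.
  assert (Le := dom_err_lim K 1 Rlt_0_1). apply is_lim_seq_spec in Le. destruct (Le eps) as [N HN]. exists N. intros m Hm. specialize (HN m Hm).
  rewrite Rminus_0_r in HN. apply Rabs_def2 in HN. assert (T := INR1_pos m). rewrite S_INR, Rabs_minus_sym.
  assert (E0 := Int_err0 h K 1 (2 * PI * (INR m + 1)) Dh ltac:(intros; apply ch) ltac:(nra)).
  eapply Rle_lt_trans. exact E0. eapply Rle_lt_trans; [|apply HN].
  assert (K0 := dom_nonneg _ _ _ Dh). unfold Rdiv. rewrite Rmult_assoc. apply Rmult_le_compat_l. exact K0.
  assert (exp (- (1) * (2 * PI * (INR m + 1))) <= exp (- (1) * (INR m + 1))). { apply exp_le. assert (T2 := PI2_1). nra. }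
  assert (0 < / (INR m + 1)) by (apply Rinv_0_lt_compat; exact T). lra. }
assert (L' := is_lim_seq_unique _ _ L). assert (S'' : is_lim_seq (sum_n (fun k => RInt (fun th => term k th * cos (nu n * th + phi)) 0 (2 * PI))) (RInt (fun th => Series (fun k => term k th * cos (nu n * th + phi))) 0 (2 * PI))) by exact S'.
apply is_lim_seq_unique in S''. rewrite L' in S''. injection S'' as S''. symmetry. exact S''.
Qed.

Lemma G0_nonneg : 0 <= G0.
Proof. assert (T := Int_le g g _ _ _ _ (dom_gauss s Hs) (dom_gauss s Hs) ltac:(intros; rewrite Rabs_pos_eq; [lra|unfold g; left; apply exp_pos])). assert (R := Rabs_pos (Int g)). unfold G0. lra. Qed.

Let pM (n : nat) := 2 * (G0 / PI) * exp (/ (4 * s) * 1) * exp (INR n * - (/ (4 * s))).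

Lemma pterm_bound n th : Rabs (pterm n th) <= pM n.
Proof.
assert (PP := PI_RGT_0). assert (H0 := G0_nonneg). assert (Q : 0 <= G0 / PI) by (apply Rdiv_le_0_compat; lra).
unfold pterm, pM. rewrite !Rabs_mult, (Rabs_pos_eq (G0 / PI)) by exact Q. rewrite (Rabs_pos_eq (exp _)) by (left; apply exp_pos).
assert (W : Rabs (wt n) <= 2). { unfold wt. destruct Hsg as [[_ [_ ->]]|[_ [_ ->]]]; destruct n; rewrite Rabs_pos_eq; lra. }
assert (C : Rabs (cos (nu n * th)) <= 1) by (apply Rabs_le, COS_bound).
assert (P4 : 0 < / (4 * s)) by (apply Rinv_0_lt_compat; lra).
assert (E : exp (- nu n ^ 2 / (4 * s)) <= exp (/ (4 * s) * 1) * exp (INR n * - (/ (4 * s)))).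
{ rewrite <- exp_plus. apply exp_le. unfold Rdiv.
  assert (N2 : INR n <= nu n ^ 2 + 1). { unfold nu. destruct Hsg as [[_ [-> _]]|[_ [-> _]]]; nra. }
  assert (0 <= (nu n ^ 2 + 1 - INR n) * / (4 * s)) by (apply Rmult_le_pos; lra). lra. }
assert (W0 := Rabs_pos (wt n)). assert (C0 := Rabs_pos (cos (nu n * th))). assert (E0 := exp_pos (- nu n ^ 2 / (4 * s))).
apply Rle_trans with (G0 / PI * 2 * (exp (/ (4 * s) * 1) * exp (INR n * - (/ (4 * s)))) * 1); [|right; ring].
apply Rmult_le_compat; try lra. apply Rmult_le_pos; [apply Rmult_le_pos; assumption|lra].
apply Rmult_le_compat; try lra. apply Rmult_le_pos; lra. apply Rmult_le_compat_l; lra.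
Qed.

Lemma ex_series_pM : ex_series pM.
Proof. unfold pM. apply ex_series_exp. assert (0 < / (4 * s)) by (apply Rinv_0_lt_compat; lra). lra. Qed.

Lemma pterm_cont n th : continuous (pterm n) th.
Proof. apply continuous_derivable. unfold pterm. auto_derive. exact I. Qed.

Lemma theta_dual_cont th : continuous theta_dual th.
Proof. apply (Series_continuous pterm pM th 1 Rlt_0_1). intros; apply pterm_bound. apply ex_series_pM. intros; apply pterm_cont. Qed.

Lemma theta_dual_period th : theta_dual (th + 2 * PI) = sg * theta_dual th.
Proof.
unfold theta_dual. rewrite <- Series_scal_l. apply Series_ext. intros n. unfold pterm.
replace (nu n * (th + 2 * PI)) with (nu n * th + 2 * PI * nu n * INR 1) by (simpl; ring).
assert (E := cos_nu_shift n 1 (nu n * th + 2 * PI * nu n * INR 1)). replace (nu n * th + 2 * PI * nu n * INR 1 - 2 * PI * nu n * INR 1) with (nu n * th) in E by ring.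
rewrite E. rewrite pow_1. rewrite <- (Rmult_1_l (cos (nu n * th + _))) at 1. rewrite <- sg_sqr. ring.
Qed.

Lemma cos_orth n m phi : RInt (fun th => cos (nu n * th) * cos (nu m * th + phi)) 0 (2 * PI) =
  (if Nat.eq_dec n m then 2 * PI * cos phi / wt m else 0) :> R.
Proof.
assert (PP := PI_RGT_0).
set (A := fun th => cos ((nu m + nu n) * th + phi)). set (B := fun th => cos ((nu m - nu n) * th + phi)).
assert (exA : ex_RInt A 0 (2 * PI)) by (apply ex_RInt_cont; [lra|intros; apply cosZ_cont]).
assert (exB : ex_RInt B 0 (2 * PI)) by (apply ex_RInt_cont; [lra|intros; apply cosZ_cont]).
rewrite (rint_ext _ (fun th => (1/2) * A th + (1/2) * B th)); [|lra|].
2:{ intros x _. unfold A, B. replace ((nu m + nu n) * x + phi) with ((nu m * x + phi) + nu n * x) by ring.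
    replace ((nu m - nu n) * x + phi) with ((nu m * x + phi) - nu n * x) by ring. set (a := nu m * x + phi). rewrite (cos_plus a), (cos_minus a). field. }
rewrite (rint_plus (fun th => (1/2) * A th) (fun th => (1/2) * B th)) by exr. rewrite (rint_scal A), (rint_scal B) by assumption.
(* The sum frequency vanishes only for [n = m = 0] in the integer case. There the integral doubles,
   which the weight 1 compensates. *)
assert (Hsum : exists k, nu m + nu n = INR k /\ (k = O -> n = O /\ m = O /\ w0 = 1)).
{ unfold nu. destruct Hsg as [[_ [-> Hw]]|[_ [-> Hw]]].
  - exists (m + n)%nat. rewrite plus_INR. split. ring. intros; split; [lia|split; [lia|exact Hw]].
  - exists (S (m + n))%nat. rewrite S_INR, plus_INR. split. field. lia. }
destruct Hsum as [k [Ek Hk]].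
assert (IA : RInt A 0 (2 * PI) = (if Nat.eq_dec k 0 then 2 * PI * cos phi else 0) :> R).
{ unfold A. rewrite Ek. destruct (Nat.eq_dec k 0) as [->|N].
  - rewrite (rint_ext _ (fun _ => cos phi)); [|lra|intros; simpl; f_equal; ring]. rewrite rint_const. ring.
  - apply RInt_cos_period. apply not_0_INR; exact N. apply cos_2PI_INR. apply sin_2PI_INR. }
assert (IB : RInt B 0 (2 * PI) = (if Nat.eq_dec n m then 2 * PI * cos phi else 0) :> R).
{ unfold B. destruct (Nat.eq_dec n m) as [->|N].
  - rewrite (rint_ext _ (fun _ => cos phi)); [|lra|intros; f_equal; ring]. rewrite rint_const. ring.
  - replace (nu m - nu n) with (INR m - INR n) by (unfold nu; ring).
    assert (Hne : INR m - INR n <> 0). { intros E. apply N. apply INR_eq. lra. }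
    apply RInt_cos_period. exact Hne.
    rewrite Rmult_minus_distr_r, cos_minus, !cos_2PI_INR, !sin_2PI_INR. ring.
    rewrite Rmult_minus_distr_r, sin_minus, !cos_2PI_INR, !sin_2PI_INR. ring. }
rewrite IA, IB. destruct (Nat.eq_dec k 0) as [K0|K0].
- destruct (Hk K0) as [-> [-> Hw]]. simpl. rewrite Hw. field.
- destruct (Nat.eq_dec n m) as [->|N]; [|ring].
  assert (W : wt m = 2). { unfold wt. destruct m; [|reflexivity]. destruct Hsg as [[_ [Hd _]]|[_ [_ ->]]]; [|reflexivity].
    exfalso. apply K0. apply INR_eq. rewrite <- Ek. unfold nu. rewrite Hd. simpl. ring. }
  rewrite W. field.
Qed.

Lemma wt_pos n : 0 < wt n.
Proof. unfold wt. destruct Hsg as [[_ [_ ->]]|[_ [_ ->]]]; destruct n; lra. Qed.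

Lemma theta_dual_coef m phi : RInt (fun th => theta_dual th * cos (nu m * th + phi)) 0 (2 * PI) =
  2 * cos phi * (exp (- (nu m) ^ 2 / (4 * s)) * G0) :> R.
Proof.
assert (PP := PI_RGT_0).
rewrite (rint_ext _ (fun th => Series (fun n => pterm n th * cos (nu m * th + phi)))); [|lra|intros; rewrite Series_scal_r; reflexivity].
assert (S' : is_series (fun n => RInt (fun th => pterm n th * cos (nu m * th + phi)) 0 (2 * PI)) (RInt (fun th => Series (fun n => pterm n th * cos (nu m * th + phi))) 0 (2 * PI))).
{ apply (RInt_Series (fun n th => pterm n th * cos (nu m * th + phi)) pM). lra.
  - intros n x _. rewrite Rabs_mult, <- (Rmult_1_r (pM n)). apply Rmult_le_compat; try apply Rabs_pos. apply pterm_bound. apply Rabs_le, COS_bound.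
  - apply ex_series_pM.
  - intros n. apply ex_RInt_cont. lra. intros x _. apply @continuous_mult. apply pterm_cont. apply cosZ_cont.
  - apply (ex_RInt_ext (fun th => theta_dual th * cos (nu m * th + phi))). intros; symmetry; apply Series_scal_r.
    apply ex_RInt_cont. lra. intros x _. apply @continuous_mult. apply theta_dual_cont. apply cosZ_cont. }
rewrite <- (is_series_unique _ _ S').
rewrite (Series_ext _ (fun n => if Nat.eq_dec n m then 2 * cos phi * (exp (- (nu m) ^ 2 / (4 * s)) * G0) else 0)). apply Series_single.
intros n.
rewrite (rint_ext _ (fun th => (G0 / PI * wt n * exp (- (nu n) ^ 2 / (4 * s))) * (cos (nu n * th) * cos (nu m * th + phi)))); [|lra|intros; unfold pterm; ring].
rewrite rint_scal. rewrite cos_orth. destruct (Nat.eq_dec n m) as [->|N]; [|ring]. assert (W := wt_pos m). field. lra.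
apply ex_RInt_cont. lra. intros x _. apply continuous_derivable. auto_derive. exact I.
Qed.

(** Both sides are continuous, acquire the factor [sg] over a period, and have equal Fourier
    coefficients at the frequencies [nu n]. *)
Theorem poisson th : theta_sum th = theta_dual th.
Proof.
assert (PP := PI_RGT_0). set (D := fun x => theta_sum x - theta_dual x).
assert (Dc : forall x, continuous D x) by (intros; apply (continuous_minus theta_sum theta_dual); [apply theta_sum_cont|apply theta_dual_cont]).
assert (Dp : forall x, D (x + 2 * PI) = sg * D x) by (intros; unfold D; rewrite theta_sum_period, theta_dual_period; ring).
assert (Do : forall n phi, RInt (fun x => D x * cos (nu n * x + phi)) 0 (2 * PI) = 0 :> R).
{ intros n phi.
  rewrite (rint_ext _ (fun x => theta_sum x * cos (nu n * x + phi) - theta_dual x * cos (nu n * x + phi))); [|lra|intros; unfold D; ring].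
  rewrite (rint_minus (fun x => theta_sum x * cos (nu n * x + phi)) (fun x => theta_dual x * cos (nu n * x + phi))), theta_sum_coef, theta_dual_coef. ring.
  apply ex_RInt_cont; [lra|intros x _; apply @continuous_mult; [apply theta_sum_cont|apply cosZ_cont]].
  apply ex_RInt_cont; [lra|intros x _; apply @continuous_mult; [apply theta_dual_cont|apply cosZ_cont]]. }
enough (D th = 0) by (unfold D in H; lra).
clearbody D. unfold nu in Do. destruct Hsg as [[E1 [E2 _]]|[E1 [E2 _]]]; rewrite E1 in Dp; rewrite E2 in Do.
- apply fourier_unique; [exact Dc|intros; rewrite Dp; ring|]. intros n phi. etransitivity; [|apply (Do n phi)]. apply rint_ext. lra. intros. rewrite Rplus_0_r. reflexivity.
- apply fourier_unique_anti; [exact Dc|intros; rewrite Dp; ring|exact Do].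
Qed.
End Poisson.

Definition theta_weight (w0 : R) (n : nat) : R := match n with O => w0 | _ => 2 end.

(* At s = 1/(4 pi) the two sides of Poisson's formula at th = 0 are proportional, which evaluates the Gaussian integral. *)
Lemma gauss_integral_fixed : Int (fun x => exp (- / (4 * PI) * x ^ 2)) = PI.
Proof.
assert (PP := PI_RGT_0). set (s := / (4 * PI)). assert (Hs : 0 < s) by (apply Rinv_0_lt_compat; lra).
assert (P := poisson 1 0 1 s (or_introl (conj eq_refl (conj eq_refl eq_refl))) Hs 0).
unfold theta_sum, theta_dual in P.
set (a := fun k : nat => exp (- (PI * INR k ^ 2))).
assert (Ea : ex_series a).
{ apply (ex_series_le a (fun k => exp PI * exp (INR k * - PI))).
  - intros k. change (Rabs (a k) <= exp PI * exp (INR k * - PI)). unfold a. rewrite Rabs_pos_eq by (left; apply exp_pos). rewrite <- exp_plus. apply exp_le.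
    assert (0 <= INR k ^ 2 - INR k + 1) by nra. nra.
  - apply ex_series_exp. lra. }
assert (Ea1 : ex_series (fun k => a (S k))) by (apply (ex_series_incr_1 a); exact Ea).
set (S0 := Series a).
assert (S1 : Series (fun k => a (S k)) = S0 - a 0%nat) by (unfold S0; rewrite (Series_incr_1 a Ea); ring).
rewrite (Series_ext _ (fun k => a k + a (S k))) in P.
2:{ intros k. rewrite pow1, Rmult_1_l, Rmult_1_l. unfold a. rewrite S_INR. f_equal; f_equal; unfold s; field; lra. }
rewrite Series_plus in P by assumption. fold S0 in P. rewrite S1 in P.
set (G := Int (fun x => exp (- s * x ^ 2))) in *.
rewrite (Series_ext _ (fun n => G / PI * (theta_weight 1 n * a n))) in P.
2:{ intros n. rewrite Rmult_0_r, cos_0, Rmult_1_r. unfold theta_weight, a. rewrite Rplus_0_r. rewrite Rmult_assoc. f_equal. f_equal. f_equal. unfold s. field. lra. }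
rewrite Series_scal_l in P.
assert (E : Series (fun n => theta_weight 1 n * a n) = S0 + (S0 - a 0%nat)).
{ rewrite Series_incr_1. simpl theta_weight. rewrite Series_scal_l, S1. ring.
  apply (ex_series_incr_1 (fun n => theta_weight 1 n * a n)). apply (ex_series_scal_l 2 (fun k => a (S k))). exact Ea1. }
rewrite E in P.
assert (a0 : a 0%nat = 1). { unfold a. simpl. rewrite <- exp_0. f_equal. ring. }
assert (Pos : 1 <= S0). { unfold S0. rewrite (Series_incr_1 a Ea), a0.
  assert (0 <= Series (fun k => a (S k))); [|lra].
  apply Series_nonneg; [|exact Ea1]. intros n. unfold a. left; apply exp_pos. }
assert (Q : (G / PI - 1) * (S0 + (S0 - a 0%nat)) = 0) by lra.
apply Rmult_integral in Q. destruct Q as [Q|Q]; [|lra].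
replace G with (G / PI * PI) by (field; lra). replace (G / PI) with 1 by lra. ring.
Qed.

Theorem gauss_integral s : 0 < s -> Int (fun x => exp (- s * x ^ 2)) = sqrt (PI / s) / 2.
Proof.
intros Hs. assert (PP := PI_RGT_0).
set (lam := sqrt (4 * PI * s)). assert (Hl : 0 < lam) by (apply sqrt_lt_R0; apply Rmult_lt_0_compat; lra).
assert (El : lam * lam = 4 * PI * s) by (apply sqrt_sqrt; left; apply Rmult_lt_0_compat; lra).
assert (S := Int_scale _ _ _ lam (dom_gauss (/ (4 * PI)) ltac:(apply Rinv_0_lt_compat; lra)) Hl).
rewrite gauss_integral_fixed in S.
rewrite (Int_ext (fun y => exp (- / (4 * PI) * (lam * y) ^ 2)) (fun x => exp (- s * x ^ 2))) in S.
2:{ intros y _. f_equal. replace ((lam * y) ^ 2) with ((lam * lam) * y ^ 2) by ring. rewrite El. field. lra. }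
rewrite S. unfold lam.
replace (PI / s) with ((2 * PI) * (2 * PI) * / (4 * PI * s)) by (field; lra).
assert (Q1 : 0 <= (2 * PI) * (2 * PI)) by (apply Rmult_le_pos; lra).
assert (Q2 : 0 < 4 * PI * s) by (apply Rmult_lt_0_compat; lra). assert (Q3 := Rinv_0_lt_compat _ Q2).
rewrite (sqrt_mult ((2 * PI) * (2 * PI)) (/ (4 * PI * s))), sqrt_square, sqrt_inv by lra. field. fold lam; lra.
Qed.

Lemma cos_INR_PI n x : cos (INR n * PI + x) = (-1) ^ n * cos x.
Proof.
revert x. induction n; intros x. simpl. rewrite Rmult_0_l, Rplus_0_l. ring.
rewrite S_INR. replace ((INR n + 1) * PI + x) with (INR n * PI + (x + PI)) by ring. rewrite IHn, neg_cos. simpl. ring.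
Qed.

Section ThetaSpecial.
Variable t : R.
Hypothesis Ht : 0 < t.
(** Chosen so that the Gaussian of Poisson's formula at [2 * PI * z] is [Eg z]. *)
Let s := t / (12 * PI ^ 2).
Let c := sqrt (3 * PI / t).
Let Eg (z : R) := exp (- (t / 3) * z ^ 2).

Lemma sp_s : 0 < s.
Proof. assert (PP := PI_RGT_0). unfold s. apply Rdiv_lt_0_compat. exact Ht. apply Rmult_lt_0_compat. lra. apply pow_lt; lra. Qed.

Lemma sp_G : Int (fun x => exp (- s * x ^ 2)) / PI = c.
Proof.
assert (PP := PI_RGT_0). rewrite (gauss_integral s sp_s). unfold s, c.
replace (PI / (t / (12 * PI ^ 2))) with ((2 * PI) * (2 * PI) * (3 * PI / t)) by (field; lra).
assert (0 < 3 * PI / t) by (apply Rdiv_lt_0_compat; lra).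
rewrite (sqrt_mult ((2 * PI) * (2 * PI)) (3 * PI / t)), sqrt_square by (first [lra|apply Rmult_le_pos; lra]). field. lra.
Qed.

Lemma sp_g z : exp (- s * (2 * PI * z) ^ 2) = Eg z.
Proof. assert (PP := PI_RGT_0). unfold Eg, s. f_equal. field. lra. Qed.

(** Poisson's formula at [th = PI + 2 * PI * y]: the shift by [PI] moves the lattice to the
    half-integers and puts the sign [(-1) ^ n] on the dual side. *)
Lemma theta_plus y : Series (fun k => Eg (INR k + 1/2 - y) + Eg (INR k + 1/2 + y)) =
  c * Series (fun n => theta_weight 1 n * ((-1) ^ n * exp (- 3 * PI ^ 2 * INR n ^ 2 / t)) * cos (2 * PI * INR n * y)).
Proof.
assert (PP := PI_RGT_0).
assert (P := poisson 1 0 1 s (or_introl (conj eq_refl (conj eq_refl eq_refl))) sp_s (PI + 2 * PI * y)).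
unfold theta_sum, theta_dual in P. rewrite sp_G in P.
rewrite <- Series_scal_l.
transitivity (Series (fun k => 1 ^ k * (exp (- s * (2 * PI * INR k + (PI + 2 * PI * y)) ^ 2) + 1 * exp (- s * (2 * PI * (INR k + 1) - (PI + 2 * PI * y)) ^ 2)))).
- apply Series_ext. intros k. rewrite pow1, !Rmult_1_l.
  replace (2 * PI * INR k + (PI + 2 * PI * y)) with (2 * PI * (INR k + 1/2 + y)) by field.
  replace (2 * PI * (INR k + 1) - (PI + 2 * PI * y)) with (2 * PI * (INR k + 1/2 - y)) by field. rewrite !sp_g. ring.
- rewrite P. apply Series_ext. intros n. rewrite Rplus_0_r.
  replace (INR n * (PI + 2 * PI * y)) with (INR n * PI + 2 * PI * INR n * y) by ring. rewrite cos_INR_PI.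
  replace (- INR n ^ 2 / (4 * s)) with (- 3 * PI ^ 2 * INR n ^ 2 / t) by (unfold s; field; lra). unfold theta_weight. ring.
Qed.

(** The same point in the alternating case; with half-integer frequencies the shift by [PI] also
    turns cosines into sines. *)
Lemma theta_minus y : Series (fun k => (-1) ^ k * (Eg (INR k + 1/2 - y) - Eg (INR k + 1/2 + y))) =
  c * Series (fun n => 2 * ((-1) ^ n * exp (- 3 * PI ^ 2 * (INR n + 1/2) ^ 2 / t)) * sin (2 * PI * (INR n + 1/2) * y)).
Proof.
assert (PP := PI_RGT_0).
assert (P := poisson (-1) (1/2) 2 s (or_intror (conj eq_refl (conj eq_refl eq_refl))) sp_s (PI + 2 * PI * y)).
unfold theta_sum, theta_dual in P. rewrite sp_G in P.
rewrite <- Series_scal_l.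
transitivity (- Series (fun k => (-1) ^ k * (exp (- s * (2 * PI * INR k + (PI + 2 * PI * y)) ^ 2) + -1 * exp (- s * (2 * PI * (INR k + 1) - (PI + 2 * PI * y)) ^ 2)))).
- rewrite <- Series_opp. apply Series_ext. intros k.
  replace (2 * PI * INR k + (PI + 2 * PI * y)) with (2 * PI * (INR k + 1/2 + y)) by field.
  replace (2 * PI * (INR k + 1) - (PI + 2 * PI * y)) with (2 * PI * (INR k + 1/2 - y)) by field. rewrite !sp_g. ring.
- rewrite P, <- Series_opp. apply Series_ext. intros n.
  replace ((INR n + 1/2) * (PI + 2 * PI * y)) with (INR n * PI + (PI / 2 + 2 * PI * (INR n + 1/2) * y)) by field. rewrite cos_INR_PI.
  rewrite cos_plus, cos_PI2, sin_PI2.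
  replace (- (INR n + 1/2) ^ 2 / (4 * s)) with (- 3 * PI ^ 2 * (INR n + 1/2) ^ 2 / t) by (unfold s; field; lra). destruct n; ring.
Qed.
End ThetaSpecial.

Lemma Series_split3 (u : nat -> R) : ex_series u -> Series u = Series (fun k => u (3 * k)%nat + u (3 * k + 1)%nat + u (3 * k + 2)%nat).
Proof.
intros E. symmetry. apply is_series_unique.
change (is_lim_seq (sum_n (fun k => u (3 * k)%nat + u (3 * k + 1)%nat + u (3 * k + 2)%nat)) (Series u)).
apply (is_lim_seq_ext (fun N => sum_n u (3 * N + 2))).
- intros N. induction N.
  + rewrite sum_O. simpl. rewrite !sum_Sn, sum_O. reflexivity.
  + rewrite sum_Sn, <- IHN. replace (3 * S N + 2)%nat with (S (S (S (3 * N + 2)))) by lia. rewrite !sum_Sn.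
    replace (3 * S N)%nat with (S (3 * N + 2)) by lia. replace (S (3 * N + 2) + 1)%nat with (S (S (3 * N + 2))) by lia. replace (S (3 * N + 2) + 2)%nat with (S (S (S (3 * N + 2)))) by lia.
    unfold plus; simpl. ring.
- apply (is_lim_seq_subseq (sum_n u) (Series u) (fun N => (3 * N + 2)%nat)).
  apply eventually_subseq. intros; lia. apply (Series_correct u E).
Qed.

(* e^{-t/12} (q^2;q^2)_oo as a theta series, by Euler's pentagonal number theorem *)
Definition eta (t : R) : R := Series (fun i => (-1) ^ i * (exp (- 3 * t * (INR i + 1/6) ^ 2) - exp (- 3 * t * (INR i + 5/6) ^ 2))).

(** Alternating Poisson summation at [th = PI / 3], where the lattice is k + 1/6 and k + 5/6. On the
    dual side [cos ((n + 1/2) * PI / 3)] is, up to the sign [(-1) ^ k], sqrt 3 / 2, 0, - sqrt 3 / 2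
    for n = 3k, 3k + 1, 3k + 2, so the series of [eta] reappears. *)
Theorem eta_inversion t : 0 < t -> eta (PI ^ 2 / t) = sqrt (t / PI) * eta t.
Proof.
intros Ht. assert (PP := PI_RGT_0). set (s := 3 * t / (4 * PI ^ 2)).
assert (PP2 : 0 < PI ^ 2) by (apply pow_lt; lra).
assert (Hs : 0 < s) by (unfold s; apply Rdiv_lt_0_compat; lra).
assert (P := poisson (-1) (1/2) 2 s (or_intror (conj eq_refl (conj eq_refl eq_refl))) Hs (PI / 3)).
unfold theta_sum, theta_dual in P. rewrite (gauss_integral s Hs) in P.
assert (EL : Series (fun k => (-1) ^ k * (exp (- s * (2 * PI * INR k + PI / 3) ^ 2) + -1 * exp (- s * (2 * PI * (INR k + 1) - PI / 3) ^ 2))) = eta t).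
{ unfold eta. apply Series_ext. intros k. unfold s.
  replace (- (3 * t / (4 * PI ^ 2)) * (2 * PI * INR k + PI / 3) ^ 2) with (- 3 * t * (INR k + 1/6) ^ 2) by (field; lra).
  replace (- (3 * t / (4 * PI ^ 2)) * (2 * PI * (INR k + 1) - PI / 3) ^ 2) with (- 3 * t * (INR k + 5/6) ^ 2) by (field; lra). ring. }
rewrite EL in P. rewrite P. clear EL.
set (tau := PI ^ 2 / t).
set (u := fun n : nat => exp (- (INR n + 1/2) ^ 2 / (4 * s)) * cos ((INR n + 1/2) * (PI / 3))).
assert (P4 : 0 < / (4 * s)) by (apply Rinv_0_lt_compat; lra).
assert (Eu : ex_series u).
{ apply (ex_series_le u (fun n => 1 * exp (INR n * - / (4 * s)))).
  - intros n. change (Rabs (u n) <= 1 * exp (INR n * - / (4 * s))). unfold u. rewrite Rabs_mult, Rabs_pos_eq, Rmult_comm by (left; apply exp_pos).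
    apply Rmult_le_compat. apply Rabs_pos. left; apply exp_pos. apply Rabs_le, COS_bound. apply exp_le. unfold Rdiv.
    assert (0 <= ((INR n + 1/2) ^ 2 - INR n) * / (4 * s)) by (apply Rmult_le_pos; [nra|lra]). lra.
  - apply ex_series_exp. lra. }
rewrite (Series_ext _ (fun n => (sqrt (PI / s) / PI) * u n)).
2:{ intros n. unfold u. destruct n; field; lra. }
rewrite Series_scal_l, (Series_split3 u Eu).
assert (c1 : forall k, u (3 * k)%nat = sqrt 3 / 2 * ((-1) ^ k * exp (- 3 * tau * (INR k + 1/6) ^ 2))).
{ intros k. unfold u. rewrite mult_INR. replace (INR 3) with 3 by (simpl; ring).
  replace ((3 * INR k + 1/2) * (PI / 3)) with (INR k * PI + PI / 6) by field. rewrite cos_INR_PI, cos_PI6.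
  replace (- (3 * INR k + 1/2) ^ 2 / (4 * s)) with (- 3 * tau * (INR k + 1/6) ^ 2) by (unfold s, tau; field; lra). ring. }
assert (c2 : forall k, u (3 * k + 1)%nat = 0).
{ intros k. unfold u. rewrite plus_INR, mult_INR. replace (INR 3) with 3 by (simpl; ring). simpl (INR 1).
  replace ((3 * INR k + 1 + 1/2) * (PI / 3)) with (INR k * PI + PI / 2) by field. rewrite cos_INR_PI, cos_PI2. ring. }
assert (c3 : forall k, u (3 * k + 2)%nat = - (sqrt 3 / 2) * ((-1) ^ k * exp (- 3 * tau * (INR k + 5/6) ^ 2))).
{ intros k. unfold u. rewrite plus_INR, mult_INR. replace (INR 3) with 3 by (simpl; ring). replace (INR 2) with 2 by (simpl; ring).
  replace ((3 * INR k + 2 + 1/2) * (PI / 3)) with (INR k * PI + (- (PI / 6) + PI)) by field. rewrite cos_INR_PI, neg_cos, cos_neg, cos_PI6.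
  replace (- (3 * INR k + 2 + 1/2) ^ 2 / (4 * s)) with (- 3 * tau * (INR k + 5/6) ^ 2) by (unfold s, tau; field; lra). ring. }
rewrite (Series_ext _ (fun k => sqrt 3 / 2 * ((-1) ^ k * (exp (- 3 * tau * (INR k + 1/6) ^ 2) - exp (- 3 * tau * (INR k + 5/6) ^ 2))))).
2:{ intros k. rewrite c1, c2, c3. ring. }
rewrite Series_scal_l. fold (eta tau).
rewrite <- !Rmult_assoc. rewrite <- (Rmult_1_l (eta tau)) at 1. f_equal.
unfold s. replace (PI / (3 * t / (4 * PI ^ 2))) with ((2 * PI) * (2 * PI) * (PI / t * / 3)) by (field; lra).
assert (0 < PI / t) by (apply Rdiv_lt_0_compat; lra).
rewrite (sqrt_mult ((2 * PI) * (2 * PI)) (PI / t * / 3)), sqrt_square, (sqrt_mult (PI / t) (/ 3)), sqrt_inv by (first [lra|apply Rmult_le_pos; lra]).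
replace (sqrt (t / PI)) with (/ sqrt (PI / t)) by (rewrite <- sqrt_inv; f_equal; field; lra).
assert (0 < sqrt (PI / t)) by (apply sqrt_lt_R0; lra). assert (0 < sqrt 3) by (apply sqrt_lt_R0; lra). field. repeat split; lra.
Qed.

(** * The Appell-Lerch sum of a three-term recurrence *)

Lemma ex_series_Rabs_le (a b : nat -> R) : (forall n, Rabs (a n) <= b n) -> ex_series b -> ex_series a.
Proof. intros H E. apply (ex_series_le a b). exact H. exact E. Qed.

Lemma Series_sum_n (x : nat -> nat -> R) N : (forall i, ex_series (fun n => x n i)) ->
  ex_series (fun n => sum_n (x n) N) /\ Series (fun n => sum_n (x n) N) = sum_n (fun i => Series (fun n => x n i)) N.
Proof.
intros H. induction N.
- split. eapply ex_series_ext; [|apply (H 0%nat)]. intros; simpl; rewrite sum_O; reflexivity. rewrite sum_O. apply Series_ext; intros; rewrite sum_O; reflexivity.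
- destruct IHN as [E I]. split.
  + eapply ex_series_ext; [|apply (ex_series_plus _ _ E (H (S N)))]. intros; simpl; rewrite sum_Sn; reflexivity.
  + rewrite sum_Sn, <- I. change (Series (fun n => sum_n (x n) (S N)) = Series (fun n => sum_n (x n) N) + Series (fun n => x n (S N))).
    rewrite <- Series_plus by (apply H || exact E). apply Series_ext. intros; rewrite sum_Sn; reflexivity.
Qed.

Lemma Series_swap (x : nat -> nat -> R) (a b : nat -> R) : (forall n i, Rabs (x n i) <= a n * b i) ->
  (forall n, 0 <= a n) -> (forall i, 0 <= b i) -> ex_series a -> ex_series b ->
  Series (fun n => Series (fun i => x n i)) = Series (fun i => Series (fun n => x n i)).
Proof.
intros H Ha Hb Ea Eb. symmetry. apply is_series_unique.
assert (En : forall i, ex_series (fun n => x n i)).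
{ intros i. apply (ex_series_Rabs_le _ (fun n => a n * b i)). intros; apply H. apply (ex_series_scal_r (b i) a). exact Ea. }
assert (A0 := Series_nonneg a Ha Ea).
change (is_lim_seq (sum_n (fun i => Series (fun n => x n i))) (Series (fun n => Series (fun i => x n i)))).
apply is_lim_seq_spec. intros eps.
destruct (series_tail_eps b (eps / (Series a + 1)) Eb) as [N HN]. apply Rdiv_lt_0_compat. apply cond_pos. lra.
exists N. intros m Hm. specialize (HN m Hm). apply Rabs_def2 in HN. destruct (Series_sum_n x m En) as [E I]. rewrite <- I, Rabs_minus_sym.
assert (ES : ex_series (fun n => Series (fun i => x n i))).
{ apply (ex_series_Rabs_le _ (fun n => a n * Series b)).
  - intros n. eapply Rle_trans. apply Series_Rabs. apply (ex_series_Rabs_le _ (fun i => a n * b i)). intros; rewrite Rabs_Rabsolu; apply H. apply (ex_series_scal_l (a n) b). exact Eb.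
    rewrite <- Series_scal_l. apply Series_le. intros; split; [apply Rabs_pos|apply H]. apply (ex_series_scal_l (a n) b). exact Eb.
  - apply (ex_series_scal_r (Series b) a). exact Ea. }
rewrite <- Series_minus by assumption.
set (d := Series b - sum_n b m) in *.
assert (T : forall n, Rabs (Series (fun i => x n i) - sum_n (x n) m) <= a n * d).
{ intros n. eapply Rle_trans. apply (series_tail (fun i => x n i) (fun i => a n * b i) m). apply H. apply (ex_series_scal_l (a n) b). exact Eb.
  right. rewrite Series_scal_l. rewrite (sum_n_mult_l (a n) b m : sum_n (fun i => a n * b i) m = a n * sum_n b m). unfold d. ring. }
assert (Ed : ex_series (fun n => a n * d)) by (apply (ex_series_scal_r d a); exact Ea).
apply Rle_lt_trans with (Series a * d).
- eapply Rle_trans. apply Series_Rabs. apply (ex_series_Rabs_le _ (fun n => a n * d)). intros; rewrite Rabs_Rabsolu; apply T. exact Ed.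
  rewrite <- Series_scal_r. apply Series_le; [|exact Ed]. intros; split; [apply Rabs_pos|apply T].
- assert (Pe := cond_pos eps). apply Rle_lt_trans with (Series a * (eps / (Series a + 1))). apply Rmult_le_compat_l; lra.
  apply Rlt_le_trans with ((Series a + 1) * (eps / (Series a + 1))). apply Rmult_lt_compat_r. apply Rdiv_lt_0_compat; lra. lra. right; field; lra.
Qed.

Lemma sign_cases sg : sg = 1 \/ sg = -1 -> sg * sg = 1 /\ (forall k, Rabs (sg ^ k) = 1).
Proof.
intros H. assert (A : Rabs sg = 1). { destruct H as [->| ->]. apply Rabs_R1. rewrite Rabs_left; lra. }
split. destruct H as [->| ->]; ring. intros k. rewrite <- RPow_abs, A. apply pow1.
Qed.

Section AppellSum.
Variables (t sg X M : R) (al : nat -> R).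
Hypothesis Ht : 0 < t.
Hypothesis Hsg : sg = 1 \/ sg = -1.
Hypothesis al_bound : forall k, Rabs (al k) <= M * exp (INR k * - (t / 8)).
(** For [al k] the Mordell integral at k + 1/2, this is the shift equation centred at 0, and [al2]
    the one centred at 1; parity has folded the negative arguments back. *)
Hypothesis al1 : al 1%nat = X / 2.
Hypothesis al2 : exp t * al 2%nat + exp (- t) * al 0%nat = X.
Hypothesis al_rec : forall n, exp (t * INR (n + 2)) * al (n + 3)%nat + sg * exp (- (t * INR (n + 2))) * al n = X.

(* Partial theta functions v_{m-1}, the bounded solution of the recurrence partial_theta_rec;
   pairing it with al solves al_rec. *)
Let vt (m i : nat) := (-1) ^ i * exp (- t * (2 * INR i * INR m + 3 * INR i ^ 2 + INR i)).
Let v (m : nat) := Series (vt m).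

Lemma m1_pow_abs k : Rabs ((-1) ^ k) = 1.
Proof. apply (sign_cases (-1)). right; reflexivity. Qed.

Lemma vt_bound m i : Rabs (vt m i) <= 1 * exp (INR i * - t).
Proof.
unfold vt. rewrite Rabs_mult, m1_pow_abs, !Rmult_1_l, Rabs_pos_eq by (left; apply exp_pos). apply exp_le.
assert (A := pos_INR i). assert (B := pos_INR m). assert (0 <= 2 * INR i * INR m + 3 * INR i ^ 2) by nra. nra.
Qed.
Lemma vt_ex m : ex_series (vt m).
Proof. apply (ex_series_Rabs_le _ _ (vt_bound m)). apply ex_series_exp. lra. Qed.
Lemma v_bound m : Rabs (v m) <= Series (fun i => 1 * exp (INR i * - t)).
Proof.
assert (E : ex_series (fun i => 1 * exp (INR i * - t))) by (apply ex_series_exp; lra).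
eapply Rle_trans. apply Series_Rabs. apply (ex_series_Rabs_le _ (fun i => 1 * exp (INR i * - t))). intros; rewrite Rabs_Rabsolu; apply vt_bound. exact E.
apply Series_le; [|exact E]. intros; split; [apply Rabs_pos|apply vt_bound].
Qed.

(** Split off the term [i = 0]: the term [i + 1] of [v m] is a fixed multiple of the term [i] of
    [v (m + 3)]. *)
Lemma partial_theta_rec m : v m = 1 - exp (- (2 * t * INR (m + 2))) * v (m + 3).
Proof.
unfold v. rewrite (Series_incr_1 _ (vt_ex m)), <- Series_scal_l. unfold Rminus. rewrite <- Series_opp. f_equal.
- unfold vt. simpl. rewrite Rmult_1_l, <- exp_0. f_equal. ring.
- apply Series_ext. intros i. unfold vt. rewrite !plus_INR, S_INR. replace (INR 3) with 3 by (simpl; ring). replace (INR 2) with 2 by (simpl; ring).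
  replace (- t * (2 * (INR i + 1) * INR m + 3 * (INR i + 1) ^ 2 + (INR i + 1))) with
    (- (2 * t * (INR m + 2)) + - t * (2 * INR i * (INR m + 3) + 3 * INR i ^ 2 + INR i)) by ring.
  rewrite exp_plus. simpl. ring.
Qed.

Let rr (i : nat) := sg * exp (- t * (2 * INR i + 1)).

Lemma rr_lt i : Rabs (rr i) < 1.
Proof.
unfold rr. rewrite Rabs_mult. replace (Rabs sg) with 1 by (symmetry; rewrite <- (pow_1 sg); apply sign_cases, Hsg).
rewrite Rmult_1_l, Rabs_pos_eq by (left; apply exp_pos). apply exp_lt_1. assert (A := pos_INR i). nra.
Qed.

(** Insert [1 = v k + exp (- (2 * t * (k + 2))) * v (k + 3)] under the sum and shift the first part
    by three. The recurrence then replaces the unknown [al] by the constant [X] everywhere except in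
    the first three terms. *)
Theorem appell_sum : Series (fun k => sg ^ k * al k) =
  al 0%nat * Series (fun i => (-1) ^ i * (exp (- t * (3 * INR i ^ 2 + INR i)) - exp (- t * (3 * INR i ^ 2 + 5 * INR i + 2)))) +
  X / 2 * sg * Series (fun i => (-1) ^ i * exp (- t * (3 * INR i ^ 2 + 3 * INR i)) * ((1 + rr i) / (1 - rr i))).
Proof.
destruct (sign_cases sg Hsg) as [S2 SA].
set (V := Series (fun i => 1 * exp (INR i * - t))).
assert (Ee : forall K, ex_series (fun k => K * exp (INR k * - (t / 8)))) by (intros; apply ex_series_exp; lra).
assert (Bv : forall k m, Rabs (sg ^ k * al k * v m) <= M * V * exp (INR k * - (t / 8))).
{ intros k m. rewrite !Rabs_mult, SA, Rmult_1_l. replace (M * V * exp (INR k * - (t / 8))) with (M * exp (INR k * - (t / 8)) * V) by ring.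
  apply Rmult_le_compat; try apply Rabs_pos. apply al_bound. apply v_bound. }
assert (E1 : ex_series (fun k => sg ^ k * al k * v k)) by (apply (ex_series_Rabs_le _ _ (fun k => Bv k k)), Ee).
assert (E2 : ex_series (fun k => sg ^ k * al k * (exp (- (2 * t * INR (k + 2))) * v (k + 3)))).
{ apply (ex_series_Rabs_le _ (fun k => M * V * exp (INR k * - (t / 8)))); [|apply Ee]. intros k.
  replace (sg ^ k * al k * (exp (- (2 * t * INR (k + 2))) * v (k + 3))) with (exp (- (2 * t * INR (k + 2))) * (sg ^ k * al k * v (k + 3))) by ring.
  rewrite Rabs_mult, Rabs_pos_eq by (left; apply exp_pos). rewrite <- (Rmult_1_l (M * V * _)). apply Rmult_le_compat. left; apply exp_pos. apply Rabs_pos.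
  apply exp_neg_le1. assert (A := pos_INR (k + 2)). nra. apply Bv. }
rewrite (Series_ext _ (fun k => sg ^ k * al k * v k + sg ^ k * al k * (exp (- (2 * t * INR (k + 2))) * v (k + 3)))).
2:{ intros k. rewrite (partial_theta_rec k). ring. }
rewrite Series_plus by assumption.
rewrite (Series_incr_n (fun k => sg ^ k * al k * v k) 3) by (lia || exact E1).
assert (E1' : ex_series (fun k => sg ^ (3 + k) * al (3 + k)%nat * v (3 + k)%nat)) by (apply (ex_series_incr_n (fun k => sg ^ k * al k * v k) 3); exact E1).
(* After the shift both series carry [v (k + 3)], and [al_rec] evaluates the combination of
   [al (k + 3)] and [al k] in front of it. *)
assert (Sum : Series (fun k => sg ^ (3 + k) * al (3 + k)%nat * v (3 + k)%nat) + Series (fun k => sg ^ k * al k * (exp (- (2 * t * INR (k + 2))) * v (k + 3)))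
  = sg * X * Series (fun k => sg ^ (k + 2) * exp (- t * INR (k + 2)) * v (k + 3))).
{ rewrite <- Series_plus by assumption. rewrite <- Series_scal_l. apply Series_ext. intros k.
  replace (3 + k)%nat with (k + 3)%nat by lia. rewrite <- (al_rec k). set (n := INR (k + 2)). rewrite !pow_add. replace (sg ^ 3) with (sg * (sg * sg)) by ring. replace (sg ^ 2) with (sg * sg) by ring. rewrite S2.
  replace (- t * n) with (- (t * n)) by ring. replace (- (2 * t * n)) with (- (t * n) + - (t * n)) by ring. rewrite exp_plus, exp_Ropp.
  assert (P := exp_pos (t * n)).
  transitivity (v (k + 3) * sg ^ k * (sg * al (k + 3)%nat + (sg * sg) * (/ exp (t * n) * / exp (t * n)) * al k)). rewrite S2. ring. field. lra. }
set (A1 := Series (fun k => sg ^ (3 + k) * al (3 + k)%nat * v (3 + k)%nat)) in *.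
set (A2 := Series (fun k => sg ^ k * al k * (exp (- (2 * t * INR (k + 2))) * v (k + 3)))) in *.
set (y := fun n => sg ^ (n + 1) * exp (- t * INR (n + 1)) * v (n + 2)).
assert (Ey : ex_series y).
{ apply (ex_series_Rabs_le _ (fun n => V * exp (INR n * - t))).
  - intros n. unfold y. rewrite !Rabs_mult, SA, Rmult_1_l, Rabs_pos_eq by (left; apply exp_pos). rewrite Rmult_comm. apply Rmult_le_compat. apply Rabs_pos. left; apply exp_pos. apply v_bound.
    apply exp_le. rewrite plus_INR. simpl (INR 1). assert (A := pos_INR n). nra.
  - apply ex_series_exp. lra. }
assert (Y : Series y = sg * exp (- t) * v 2 + Series (fun k => sg ^ (k + 2) * exp (- t * INR (k + 2)) * v (k + 3))).
{ rewrite (Series_incr_1 y Ey). f_equal. unfold y. simpl. rewrite !Rmult_1_r. reflexivity.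
  apply Series_ext. intros k. unfold y. replace (S k + 1)%nat with (k + 2)%nat by lia. replace (S k + 2)%nat with (k + 3)%nat by lia. reflexivity. }
(* The conditions [al1] and [al2] eliminate two of the three leftover values; the [X] part of [al 2]
   supplies the initial term of [y]. *)
assert (Main : sum_f_R0 (fun k => sg ^ k * al k * v k) (pred 3) + A1 + A2 = al 0%nat * (v 0%nat - exp (- (2 * t)) * v 2%nat) + X / 2 * sg * (v 1%nat + 2 * Series y)).
{ replace (sum_f_R0 (fun k => sg ^ k * al k * v k) (pred 3)) with (al 0%nat * v 0%nat + sg * al 1%nat * v 1%nat + (sg * sg) * al 2%nat * v 2%nat) by (simpl; ring).
  rewrite S2. rewrite Rplus_assoc, Sum, Y, al1.
  assert (A : al 2%nat = exp (- t) * X - exp (- (2 * t)) * al 0%nat).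
  { rewrite <- al2. replace (- (2 * t)) with (- t + - t) by ring. rewrite exp_plus, exp_Ropp. assert (P := exp_pos t). field. lra. }
  rewrite A. transitivity (al 0%nat * v 0%nat + sg * (X / 2) * v 1%nat + ((sg * sg) * exp (- t) * X - exp (- (2 * t)) * al 0%nat) * v 2%nat + sg * X * Series (fun k => sg ^ (k + 2) * exp (- t * INR (k + 2)) * v (k + 3))).
  rewrite S2. ring. field. }
rewrite Main. f_equal.
- f_equal. unfold v. rewrite <- Series_scal_l, <- Series_minus.
  + apply Series_ext. intros i. unfold vt. simpl (INR 0). replace (INR 2) with 2 by (simpl; ring).
    replace (- t * (3 * INR i ^ 2 + 5 * INR i + 2)) with (- (2 * t) + - t * (2 * INR i * 2 + 3 * INR i ^ 2 + INR i)) by ring. rewrite exp_plus.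
    replace (2 * INR i * 0 + 3 * INR i ^ 2 + INR i) with (3 * INR i ^ 2 + INR i) by ring. ring.
  + apply vt_ex.
  + apply (ex_series_scal_l (exp (- (2 * t))) (vt 2)). apply vt_ex.
- f_equal.
  (* Summed over [n] first, the double series is geometric with ratio [rr i]. Together with [v 1]
     this gives [1 + 2 * rr / (1 - rr) = (1 + rr) / (1 - rr)]. *)
  set (x := fun n i : nat => sg ^ (n + 1) * exp (- t * INR (n + 1)) * vt (n + 2) i).
  assert (Ex1 : Series y = Series (fun n => Series (fun i => x n i))).
  { apply Series_ext. intros n. unfold y, v, x. rewrite Series_scal_l. reflexivity. }
  rewrite Ex1, (Series_swap x (fun n => 1 * exp (INR n * - t)) (fun i => 1 * exp (INR i * - t))).
  + assert (Es : forall i, Series (fun n => x n i) = (-1) ^ i * exp (- t * (3 * INR i ^ 2 + 3 * INR i)) * (rr i / (1 - rr i))).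
    { intros i. rewrite (Series_ext _ (fun n => ((-1) ^ i * exp (- t * (3 * INR i ^ 2 + 3 * INR i)) * rr i) * rr i ^ n)).
      - rewrite Series_scal_l. change (Series (pow (rr i))) with (Series (fun n => rr i ^ n)). rewrite Series_geom by apply rr_lt. unfold Rdiv. ring.
      - intros n. rewrite Rmult_assoc. replace (rr i * rr i ^ n) with (rr i ^ (n + 1)) by (rewrite Nat.add_1_r; reflexivity).
        unfold rr, x, vt. rewrite Rpow_mult_distr. rewrite <- (exp_INR_mul (n + 1)). rewrite !plus_INR. simpl (INR 1). replace (INR 2) with 2 by (simpl; ring).
        transitivity ((-1) ^ i * sg ^ (n + 1) * (exp (- t * (INR n + 1)) * exp (- t * (2 * INR i * (INR n + 2) + 3 * INR i ^ 2 + INR i)))). ring.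
        rewrite <- exp_plus. transitivity ((-1) ^ i * sg ^ (n + 1) * (exp (- t * (3 * INR i ^ 2 + 3 * INR i)) * exp ((INR n + 1) * (- t * (2 * INR i + 1))))).
        rewrite <- exp_plus. f_equal. f_equal. ring. ring. }
    rewrite (Series_ext _ _ Es). unfold v. rewrite <- Series_scal_l, <- Series_plus.
    * apply Series_ext. intros i. assert (R := rr_lt i). apply Rabs_def2 in R. unfold vt. simpl (INR 1).
      replace (2 * INR i * 1 + 3 * INR i ^ 2 + INR i) with (3 * INR i ^ 2 + 3 * INR i) by ring. field. lra.
    * apply vt_ex.
    * set (k := / (1 - exp (- t))).
      assert (et : exp (- t) < 1) by (rewrite <- exp_0; apply exp_increasing; lra).
      apply (ex_series_Rabs_le _ (fun i => 2 * k * exp (INR i * - t))); [|apply ex_series_exp; lra].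
      intros i. assert (A := pos_INR i).
      assert (Rk : Rabs (rr i) <= exp (- t)).
      { unfold rr. rewrite Rabs_mult. replace (Rabs sg) with 1 by (symmetry; rewrite <- (pow_1 sg); apply SA). rewrite Rmult_1_l, Rabs_pos_eq by (left; apply exp_pos). apply exp_le. nra. }
      assert (D : 1 - exp (- t) <= 1 - rr i). { apply Rabs_le_between in Rk. lra. }
      rewrite !Rabs_mult, m1_pow_abs, Rmult_1_l. rewrite (Rabs_pos_eq 2), (Rabs_pos_eq (exp _)) by (lra || (left; apply exp_pos)).
      assert (Q : Rabs (rr i / (1 - rr i)) <= k).
      { unfold Rdiv. rewrite Rabs_mult, (Rabs_pos_eq (/ (1 - rr i))) by (left; apply Rinv_0_lt_compat; lra). unfold k. rewrite <- (Rmult_1_l (/ (1 - exp (- t)))).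
        apply Rmult_le_compat. apply Rabs_pos. left; apply Rinv_0_lt_compat; lra. left; apply rr_lt. apply Rinv_le_contravar; lra. }
      assert (Q2 : exp (- t * (3 * INR i ^ 2 + 3 * INR i)) <= exp (INR i * - t)) by (apply exp_le; nra).
      assert (P2 := exp_pos (- t * (3 * INR i ^ 2 + 3 * INR i))). assert (P3 := Rabs_pos (rr i / (1 - rr i))).
      replace (2 * k * exp (INR i * - t)) with (2 * (exp (INR i * - t) * k)) by ring. apply Rmult_le_compat_l. lra. apply Rmult_le_compat; lra.
  + intros n i. unfold x. rewrite !Rabs_mult, SA, Rmult_1_l, Rabs_pos_eq by (left; apply exp_pos). apply Rmult_le_compat. left; apply exp_pos. apply Rabs_pos.
    rewrite Rmult_1_l. apply exp_le. rewrite plus_INR. simpl (INR 1). nra. apply vt_bound.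
  + intros. rewrite Rmult_1_l. left; apply exp_pos.
  + intros. rewrite Rmult_1_l. left; apply exp_pos.
  + apply ex_series_exp; lra.
  + apply ex_series_exp; lra.
Qed.
End AppellSum.

(** * Mordell integrals *)

(** [f] may have a wrong value at 0, as the quotient in [W3] has; [g] is its continuous version on
    the closed half-line, and one point does not change the integral. *)
Lemma RInt_gen_Int (f g : R -> R) K a : dom f K a -> (forall y, 0 <= y -> continuous g y) -> (forall y, 0 < y -> f y = g y) ->
  RInt_gen f (at_point 0) (Rbar_locally p_infty) = Int f.
Proof.
intros D Hc E. assert (Ha := dom_rate _ _ _ D).
assert (Dg : dom g K a) by (eapply dom_ext; eassumption).
assert (Ei : Int f = Int g) by (apply Int_ext; exact E).
apply is_RInt_gen_unique. rewrite Ei. intros P [eps HP].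
assert (L : exists M, forall Y, M < Y -> 0 < Y /\ K * exp (- a * Y) / a < eps).
{ assert (K0 := dom_nonneg _ _ _ Dg).
  destruct (exp_small (eps * a / (K + 1))) as [u [Hu Hu2]]. apply Rdiv_lt_0_compat. apply Rmult_lt_0_compat. apply cond_pos. exact Ha. lra.
  exists (- u / a). intros Y HY. assert (0 < - u / a) by (apply Rdiv_lt_0_compat; lra). split. lra.
  assert (exp (- a * Y) <= exp u). { apply exp_le. replace u with (- a * (- u / a)) by (field; lra). nra. }
  apply Rmult_lt_reg_r with a. exact Ha. replace (K * exp (- a * Y) / a * a) with (K * exp (- a * Y)) by (field; lra).
  assert (Q := exp_pos (- a * Y)).
  apply Rle_lt_trans with ((K + 1) * exp u). apply Rmult_le_compat; lra. apply Rlt_le_trans with ((K + 1) * (eps * a / (K + 1))). apply Rmult_lt_compat_l; lra. right; field; lra. }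
destruct L as [M HM].
apply (Filter_prod (at_point 0) (Rbar_locally p_infty) _ (fun x => x = 0) (fun Y => M < Y)).
- reflexivity.
- exists M. auto.
- intros x Y -> HY. destruct (HM Y HY) as [Y0 B]. simpl.
  exists (RInt g 0 Y). split.
  + apply (is_RInt_ext g). intros x. rewrite Rmin_left, Rmax_right by lra. intros Hx. symmetry. apply E. lra.
    apply (RInt_correct g). apply ex_RInt_cont. lra. intros; apply Hc; lra.
  + apply HP. change (Rabs (RInt g 0 Y - Int g) < eps). rewrite Rabs_minus_sym. eapply Rle_lt_trans; [|exact B]. apply (Int_err0 _ _ _ _ Dg Hc Y0).
Qed.

(** The two translates together make up the Gaussian on the whole line: by evenness, what one gains
    on [[- a, 0]] is what the other lacks on [[0, a]]. *)
Lemma gauss_translate s a : 0 < s -> 0 <= a ->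
  Int (fun x => exp (- s * (x - a) ^ 2) + exp (- s * (x + a) ^ 2)) = sqrt (PI / s).
Proof.
intros Hs Ha. set (g := fun x => exp (- s * x ^ 2)).
assert (Dg := dom_gauss s Hs). fold g in Dg. set (K := exp (/ (4 * s))) in *. assert (K0 : 0 < K) by apply exp_pos.
assert (cg : forall x, continuous g x) by (intros; apply continuous_derivable; unfold g; auto_derive; exact I).
set (h := fun x => g (x - a) + g (x + a)).
assert (ch : forall x, continuous h x) by (intros; apply continuous_derivable; unfold h, g; auto_derive; exact I).
assert (Gb : forall x, g x <= K * exp (- x)). { intros x. unfold g, K. rewrite <- exp_plus. apply exp_le. assert (T := gauss_exp_bound s x Hs). lra. }
assert (Dh : dom h (2 * K * exp a) 1).
{ split. lra. intros; apply ch. intros y Hy. unfold h.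
  assert (P1 : 0 < g (y - a)) by apply exp_pos. assert (P2 : 0 < g (y + a)) by apply exp_pos. rewrite Rabs_pos_eq by lra.
  assert (B1 := Gb (y - a)). assert (B2 := Gb (y + a)).
  replace (- (y - a)) with (a + - y) in B1 by ring. assert (exp (- (y + a)) <= exp (a + - y)) by (apply exp_le; lra).
  rewrite exp_plus in *. replace (- (1) * y) with (- y) by ring. nra. }
assert (E : Int h = 2 * Int g).
{ apply Rminus_diag_uniq. apply (exp_decay_zero _ (4 * K * exp a) 1 Rlt_0_1). intros Y0 HY0.
  set (Y := Y0 + a). assert (HY : 0 < Y) by (unfold Y; lra).
  assert (Eh := Int_err0 _ _ _ Y Dh ltac:(intros; apply ch) HY).
  assert (E1 := Int_err0 _ _ _ Y0 Dg ltac:(intros; apply cg) HY0).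
  assert (E2 := Int_err0 _ _ _ (Y + a) Dg ltac:(intros; apply cg) ltac:(lra)).
  assert (exg : forall p q, ex_RInt g p q) by (intros; apply (@ex_RInt_continuous R_CompleteNormedModule); intros; apply cg).
  assert (I1 : RInt (fun x => g (x - a)) 0 Y = RInt g (- a) Y0 :> R).
  { assert (L := RInt_comp_lin g 1 (- a) 0 Y (exg _ _)). replace (1 * 0 + - a) with (- a) in L by ring. replace (1 * Y + - a) with Y0 in L by (unfold Y; ring).
    rewrite <- L. apply rint_ext. lra. intros x _. unfold scal; simpl. unfold mult; simpl. rewrite !Rmult_1_l. reflexivity. }
  assert (I2 : RInt (fun x => g (x + a)) 0 Y = RInt g a (Y + a) :> R).
  { assert (L := RInt_comp_lin g 1 a 0 Y (exg _ _)). replace (1 * 0 + a) with a in L by ring. replace (1 * Y + a) with (Y + a) in L by ring.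
    rewrite <- L. apply rint_ext. lra. intros x _. unfold scal; simpl. unfold mult; simpl. rewrite !Rmult_1_l. reflexivity. }
  assert (I3 : RInt g (- a) 0 = RInt g 0 a :> R).
  { assert (L := RInt_comp_lin g (-1) 0 (- a) 0 (exg _ _)). replace (-1 * - a + 0) with a in L by ring. replace (-1 * 0 + 0) with 0 in L by ring.
    rewrite <- (opp_RInt_swap g 0 a) in L by apply exg.
    rewrite (rint_ext (fun y => scal (-1) (g (-1 * y + 0))) (fun y => -1 * g y)) in L.
    rewrite rint_scal in L by apply exg. assert (Q : forall p q : R, -1 * p = - q -> p = q) by (intros; lra). apply Q. exact L.
    lra. intros x _. unfold scal; simpl. unfold mult; simpl. f_equal. unfold g. f_equal. ring. }
  assert (Sum : RInt h 0 Y = RInt g 0 Y0 + RInt g 0 (Y + a) :> R).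
  { unfold h. rewrite (rint_plus (fun x => g (x - a)) (fun x => g (x + a))).
    rewrite I1, I2, <- (rint_Chasles g (- a) 0 Y0), <- (rint_Chasles g 0 a (Y + a)), I3 by apply exg. ring.
    apply ex_RInt_cont; [lra|]. intros; apply continuous_derivable; unfold g; auto_derive; exact I.
    apply ex_RInt_cont; [lra|]. intros; apply continuous_derivable; unfold g; auto_derive; exact I. }
  rewrite Sum in Eh. replace (- (1) * Y) with (- Y0 + - a) in Eh by (unfold Y; ring). rewrite exp_plus in Eh.
  replace (2 * K * exp a * (exp (- Y0) * exp (- a)) / 1) with (2 * K * exp (- Y0)) in Eh.
  2:{ rewrite (exp_Ropp a). assert (P := exp_pos a). field. lra. }
  replace (- (1) * Y0) with (- Y0) in * by ring.
  assert (Q1 : exp (- (1) * (Y + a)) <= exp (- Y0)) by (apply exp_le; unfold Y; lra).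
  assert (Q2 : 1 <= exp a) by (rewrite <- exp_0; apply exp_le; exact Ha). assert (Q3 := exp_pos (- Y0)).
  assert (Q4 : K * exp (- (1) * (Y + a)) <= K * exp (- Y0)) by (apply Rmult_le_compat_l; lra).
  assert (Q5 : K * exp (- Y0) <= K * exp a * exp (- Y0)). { rewrite <- (Rmult_1_r K) at 1. apply Rmult_le_compat_r. lra. apply Rmult_le_compat_l; lra. }
  unfold Rdiv in E1, E2. rewrite Rinv_1, Rmult_1_r in E1, E2.
  apply Rabs_le_between in Eh, E1, E2. apply Rabs_le. split; lra. }
change (Int h = sqrt (PI / s)). rewrite E. unfold g. rewrite (gauss_integral s Hs). field.
Qed.

Section Mordell.
Variable t : R.
Hypothesis Ht : 0 < t.
Let c := sqrt (3 * PI / t).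
Let Eg (z : R) := exp (- (t / 3) * z ^ 2).
(* 1/cosh for sg = 1 and 1/sinh for sg = -1 *)
Definition ker (sg x : R) : R := 2 / (exp x + sg * exp (- x)).
Definition mint (sg xi x : R) : R := (Eg (xi - x / t) + sg * Eg (xi + x / t)) * ker sg x.
Definition mordell (sg xi : R) : R := Int (mint sg xi).

Lemma ker_den sg x : (sg = 1 \/ sg = -1) -> 0 < x -> 0 < exp x + sg * exp (- x).
Proof.
intros H Hx. assert (Q := exp_pos (- x)). assert (exp (- x) < exp x) by (apply exp_increasing; lra).
destruct H as [->| ->]; lra.
Qed.
Lemma ker_plus x : ker 1 x = / cosh x.
Proof. unfold ker, cosh. assert (P := exp_pos x). assert (Q := exp_pos (- x)). field. lra. Qed.
Lemma ker_minus x : 0 < x -> ker (-1) x = / sinh x.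
Proof. intros Hx. unfold ker, sinh. assert (exp (- x) < exp x) by (apply exp_increasing; lra). field. lra. Qed.

Lemma Eg_even z : Eg (- z) = Eg z.
Proof. unfold Eg. f_equal. ring. Qed.
(** Tangent bound to the parabola at 3/8. The slope is such that the growth [exp (x / 4)] stays
    below the decay of both kernels while exponential decay in [xi] remains. *)
Lemma Eg_bound xi x : Eg (xi - x / t) <= exp (3 * t / 64) * exp (- (t / 4) * xi) * exp (x / 4).
Proof.
unfold Eg. rewrite <- !exp_plus. apply exp_le. set (z := xi - x / t).
replace (3 * t / 64 + - (t / 4) * xi + x / 4) with (3 * t / 64 - t / 4 * z) by (unfold z; field; lra).
assert (0 <= t / 3 * (z - 3/8) ^ 2). { apply Rmult_le_pos. lra. apply pow2_ge_0. } lra.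
Qed.
Lemma Eg_diff xi x : 0 <= xi -> 0 < x -> Eg (xi + x / t) = Eg (xi - x / t) * exp (- (4 * xi * x / 3)).
Proof. intros. unfold Eg. rewrite <- exp_plus. f_equal. field. lra. Qed.

(** One constant for both kernels: 4 serves 1/cosh, and [86 / t] exceeds the [256 / (3 * t)] that
    arises for 1/sinh. *)
Let Ct := (4 + 86 / t) * exp (3 * t / 64).

(** The decay in [xi] makes the sum over half-integers converge. For 1/sinh, the difference of the
    two Gaussians compensates the pole at 0 at the price of a factor [xi], which half of the decay
    [exp (- t * xi / 4)] absorbs. *)
Lemma dom_mint_pos sg xi : (sg = 1 \/ sg = -1) -> 0 <= xi -> dom (mint sg xi) (Ct * exp (- (t / 8) * xi)) (1/2).
Proof.
intros Hsg Hxi. assert (P86 : 0 < 86 / t) by (apply Rdiv_lt_0_compat; lra). assert (P3 := exp_pos (3 * t / 64)). split. lra.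
- intros y Hy. assert (D := ker_den sg y Hsg Hy). apply continuous_derivable. unfold mint, ker, Eg. auto_derive. repeat split; lra.
- intros x Hx. unfold mint. assert (B := Eg_bound xi x). assert (P0 : 0 < Eg (xi - x / t)) by apply exp_pos.
  rewrite (Eg_diff xi x Hxi Hx). set (d := 4 * xi * x / 3). assert (d0 : 0 <= d). { unfold d. assert (0 <= xi * x) by (apply Rmult_le_pos; lra). lra. }
  assert (ed : 0 < exp (- d) <= 1). { split. apply exp_pos. apply exp_neg_le1. lra. }
  assert (Split : exp (- (t / 4) * xi) = exp (- (t / 8) * xi) * exp (- (t / 8) * xi)) by (rewrite <- exp_plus; f_equal; field).
  set (u := exp (- (t / 8) * xi)) in *. assert (u0 : 0 < u) by apply exp_pos. assert (u1 : u <= 1) by (apply exp_neg_le1; nra).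
  destruct Hsg as [->| ->].
  + rewrite ker_plus. assert (Cb := cosh_inv_bound x). assert (Cp := Rinv_0_lt_compat _ (cosh_pos x)).
    rewrite Rmult_1_l, Rabs_pos_eq by (apply Rmult_le_pos; nra).
    apply Rle_trans with ((2 * (exp (3 * t / 64) * (u * u) * exp (x / 4))) * (2 * exp (- x))).
    { apply Rmult_le_compat; try lra. nra. rewrite Split in B. nra. }
    replace (2 * (exp (3 * t / 64) * (u * u) * exp (x / 4)) * (2 * exp (- x))) with (4 * exp (3 * t / 64) * (u * u) * exp (- (3/4) * x)).
    2:{ replace (- (3/4) * x) with (x / 4 + - x) by field. rewrite exp_plus. ring. }
    assert (X : exp (- (3/4) * x) <= exp (- (1/2) * x)) by (apply exp_le; lra). assert (X0 := exp_pos (- (3/4) * x)).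
    unfold Ct. apply Rmult_le_compat; try lra. apply Rmult_le_pos; nra.
    apply Rle_trans with (4 * exp (3 * t / 64) * u). apply Rmult_le_compat_l. lra. nra. apply Rmult_le_compat_r. lra. apply Rmult_le_compat_r; lra.
  + rewrite (ker_minus x Hx). assert (Sp := sinh_pos x Hx). assert (Si := Rinv_0_lt_compat _ Sp). assert (Rb := ratio_sinh_bound x Hx).
    assert (N : 0 <= 1 - exp (- d) <= d). { split. lra. assert (T := exp_ineq1_le (- d)). lra. }
    replace ((Eg (xi - x / t) + -1 * (Eg (xi - x / t) * exp (- d))) * / sinh x) with (Eg (xi - x / t) * ((1 - exp (- d)) * / sinh x)) by ring.
    assert (N2 : 0 <= (1 - exp (- d)) * / sinh x <= 4 * xi / 3 * (8 * exp (- (3/4) * x))).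
    { split. apply Rmult_le_pos; lra. apply Rle_trans with (d * / sinh x). apply Rmult_le_compat_r; lra.
      replace (d * / sinh x) with (4 * xi / 3 * (x / sinh x)) by (unfold d; field; lra). apply Rmult_le_compat_l; lra. }
    rewrite Rabs_pos_eq by (apply Rmult_le_pos; lra).
    apply Rle_trans with ((exp (3 * t / 64) * (u * u) * exp (x / 4)) * (4 * xi / 3 * (8 * exp (- (3/4) * x)))).
    { apply Rmult_le_compat; try lra. rewrite Split in B. exact B. }
    replace (exp (3 * t / 64) * (u * u) * exp (x / 4) * (4 * xi / 3 * (8 * exp (- (3/4) * x)))) with (32 / 3 * exp (3 * t / 64) * u * (xi * u) * exp (- (1/2) * x)).
    2:{ replace (- (1/2) * x) with (x / 4 + - (3/4) * x) by field. rewrite exp_plus. field. }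
    apply Rmult_le_compat_r. left; apply exp_pos.
    assert (xu : xi * u <= 8 / t).
    { assert (T := exp_ineq1_le (t / 8 * xi)). unfold u. replace (- (t / 8) * xi) with (- (t / 8 * xi)) by ring. rewrite exp_Ropp.
      assert (Q := exp_pos (t / 8 * xi)). apply Rmult_le_reg_r with (exp (t / 8 * xi)). exact Q. rewrite Rmult_assoc, Rinv_l, Rmult_1_r by lra.
      apply Rle_trans with (8 / t * (t / 8 * xi)). right; field; lra. apply Rmult_le_compat_l. left; apply Rdiv_lt_0_compat; lra. lra. }
    assert (0 <= xi * u) by (apply Rmult_le_pos; lra).
    apply Rle_trans with (32 / 3 * exp (3 * t / 64) * u * (8 / t)). apply Rmult_le_compat_l. apply Rmult_le_pos; lra. exact xu.
    unfold Ct. replace (32 / 3 * exp (3 * t / 64) * u * (8 / t)) with (256 / 3 / t * (exp (3 * t / 64) * u)) by (field; lra).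
    rewrite Rmult_assoc. apply Rmult_le_compat_r. apply Rmult_le_pos; lra.
    assert (256 / 3 / t <= 86 / t). { apply Rmult_le_compat_r. left; apply Rinv_0_lt_compat; exact Ht. lra. } lra.
Qed.

Lemma mint_opp sg xi x : (sg = 1 \/ sg = -1) -> mint sg (- xi) x = sg * mint sg xi x.
Proof.
intros H. unfold mint. replace (- xi - x / t) with (- (xi + x / t)) by ring. replace (- xi + x / t) with (- (xi - x / t)) by ring. rewrite !Eg_even.
destruct H as [->| ->]; ring.
Qed.

Lemma mordell_opp sg xi : (sg = 1 \/ sg = -1) -> 0 <= xi -> mordell sg (- xi) = sg * mordell sg xi.
Proof.
intros H Hxi. unfold mordell. rewrite (Int_ext (mint sg (- xi)) (fun x => sg * mint sg xi x)).
apply (Int_scal _ _ _ _ (dom_mint_pos sg xi H Hxi)). intros; apply mint_opp; exact H.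
Qed.

Lemma dom_mint sg xi : (sg = 1 \/ sg = -1) -> exists K, dom (mint sg xi) K (1/2).
Proof.
intros H. destruct (Rle_dec 0 xi) as [L|L].
- eexists. apply (dom_mint_pos sg xi H L).
- eexists. eapply dom_ext; [|apply (dom_scal _ sg _ _ (dom_mint_pos sg (- xi) H ltac:(lra)))].
  intros y Hy. cbv beta. rewrite <- (mint_opp sg (- xi) y H), Ropp_involutive. reflexivity.
Qed.

(** A shift of [xi] by 3/2, compensated by [exp (t * xi)] or its inverse, multiplies the Gaussians
    by [exp x] or [exp (- x)] and a constant. The combination contains the factor
    [exp x + sg * exp (- x)], which cancels the kernel and leaves a Gaussian integral. *)
Lemma mordell_shift sg xi : (sg = 1 \/ sg = -1) -> 0 <= xi ->
  exp (t * xi) * mordell sg (xi + 3/2) + sg * exp (- (t * xi)) * mordell sg (xi - 3/2) = 2 * t * c * exp (- (3 * t / 4)).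
Proof.
intros H Hxi. destruct (dom_mint sg (xi + 3/2) H) as [K1 D1]. destruct (dom_mint sg (xi - 3/2) H) as [K2 D2].
unfold mordell. rewrite <- (Int_scal _ (exp (t * xi)) _ _ D1), <- (Int_scal _ (sg * exp (- (t * xi))) _ _ D2).
rewrite <- (Int_plus _ _ _ _ _ _ (dom_scal _ (exp (t * xi)) _ _ D1) (dom_scal _ (sg * exp (- (t * xi))) _ _ D2)).
assert (PP := PI_RGT_0). assert (P3 : 0 < / (3 * t)) by (apply Rinv_0_lt_compat; lra).
assert (G := gauss_translate (/ (3 * t)) (t * xi) P3 ltac:(apply Rmult_le_pos; lra)).
assert (Ec : sqrt (PI / / (3 * t)) = t * c).
{ unfold c. replace (PI / / (3 * t)) with (t * t * (3 * PI / t)) by (field; lra). assert (0 < 3 * PI / t) by (apply Rdiv_lt_0_compat; lra). rewrite (sqrt_mult (t * t) (3 * PI / t)), sqrt_square by (first [lra|apply Rmult_le_pos; lra]). reflexivity. }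
rewrite Ec in G.
assert (DG : dom (fun x => exp (- / (3 * t) * (x - t * xi) ^ 2) + exp (- / (3 * t) * (x + t * xi) ^ 2)) (2 * exp (/ (4 * / (3 * t))) * exp (t * xi)) 1).
{ split. lra. intros y _. apply continuous_derivable. auto_derive. exact I.
  intros y Hy. assert (P1 := exp_pos (- / (3 * t) * (y - t * xi) ^ 2)). assert (P2 := exp_pos (- / (3 * t) * (y + t * xi) ^ 2)). rewrite Rabs_pos_eq by lra.
  assert (Q : 0 <= t * xi) by (apply Rmult_le_pos; lra).
  assert (B : forall z, y - t * xi <= z -> exp (- / (3 * t) * z ^ 2) <= exp (/ (4 * / (3 * t))) * exp (t * xi) * exp (- (1) * y)).
  { intros z Hz. rewrite <- !exp_plus. apply exp_le. assert (T := gauss_exp_bound (/ (3 * t)) z P3). lra. }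
  assert (B1 := B (y - t * xi) ltac:(lra)). assert (B2 := B (y + t * xi) ltac:(lra)). lra. }
transitivity (Int (fun x => 2 * exp (- (3 * t / 4)) * (exp (- / (3 * t) * (x - t * xi) ^ 2) + exp (- / (3 * t) * (x + t * xi) ^ 2)))).
2:{ rewrite (Int_scal _ _ _ _ DG), G. ring. }
apply Int_ext. intros x Hx. unfold mint.
assert (e1 : exp (- / (3 * t) * (x - t * xi) ^ 2) = Eg (xi - x / t)) by (unfold Eg; f_equal; field; lra).
assert (e2 : exp (- / (3 * t) * (x + t * xi) ^ 2) = Eg (xi + x / t)) by (unfold Eg; f_equal; field; lra).
rewrite e1, e2.
assert (f1 : exp (t * xi) * Eg (xi + 3/2 - x / t) = Eg (xi - x / t) * exp x * exp (- (3 * t / 4))) by (unfold Eg; rewrite <- !exp_plus; f_equal; field; lra).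
assert (f2 : exp (t * xi) * Eg (xi + 3/2 + x / t) = Eg (xi + x / t) * exp (- x) * exp (- (3 * t / 4))) by (unfold Eg; rewrite <- !exp_plus; f_equal; field; lra).
assert (f3 : exp (- (t * xi)) * Eg (xi - 3/2 - x / t) = Eg (xi - x / t) * exp (- x) * exp (- (3 * t / 4))) by (unfold Eg; rewrite <- !exp_plus; f_equal; field; lra).
assert (f4 : exp (- (t * xi)) * Eg (xi - 3/2 + x / t) = Eg (xi + x / t) * exp x * exp (- (3 * t / 4))) by (unfold Eg; rewrite <- !exp_plus; f_equal; field; lra).
transitivity (((exp (t * xi) * Eg (xi + 3/2 - x / t)) + sg * (exp (t * xi) * Eg (xi + 3/2 + x / t)) + sg * (exp (- (t * xi)) * Eg (xi - 3/2 - x / t)) + (sg * sg) * (exp (- (t * xi)) * Eg (xi - 3/2 + x / t))) * ker sg x). ring.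
rewrite f1, f2, f3, f4. replace (sg * sg) with 1 by (destruct H as [->| ->]; ring).
unfold ker. assert (D := ker_den sg x H Hx). field. lra.
Qed.

(** Euler's pentagonal series in q^2 for q = e^(-t), its terms of index [i] and [- (i + 1)] paired;
    [poch_lim] identifies it with (q^2;q^2)_oo. *)
Definition pent : R := Series (fun i => (-1) ^ i * (exp (- t * (3 * INR i ^ 2 + INR i)) - exp (- t * (3 * INR i ^ 2 + 5 * INR i + 2)))).

Definition lambert (sg : R) : R := Series (fun i => (-1) ^ i * exp (- 3 * t * (INR i + 1/2) ^ 2) *
  ((1 + sg * exp (- t * (2 * INR i + 1))) / (1 - sg * exp (- t * (2 * INR i + 1))))).

(** The q-side evaluation: [appell_sum] for the values at the half-integers, the recurrence being
    the shift equation centred at [n + 2]. *)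
Lemma mordell_sum sg : (sg = 1 \/ sg = -1) ->
  Series (fun k => sg ^ k * mordell sg (INR k + 1/2)) = mordell sg (1/2) * pent + t * c * sg * lambert sg.
Proof.
intros H. set (X := 2 * t * c * exp (- (3 * t / 4))).
assert (PCt : 0 < Ct). { unfold Ct. apply Rmult_lt_0_compat. assert (0 < 86 / t) by (apply Rdiv_lt_0_compat; lra). lra. apply exp_pos. }
rewrite (appell_sum t sg X (2 * Ct) (fun k => mordell sg (INR k + 1/2)) Ht H).
- simpl (INR 0). rewrite Rplus_0_l. fold pent. f_equal. unfold lambert, X.
  replace (2 * t * c * exp (- (3 * t / 4)) / 2 * sg) with (t * c * sg * exp (- (3 * t / 4))) by field.
  rewrite Rmult_assoc. f_equal. rewrite <- Series_scal_l. apply Series_ext. intros i.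
  replace (- 3 * t * (INR i + 1/2) ^ 2) with (- (3 * t / 4) + - t * (3 * INR i ^ 2 + 3 * INR i)) by field. rewrite exp_plus. ring.
- intros k. assert (Pk := pos_INR k). eapply Rle_trans. apply (Int_bound _ _ _ (dom_mint_pos sg (INR k + 1/2) H ltac:(lra))).
  replace (Ct * exp (- (t / 8) * (INR k + 1/2)) / (1/2)) with (2 * Ct * exp (- (t / 8) * (INR k + 1/2))) by field.
  apply Rmult_le_compat_l. lra. apply exp_le. nra.
- assert (S := mordell_shift sg 0 H ltac:(lra)). rewrite Rmult_0_r, Ropp_0, exp_0 in S.
  replace (0 - 3/2) with (- (3/2)) in S by ring. rewrite (mordell_opp sg (3/2) H ltac:(lra)), Rplus_0_l in S. fold X in S.
  simpl (INR 1). replace (1 + 1/2) with (3/2) by field.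
  assert (Q : sg * sg = 1) by (destruct H as [->| ->]; ring).
  replace (1 * mordell sg (3 / 2) + sg * 1 * (sg * mordell sg (3 / 2))) with (mordell sg (3/2) + (sg * sg) * mordell sg (3/2)) in S by ring. rewrite Q in S. lra.
- assert (S := mordell_shift sg 1 H ltac:(lra)). rewrite Rmult_1_r in S.
  replace (1 - 3/2) with (- (1/2)) in S by field. rewrite (mordell_opp sg (1/2) H ltac:(lra)) in S. fold X in S.
  simpl (INR 0). replace (INR 2) with 2 by (simpl; ring). rewrite Rplus_0_l. replace (2 + 1/2) with (1 + 3/2) by field.
  assert (Q : sg * sg = 1) by (destruct H as [->| ->]; ring). rewrite <- S.
  transitivity (exp t * mordell sg (1 + 3/2) + (sg * sg) * exp (- t) * mordell sg (1/2)). rewrite Q. ring. ring.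
- intros n. assert (Pn := pos_INR (n + 2)). assert (S := mordell_shift sg (INR (n + 2)) H Pn). fold X in S. rewrite <- S.
  replace (INR (n + 3) + 1/2) with (INR (n + 2) + 3/2) by (rewrite !plus_INR; simpl; field).
  replace (INR n + 1/2) with (INR (n + 2) - 3/2) by (rewrite !plus_INR; simpl; field). reflexivity.
Qed.

Lemma mordell_sum_Int sg : (sg = 1 \/ sg = -1) ->
  Series (fun k => sg ^ k * mordell sg (INR k + 1/2)) = Int (fun x => Series (fun k => sg ^ k * (Eg (INR k + 1/2 - x / t) + sg * Eg (INR k + 1/2 + x / t))) * ker sg x).
Proof.
intros H. assert (SA := proj2 (sign_cases sg H)).
assert (D : forall k, dom (fun x => sg ^ k * mint sg (INR k + 1/2) x) (Ct * exp (INR k * - (t / 8))) (1/2)).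
{ intros k. assert (Pk := pos_INR k). eapply dom_weaken; [apply (dom_scal _ (sg ^ k) _ _ (dom_mint_pos sg (INR k + 1/2) H ltac:(lra)))|lra|].
  rewrite SA, Rmult_1_l. apply Rmult_le_compat_l. unfold Ct. assert (0 < 86 / t) by (apply Rdiv_lt_0_compat; lra). assert (T := exp_pos (3 * t / 64)). nra. apply exp_le. nra. }
assert (S := Int_Series _ _ _ D (ex_series_exp (- (t / 8)) Ct ltac:(lra))).
apply is_series_unique in S.
rewrite (Series_ext _ (fun k => Int (fun x => sg ^ k * mint sg (INR k + 1/2) x))).
2:{ intros k. symmetry. assert (Pk := pos_INR k). apply (Int_scal _ _ _ _ (dom_mint_pos sg (INR k + 1/2) H ltac:(lra))). }
rewrite S. apply Int_ext. intros x _. rewrite <- Series_scal_r. apply Series_ext. intros k. unfold mint. ring.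
Qed.

(** The q_1-side series for 1/cosh, as the termwise Fourier transform delivers it; it turns out to
    be the numerator of f at q_1^2. Likewise [tanh_sum] for 1/sinh turns out to be a Lambert series
    at q_1. *)
Definition sech_sum : R := Series (fun n => theta_weight 1 n * ((-1) ^ n * exp (- 3 * PI ^ 2 * INR n ^ 2 / t)) / cosh (PI ^ 2 * INR n / t)).
Definition tanh_sum : R := Series (fun n => (-1) ^ n * exp (- 3 * PI ^ 2 * (INR n + 1/2) ^ 2 / t) * (sinh (PI ^ 2 * (INR n + 1/2) / t) / cosh (PI ^ 2 * (INR n + 1/2) / t))).

(** The q_1-side evaluation: under the integral the Gaussians sum to a theta series in [x / t],
    whose dual is a cosine series; each cosine is then integrated against 1/cosh. *)
Lemma dual_sum_plus : Series (fun k => 1 ^ k * mordell 1 (INR k + 1/2)) = c * (PI / 2) * sech_sum.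
Proof.
assert (PP := PI_RGT_0). assert (PP2 : 0 < PI ^ 2) by (apply pow_lt; lra). assert (Pt : 0 < PI ^ 2 / t) by (apply Rdiv_lt_0_compat; lra).
rewrite (mordell_sum_Int 1 (or_introl eq_refl)).
set (co := fun n : nat => theta_weight 1 n * ((-1) ^ n * exp (- 3 * PI ^ 2 * INR n ^ 2 / t))).
set (h := fun n x => co n * (cos (2 * PI * INR n / t * x) / cosh x)).
assert (Cb : forall n, Rabs (co n) <= 2 * exp (3 * PI ^ 2 / t) * exp (INR n * - (3 * PI ^ 2 / t))).
{ intros n. unfold co. rewrite !Rabs_mult, m1_pow_abs, Rmult_1_l, (Rabs_pos_eq (exp _)) by (left; apply exp_pos).
  replace (2 * exp (3 * PI ^ 2 / t) * exp (INR n * - (3 * PI ^ 2 / t))) with (2 * (exp (3 * PI ^ 2 / t) * exp (INR n * - (3 * PI ^ 2 / t)))) by ring.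
  apply Rmult_le_compat. apply Rabs_pos. left; apply exp_pos. unfold theta_weight. destruct n; rewrite Rabs_pos_eq; lra.
  rewrite <- exp_plus. apply exp_le. replace (- 3 * PI ^ 2 * INR n ^ 2 / t) with (- (3 * (PI ^ 2 / t)) * INR n ^ 2) by (field; lra). replace (3 * PI ^ 2 / t) with (3 * (PI ^ 2 / t)) by (field; lra).
  assert (0 <= 3 * (PI ^ 2 / t) * (INR n ^ 2 - INR n + 1)) by (apply Rmult_le_pos; nra). lra. }
assert (Ds : forall xi, dom (fun x => cos (xi * x) / cosh x) 2 1).
{ intros xi. split. lra. intros y _. apply continuous_derivable. assert (T := cosh_pos y). unfold cosh in *. auto_derive. lra.
  intros y _. unfold Rdiv. rewrite Rabs_mult. assert (T := Rinv_0_lt_compat _ (cosh_pos y)). rewrite (Rabs_pos_eq (/ cosh y)) by lra.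
  apply Rle_trans with (1 * / cosh y). apply Rmult_le_compat_r. lra. apply Rabs_le, COS_bound. rewrite Rmult_1_l. replace (- (1) * y) with (- y) by ring. apply cosh_inv_bound. }
assert (D : forall n, dom (h n) (4 * exp (3 * PI ^ 2 / t) * exp (INR n * - (3 * PI ^ 2 / t))) 1).
{ intros n. eapply dom_weaken; [apply (dom_scal _ (co n) _ _ (Ds (2 * PI * INR n / t)))|lra|]. specialize (Cb n). lra. }
assert (S := Int_Series _ _ _ D (ex_series_exp (- (3 * PI ^ 2 / t)) (4 * exp (3 * PI ^ 2 / t)) ltac:(lra))).
apply is_series_unique in S.
assert (DS := dom_Series _ _ _ D (ex_series_exp (- (3 * PI ^ 2 / t)) (4 * exp (3 * PI ^ 2 / t)) ltac:(lra))).
transitivity (c * Int (fun y => Series (fun n => h n y))).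
- rewrite <- (Int_scal _ c _ _ DS). apply Int_ext. intros x Hx. rewrite ker_plus.
  transitivity (Series (fun k => Eg (INR k + 1/2 - x / t) + Eg (INR k + 1/2 + x / t)) * / cosh x).
  f_equal. apply Series_ext; intros; rewrite pow1; ring.
  unfold Eg. rewrite (theta_plus t Ht (x / t)). fold c. rewrite Rmult_assoc. f_equal. rewrite <- Series_scal_r. apply Series_ext. intros n. unfold h, co, Rdiv. rewrite Rmult_assoc. f_equal. f_equal. f_equal. ring.
- rewrite <- S. rewrite Rmult_assoc. f_equal. unfold sech_sum. rewrite <- Series_scal_l. apply Series_ext. intros n. unfold h.
  rewrite (Int_scal _ _ _ _ (Ds (2 * PI * INR n / t))), sech_transform. fold (co n).
  replace (PI * (2 * PI * INR n / t) / 2) with (PI ^ 2 * INR n / t) by (field; lra). assert (T := cosh_pos (PI ^ 2 * INR n / t)). field. lra.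
Qed.

Lemma dual_sum_minus : Series (fun k => (-1) ^ k * mordell (-1) (INR k + 1/2)) = c * PI * tanh_sum.
Proof.
assert (PP := PI_RGT_0). assert (PP2 : 0 < PI ^ 2) by (apply pow_lt; lra). assert (Pt : 0 < PI ^ 2 / t) by (apply Rdiv_lt_0_compat; lra).
rewrite (mordell_sum_Int (-1) (or_intror eq_refl)).
set (co := fun n : nat => 2 * ((-1) ^ n * exp (- 3 * PI ^ 2 * (INR n + 1/2) ^ 2 / t))).
set (xi := fun n : nat => 2 * PI * (INR n + 1/2) / t).
set (h := fun n x => co n * (sin (xi n * x) / sinh x)).
set (r := PI ^ 2 / t) in *.
(* The majorant of [sin (xi * x) / sinh x] grows linearly in the frequency;
   [2 * r * z <= exp (2 * r * z)] hands this growth to the Gaussian coefficient. *)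
assert (Cb : forall n, Rabs (co n) * (8 * Rabs (xi n)) <= 16 / PI * exp r * exp (INR n * - r)).
{ intros n. assert (Pn := pos_INR n). unfold co. rewrite !Rabs_mult, m1_pow_abs, Rmult_1_l, (Rabs_pos_eq 2), (Rabs_pos_eq (exp _)) by (lra || (left; apply exp_pos)).
  assert (Px : 0 < xi n) by (apply Rdiv_lt_0_compat; [apply Rmult_lt_0_compat; lra|exact Ht]). rewrite (Rabs_pos_eq (xi n)) by lra.
  replace (- 3 * PI ^ 2 * (INR n + 1/2) ^ 2 / t) with (- (3 * r * (INR n + 1/2) ^ 2)) by (unfold r; field; lra).
  assert (Ex : xi n = 2 / PI * (r * (INR n + 1/2))) by (unfold xi, r; field; lra).
  set (z := INR n + 1/2) in *. assert (B := exp_ineq1_le (2 * r * z)).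
  rewrite Ex.
  apply Rle_trans with (16 / PI * (exp (2 * r * z) * exp (- (3 * r * z ^ 2)))).
  - replace (2 * exp (- (3 * r * z ^ 2)) * (8 * (2 / PI * (r * z)))) with (16 / PI * ((2 * r * z) * exp (- (3 * r * z ^ 2)))) by (field; lra).
    apply Rmult_le_compat_l. left; apply Rdiv_lt_0_compat; lra. apply Rmult_le_compat_r. left; apply exp_pos. lra.
  - replace (16 / PI * exp r * exp (INR n * - r)) with (16 / PI * (exp r * exp (INR n * - r))) by ring.
    apply Rmult_le_compat_l. left; apply Rdiv_lt_0_compat; lra. rewrite <- !exp_plus. apply exp_le. replace (INR n) with (z - 1/2) by (unfold z; ring).
    assert (0 <= r * (3 * z ^ 2 - 2 * z - (z - 1/2) + 1)); [|lra].
    apply Rmult_le_pos. lra. nra. }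
assert (D : forall n, dom (h n) (16 / PI * exp r * exp (INR n * - r)) (3/4)).
{ intros n. eapply dom_weaken; [apply (dom_scal _ (co n) _ _ (dom_csch (xi n)))|lra|apply Cb]. }
assert (S := Int_Series _ _ _ D (ex_series_exp (- r) (16 / PI * exp r) ltac:(lra))).
apply is_series_unique in S.
assert (DS := dom_Series _ _ _ D (ex_series_exp (- r) (16 / PI * exp r) ltac:(lra))).
transitivity (c * Int (fun y => Series (fun n => h n y))).
- rewrite <- (Int_scal _ c _ _ DS). apply Int_ext. intros x Hx. rewrite (ker_minus x Hx).
  transitivity (Series (fun k => (-1) ^ k * (Eg (INR k + 1/2 - x / t) - Eg (INR k + 1/2 + x / t))) * / sinh x).
  f_equal. apply Series_ext; intros; ring.
  unfold Eg. rewrite (theta_minus t Ht (x / t)). fold c. rewrite Rmult_assoc. f_equal. rewrite <- Series_scal_r. apply Series_ext. intros n. unfold h, co, xi, Rdiv. rewrite Rmult_assoc. f_equal. f_equal. f_equal. ring.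
- rewrite <- S. rewrite Rmult_assoc. f_equal. unfold tanh_sum. rewrite <- Series_scal_l. apply Series_ext. intros n. unfold h.
  rewrite (Int_scal _ _ _ _ (dom_csch (xi n))), csch_transform. unfold co.
  replace (PI * xi n / 2) with (PI ^ 2 * (INR n + 1/2) / t) by (unfold xi; field; lra). assert (T := cosh_pos (PI ^ 2 * (INR n + 1/2) / t)). field. lra.
Qed.
End Mordell.

(** * Inversion of the Lambert series *)

(** At [xi = 1/2] the two Gaussians are a common one times [exp (x / 3)] and [exp (- x / 3)].
    Rescaling [x] by 3 produces the quotients in [W2] and [W3]; [r] is the quotient continued to
    0. *)
Lemma mordell_half (t sg : R) (r g : R -> R) : 0 < t -> (sg = 1 \/ sg = -1) ->
  (forall x, 0 < x -> (exp x + sg * exp (- x)) / (exp (3 * x) + sg * exp (- (3 * x))) = r x) ->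
  (forall x, continuous r x) -> (forall x, Rabs (r x) <= 1) ->
  (forall x, 0 < x -> g x = exp (- 3 * x ^ 2 / t) * r x) ->
  mordell t sg (1/2) = 6 * exp (- (t / 12)) * RInt_gen g (at_point 0) (Rbar_locally p_infty).
Proof.
intros Ht H Hr Hc Hb Hg. assert (P3 : 0 < 3 / t) by (apply Rdiv_lt_0_compat; lra).
assert (D : dom (fun x => r x * exp (- (3 / t) * x ^ 2)) (1 * exp (/ (4 * (3 / t)))) 1).
{ apply (dom_mult_bounded _ r _ _ 1 (dom_gauss (3 / t) P3)). intros; apply Hc. intros; apply Hb. }
assert (Eg : forall x, 0 < x -> r x * exp (- (3 / t) * x ^ 2) = g x).
{ intros x Hx. rewrite (Hg x Hx). replace (- 3 * x ^ 2 / t) with (- (3 / t) * x ^ 2) by (field; lra). ring. }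
assert (Dg : dom g (1 * exp (/ (4 * (3 / t)))) 1) by (eapply dom_ext; [exact Eg|exact D]).
rewrite (RInt_gen_Int g (fun x => r x * exp (- (3 / t) * x ^ 2)) _ _ Dg).
2:{ intros y _. apply @continuous_mult. apply Hc. apply continuous_derivable. auto_derive. exact I. }
2:{ intros y Hy. symmetry. apply Eg, Hy. }
assert (S := Int_scale g _ _ (1/3) Dg ltac:(lra)).
assert (Ds : dom (fun y => g (1/3 * y)) (1 * exp (/ (4 * (3 / t)))) (1/3)).
{ split. lra. intros y Hy. apply (continuous_comp (fun y => 1/3 * y) g). apply continuous_derivable. auto_derive. exact I. apply (dom_cont _ _ _ Dg). lra.
  intros y Hy. eapply Rle_trans. apply (dom_bound _ _ _ Dg). lra. right. f_equal. f_equal. field. }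
transitivity (2 * exp (- (t / 12)) * Int (fun y => g (1/3 * y))).
2:{ rewrite S. field. }
rewrite <- (Int_scal _ _ _ _ Ds). unfold mordell. apply Int_ext. intros x Hx. rewrite (Hg (1/3 * x) ltac:(lra)). rewrite <- (Hr (1/3 * x) ltac:(lra)).
unfold mint, ker.
replace (exp (- (t / 3) * (1 / 2 - x / t) ^ 2)) with (exp (- (t / 12)) * exp (- 3 * (1/3 * x) ^ 2 / t) * exp (1/3 * x)) by (rewrite <- !exp_plus; f_equal; field; lra).
replace (exp (- (t / 3) * (1 / 2 + x / t) ^ 2)) with (exp (- (t / 12)) * exp (- 3 * (1/3 * x) ^ 2 / t) * exp (- (1/3 * x))) by (rewrite <- !exp_plus; f_equal; field; lra).
replace (3 * (1/3 * x)) with x by field. assert (K := ker_den sg x H Hx). field. lra.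
Qed.

Lemma mordell_W3 t : 0 < t -> mordell t (-1) (1/2) = 6 * t * exp (- (t / 12)) * W3 t.
Proof.
intros Ht. unfold W3.
(* [sinh (3 * x) = sinh x * (1 + 2 * cosh (2 * x))], so this is the continuous version of the
   quotient, with value 1/3 at 0. *)
set (r := fun x => / (1 + 2 * cosh (2 * x))).
assert (Q : forall x, 0 < 1 + 2 * cosh (2 * x)) by (intros x; assert (T := cosh_pos (2 * x)); lra).
assert (Qr : forall x, 0 < x -> (exp x + -1 * exp (- x)) / (exp (3 * x) + -1 * exp (- (3 * x))) = r x).
{ intros x Hx. assert (L : exp (- (3 * x)) < exp (3 * x)) by (apply exp_increasing; lra). unfold r. specialize (Q x). unfold cosh in *.
  apply Rmult_eq_reg_r with ((exp (3 * x) + -1 * exp (- (3 * x))) * (1 + 2 * ((exp (2 * x) + exp (- (2 * x))) / 2))).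
  2:{ apply Rgt_not_eq. apply Rmult_lt_0_compat; lra. }
  transitivity ((exp x + -1 * exp (- x)) * (1 + (exp (2 * x) + exp (- (2 * x))))). field. lra.
  transitivity (exp (3 * x) + -1 * exp (- (3 * x))); [|field; lra].
  replace (exp (3 * x)) with (exp x * exp (2 * x)) by (rewrite <- exp_plus; f_equal; ring).
  replace (exp (- (3 * x))) with (exp (- x) * exp (- (2 * x))) by (rewrite <- exp_plus; f_equal; ring).
  replace (exp (2 * x)) with (exp x * exp x) by (rewrite <- exp_plus; f_equal; ring). replace (exp (- (2 * x))) with (exp (- x) * exp (- x)) by (rewrite <- exp_plus; f_equal; ring).
  rewrite exp_Ropp. assert (P := exp_pos x). field. lra. }
rewrite (mordell_half t (-1) r (fun x => exp (- 3 * x ^ 2 / t) * (sinh x / sinh (3 * x))) Ht (or_intror eq_refl) Qr).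
- field. lra.
- intros x. apply continuous_derivable. unfold r. specialize (Q x). unfold cosh in *. auto_derive. lra.
- intros x. unfold r. rewrite Rabs_pos_eq by (left; apply Rinv_0_lt_compat, Q). rewrite <- Rinv_1. apply Rinv_le_contravar. lra. assert (T := cosh_pos (2 * x)). lra.
- intros x Hx. f_equal. rewrite <- (Qr x Hx). unfold sinh. assert (L : exp (- (3 * x)) < exp (3 * x)) by (apply exp_increasing; lra). field. lra.
Qed.

Lemma mordell_W2 t : 0 < t -> mordell t 1 (1/2) = 3 * t * exp (- (t / 12)) * W2 (t / 2).
Proof.
intros Ht. unfold W2.
set (r := fun x => cosh x / cosh (3 * x)).
rewrite (mordell_half t 1 r (fun x => exp (- (3 / 2) * x ^ 2 / (t / 2)) * (cosh x / cosh (3 * x))) Ht (or_introl eq_refl)).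
- field. lra.
- intros x _. unfold r, cosh. assert (P := exp_pos (3 * x)). assert (P' := exp_pos (- (3 * x))). field. lra.
- intros x. apply continuous_derivable. unfold r. assert (T := cosh_pos (3 * x)). unfold cosh in *. auto_derive. lra.
- intros x. unfold r. assert (T := cosh_pos x). assert (T3 := cosh_pos (3 * x)). rewrite Rabs_pos_eq by (left; apply Rdiv_lt_0_compat; assumption).
  apply Rmult_le_reg_r with (cosh (3 * x)). exact T3. unfold Rdiv. rewrite Rmult_assoc, Rinv_l, Rmult_1_r, Rmult_1_l by lra.
  assert (E : cosh (3 * x) = cosh x * (1 + 4 * sinh x ^ 2)).
  { unfold cosh, sinh. replace (exp (3 * x)) with (exp x * exp x * exp x) by (rewrite <- !exp_plus; f_equal; ring).
    replace (exp (- (3 * x))) with (exp (- x) * exp (- x) * exp (- x)) by (rewrite <- !exp_plus; f_equal; ring). rewrite exp_Ropp. assert (P := exp_pos x). field. lra. }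
  rewrite E. assert (0 <= sinh x ^ 2) by apply pow2_ge_0. nra.
- intros x Hx. unfold r. f_equal. f_equal. field. lra.
Qed.

Lemma pent_eta t : pent t = exp (t / 12) * eta t.
Proof.
unfold pent, eta. rewrite <- Series_scal_l. apply Series_ext. intros i.
replace (- t * (3 * INR i ^ 2 + INR i)) with (t / 12 + - 3 * t * (INR i + 1/6) ^ 2) by field.
replace (- t * (3 * INR i ^ 2 + 5 * INR i + 2)) with (t / 12 + - 3 * t * (INR i + 5/6) ^ 2) by field. rewrite !exp_plus. ring.
Qed.

(** (1 - e^(-2z)) / (1 + e^(-2z)) is the hyperbolic tangent of z. This is why omega(-q) is
    transformed into itself. *)
Lemma tanh_sum_lambert t : 0 < t -> tanh_sum t = lambert (PI ^ 2 / t) (-1).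
Proof.
intros Ht. unfold tanh_sum, lambert. apply Series_ext. intros n.
replace (- 3 * (PI ^ 2 / t) * (INR n + 1/2) ^ 2) with (- 3 * PI ^ 2 * (INR n + 1/2) ^ 2 / t) by (field; lra). f_equal.
set (z := PI ^ 2 * (INR n + 1/2) / t). replace (- (PI ^ 2 / t) * (2 * INR n + 1)) with (- z + - z) by (unfold z; field; lra).
rewrite exp_plus. unfold sinh, cosh. assert (P := exp_pos z). rewrite exp_Ropp.
field. repeat split; try nra.
Qed.

Lemma sqrt_ratio t : 0 < t -> sqrt (3 * PI / t) * sqrt (3 * t / PI) = 3 /\ sqrt (12 * t / PI) = 2 * sqrt (3 * t / PI) /\
  sqrt (PI / t) = PI / t * sqrt (t / PI) /\ sqrt (PI / (4 * t)) = PI / (2 * t) * sqrt (t / PI).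
Proof.
intros Ht. assert (PP := PI_RGT_0).
assert (A : 0 < 3 * PI / t) by (apply Rdiv_lt_0_compat; lra). assert (B : 0 < 3 * t / PI) by (apply Rdiv_lt_0_compat; lra).
assert (C1 : 0 < PI / (2 * t)) by (apply Rdiv_lt_0_compat; lra).
split; [|split; [|split]].
- rewrite <- sqrt_mult by lra. replace (3 * PI / t * (3 * t / PI)) with (3 * 3) by (field; lra). apply sqrt_square. lra.
- replace (12 * t / PI) with (2 * 2 * (3 * t / PI)) by (field; lra). rewrite (sqrt_mult (2 * 2)), sqrt_square by lra. reflexivity.
- replace (PI / t) with ((PI / t) * (PI / t) * (t / PI)) at 1 by (field; lra). rewrite (sqrt_mult ((PI / t) * (PI / t))), sqrt_square by (first [lra|apply Rmult_le_pos; lra]). reflexivity.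
- replace (PI / (4 * t)) with ((PI / (2 * t)) * (PI / (2 * t)) * (t / PI)) at 1 by (field; lra). rewrite (sqrt_mult ((PI / (2 * t)) * (PI / (2 * t)))), sqrt_square by (first [lra|apply Rmult_le_pos; lra]). reflexivity.
Qed.

(** Equate the two evaluations of the alternating sum of Mordell integrals and divide by [t * c];
    the product [c * d = 3] turns the coefficient of [W3] into the stated root. *)
Theorem lambert_minus_inversion t : 0 < t ->
  lambert t (-1) = - (PI / t) * lambert (PI ^ 2 / t) (-1) + sqrt (12 * t / PI) * W3 t * eta t.
Proof.
intros Ht. assert (PP := PI_RGT_0).
assert (S := mordell_sum t Ht (-1) (or_intror eq_refl)). rewrite (dual_sum_minus t Ht), (tanh_sum_lambert t Ht), (mordell_W3 t Ht), pent_eta in S.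
destruct (sqrt_ratio t Ht) as [Q1 [Q2 _]]. rewrite Q2.
set (c := sqrt (3 * PI / t)) in *. set (d := sqrt (3 * t / PI)) in *. assert (Pc : 0 < c) by (apply sqrt_lt_R0, Rdiv_lt_0_compat; lra).
replace (6 * t * exp (- (t / 12)) * W3 t * (exp (t / 12) * eta t)) with (6 * t * W3 t * eta t) in S by (rewrite exp_Ropp; assert (P := exp_pos (t / 12)); field; lra).
assert (Ed : d = 3 / c) by (rewrite <- Q1; field; lra). rewrite Ed.
apply Rmult_eq_reg_l with (t * c); [|apply Rgt_not_eq, Rmult_lt_0_compat; lra].
transitivity (- (c * PI * lambert (PI ^ 2 / t) (-1)) + 6 * t * W3 t * eta t). lra. field. split; lra.
Qed.

Theorem lambert_plus_inversion t : 0 < t ->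
  lambert t 1 = PI / (2 * t) * sech_sum t - sqrt (3 * t / PI) * W2 (t / 2) * eta t.
Proof.
intros Ht. assert (PP := PI_RGT_0).
assert (S := mordell_sum t Ht 1 (or_introl eq_refl)). rewrite (dual_sum_plus t Ht), (mordell_W2 t Ht), pent_eta in S.
destruct (sqrt_ratio t Ht) as [Q1 _].
set (c := sqrt (3 * PI / t)) in *. set (d := sqrt (3 * t / PI)) in *. assert (Pc : 0 < c) by (apply sqrt_lt_R0, Rdiv_lt_0_compat; lra).
replace (3 * t * exp (- (t / 12)) * W2 (t / 2) * (exp (t / 12) * eta t)) with (3 * t * W2 (t / 2) * eta t) in S by (rewrite exp_Ropp; assert (P := exp_pos (t / 12)); field; lra).
assert (Ed : d = 3 / c) by (rewrite <- Q1; field; lra). rewrite Ed.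
apply Rmult_eq_reg_l with (t * c); [|apply Rgt_not_eq, Rmult_lt_0_compat; lra].
transitivity (c * (PI / 2) * sech_sum t - 3 * t * W2 (t / 2) * eta t). lra. field. split; lra.
Qed.

(** * Euler's pentagonal number theorem *)

Section Pentagonal.
Variable t : R.
Hypothesis Ht : 0 < t.
Fixpoint poch (n : nat) : R := match n with O => 1 | S n => poch n * (1 - exp (- (2 * t * INR (S n)))) end.

Lemma poch_factor n : 0 < 1 - exp (- (2 * t * INR (S n))) < 1.
Proof. assert (P := exp_pos (- (2 * t * INR (S n)))). assert (exp (- (2 * t * INR (S n))) < 1). { apply exp_lt_1. assert (T := pos_INR n). rewrite S_INR. nra. } lra. Qed.
Lemma poch_pos n : 0 < poch n.
Proof. induction n. simpl. lra. change (0 < poch n * (1 - exp (- (2 * t * INR (S n))))). assert (F := poch_factor n). nra. Qed.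
Lemma poch_decr k n : poch (k + n) <= poch n.
Proof. induction k. simpl. lra. change (poch (k + n) * (1 - exp (- (2 * t * INR (S (k + n))))) <= poch n). assert (F := poch_factor (k + n)). assert (P := poch_pos (k + n)). nra. Qed.

(* Shanks' finite form of Euler's pentagonal number theorem *)
Let T (n k : nat) := (-1) ^ k * (poch n / poch k) * exp (- t * (2 * INR k * INR n + INR k * (INR k + 1))).
Let V (n k : nat) := (-1) ^ k * (poch n / poch k) * exp (- t * (2 * (INR k + 1) * INR n + (INR k + 1) * (INR k + 2))).

Lemma shanks_step m j : sum_n (fun k => T (S m) k - T m k) j = - V m j.
Proof.
induction j.
- rewrite sum_O. unfold T, V. change (poch (S m)) with (poch m * (1 - exp (- (2 * t * INR (S m))))). rewrite S_INR. simpl.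
  replace (- t * (2 * 0 * (INR m + 1) + 0 * (0 + 1))) with 0 by ring. replace (- t * (2 * 0 * INR m + 0 * (0 + 1))) with 0 by ring.
  replace (- t * (2 * (0 + 1) * INR m + (0 + 1) * (0 + 2))) with (- (2 * t * (INR m + 1))) by ring. rewrite exp_0. field.
- rewrite sum_Sn, IHj. change (- V m j + (T (S m) (S j) - T m (S j)) = - V m (S j)). unfold T, V.
  change (poch (S m)) with (poch m * (1 - exp (- (2 * t * INR (S m))))). change (poch (S j)) with (poch j * (1 - exp (- (2 * t * INR (S j))))). rewrite !S_INR.
  assert (F := poch_factor j). rewrite S_INR in F. assert (Pj := poch_pos j).
  set (a := INR j) in *. set (b := INR m).
  set (x := exp (- (2 * t * (a + 1)))) in *. set (y := exp (- (2 * t * (b + 1)))).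
  set (w := exp (- t * (2 * (a + 1) * b + (a + 1) * (a + 2)))).
  replace (exp (- t * (2 * (a + 1) * (b + 1) + (a + 1) * (a + 1 + 1)))) with (w * x) by (unfold w, x; rewrite <- exp_plus; f_equal; ring).
  replace (exp (- t * (2 * (a + 1) * b + (a + 1) * (a + 1 + 1)))) with w by (unfold w; f_equal; ring).
  replace (exp (- t * (2 * (a + 1 + 1) * b + (a + 1 + 1) * (a + 1 + 2)))) with (w * x * y) by (unfold w, x, y; rewrite <- !exp_plus; f_equal; ring).
  simpl pow. field. split; lra.
Qed.

Let pt (i : nat) := (-1) ^ i * (exp (- t * (3 * INR i ^ 2 + INR i)) - exp (- t * (3 * INR i ^ 2 + 5 * INR i + 2))).

(** In passing from [n] to [n + 1], the boundary term [V n n] cancels the old correction, and the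
    new diagonal term of [T] is the first half of [pt (n + 1)]; the missing second half is the new
    correction. *)
Lemma shanks n : sum_n (T n) n = sum_n pt n + (-1) ^ n * exp (- t * (3 * INR n ^ 2 + 5 * INR n + 2)).
Proof.
induction n.
- rewrite !sum_O. unfold T, pt. simpl. replace (- t * (2 * 0 * 0 + 0 * (0 + 1))) with 0 by ring. replace (- t * (3 * (0 * (0 * 1)) + 0)) with 0 by ring. rewrite exp_0. field.
- assert (S1 := shanks_step n n).
  assert (E : sum_n (T (S n)) n = sum_n (T n) n - V n n).
  { assert (L := sum_n_plus (T n) (fun k => T (S n) k - T n k) n). rewrite S1 in L. change (sum_n (fun k => T n k + (T (S n) k - T n k)) n = sum_n (T n) n + - V n n) in L.
    rewrite (sum_n_ext _ (T (S n))) in L. rewrite L. reflexivity. assert (Q : forall x y : R, x + (y - x) = y) by (intros; ring). intros k. apply Q. }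
  rewrite !sum_Sn. change (sum_n (T (S n)) n + T (S n) (S n) = sum_n pt n + pt (S n) + (-1) ^ S n * exp (- t * (3 * INR (S n) ^ 2 + 5 * INR (S n) + 2))).
  rewrite E, IHn. unfold V, T, pt. assert (P := poch_pos n). assert (P' := poch_pos (S n)).
  rewrite !S_INR. set (a := INR n).
  replace (poch n / poch n) with 1 by (field; lra). replace (poch (S n) / poch (S n)) with 1 by (field; lra).
  replace (- t * (2 * (a + 1) * a + (a + 1) * (a + 2))) with (- t * (3 * a ^ 2 + 5 * a + 2)) by ring.
  replace (- t * (2 * (a + 1) * (a + 1) + (a + 1) * (a + 1 + 1))) with (- t * (3 * (a + 1) ^ 2 + (a + 1))) by ring.
  simpl pow. ring.
Qed.

(** In Shanks' identity the term [k = 0] is [poch n] itself; the other terms and the correction are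
    of order [exp (- n * t)]. *)
Lemma poch_lim : is_lim_seq poch (pent t).
Proof.
assert (Ept : ex_series pt).
{ apply (ex_series_Rabs_le _ (fun i => 2 * exp (INR i * - t))); [|apply ex_series_exp; lra]. intros i. assert (Pi := pos_INR i).
  unfold pt. rewrite Rabs_mult, m1_pow_abs, Rmult_1_l.
  assert (A := exp_pos (- t * (3 * INR i ^ 2 + INR i))). assert (B := exp_pos (- t * (3 * INR i ^ 2 + 5 * INR i + 2))).
  assert (A1 : exp (- t * (3 * INR i ^ 2 + INR i)) <= exp (INR i * - t)) by (apply exp_le; nra).
  assert (B1 : exp (- t * (3 * INR i ^ 2 + 5 * INR i + 2)) <= exp (INR i * - t)) by (apply exp_le; nra). apply Rabs_le. lra. }
assert (L1 : is_lim_seq (sum_n pt) (pent t)) by apply (Series_correct pt Ept).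
set (C := Series (fun k => 1 * exp (INR k * - t))).
assert (EC : ex_series (fun k => 1 * exp (INR k * - t))) by (apply ex_series_exp; lra).
assert (Bd : forall n, Rabs (poch n - sum_n pt n) <= (C + 1) * exp (INR n * - t)).
{ intros n. assert (Sh := shanks n). assert (Pn := pos_INR n).
  assert (T0 : forall n, T n 0%nat = poch n). { intros m. unfold T. simpl. replace (- t * (2 * 0 * INR m + 0 * (0 + 1))) with 0 by ring. rewrite exp_0. field. }
  assert (R1 : Rabs (sum_n (T n) n - poch n) <= C * exp (INR n * - t)).
  { assert (G : forall N, (N <= n)%nat -> Rabs (sum_n (T n) N - poch n) <= exp (INR n * - t) * sum_n (fun k => 1 * exp (INR k * - t)) N).
    { induction N; intros HN. rewrite !sum_O, T0, Rminus_diag, Rabs_R0. apply Rmult_le_pos. left; apply exp_pos. rewrite Rmult_1_l. left; apply exp_pos.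
      rewrite !sum_Sn. change (Rabs (sum_n (T n) N + T n (S N) - poch n) <= exp (INR n * - t) * (sum_n (fun k => 1 * exp (INR k * - t)) N + 1 * exp (INR (S N) * - t))).
      replace (sum_n (T n) N + T n (S N) - poch n) with ((sum_n (T n) N - poch n) + T n (S N)) by ring.
      eapply Rle_trans. apply Rabs_triang. rewrite Rmult_plus_distr_l. apply Rplus_le_compat. apply IHN. lia.
      unfold T. rewrite !Rabs_mult, m1_pow_abs, Rmult_1_l, Rmult_1_l. rewrite (Rabs_pos_eq (exp _)) by (left; apply exp_pos).
      assert (Pq : 0 < poch (S N)) by apply poch_pos. assert (Pp : 0 < poch n) by apply poch_pos.
      assert (Dr : poch n <= poch (S N)). { assert (D := poch_decr (n - S N) (S N)). replace (n - S N + S N)%nat with n in D by lia. exact D. }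
      rewrite Rabs_pos_eq by (left; apply Rdiv_lt_0_compat; assumption).
      assert (Q : poch n / poch (S N) <= 1). { apply Rmult_le_reg_r with (poch (S N)). exact Pq. unfold Rdiv. rewrite Rmult_assoc, Rinv_l; lra. }
      rewrite <- exp_plus. rewrite <- (Rmult_1_l (exp (INR n * - t + _))). apply Rmult_le_compat. left; apply Rdiv_lt_0_compat; assumption. left; apply exp_pos. exact Q.
      apply exp_le. rewrite S_INR. assert (Pk := pos_INR N). assert (0 <= INR N * INR n) by (apply Rmult_le_pos; assumption). nra. }
    eapply Rle_trans. apply (G n). lia. rewrite Rmult_comm. apply Rmult_le_compat_r. left; apply exp_pos.
    unfold C. assert (Tl := series_tail (fun k => 1 * exp (INR k * - t)) (fun k => 1 * exp (INR k * - t)) n ltac:(intros; rewrite Rabs_pos_eq; [lra|rewrite Rmult_1_l; left; apply exp_pos]) EC).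
    assert (Ab := Rabs_pos (Series (fun k => 1 * exp (INR k * - t)) - sum_n (fun k => 1 * exp (INR k * - t)) n)). lra. }
  assert (R2 : Rabs ((-1) ^ n * exp (- t * (3 * INR n ^ 2 + 5 * INR n + 2))) <= exp (INR n * - t)).
  { rewrite Rabs_mult, m1_pow_abs, Rmult_1_l, Rabs_pos_eq by (left; apply exp_pos). apply exp_le. nra. }
  apply Rabs_le_between in R1, R2. apply Rabs_le. lra. }
apply is_lim_seq_ext with (fun n => sum_n pt n + (poch n - sum_n pt n)). intros; ring.
replace (Finite (pent t)) with (Finite (pent t + 0)) by (f_equal; ring). apply is_lim_seq_plus'. exact L1.
apply is_lim_seq_abs_0. apply is_lim_seq_le_le with (fun _ => 0) (fun n => (C + 1) * exp (INR n * - t)).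
- intros n. split. apply Rabs_pos. apply Bd.
- apply is_lim_seq_const.
- apply (ex_series_lim_0 (fun n => (C + 1) * exp (INR n * - t))). apply ex_series_exp. lra.
Qed.
End Pentagonal.

(** * Existence *)

(** The reciprocal 1/(z;z)_n. Working with reciprocals from the start spares a proof that the
    infinite product has no zeros. *)
Fixpoint pprod (n : nat) (z : C) : C := match n with O => 1 | S n => (pprod n z / (1 - z ^ S n))%C end.

(* 1/(z;z)_oo as the telescoping sum of the differences of its partial products *)
Definition euler_inv (z : C) : C := (1 + CSeries (fun n => z ^ S n * pprod (S n) z))%C.

(** The numerator in Watson's formula for omega, the denominator being (z^2;z^2)_oo. *)
Definition omega_num (z : C) : C :=
  CSeries (fun l => RtoC ((-1) ^ l) * z ^ (3 * l * (l + 1)) * ((1 + z ^ (2 * l + 1)) / (1 - z ^ (2 * l + 1))))%C.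

(* the pentagonal number k(3k+1)/2 for k = n+1 *)
Fixpoint pexp (n : nat) : nat := match n with O => 2 | S n => pexp n + 3 * n + 5 end.

(** The numerator in Watson's formula for f, 1 + 4 sum over k >= 1 of (-1)^k z^(k(3k+1)/2) / (1 +
    z^k); the index [n] stands for k = n + 1. *)
Definition f_num (z : C) : C :=
  (1 + CSeries (fun n => RtoC (4 * (-1) ^ S n) * z ^ pexp n * / (1 + z ^ S n)))%C.

(* The Appell-Lerch forms of Ramanujan's third order mock theta functions. *)
Definition omega_sol (z : C) : C := (omega_num z * euler_inv (z ^ 2))%C.
Definition f_sol (z : C) : C := (f_num z * euler_inv z)%C.

Lemma Cmod_pow_le z r n : Cmod z <= r -> r < 1 -> (0 < n)%nat -> Cmod (z ^ n) <= r.
Proof.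
intros Hz Hr Hn. assert (P := Cmod_ge_0 z). rewrite Cmod_pow. destruct n as [|n]. lia. simpl.
assert (Cmod z ^ n <= 1) by (rewrite <- (pow1 n); apply pow_incr; lra). assert (0 <= Cmod z ^ n) by (apply pow_le; exact P). nra.
Qed.

Lemma Cmod_one_minus_ge (w : C) : 1 - Cmod w <= Cmod (1 - w).
Proof. assert (T := Cmod_triangle (1 - w) w). replace (1 - w + w)%C with (RtoC 1) in T by ring. rewrite Cmod_1 in T. lra. Qed.
Lemma Cmod_one_plus_ge (w : C) : 1 - Cmod w <= Cmod (1 + w).
Proof. assert (T := Cmod_one_minus_ge (- w)). rewrite Cmod_opp in T. replace (1 - - w)%C with (1 + w)%C in T by ring. exact T. Qed.

Lemma one_minus_pow_neq z n : Cmod z < 1 -> (0 < n)%nat -> (1 - z ^ n)%C <> 0.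
Proof. intros Hz Hn. apply Cmod_gt_0. assert (A := Cmod_one_minus_ge (z ^ n)). assert (B := Cmod_pow_le z (Cmod z) n (Rle_refl _) Hz Hn). lra. Qed.
Lemma one_plus_pow_neq z n : Cmod z < 1 -> (0 < n)%nat -> (1 + z ^ n)%C <> 0.
Proof. intros Hz Hn. apply Cmod_gt_0. assert (A := Cmod_one_plus_ge (z ^ n)). assert (B := Cmod_pow_le z (Cmod z) n (Rle_refl _) Hz Hn). lra. Qed.

Lemma cdiff_zpow n (z : C) : cdiff (fun w => w ^ n)%C z.
Proof. apply (cdiff_pow (fun w => w)), cdiff_id. Qed.

Lemma holo_pprod n : holo (pprod n).
Proof.
induction n; intros z Hz. apply cdiff_const.
apply (cdiff_div (pprod n) (fun z => 1 - z ^ S n)%C). apply IHn, Hz. apply cdiff_minus. apply cdiff_const. apply cdiff_zpow. apply one_minus_pow_neq. exact Hz. lia.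
Qed.

(** Each factor is at most [1 + r ^ k / (1 - r)], hence at most [exp (r ^ k / (1 - r))]. The
    exponents form a geometric sum, kept in closed form for the induction. *)
Lemma pprod_bound r n z : 0 < r < 1 -> Cmod z <= r -> Cmod (pprod n z) <= exp ((1 - r ^ n) * (r / (1 - r) ^ 2)).
Proof.
intros Hr Hz. induction n. simpl. rewrite Cmod_1, Rminus_diag, Rmult_0_l, exp_0. lra.
change (Cmod (pprod n z / (1 - z ^ S n)) <= exp ((1 - r ^ S n) * (r / (1 - r) ^ 2))).
rewrite Cmod_div by (apply one_minus_pow_neq; [lra|lia]).
set (x := r ^ S n). assert (Hx : 0 < x <= r). { unfold x. split. apply pow_lt; lra. simpl. assert (r ^ n <= 1) by (rewrite <- (pow1 n); apply pow_incr; lra). assert (0 <= r ^ n) by (apply pow_le; lra). nra. }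
assert (D : 1 - x <= Cmod (1 - z ^ S n)).
{ eapply Rle_trans; [|apply Cmod_one_minus_ge]. assert (Cmod (z ^ S n) <= x). { rewrite Cmod_pow. apply pow_incr. split. apply Cmod_ge_0. exact Hz. } lra. }
replace ((1 - x) * (r / (1 - r) ^ 2)) with ((1 - r ^ n) * (r / (1 - r) ^ 2) + x / (1 - r)).
2:{ unfold x. simpl. field. lra. }
rewrite exp_plus. apply Rmult_le_compat. apply Cmod_ge_0. left; apply Rinv_0_lt_compat; lra. exact IHn.
apply Rle_trans with (/ (1 - x)). apply Rinv_le_contravar; lra.
apply Rle_trans with (1 + x / (1 - r)).
- replace (/ (1 - x)) with (1 + x / (1 - x)) by (field; lra). apply Rplus_le_compat_l. apply Rmult_le_compat_l. lra. apply Rinv_le_contravar; lra.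
- apply exp_ineq1_le.
Qed.

Lemma pprod_unif r : 0 < r < 1 -> exists K, 0 <= K /\ forall n z, Cmod z <= r -> Cmod (pprod n z) <= K.
Proof.
intros Hr. exists (exp (r / (1 - r) ^ 2)). split. left; apply exp_pos. intros n z Hz. eapply Rle_trans. apply (pprod_bound r n z Hr Hz). apply exp_le.
assert (P : 0 <= r / (1 - r) ^ 2). { apply Rdiv_le_0_compat. lra. apply pow_lt; lra. }
assert (0 < r ^ n) by (apply pow_lt; lra). nra.
Qed.

Lemma ex_series_geo r K : 0 < r < 1 -> ex_series (fun n => K * r ^ n).
Proof. intros Hr. apply (ex_series_scal_l K (fun n => r ^ n)). apply ex_series_geom. rewrite Rabs_pos_eq; lra. Qed.

Lemma euler_term_bound r : 0 < r < 1 -> exists K, 0 <= K /\ forall n z, Cmod z <= r -> Cmod (z ^ S n * pprod (S n) z) <= K * r ^ n.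
Proof.
intros Hr. destruct (pprod_unif r Hr) as [K [K0 HK]]. exists K. split. exact K0. intros n z Hz. rewrite Cmod_mult, Cmod_pow, Rmult_comm.
apply Rmult_le_compat. apply Cmod_ge_0. apply pow_le, Cmod_ge_0. apply HK, Hz. assert (P := Cmod_ge_0 z).
apply Rle_trans with (r ^ S n). apply pow_incr; lra. simpl. assert (0 < r ^ n) by (apply pow_lt; lra). nra.
Qed.

Lemma holo_euler_inv : holo euler_inv.
Proof.
assert (H : holo (fun z => CSeries (fun n => z ^ S n * pprod (S n) z)%C)).
{ apply (holo_CSeries (fun n z => z ^ S n * pprod (S n) z)%C).
  - intros n. apply holo_mult. intros z _. apply cdiff_zpow. apply holo_pprod.
  - intros r Hr. destruct (euler_term_bound r Hr) as [K [_ HK]]. exists (fun n => K * r ^ n). split. apply ex_series_geo, Hr. intros n z Hz. apply HK, Hz. }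
intros z Hz. apply cdiff_plus. apply cdiff_const. apply H, Hz.
Qed.

Lemma pow_le_pow r m n : 0 < r < 1 -> (m <= n)%nat -> r ^ n <= r ^ m.
Proof.
intros Hr Hmn. replace n with (m + (n - m))%nat by lia. rewrite pow_add. assert (0 < r ^ m) by (apply pow_lt; lra).
assert (r ^ (n - m) <= 1) by (rewrite <- (pow1 (n - m)); apply pow_incr; lra). nra.
Qed.

Lemma Cmod_pow_le_pow z r m n : 0 < r < 1 -> Cmod z <= r -> (m <= n)%nat -> Cmod (z ^ n) <= r ^ m.
Proof.
intros Hr Hz Hmn. rewrite Cmod_pow. eapply Rle_trans; [|apply (pow_le_pow r m n Hr Hmn)]. apply pow_incr. split. apply Cmod_ge_0. exact Hz.
Qed.

Lemma Cmod_m1pow n : Cmod (RtoC ((-1) ^ n)) = 1.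
Proof. rewrite Cmod_R. apply m1_pow_abs. Qed.

Lemma omega_term_bound r l z : 0 < r < 1 -> Cmod z <= r ->
  Cmod (RtoC ((-1) ^ l) * z ^ (3 * l * (l + 1)) * ((1 + z ^ (2 * l + 1)) / (1 - z ^ (2 * l + 1)))) <= 2 / (1 - r) * r ^ l.
Proof.
intros Hr Hz. assert (N := one_minus_pow_neq z (2 * l + 1) ltac:(lra) ltac:(lia)).
rewrite !Cmod_mult, Cmod_m1pow, Rmult_1_l, (Cmod_div _ _ N), Rmult_comm.
assert (B := Cmod_pow_le z r (2 * l + 1) Hz ltac:(lra) ltac:(lia)).
apply Rmult_le_compat. apply Rdiv_le_0_compat. apply Cmod_ge_0. apply Cmod_gt_0, N. apply Cmod_ge_0.
- apply Rmult_le_compat. apply Cmod_ge_0. left; apply Rinv_0_lt_compat, Cmod_gt_0, N.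
  eapply Rle_trans. apply Cmod_triangle. rewrite Cmod_1. lra.
  apply Rinv_le_contravar. lra. eapply Rle_trans; [|apply Cmod_one_minus_ge]. lra.
- apply Cmod_pow_le_pow; try assumption. nia.
Qed.

Lemma holo_omega_num : holo omega_num.
Proof.
apply (holo_CSeries (fun l z => RtoC ((-1) ^ l) * z ^ (3 * l * (l + 1)) * ((1 + z ^ (2 * l + 1)) / (1 - z ^ (2 * l + 1))))%C).
- intros l z Hz. apply cdiff_mult. apply cdiff_mult. apply cdiff_const. apply cdiff_zpow. apply cdiff_div.
  apply cdiff_plus. apply cdiff_const. apply cdiff_zpow. apply cdiff_minus. apply cdiff_const. apply cdiff_zpow. apply one_minus_pow_neq. exact Hz. lia.
- intros r Hr. exists (fun l => 2 / (1 - r) * r ^ l). split. apply ex_series_geo, Hr. intros l z Hz. apply omega_term_bound; assumption.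
Qed.

Lemma pexp_ge n : (n <= pexp n)%nat.
Proof. induction n; simpl; lia. Qed.
Lemma pexp_val n : 2 * INR (pexp n) = (INR n + 1) * (3 * INR n + 4).
Proof. induction n. simpl. ring. change (pexp (S n)) with (pexp n + 3 * n + 5)%nat. rewrite !plus_INR, mult_INR, (S_INR n). replace (INR 3) with 3 by (simpl; ring). replace (INR 5) with 5 by (simpl; ring). replace (2 * (INR (pexp n) + 3 * INR n + 5)) with (2 * INR (pexp n) + 6 * INR n + 10) by ring. rewrite IHn. ring. Qed.

Lemma f_term_bound r n z : 0 < r < 1 -> Cmod z <= r ->
  Cmod (RtoC (4 * (-1) ^ S n) * z ^ pexp n * / (1 + z ^ S n)) <= 4 / (1 - r) * r ^ n.
Proof.
intros Hr Hz. assert (N := one_plus_pow_neq z (S n) ltac:(lra) ltac:(lia)).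
rewrite !Cmod_mult, RtoC_mult, Cmod_mult, Cmod_m1pow, Rmult_1_r, Cmod_R, (Rabs_pos_eq 4), (Cmod_inv _ N) by lra.
assert (B := Cmod_pow_le z r (S n) Hz ltac:(lra) ltac:(lia)).
replace (4 / (1 - r) * r ^ n) with (4 * r ^ n * / (1 - r)) by (field; lra).
apply Rmult_le_compat. apply Rmult_le_pos. lra. apply Cmod_ge_0. left; apply Rinv_0_lt_compat, Cmod_gt_0, N.
apply Rmult_le_compat_l. lra. apply Cmod_pow_le_pow; try assumption. apply pexp_ge.
apply Rinv_le_contravar. lra. eapply Rle_trans; [|apply Cmod_one_plus_ge]. lra.
Qed.

Lemma holo_f_num : holo f_num.
Proof.
assert (H : holo (fun z => CSeries (fun n => RtoC (4 * (-1) ^ S n) * z ^ pexp n * / (1 + z ^ S n))%C)).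
{ apply (holo_CSeries (fun n z => RtoC (4 * (-1) ^ S n) * z ^ pexp n * / (1 + z ^ S n))%C).
  - intros n z Hz. apply (cdiff_div (fun z => RtoC (4 * (-1) ^ S n) * z ^ pexp n)%C (fun z => 1 + z ^ S n)%C). apply cdiff_mult. apply cdiff_const. apply cdiff_zpow.
    apply cdiff_plus. apply cdiff_const. apply cdiff_zpow. apply one_plus_pow_neq. exact Hz. lia.
  - intros r Hr. exists (fun n => 4 / (1 - r) * r ^ n). split. apply ex_series_geo, Hr. intros n z Hz. apply f_term_bound; assumption. }
intros z Hz. apply cdiff_plus. apply cdiff_const. apply H, Hz.
Qed.

Lemma holo_omega_sol : holo omega_sol.
Proof.
apply holo_mult. apply holo_omega_num. intros z Hz. apply (cdiff_comp euler_inv (fun z => z ^ 2)%C). apply holo_euler_inv.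
rewrite Cmod_pow. assert (P := Cmod_ge_0 z). nra. apply cdiff_zpow.
Qed.
Lemma holo_f_sol : holo f_sol.
Proof. apply holo_mult. apply holo_f_num. apply holo_euler_inv. Qed.

Lemma CSeries_RtoC (a : nat -> R) : CSeries (fun n => RtoC (a n)) = RtoC (Series a).
Proof. unfold CSeries. simpl. rewrite Series_zero. reflexivity. Qed.

(** The uniform bound on the reciprocals keeps [poch] away from 0, which makes the limit [pent t]
    positive, a fact its alternating series does not show. The defining sum of [euler_inv] then
    telescopes. *)
Lemma euler_inv_value t : 0 < t -> 0 < pent t /\ euler_inv (RtoC (exp (- (2 * t)))) = RtoC (/ pent t).
Proof.
intros Ht. set (q := exp (- (2 * t))). assert (Hq : 0 < q < 1) by (split; [apply exp_pos|apply exp_lt_1; lra]).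
assert (Pp := poch_pos t Ht).
assert (Pq : forall n, q ^ n = exp (- (2 * t * INR n))). { intros n. unfold q. rewrite <- exp_INR_mul. f_equal. ring. }
assert (Ev : forall n, pprod n (RtoC q) = RtoC (/ poch t n)).
{ induction n. simpl. rewrite Rinv_1. reflexivity.
  change (pprod (S n) (RtoC q)) with (pprod n (RtoC q) / (1 - RtoC q ^ S n))%C. rewrite IHn, <- RtoC_pow, <- RtoC_minus, <- RtoC_div.
  f_equal. rewrite Pq. change (poch t (S n)) with (poch t n * (1 - exp (- (2 * t * INR (S n))))). assert (F := poch_factor t Ht n). specialize (Pp n). field. lra.
  rewrite Pq. assert (F := poch_factor t Ht n). lra. }
destruct (pprod_unif q Hq) as [K [K0 HK]].
assert (Low : forall n, / (K + 1) <= poch t n).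
{ intros n. specialize (HK n (RtoC q) ltac:(rewrite Cmod_R, Rabs_pos_eq; lra)). rewrite Ev, Cmod_R, Rabs_pos_eq in HK by (left; apply Rinv_0_lt_compat, Pp).
  rewrite <- (Rinv_inv (poch t n)). apply Rinv_le_contravar. apply Rinv_0_lt_compat, Pp. lra. }
assert (L := poch_lim t Ht).
assert (PK : 0 < / (K + 1)) by (apply Rinv_0_lt_compat; lra).
assert (Pos : 0 < pent t).
{ apply Rlt_le_trans with (/ (K + 1)). exact PK. assert (LL := is_lim_seq_le (fun _ => / (K + 1)) (poch t) (/ (K + 1)) (pent t) Low (is_lim_seq_const _) L). exact LL. }
split. exact Pos.
unfold euler_inv. rewrite (CSeries_ext _ (fun n => RtoC (q ^ S n * / poch t (S n)))).
2:{ intros n. rewrite Ev, <- RtoC_pow, <- RtoC_mult. reflexivity. }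
rewrite CSeries_RtoC, <- RtoC_plus. f_equal.
assert (Sr : is_series (fun n => q ^ S n * / poch t (S n)) (/ pent t - 1)).
{ change (is_lim_seq (sum_n (fun n => q ^ S n * / poch t (S n))) (/ pent t - 1)).
  assert (Sm : forall N, sum_n (fun n => q ^ S n * / poch t (S n)) N = / poch t (S N) - 1).
  { assert (St : forall n, q ^ S n * / poch t (S n) = / poch t (S n) - / poch t n).
    { intros n. rewrite Pq. change (poch t (S n)) with (poch t n * (1 - exp (- (2 * t * INR (S n))))). assert (F := poch_factor t Ht n). specialize (Pp n). field. lra. }
    induction N. rewrite sum_O, St. simpl poch at 2. rewrite Rinv_1. reflexivity.
    rewrite sum_Sn, IHN, St. unfold plus; simpl. ring. }
  apply (is_lim_seq_ext (fun N => / poch t (S N) - 1)). intros; symmetry; apply Sm.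
  apply is_lim_seq_minus'; [|apply is_lim_seq_const].
  apply (is_lim_seq_inv (fun N => poch t (S N)) (pent t)). apply (is_lim_seq_incr_1 (poch t)). exact L.
  intros E. injection E as E. lra. }
rewrite (is_series_unique _ _ Sr). ring.
Qed.

Lemma omega_num_value t sg : 0 < t -> (sg = 1 \/ sg = -1) -> omega_num (RtoC (sg * exp (- t))) = RtoC (exp (3 * t / 4) * lambert t sg).
Proof.
intros Ht H. unfold omega_num, lambert. rewrite <- Series_scal_l, <- CSeries_RtoC. apply CSeries_ext. intros l.
assert (S2 : sg * sg = 1) by (destruct H as [->| ->]; ring).
assert (Ev : forall k, sg ^ (2 * k) = 1). { intros k. rewrite pow_mult. replace (sg ^ 2) with (sg * sg) by ring. rewrite S2. apply pow1. }
assert (E1 : (sg * exp (- t)) ^ (2 * l + 1) = sg * exp (- t * (2 * INR l + 1))).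
{ rewrite Rpow_mult_distr, pow_add, Ev, pow_1, Rmult_1_l, <- exp_INR_mul. f_equal. f_equal. rewrite plus_INR, mult_INR. simpl. ring. }
assert (E2 : (sg * exp (- t)) ^ (3 * l * (l + 1)) = exp (- t * (3 * INR l ^ 2 + 3 * INR l))).
{ rewrite Rpow_mult_distr.
  (* The exponent [3 * l * (l + 1)] is even, so the sign of the argument survives only in the odd
     powers [2 * l + 1]. *)
  assert (Hev : exists k, (3 * l * (l + 1) = 2 * k)%nat). { destruct (Nat.Even_or_Odd l) as [[m ->]|[m ->]]. exists (3 * m * (2 * m + 1))%nat. lia. exists (3 * (2 * m + 1) * (m + 1))%nat. lia. }
  destruct Hev as [k Hk]. rewrite Hk at 1. rewrite Ev, Rmult_1_l, <- exp_INR_mul. f_equal. rewrite !mult_INR, plus_INR. simpl. ring. }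
assert (D : 1 - sg * exp (- t * (2 * INR l + 1)) <> 0).
{ assert (P := exp_pos (- t * (2 * INR l + 1))). assert (Q : exp (- t * (2 * INR l + 1)) < 1). { apply exp_lt_1. assert (T := pos_INR l). nra. } destruct H as [->| ->]; lra. }
rewrite <- !RtoC_pow, E1, E2, <- RtoC_plus, <- RtoC_minus, <- RtoC_div by exact D. rewrite <- !RtoC_mult. f_equal.
replace (- 3 * t * (INR l + 1/2) ^ 2) with (- (3 * t / 4) + - t * (3 * INR l ^ 2 + 3 * INR l)) by field. rewrite exp_plus, exp_Ropp.
assert (P := exp_pos (3 * t / 4)). field. split; lra.
Qed.

(** The prefactor q^(2/3) is what completing the square leaves: 3/4 from the numerator minus 1/12
    from the pentagonal series. *)
Lemma omega_sol_value t sg : 0 < t -> (sg = 1 \/ sg = -1) ->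
  (RtoC (exp (- (2 / 3 * t))) * omega_sol (RtoC (sg * exp (- t))))%C = RtoC (lambert t sg / eta t).
Proof.
intros Ht H. unfold omega_sol. rewrite (omega_num_value t sg Ht H).
destruct (euler_inv_value t Ht) as [Pos E].
replace (RtoC (sg * exp (- t)) ^ 2)%C with (RtoC (exp (- (2 * t)))).
2:{ rewrite <- RtoC_pow. f_equal. rewrite Rpow_mult_distr. replace (sg ^ 2) with 1 by (destruct H as [->| ->]; ring). rewrite Rmult_1_l, <- exp_INR_mul. f_equal. simpl. ring. }
rewrite E, <- !RtoC_mult. f_equal. rewrite pent_eta in *. assert (P12 := exp_pos (t / 12)).
assert (He : eta t <> 0) by (intros Z; rewrite Z, Rmult_0_r in Pos; lra).
replace (3 * t / 4) with (t / 12 + 2 / 3 * t) by field. rewrite exp_plus, exp_Ropp. assert (P23 := exp_pos (2 / 3 * t)). field. repeat split; lra.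
Qed.

(** 1/cosh z equals 2 e^(-z) / (1 + e^(-2z)). This 2 and the theta weight 2 make the coefficient 4,
    and the factor e^(-z) completes the Gaussian exponent to a pentagonal number. *)
Lemma f_num_value t : 0 < t -> f_num (RtoC (exp (- (2 * (PI ^ 2 / t))))) = RtoC (sech_sum t).
Proof.
intros Ht. set (tau := PI ^ 2 / t). assert (PP := PI_RGT_0). assert (Ptau : 0 < tau) by (apply Rdiv_lt_0_compat; [apply pow_lt|]; lra).
set (a := fun n : nat => theta_weight 1 n * ((-1) ^ n * exp (- 3 * PI ^ 2 * INR n ^ 2 / t)) / cosh (PI ^ 2 * INR n / t)).
assert (Ea : forall n, a (S n) = 4 * (-1) ^ S n * (exp (- (2 * tau)) ^ pexp n * / (1 + exp (- (2 * tau)) ^ S n))).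
{ intros n. unfold a, theta_weight. rewrite <- !exp_INR_mul.
  replace (INR (pexp n) * - (2 * tau)) with (- (2 * INR (pexp n)) * tau) by ring. rewrite pexp_val, S_INR. set (x := INR n + 1).
  replace (- 3 * PI ^ 2 * x ^ 2 / t) with (- (3 * tau * x ^ 2)) by (unfold tau; field; lra). replace (PI ^ 2 * x / t) with (tau * x) by (unfold tau; field; lra).
  replace (- (x * (3 * INR n + 4)) * tau) with (- (3 * tau * x ^ 2) + - (tau * x)) by (unfold x; ring).
  replace (x * - (2 * tau)) with (- (tau * x) + - (tau * x)) by ring. rewrite !exp_plus. unfold cosh. rewrite !(exp_Ropp (tau * x)).
  assert (P := exp_pos (tau * x)). field. repeat split; nra. }
assert (Ex : ex_series a).
{ apply ex_series_incr_1. apply (ex_series_Rabs_le _ (fun n => 4 * exp (- (2 * tau)) ^ n)).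
  - intros n. rewrite Ea. set (q := exp (- (2 * tau))). assert (Hq : 0 < q < 1) by (split; [apply exp_pos|apply exp_lt_1; lra]).
    assert (Q1 : 0 < q ^ S n) by (apply pow_lt; lra). assert (Q2 : 0 < q ^ pexp n) by (apply pow_lt; lra).
    rewrite !Rabs_mult, m1_pow_abs, (Rabs_pos_eq 4), (Rabs_pos_eq (q ^ pexp n)), (Rabs_pos_eq (/ (1 + q ^ S n))) by (lra || (left; apply Rinv_0_lt_compat; lra)).
    rewrite Rmult_1_r. apply Rmult_le_compat_l. lra. apply Rle_trans with (q ^ n * 1); [|lra].
    apply Rmult_le_compat. lra. left; apply Rinv_0_lt_compat; lra. apply pow_le_pow. exact Hq. apply pexp_ge. rewrite <- Rinv_1. apply Rinv_le_contravar; lra.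
  - apply ex_series_geo. split. apply exp_pos. apply exp_lt_1. lra. }
unfold f_num. rewrite (CSeries_ext _ (fun n => RtoC (a (S n)))).
- rewrite CSeries_RtoC, <- RtoC_plus. f_equal. unfold sech_sum. fold a. rewrite (Series_incr_1 a Ex). f_equal.
  unfold a. simpl. rewrite !Rmult_0_l, !Rmult_0_r. unfold Rdiv. rewrite !Rmult_0_l, cosh_0, exp_0. field.
- intros n. rewrite Ea. fold tau. assert (Q1 : 0 < exp (- (2 * tau)) ^ S n) by (apply pow_lt, exp_pos).
  rewrite <- !RtoC_pow, <- RtoC_plus, <- RtoC_inv, <- !RtoC_mult by lra. f_equal. ring.
Qed.

(** Divide the two Lambert inversions by [eta t]: its inversion turns [PI / t] into [sqrt (PI / t)]
    and [PI / (2 * t)] into [sqrt (PI / (4 * t))]. The factor q_1^(-1/12) is the ratio of [pent] to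
    [eta] at [PI ^ 2 / t]. *)
Theorem solution_exists : is_solution f_sol omega_sol.
Proof.
assert (PP := PI_RGT_0).
assert (Eta : forall t, 0 < t -> 0 < eta t).
{ intros t Ht. destruct (euler_inv_value t Ht) as [Pos _]. rewrite pent_eta in Pos. assert (P := exp_pos (t / 12)). apply Rnot_le_lt. intros L. nra. }
split; [|split; [|split]].
- apply holomorphic_holo, holo_f_sol.
- apply holomorphic_holo, holo_omega_sol.
- intros t Ht. unfold qpow, q1pow. assert (Ptau : 0 < PI ^ 2 / t) by (apply Rdiv_lt_0_compat; [apply pow_lt|]; lra).
  replace (- exp (- (1 * t))) with (-1 * exp (- t)) by (replace (1 * t) with t by ring; ring).
  replace (- exp (- (1 * PI ^ 2 / t))) with (-1 * exp (- (PI ^ 2 / t))) by (replace (1 * PI ^ 2 / t) with (PI ^ 2 / t) by (field; lra); ring).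
  replace (2 / 3 * PI ^ 2 / t) with (2 / 3 * (PI ^ 2 / t)) by (field; lra).
  rewrite (omega_sol_value t (-1) Ht (or_intror eq_refl)).
  rewrite <- Cmult_assoc, (omega_sol_value (PI ^ 2 / t) (-1) Ptau (or_intror eq_refl)).
  rewrite <- RtoC_opp, <- !RtoC_mult, <- RtoC_plus. f_equal.
  rewrite (lambert_minus_inversion t Ht), (eta_inversion t Ht). destruct (sqrt_ratio t Ht) as [_ [_ [Q _]]]. rewrite Q.
  specialize (Eta t Ht). assert (Ps : 0 < sqrt (t / PI)) by (apply sqrt_lt_R0, Rdiv_lt_0_compat; lra). field. repeat split; lra.
- intros t Ht. unfold qpow, q1pow. assert (Ptau : 0 < PI ^ 2 / t) by (apply Rdiv_lt_0_compat; [apply pow_lt|]; lra).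
  replace (exp (- (1 * t))) with (1 * exp (- t)) by (replace (1 * t) with t by ring; ring).
  rewrite (omega_sol_value t 1 Ht (or_introl eq_refl)).
  replace (exp (- (1 * PI ^ 2 / t)) ^ 2) with (exp (- (2 * (PI ^ 2 / t)))) by (rewrite <- exp_INR_mul; f_equal; simpl; field; lra).
  unfold f_sol. rewrite (f_num_value t Ht), (proj2 (euler_inv_value _ Ptau)).
  rewrite <- !RtoC_mult, <- RtoC_minus. f_equal.
  rewrite (lambert_plus_inversion t Ht), pent_eta, (eta_inversion t Ht). destruct (sqrt_ratio t Ht) as [_ [_ [_ Q]]]. rewrite Q.
  replace (- (- (1 / 12) * PI ^ 2 / t)) with (PI ^ 2 / t / 12) by (field; lra).
  specialize (Eta t Ht). assert (Ps : 0 < sqrt (t / PI)) by (apply sqrt_lt_R0, Rdiv_lt_0_compat; lra). assert (P12 := exp_pos (PI ^ 2 / t / 12)). field. repeat split; lra.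
Qed.

Theorem theorem3p6 :
  (exists f omega : C -> C, is_solution f omega) /\
  (forall f1 omega1 f2 omega2 : C -> C,
     is_solution f1 omega1 -> is_solution f2 omega2 ->
     forall z : C, in_unit_disk z -> f1 z = f2 z /\ omega1 z = omega2 z).
Proof.
split; [exists f_sol, omega_sol; exact solution_exists|exact solution_unique].
Qed.
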